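(* For every $x_0\in\Gamma$ and $r>0$, $$\omega^X(B(x_0,2r)\cap\Gamma)\le C\,\omega^X(B(x_0,r)\cap\Gamma)\quad\text{for }X\in\Omega\setminus B(x_0,4r)$$ and $$\omega^X(\Gamma\setminus B(x_0,r))\le C\,\omega^X(\Gamma\setminus B(x_0,2r))\quad\text{for }X\in\Omega\cap B(x_0,r/2),$$ where $C>0$ depends only on $n$, $d$, $C_0$ and $C_1$.
   Context: Let $n\ge2$ and let $0<d<n-1$ be a real number. $\Gamma\subset\mathbb R^n$ is a nonempty closed set which is Ahlfors regular of dimension $d$: there is $C_0\ge1$ with $C_0^{-1}r^d\le\mathcal H^d(\Gamma\cap B(x,r))\le C_0r^d$ for all $x\in\Gamma$, $r>0$. Set $\Omega=\mathbb R^n\setminus\Gamma$, $\sigma=\mathcal H^d|_\Gamma$, $\delta(z)=\operatorname{dist}(z,\Gamma)$ and $w(z)=\delta(z)^{d+1-n}$. $W=\{u\in L^1_{loc}(\Omega):\nabla u\in L^2(\Omega,w)\}$ (distributional gradient in $\Omega$; $L^2(\Omega,w)=L^2(\Omega,w\,dz)$); every $u\in W$ lies in $L^1_{loc}(\mathbb R^n)$. The trace of $u\in W$ is $Tu(x)=\lim_{r\to0}\frac1{|B(x,r)|}\int_{B(x,r)}u\,dz$, which exists for $\sigma$-a.e. $x\in\Gamma$; $W_0=\{u\in W:Tu=0\}$. $H$ is the space of measurable $g$ on $\Gamma$ with $\int_\Gamma\int_\Gamma\frac{|g(x)-g(y)|^2}{|x-y|^{d+1}}\,d\sigma(x)\,d\sigma(y)<\infty$.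 $A:\Omega\to M_n(\mathbb R)$ is measurable and satisfies, for some $C_1\ge1$, $|A(x)\xi\cdot\zeta|\le C_1w(x)|\xi||\zeta|$ and $A(x)\xi\cdot\xi\ge C_1^{-1}w(x)|\xi|^2$ for all $x\in\Omega$, $\xi,\zeta\in\mathbb R^n$; $L=-\operatorname{div}A\nabla$. Harmonic measure: let $C_0^0(\Gamma)$ be the compactly supported continuous functions on $\Gamma$. For $g\in C_0^0(\Gamma)\cap H$ there is a unique $u=Ug\in W$ with $\int_\Omega A\nabla u\cdot\nabla v\,dz=0$ for all $v\in W_0$ and $Tu=g$ $\sigma$-a.e.; it has a continuous representative on $\mathbb R^n$ equal to $g$ on $\Gamma$. The map $U$ extends uniquely to a linear operator $U:C_0^0(\Gamma)\to C^0(\mathbb R^n)$ bounded for the sup norms. For $X\in\Omega$, $\omega^X$ is the unique positive regular Borel measure on $\Gamma$ with $Ug(X)=\int_\Gamma g\,d\omega^X$ for all $g\in C_0^0(\Gamma)$; it is a probability measure. *)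

(* Defs.v *)
From HB Require Import structures.
From mathcomp Require Import all_boot all_order all_algebra.
From mathcomp Require Import all_classical all_reals all_analysis.

Set Implicit Arguments.
Unset Strict Implicit.
Unset Printing Implicit Defensive.

Import Order.TTheory GRing.Theory Num.Theory.
Import numFieldNormedType.Exports.

Local Open Scope classical_set_scope.
Local Open Scope ring_scope.

(* The norm that the library puts on ['rV[R]_n] is the sup norm; it induces the
   right topology, but distances, balls and diameters must be Euclidean. *)

Definition dotp (R : realType) n (u v : 'rV[R]_n) : R :=
  \sum_(i < n) u ord0 i * v ord0 i.

Definition enorm (R : realType) n (u : 'rV[R]_n) : R := Num.sqrt (dotp u u).

Definition eball (R : realType) n (x : 'rV[R]_n) (r : R) : set 'rV[R]_n :=
  [set y | enorm (y - x) < r].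

Definition edist_set (R : realType) n (S : set 'rV[R]_n) (z : 'rV[R]_n) : R :=
  inf [set enorm (z - y) | y in S].

Definition ediam (R : realType) n (S : set 'rV[R]_n) : R :=
  sup [set enorm (p.1 - p.2) | p in S `*` S].

(* Outer measures by countable covers: the sets allowed in a cover are the
   [B i] for [i] in [P], with weight [v i]. The covering family [D] may be
   finite or empty, so that [set0] has measure 0 whatever the weights are. *)

Section cover_outer.
Context (R : realType) (T : Type) (I : choiceType).
Variables (B : I -> set T) (P : set I) (v : I -> R).
Local Open Scope ereal_scope.

Definition countable_cover (X : set T) : set (set I) :=
  [set D | [/\ countable D, D `<=` P & X `<=` \bigcup_(i in D) B i]].

Definition cover_outer (X : set T) : \bar R :=
  ereal_inf [set \esum_(i in D) (v i)%:E | D in countable_cover X].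

Hypothesis v_ge0 : forall i, (0 <= v i)%R.

Lemma cover_outer_ge0 X : 0 <= cover_outer X.
Proof.
apply: le_ereal_inf_tmp => _ [D _ <-].
by apply: esum_ge0 => i _; rewrite lee_fin.
Qed.

Lemma cover_outer0 : cover_outer set0 = 0.
Proof.
apply/eqP; rewrite eq_le cover_outer_ge0 andbT.
apply: ereal_inf_lbound; exists set0; last by rewrite esum_set0.
by split => //; exact: countable0.
Qed.

Lemma le_cover_outer : {homo cover_outer : X Y / X `<=` Y >-> X <= Y}.
Proof.
move=> X Y XY; apply: ereal_inf_le_tmp => _ [D [cD DP YD] <-].
by exists D => //; split => //; exact: subset_trans YD.
Qed.

Lemma cover_outer_sigma_subadditive : sigma_subadditive cover_outer.
Proof.
move=> A; have [[i ioo]|] := pselect (exists i, cover_outer (A i) = +oo).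
  rewrite (eseries_pinfty _ _ ioo) ?leey// => n _.
  by rewrite -ltNye (lt_le_trans _ (cover_outer_ge0 _)).
rewrite -forallNE => Aoo.
suff add2e (e : {posnum R}) :
    cover_outer (\bigcup_n A n) <=
    \sum_(i <oo) cover_outer (A i) + e%:num%:E.
  by apply/lee_addgt0Pr => _/posnumP[].
rewrite (le_trans _ (epsilon_trick _ _ _))//; last first.
  by move=> n; exact: cover_outer_ge0.
pose Q n (D : set I) := countable_cover (A n) D /\
  \esum_(i in D) (v i)%:E <= cover_outer (A n) + (e%:num / (2 ^ n.+1)%:R)%:E.
have [G QG] : {G : nat -> set I & forall n, Q n (G n)}.
  apply: (@choice _ _ Q) => n; rewrite /Q /cover_outer.
  set S := (X in ereal_inf X); move infS : (ereal_inf S) => iS.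
  case: iS infS => [r Sr|Soo|Soo].
  - have en1 : (0 < e%:num / (2 ^ n.+1)%:R)%R by [].
    have /(lb_ereal_inf_adherent en1) : ereal_inf S \is a fin_num by rewrite Sr.
    move=> [x [D AnD vDx] xS].
    by exists D; split => //; rewrite vDx -Sr; exact/ltW.
  - by have := Aoo n; rewrite /cover_outer Soo.
  - by have := cover_outer_ge0 (A n); rewrite /cover_outer Soo.
have v0 i : 0 <= (v i)%:E by rewrite lee_fin.
apply: (@le_trans _ _ (\esum_(i in \bigcup_n G n) (v i)%:E)).
  apply: ereal_inf_lbound; exists (\bigcup_n G n) => //; split.
  - by apply: bigcup_countable => // n _; have [[]] := QG n.
  - by move=> i [n _]; have [[_ GP _] _] := QG n; exact: GP.
  - move=> x [n _ Anx]; have [[_ _ AG] _] := QG n.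
    by have [i Gi Bx] := AG _ Anx; exists i => //; exists n.
rewrite seqDU_bigcup_eq nneseries_sum_bigcup//.
apply: lee_nneseries => n *; first by exact: esum_ge0.
apply: le_trans (QG n).2; rewrite esum_mkcond [leRHS]esum_mkcond.
apply: le_esum => i _; case: ifPn => [|_]; last by case: ifPn.
by rewrite inE => -[Gi _]; rewrite mem_set.
Qed.

End cover_outer.

Section lebesgue_n.
Context (R : realType) (n : nat).

Definition box (ab : 'rV[R]_n * 'rV[R]_n) : set 'rV[R]_n :=
  [set x | forall i, ab.1 ord0 i <= x ord0 i <= ab.2 ord0 i].

Definition proper_box : set ('rV[R]_n * 'rV[R]_n) :=
  [set ab : 'rV[R]_n * 'rV[R]_n | forall i : 'I_n, ab.1 ord0 i <= ab.2 ord0 i].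

(* The absolute values play no role on [proper_box]; they make the weight
   nonnegative for all pairs, as [cover_outer] wants. *)
Definition box_volume (ab : 'rV[R]_n * 'rV[R]_n) : R :=
  \prod_(i < n) `|ab.2 ord0 i - ab.1 ord0 i|.

Definition lebesgue_outer : set 'rV[R]_n -> \bar R :=
  cover_outer box proper_box box_volume.

Lemma box_volume_ge0 ab : 0 <= box_volume ab.
Proof. exact: prodr_ge0. Qed.

HB.instance Definition _ := isOuterMeasure.Build R 'rV[R]_n lebesgue_outer
  (@cover_outer0 _ _ _ box proper_box _ box_volume_ge0)
  (@cover_outer_ge0 _ _ _ box proper_box _ box_volume_ge0)
  (@le_cover_outer _ _ _ box proper_box box_volume)
  (@cover_outer_sigma_subadditive _ _ _ box proper_box _ box_volume_ge0).

(* The measurable sets of [lebT] are the Caratheodory-measurable ones, i.e., the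
   Lebesgue-measurable sets: this sigma-algebra is complete. *)
Let leb_outer : {outer_measure set 'rV[R]_n -> \bar R} := lebesgue_outer.

Definition lebT := caratheodory_type leb_outer.

Definition lebesgue_n : {measure set lebT -> \bar R} := leb_outer.

End lebesgue_n.

Section hausdorff.
Context (R : realType) (n : nat) (s : R).

Definition small_set (eps : R) : set (set 'rV[R]_n) :=
  [set F | forall x y, F x -> F y -> enorm (x - y) <= eps].

Definition hausdorff_content (eps : R) : set 'rV[R]_n -> \bar R :=
  cover_outer id (small_set eps) (fun F => ediam F `^ s).

(* No normalizing constant is used. The supremum is the limit as [eps] tends
   to 0, since the content is nonincreasing in [eps]. *)
Definition hausdorff_outer (X : set 'rV[R]_n) : \bar R :=
  ereal_sup [set hausdorff_content eps X | eps in [set eps | 0 < eps]].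

Lemma powR_ediam_ge0 (F : set 'rV[R]_n) : 0 <= ediam F `^ s.
Proof. exact: powR_ge0. Qed.

Local Open Scope ereal_scope.

Lemma hausdorff_outer_ge0 X : 0 <= hausdorff_outer X.
Proof.
apply: (@le_trans _ _ (hausdorff_content 1%R X)).
  exact/cover_outer_ge0/powR_ediam_ge0.
by apply: ereal_sup_ubound; exists 1%R => //=.
Qed.

Lemma hausdorff_outer0 : hausdorff_outer set0 = 0.
Proof.
apply/eqP; rewrite eq_le hausdorff_outer_ge0 andbT.
apply: ge_ereal_sup => _ [eps _ <-].
by rewrite /hausdorff_content cover_outer0//; exact: powR_ediam_ge0.
Qed.

Lemma le_hausdorff_outer : {homo hausdorff_outer : X Y / X `<=` Y >-> X <= Y}.
Proof.
move=> X Y XY; apply: ge_ereal_sup => _ [eps eps0 <-].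
apply: (@le_trans _ _ (hausdorff_content eps Y)); first exact: le_cover_outer.
by apply: ereal_sup_ubound; exists eps.
Qed.

Lemma hausdorff_outer_sigma_subadditive : sigma_subadditive hausdorff_outer.
Proof.
move=> A; apply: ge_ereal_sup => _ [eps eps0 <-].
have /le_trans := @cover_outer_sigma_subadditive _ _ _ id (small_set eps) _
  powR_ediam_ge0 A.
apply.
apply: lee_nneseries => k *; first exact/cover_outer_ge0/powR_ediam_ge0.
by apply: ereal_sup_ubound; exists eps.
Qed.

HB.instance Definition _ := isOuterMeasure.Build R 'rV[R]_n hausdorff_outer
  hausdorff_outer0 hausdorff_outer_ge0 le_hausdorff_outer
  hausdorff_outer_sigma_subadditive.

Let haus_outer : {outer_measure set 'rV[R]_n -> \bar R} := hausdorff_outer.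

Definition hausT := caratheodory_type haus_outer.

Definition hausdorff : {measure set hausT -> \bar R} := haus_outer.

End hausdorff.

Section gradient.
Context (R : realType) (n : nat).
Implicit Types (Om : set 'rV[R]_n) (u phi : 'rV[R]_n -> R).
Implicit Type G : 'rV[R]_n -> 'rV[R]_n.

Definition partial_derive (i : 'I_n) phi : 'rV[R]_n -> R :=
  fun z => 'D_(delta_mx ord0 i) phi z.

Definition smooth phi := forall s : seq 'I_n,
  let D := foldr partial_derive phi s in
  continuous D /\ forall i z, derivable D z (delta_mx ord0 i).

Definition test_function Om phi :=
  smooth phi /\
  exists K, [/\ compact K, K `<=` Om & forall z, ~ K z -> phi z = 0].

Definition L1loc Om u := forall K, compact K -> K `<=` Om ->
  (lebesgue_n R n).-integrable K (EFin \o u).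

Definition weak_gradient Om u G :=
  (forall i, L1loc Om (fun z => G z ord0 i)) /\
  forall phi, test_function Om phi -> forall i,
    \int[lebesgue_n R n]_(z in Om) (u z * partial_derive i phi z) =
    - \int[lebesgue_n R n]_(z in Om) (G z ord0 i * phi z).

End gradient.

(* Functions on [~` Gam], or on [Gam], are represented by total functions on
   ['rV[R]_n] whose other values are irrelevant. *)

Section elliptic.
Context (R : realType) (n : nat).
Variables (Gam : set 'rV[R]_n) (d : R).
Implicit Types (u v g : 'rV[R]_n -> R) (A : 'rV[R]_n -> 'M[R]_n).
Implicit Types (z x : 'rV[R]_n).

Local Notation leb := (lebesgue_n R n).
Local Notation Om := (~` Gam).

Definition ahlfors_regular (C0 : R) := forall x r, Gam x -> 0 < r ->
  ((C0^-1 * r `^ d)%:E <= hausdorff n d (Gam `&` eball x r) /\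
   hausdorff n d (Gam `&` eball x r) <= (C0 * r `^ d)%:E)%E.

Definition weight z : R := edist_set Gam z `^ (d + 1 - n%:R).

Definition in_W u := L1loc Om u /\
  exists G, weak_gradient Om u G /\
    (\int[leb]_(z in Om) (enorm (G z) ^+ 2 * weight z)%:E < +oo)%E.

Definition ball_average u x (r : R) : R :=
  (fine (leb (eball x r)))^-1 * \int[leb]_(z in eball x r) u z.

Definition has_trace u x (l : R) := ball_average u x r @[r --> 0^'+] --> l.

Definition trace_eq u g :=
  {ae hausdorff n d, forall x, Gam x -> has_trace u x (g x)}.

Definition in_W0 u := in_W u /\ trace_eq u (fun=> 0).

Definition in_H g :=
  measurable_fun (Gam : set (hausT n d)) (g : hausT n d -> R) /\
  (\int[hausdorff n d]_(x in Gam) \int[hausdorff n d]_(y in Gam)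
     (`|g x - g y| ^+ 2 / enorm (x - y) `^ (d + 1))%:E < +oo)%E.

(* the product of a matrix and a column vector, both vectors being written as
   rows *)
Definition mulmv (M : 'M[R]_n) (xi : 'rV[R]_n) : 'rV[R]_n := xi *m M^T.

Definition weighted_elliptic (C1 : R) A :=
  (forall i j, measurable_fun (Om : set (lebT R n))
                 ((fun z => A z i j) : lebT R n -> R)) /\
  forall z, Om z ->
    (forall xi zeta, `|dotp (mulmv (A z) xi) zeta| <=
                     C1 * weight z * enorm xi * enorm zeta) /\
    (forall xi, C1^-1 * weight z * enorm xi ^+ 2 <= dotp (mulmv (A z) xi) xi).

Definition weak_solution A u := forall v Gu Gv,
  in_W0 v -> weak_gradient Om u Gu -> weak_gradient Om v Gv ->
  \int[leb]_(z in Om) dotp (mulmv (A z) (Gu z)) (Gv z) = 0.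

(* [in_Cc], [dirichlet_operator]: C_0^0(Gam), and the operator U. The bound in
   sup norm makes [U g] depend on the values of [g] on [Gam] only, and, with the
   density of C_0^0(Gam) `&` H in C_0^0(Gam), makes U unique on C_0^0(Gam). *)
Definition in_Cc g := {within Gam, continuous g} /\
  exists K, [/\ compact K, K `<=` Gam & forall x, Gam x -> ~ K x -> g x = 0].

Definition dirichlet_operator A (U : ('rV[R]_n -> R) -> ('rV[R]_n -> R)) :=
  [/\ (forall (a : R) g h, in_Cc g -> in_Cc h -> forall z,
         U (fun x => a * g x + h x) z = a * U g z + U h z),
      (exists M : R, forall g (c : R), in_Cc g ->
         (forall x, Gam x -> `|g x| <= c) -> forall z, `|U g z| <= M * c),
      (forall g, in_Cc g -> continuous (U g)) &
      (forall g, in_Cc g -> in_H g ->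
         [/\ in_W (U g), weak_solution A (U g), trace_eq (U g) g &
             forall x, Gam x -> U g x = g x])].

Definition borelT := g_sigma_algebraType (@open 'rV[R]_n).

Definition regular_borel (mu : {measure set borelT -> \bar R}) :=
  [/\ (forall K : set 'rV[R]_n, compact K -> (mu K < +oo)%E),
      (forall E : set borelT, measurable E ->
         mu E = ereal_inf [set mu V | V in
                  [set V : set 'rV[R]_n | open V /\ E `<=` V]]) &
      (forall V : set 'rV[R]_n, open V ->
         mu V = ereal_sup [set mu K | K in
                  [set K : set 'rV[R]_n | compact K /\ K `<=` V]])].

(* a Borel measure on [Gam] is a Borel measure on R^n that does not charge
   the complement of [Gam] *)
Definition harmonic_measure (U : ('rV[R]_n -> R) -> ('rV[R]_n -> R)) z
    (om : {measure set borelT -> \bar R}) :=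
  [/\ regular_borel om, om (~` Gam) = 0%E &
      forall g, in_Cc g -> (U g z)%:E = (\int[om]_(x in Gam) (g x)%:E)%E].

End elliptic.

(* Main.v *)
(* Harmonic measure is estimated through the solutions U g for Lipschitz g, without Green functions. For 0 <= g1 <= 1
   and g2 >= 0 the function u = U g1 - C U g2 is a solution. De Giorgi iteration (Caccioppoli's inequality, and weighted
   Poincare inequalities proved by bisecting cubes and testing against C^1 bumps) yields growth lemmas at Gam and inside
   Omega, which propagate along Harnack chains starting at corkscrew points: if C is large then u <= 1 everywhere and
   u <= -M at all points that are not too close to Gam. By the argument of De Silva and Savin the two bounds, together with
   u <= 0 on Gam, are inherited by the concentric cube of half the size up to a common factor, so that u <= 0 after
   iteration: U g1 <= C U g2 away from the support of g1.
   For the first inequality g1 is 1 on B(x0, 2r) and g2 lives in B(x0, r); the comparison holds in a shell around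
   |z - x0| = 3r, and outside it by the maximum principle. For the second one g1 approximates the indicator of the
   complement of B(x0, r), g2 is a bump at some point of Gam at distance about r outside B(x0, 2r), and the comparison
   holds directly in B(x0, r/2). *)

Require Import Defs.
From mathcomp Require Import all_boot all_order all_algebra.
From mathcomp Require Import all_classical all_reals all_analysis.
From mathcomp Require Import measurable_realfun ring lra.
Import Order.TTheory GRing.Theory Num.Theory.
Import numFieldNormedType.Exports.

Set Implicit Arguments.
Unset Strict Implicit.
Unset Printing Implicit Defensive.

Local Open Scope classical_set_scope.
Local Open Scope ring_scope.


(** * Lebesgue measure and integrals over boxes *)

Section leb.
Context (R : realType) (n : nat).
Local Notation V := 'rV[R]_n.
Local Notation mu := (lebesgue_n R n).
Implicit Types (a b x y z h : V) (f g : V -> R) (X : set V).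

(** Every constant that matters is produced before [Gam], [A] and the solution are quantified, so
    each estimate has to be scale invariant. The assumption [d < n - 1] enters through a = n - 1 - d
    > 0: the weight is dist^(-a), an A1 weight whose mass on a cube of side r is at most a multiple
    of r^(d+1), and segments can be shifted away from Gam by a quantitative distance. All Poincare
    inequalities are in L^1: moving the average of a function from a box of side l to one of its
    halves costs a multiple of l^(1-n) times the integral of the gradient, and these costs are
    summed over the bisections. Young's inequality with a free parameter then turns the L^1 norm of
    the gradient into energy plus the mass of a level shell. In place of Sobolev's inequality, De
    Giorgi's iteration uses that a function whose support has relative mass 2^(-nN) has a Poincare
    constant of order 2^(-N). The obstacle throughout is Gam itself: weak gradients are known only
    off Gam. Truncations F(u), with F' vanishing below a level slightly above the values of u on
    Gam, have a weak gradient across Gam. *)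

Lemma outer_le_esum (T : Type) (I : choiceType) (nu : {outer_measure set T -> \bar R})
    (D : set I) (F : I -> set T) : countable D ->
  (nu (\bigcup_(i in D) F i) <= \esum_(i in D) nu (F i))%E.
Proof.
move=> /countable_injP[e einj].
have [->|/set0P[i0 Di0]] := eqVneq D set0.
  by rewrite bigcup_set0 outer_measure0 esum_ge0.
pose e' : nat -> I := fun k => if pselect (exists2 i, D i & e i = k) is left h
  then projT1 (cid2 h) else i0.
have eK i : D i -> e' (e i) = i.
  move=> Di; rewrite /e'; case: pselect => [h|]; last by case; exists i.
  by case: (cid2 h) => /= j Dj eji; apply: einj; rewrite ?inE.
pose F' k := if k \in e @` D then F (e' k) else set0.
have -> : \bigcup_(i in D) F i = \bigcup_k F' k.
  apply/seteqP; split => [x [i Di Fx]|x [k _]].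
    exists (e i) => //; rewrite /F' mem_set ?eK//; by exists i.
  rewrite /F'; case: ifPn => //; rewrite inE => -[i Di <-]; rewrite eK// => ?.
  by exists i.
apply: (le_trans (outer_measure_sigma_subadditive nu F')).
rewrite nneseries_esum//.
have <- : \esum_(k in e @` D) nu (F (e' k)) = \esum_(k in [set _ | true]) nu (F' k).
  rewrite esum_mkcond [RHS]esum_mkcond; apply: eq_esum => k _.
  rewrite (_ : (k \in [set _ | true]) = true); last by rewrite mem_set.
  by rewrite /F'; case: ifP => //; rewrite outer_measure0.
rewrite (@reindex_esum R _ _ D (e @` D) e) //; last first.
  exact/inj_bij.
  by apply: le_esum => i Di; rewrite eK.
by move=> k _; exact: outer_measure_ge0.
Qed.

(** Half-open, so that bisecting a box is an exact partition, without overlap on a face. *)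
Definition hbox (a b : V) : set V := [set z | forall i, a ord0 i <= z ord0 i < b ord0 i].

Definition upd (a : V) (i : 'I_n) (c : R) : V := \row_j (if j == i then c else a ord0 j).

Lemma upd_eq a i c : upd a i c ord0 i = c.
Proof. by rewrite mxE eqxx. Qed.

Lemma upd_neq a i c j : j != i -> upd a i c ord0 j = a ord0 j.
Proof. by rewrite mxE => /negbTE ->. Qed.

Lemma leb_box_le (a b : V) : (forall i, a ord0 i <= b ord0 i) ->
  (lebesgue_outer (box (a, b)) <= (\prod_i (b ord0 i - a ord0 i))%:E)%E.
Proof.
move=> ab; apply: ereal_inf_lbound; exists [set (a, b)].
  by split => //; [move=> _ ->|move=> x; exists (a,b)].
rewrite esum_set1 ?lee_fin ?box_volume_ge0// /box_volume /=; congr (_%:E).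
by apply: eq_bigr => i _; rewrite ger0_norm// subr_ge0.
Qed.

Lemma nbhs_coordP (x : V) (A : set V) : nbhs x A <->
  exists2 e : R, 0 < e & forall y : V, (forall j, `|y ord0 j - x ord0 j| < e) -> A y.
Proof.
split.
  move=> /nbhs_ballP[e /= e0 xeU]; exists e => // y hy; apply: xeU; split => // i j.
  by rewrite ord1 /ball /= distrC.
move=> [e e0 h]; apply/nbhs_ballP; exists e => //= y [_ hy]; apply: h => j.
by have := hy ord0 j; rewrite /ball /= distrC.
Qed.

(** The hyperplane cuts each box of a cover into two boxes whose volumes add up, so it splits every
    cover without loss. *)
Lemma measurable_coord_lt i c : measurable ([set z : V | z ord0 i < c] : set (lebT R n)).
Proof.
apply: le_caratheodory_measurable => X.
apply: le_ereal_inf_tmp => _ [D [cD DP XD] <-].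
set H := [set z : V | z ord0 i < c].
have cov (K : set V) : (lebesgue_outer (X `&` K) <= \esum_(i in D) lebesgue_outer (box i `&` K))%E.
  have /(_ (fun i => box i `&` K)) := @outer_le_esum _ _ (@lebesgue_outer R n : {outer_measure set _ -> \bar R}) D ^~ cD.
  apply: le_trans.
  apply: le_outer_measure => x [Xx Kx]; have [p Dp px] := XD _ Xx.
  by exists p.
apply: (le_trans (leeD (cov H) (cov (~` H)))).
rewrite -esumD; last 2 first.
  by move=> *; exact: outer_measure_ge0.
  by move=> *; exact: outer_measure_ge0.
apply: le_esum => -[a b] Dab.
have ab : forall i, a ord0 i <= b ord0 i by exact: (DP _ Dab).
have volE : box_volume (a, b) = \prod_i (b ord0 i - a ord0 i).
  by apply: eq_bigr => j _; rewrite ger0_norm// subr_ge0.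
have [bc|cb] := ltP (b ord0 i) c.
  have -> : box (a, b) `&` ~` H = set0.
    by apply/seteqP; split => // x [/(_ i)/andP[_ xb]] /=; rewrite /H /= (le_lt_trans xb).
  rewrite outer_measure0 adde0 volE.
  by apply: le_trans (leb_box_le ab); apply: le_outer_measure => x [].
have [ca|ac] := leP c (a ord0 i).
  have -> : box (a, b) `&` H = set0.
    apply/seteqP; split => // x [/(_ i)/andP[xa _]] /=; rewrite /H /= => xc.
    by have := lt_le_trans xc ca; rewrite ltNge xa.
  rewrite outer_measure0 add0e volE.
  by apply: le_trans (leb_box_le ab); apply: le_outer_measure => x [].
have -> : box_volume (a, b) = \prod_j (upd b i c ord0 j - a ord0 j) + \prod_j (b ord0 j - upd a i c ord0 j).
  rewrite volE (bigD1 i)//= [X in _ = X + _](bigD1 i)//= [X in _ = _ + X](bigD1 i)//= !upd_eq.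
  under [X in _ = _ * X + _]eq_bigr do rewrite upd_neq//.
  under [X in _ = _ + _ * X]eq_bigr do rewrite upd_neq//.
  by rewrite -mulrDl; congr (_ * _); lra.
rewrite EFinD; apply: leeD.
  apply: (@le_trans _ _ (lebesgue_outer (box (a, upd b i c)))).
    apply: le_outer_measure => x [abx]; rewrite /H /= => xc j /=.
    by rewrite mxE; case: eqP => [->|_]; [case/andP: (abx i) => -> _; rewrite ltW|exact: abx].
  apply: leb_box_le => j; rewrite mxE; case: eqP => [->|//]; exact: ltW.
apply: (@le_trans _ _ (lebesgue_outer (box (upd a i c, b)))).
  apply: le_outer_measure => x [abx]; rewrite /H /= => /negP; rewrite -leNgt => xc j /=.
  by rewrite mxE; case: eqP => [->|_]; [case/andP: (abx i) => _ ->; rewrite xc|exact: abx].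
by apply: leb_box_le => j; rewrite mxE; case: eqP => [->|//].
Qed.

Lemma measurable_hbox a b : measurable (hbox a b : set (lebT R n)).
Proof.
have -> : hbox a b = \bigcap_(i in [set: 'I_n]) ([set z | z ord0 i < b ord0 i] `\` [set z | z ord0 i < a ord0 i]).
  apply/seteqP; split => [x h i _|x h i].
    have /andP[h1 h2] := h i; split => //=; apply/negP; by rewrite -leNgt.
  by have [h1 /= /negP] := h i I; rewrite -leNgt => h2; rewrite h2.
apply: fin_bigcap_measurable => [|i _]; first exact: finite_finset.
apply: measurableD; exact: measurable_coord_lt.
Qed.

(** Rational corners make the family countable; boxes that are not contained in [U] are replaced by
    the empty set. The same decomposition gives open sets for Lebesgue and for Hausdorff measure. *)
Lemma open_hboxes (U : set V) : open U -> exists2 F : 'rV[rat]_n * 'rV[rat]_n -> set V,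
  (forall pq, F pq = set0 \/ exists a b, F pq = hbox a b) & U = \bigcup_pq F pq.
Proof.
move=> oU.
pose F (pq : 'rV[rat]_n * 'rV[rat]_n) := if pselect (hbox (map_mx ratr pq.1) (map_mx ratr pq.2) `<=` U)
  then hbox (map_mx ratr pq.1) (map_mx ratr pq.2) else set0.
exists F; first by move=> pq; rewrite /F; case: pselect => h; [right; do 2 eexists|left].
  apply/seteqP; split => [x Ux|x [pq _]]; last by rewrite /F; case: pselect => // h /h.
  have [e /= e0 xeU] : exists2 e : R, 0 < e & ball x e `<=` U.
    by have /nbhs_ballP[e e0 he] := open_nbhs_nbhs (conj oU Ux); exists e.
  have pP i : {q : rat | ratr q \in `]x ord0 i - e, x ord0 i[}.
    by apply/cid/rat_in_itvoo; lra.
  have qP i : {q : rat | ratr q \in `]x ord0 i, x ord0 i + e[}.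
    by apply/cid/rat_in_itvoo; lra.
  exists (\row_i (sval (pP i)), \row_i (sval (qP i))) => //.
  rewrite /F; case: pselect => /= [_ i|].
    rewrite !mxE; case: (pP i) => p /=; case: (qP i) => q /=; rewrite !in_itv /= => /andP[h1 _] /andP[_ h2].
    by rewrite h1 ltW.
  case => y /= hy; apply: xeU; split => // i j; rewrite ord1 {i}; move: (hy j).
  rewrite !mxE; case: (pP j) => p /=; case: (qP j) => q /=; rewrite !in_itv /= => /andP[h1 h2] /andP[h3 h4] /andP[h5 h6].
  by rewrite /ball /= ltr_norml; lra.
Qed.

Lemma measurable_open (U : set V) : open U -> measurable (U : set (lebT R n)).
Proof.
move=> /open_hboxes[F hF ->].
apply: countable_bigcupT_measurable; first exact: countableP.
move=> pq; have [->|[a [b ->]]] := hF pq; [exact: measurable0|exact: measurable_hbox].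
Qed.

Lemma continuous_measurable_leb (f : V -> R) : continuous f -> measurable_fun [set: lebT R n] (f : lebT R n -> R).
Proof.
move=> cf; apply: (measurability _ (measurable_realfun.RGenOInfty.measurableE R)) => _ [_ [x ->] <-].
rewrite setTI; apply: measurable_open; apply: open_comp => [y _|]; [exact: cf|exact: rray_open].
Qed.

Lemma lebesgue_outer_shift (X : set V) (h : V) : lebesgue_outer [set x : V | X (x + h)] = lebesgue_outer X.
Proof.
(* One inequality for all sets and all shifts is enough: the shift by [- h] gives the other. *)
suff le (Y : set V) (k : V) : (lebesgue_outer [set x : V | Y (x + k)%R] <= lebesgue_outer Y)%E.
  apply/eqP; rewrite eq_le le /=.
  have := le [set x : V | X (x + h)] (- h); congr (_ <= _)%E; congr lebesgue_outer.
  by apply/seteqP; split => x /=; rewrite subrK.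
apply: le_ereal_inf_tmp => _ [D [cD DP XD] <-].
apply: ereal_inf_lbound.
pose sh (ab : V * V) := (ab.1 - k, ab.2 - k).
have shinj : injective sh by move=> [a b] [a' b'] [/addIr -> /addIr ->].
exists (sh @` D).
  split.
    exact: card_le_trans (card_image_le _ _) cD.
    by move=> _ [ab /DP Dab <-] i; rewrite !mxE lerD2r; exact: Dab.
  move=> x /XD [ab Dab xab]; exists (sh ab); first by exists ab.
  by move=> i; have := xab i; rewrite !mxE lerBlDr lerBrDr.
rewrite (@reindex_esum R _ _ D (sh @` D) sh) //; last first.
  by apply/inj_bij => // p q _ _; exact: shinj.
apply: eq_esum => -[a b] _; congr (_%:E); apply: eq_bigr => i _ /=.
by rewrite !mxE; congr (`| _ |); lra.
Qed.

Lemma measurable_shift (h : V) : measurable_fun [set: lebT R n] ((fun z : V => z + h) : lebT R n -> lebT R n).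
Proof.
move=> _ Y mY; rewrite setTI; apply: le_caratheodory_measurable => X.
pose X' : set V := [set x : V | X (x - h)].
have mE : lebesgue_outer X' = (lebesgue_outer (X' `&` Y) + lebesgue_outer (X' `&` ~` Y))%E by exact: (mY X').
have := lebesgue_outer_shift X (- h) => /= E.
change (lebesgue_outer X) with (lebesgue_outer (n := n) X).
rewrite -E -/X' mE.
rewrite -(lebesgue_outer_shift (X' `&` Y) h).
rewrite -(lebesgue_outer_shift (X' `&` ~` Y) h) /=.
rewrite le_eqVlt; apply/orP; left; apply/eqP; congr (_ + _)%E; congr (lebesgue_outer _);
 by apply/seteqP; split => x [/=]; rewrite /X' /= addrK.
Qed.

Lemma Rintegral_shift (f : V -> R) (h : V) : measurable_fun [set: lebT R n] (f : lebT R n -> R) ->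
  mu.-integrable setT (fun z => (f (z + h))%:E) ->
  \int[mu]_z f (z + h) = \int[mu]_z f z.
Proof.
move=> mf intf; rewrite /Rintegral; congr fine.
have E : forall A, measurable A -> pushforward mu ((fun z : V => z + h) : lebT R n -> lebT R n) A = mu A.
  by move=> A mA; rewrite /pushforward; exact: lebesgue_outer_shift.
have := @integral_pushforward _ _ _ _ R _ (measurable_shift h) mu setT (EFin \o f).
rewrite preimage_setT => /(_ _ intf measurableT) <-; last exact/measurable_EFinP.
pose nu : measure (lebT R n) R := pushforward mu ((fun z : V => z + h) : lebT R n -> lebT R n).
have H2 := @eq_measure_integral _ _ R setT mu (nu (measurable_shift h)) (EFin \o f) (fun A mA _ => E A mA).
exact: H2.
Qed.

(** Induction on the dimension: the slice at height [t] of the first coordinate is covered by the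
    slices of the boxes whose first side contains [t]. Integrating the resulting inequality in [t]
    gives the one for the volumes. *)
Lemma box_cover_volume (a b : nat -> V) (P : pred nat) (p q : V) :
  (forall i, p ord0 i <= q ord0 i) ->
  (forall k, P k -> forall i, a k ord0 i <= b k ord0 i) ->
  (forall x : V, (forall i, p ord0 i <= x ord0 i <= q ord0 i) ->
    exists2 k, P k & forall i, a k ord0 i <= x ord0 i <= b k ord0 i) ->
  ((\prod_i (q ord0 i - p ord0 i))%:E <=
   \sum_(0 <= k <oo | P k) (\prod_i (b k ord0 i - a k ord0 i))%:E)%E.
Proof.
clear.
elim: n a b P p q => [|m IH] a b P p q pq ab cov.
  (* In dimension 0 all products are 1, and the only point forces at least one box into the
     cover. *)
  rewrite big_ord0; have [k Pk _] := cov 0 (fun i => match i with Ordinal _ h => ltac:(done) end).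
  rewrite (@nneseriesD1 _ _ k)//; last by move=> *; rewrite big_ord0.
  rewrite big_ord0 leeDl// nneseries_ge0// => *; by rewrite big_ord0.
pose tl (x : 'rV[R]_(m.+1)) : 'rV[R]_m := \row_j x ord0 (lift ord0 j).
pose v k := \prod_i (b k ord0 (lift ord0 i) - a k ord0 (lift ord0 i)).
pose v1 := \prod_i (q ord0 (lift ord0 i) - p ord0 (lift ord0 i)).
have v10 : 0 <= v1 by apply: prodr_ge0 => i _; rewrite subr_ge0; exact: pq.
have v0 k : P k -> 0 <= v k.
  by move=> Pk; apply: prodr_ge0 => i _; rewrite subr_ge0; exact: ab.
have step t : p ord0 ord0 <= t <= q ord0 ord0 ->
    (v1%:E <= \sum_(0 <= k <oo | P k) (v k * \1_(`[a k ord0 ord0, b k ord0 ord0]%classic) t)%:E)%E.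
  move=> t01.
  pose Q := [pred k | P k && (a k ord0 ord0 <= t <= b k ord0 ord0)].
  have := IH (tl \o a) (tl \o b) Q (tl p) (tl q).
  have Q1 : forall k, Q k -> forall i, (tl \o a) k ord0 i <= (tl \o b) k ord0 i.
    by move=> k /andP[Pk _] i; rewrite !mxE; exact: ab.
  have Q2 : forall i, tl p ord0 i <= tl q ord0 i by move=> i; rewrite !mxE.
  move=> /(_ Q2 Q1) H; rewrite (_ : v1 = \prod_i (tl q ord0 i - tl p ord0 i)); last first.
    by apply: eq_bigr => i _; rewrite !mxE.
  apply: (le_trans (H _)).
    move=> x x01.
    have [|k Pk kx] := cov (\row_j (if unlift ord0 j is Some j' then x ord0 j' else t)).
      move=> i; rewrite mxE; case: unliftP => [j ->|-> //].
      by have := x01 j; rewrite !mxE.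
    exists k.
      by rewrite inE Pk /=; have := kx ord0; rewrite mxE unlift_none.
    by move=> i; rewrite !mxE; have := kx (lift ord0 i); rewrite mxE liftK.
  rewrite (eq_eseriesl (P := Q) (Q := fun k => P k && Q k)); last by move=> k /=; case: (P k).
  rewrite eseries_mkcondr; apply: lee_nneseries => k; first move=> _ Pk; last move=> Pk.
    by case: ifP => // _; rewrite ?lee_fin; apply: prodr_ge0 => i _; rewrite !mxE subr_ge0; exact: ab.
  rewrite /= Pk /= indicE; have [h|h] := ifPn; last by rewrite lee_fin mulr_ge0 ?v0.
  rewrite mem_set ?mulr1 ?lee_fin; last by rewrite /= in_itv.
  by rewrite le_eqVlt /v; apply/orP; left; apply/eqP; apply: eq_bigr => i _; rewrite !mxE.
pose lam := @lebesgue_measure R.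
have mI k : measurable (`[a k ord0 ord0, b k ord0 ord0]%classic : set (measurableTypeR R)) by [].
have : (\int[lam]_(t in `[p ord0 ord0, q ord0 ord0]) (cst v1%:E t) <=
   \int[lam]_(t in `[p ord0 ord0, q ord0 ord0]) \sum_(0 <= k <oo | P k) (v k * \1_(`[a k ord0 ord0, b k ord0 ord0]%classic) t)%:E)%E.
  apply: ge0_le_integral => //.
    apply: ge0_emeasurable_sum => [k t _ Pk|k Pk]; first by rewrite lee_fin mulr_ge0 ?v0.
    apply/measurable_EFinP; apply: measurable_funM => //; exact: measurable_indic.
rewrite integral_cst//= lebesgue_measure_itv /= => H.
apply: (@le_trans _ _ (v1%:E * (if ((p ord0 ord0)%:E < (q ord0 ord0)%:E)%E
   then (q ord0 ord0)%:E - (p ord0 ord0)%:E else 0))%E).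
  rewrite big_ord_recl muleC EFinM; apply: lee_wpmul2r; first by rewrite lee_fin.
  rewrite lte_fin; have [_|qp] := ltP; first by rewrite EFinB.
  by rewrite lee_fin subr_le0.
apply: (le_trans H).
under eq_integral do rewrite eseries_mkcond.
rewrite integral_nneseries //; last 2 first.
  move=> k; case: (P k) => //=.
  apply/measurable_EFinP; apply: measurable_funM => //; exact: measurable_indic.
  by move=> k t _; case: ifPn => // Pk; rewrite lee_fin mulr_ge0 ?v0.
rewrite [leRHS]eseries_mkcond; apply: lee_nneseries => [k _ _|k _].
  by apply: integral_ge0 => t _; case: ifPn => // Pk; rewrite lee_fin mulr_ge0 ?v0.
case: ifPn => Pk; last by rewrite integral0.
under eq_integral do rewrite EFinM.
rewrite ge0_integralZl//; last 2 first.
  exact/measurable_EFinP/measurable_indic.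
  by rewrite lee_fin v0.
rewrite integral_indic// big_ord_recl EFinM muleC; apply: lee_wpmul2r; first by rewrite lee_fin v0.
apply: (@le_trans _ _ (lam `[a k ord0 ord0, b k ord0 ord0]%classic)).
  by apply: le_measure; rewrite ?inE//; exact: measurableI.
rewrite /lam lebesgue_measure_itv /= lte_fin; case: ifP => _; first by rewrite EFinB.
by rewrite lee_fin subr_ge0; exact: ab.
Qed.

Lemma leb_box_ge (p q : V) : (forall i, p ord0 i <= q ord0 i) ->
  ((\prod_i (q ord0 i - p ord0 i))%:E <= lebesgue_outer (box (p, q)))%E.
Proof.
move=> pq; apply: le_ereal_inf_tmp => _ [D [/countable_injP[e einj] DP XD] <-].
pose g k := [set i | D i /\ e i = k].
pose P k : bool := `[< exists i, g k i >].
pose ab k : V * V := if pselect (exists i, g k i) is left h then projT1 (cid h) else (0, 0).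
have abP k : P k -> D (ab k) /\ e (ab k) = k.
  rewrite /P /ab => /asboolP; case: pselect => // h _; by case: cid.
have eK i : D i -> P (e i) /\ ab (e i) = i.
  move=> Di; have Pi : P (e i) by apply/asboolP; exists i.
  by split=> //; have [D1 E] := abP _ Pi; apply: einj; rewrite ?inE.
have H := @box_cover_volume (fun k => (ab k).1) (fun k => (ab k).2) P _ _ pq.
apply: (le_trans (H _ _)).
- by move=> k /abP[/DP Dk _].
- move=> x x01; have [|i Di xi] := XD x; first by move=> j /=.
  by have [Pi E] := eK _ Di; exists (e i) => //; rewrite E; exact: xi.
rewrite nneseries_esum; last first.
  by move=> k /abP[/DP Dk _]; rewrite lee_fin; apply: prodr_ge0 => j _; rewrite subr_ge0; exact: Dk.
rewrite (@reindex_esum R _ _ D [set k | P k] e); last first.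
  split.
  - by move=> i /eK[].
  - exact: einj.
  - by move=> k /abP[Dk Ek]; exists (ab k).
apply: le_esum => i Di; have [_ ->] := eK _ Di.
by rewrite lee_fin; apply: ler_prod => j _; rewrite subr_ge0 (DP _ Di) /= ler_norm.
Qed.

Definition ibox (a b : V) (f : V -> R) : R := \int[mu]_(z in hbox a b) f z.

Definition locint (f : V -> R) := measurable_fun [set: lebT R n] (f : lebT R n -> R) /\
  forall a b, mu.-integrable (hbox a b) (EFin \o f).

Definition locbd (f : V -> R) := forall a b, exists M, forall z, hbox a b z -> `|f z| <= M.

Lemma hbox_sub a b a' b' : (forall i, a' ord0 i <= a ord0 i) -> (forall i, b ord0 i <= b' ord0 i) ->
  hbox a b `<=` hbox a' b'.
Proof.
by move=> ha hb z zab i; have /andP[h1 h2] := zab i; rewrite (le_trans (ha i))//= (lt_le_trans h2).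
Qed.

Lemma leb_hbox_le a b : (forall i, a ord0 i <= b ord0 i) ->
  (mu (hbox a b) <= (\prod_i (b ord0 i - a ord0 i))%:E)%E.
Proof.
move=> ab; apply: le_trans (leb_box_le ab); apply: le_outer_measure => z zab i /=.
by have /andP[-> /ltW ->] := zab i.
Qed.

Lemma leb_hbox_fin a b : (mu (hbox a b) < +oo)%E.
Proof.
have [ab|/existsNP[i ab]] := pselect (forall i, a ord0 i <= b ord0 i).
  by apply: le_lt_trans (leb_hbox_le ab) _; rewrite ltry.
rewrite (_ : hbox a b = set0) ?measure0//.
apply/seteqP; split => // z /(_ i) /andP[h1 h2]; apply: ab.
by apply: ltW; exact: le_lt_trans h2.
Qed.

Lemma compact_box a b : compact (box (a, b) : set V).
Proof.
have := @rV_compact R n (fun i => `[a ord0 i, b ord0 i]%classic) (fun i => @segment_compact _ _ _).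
congr (compact _); apply/seteqP; split => x h i; have := h i; rewrite /= in_itv //.
Qed.

Lemma cont_bounded_box (f : V -> R) a b : continuous f -> exists M, forall z, box (a, b) z -> `|f z| <= M.
Proof.
move=> cf.
have : compact (f @` box (a, b)).
  apply: continuous_compact; [exact: continuous_subspaceT|exact: compact_box].
move=> /compact_bounded [M [Mr h]]; exists (M + 1) => z zab.
by apply: (h (M + 1)); [rewrite ltrDl|exists z].
Qed.

Lemma hbox_box a b : hbox a b `<=` box (a, b).
Proof. by move=> z zab i; have /andP[h /ltW h'] := zab i; rewrite /= h h'. Qed.

Lemma cont_locbd f : continuous f -> locbd f.
Proof.
by move=> cf a b; have [M h] := cont_bounded_box a b cf; exists M => z /hbox_box; exact: h.
Qed.

Lemma locint_bd (f : V -> R) : measurable_fun [set: lebT R n] (f : lebT R n -> R) -> locbd f -> locint f.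
Proof.
move=> mf bf; split => // a b; have [M h] := bf a b.
apply: measurable_bounded_integrable => //=.
- exact: measurable_hbox.
- exact: leb_hbox_fin.
- exact: measurable_funS mf.
- exists M; split; first exact: num_real.
  by move=> x Mx z zab; apply: le_trans (h _ zab) (ltW Mx).
Qed.

Lemma locint_cont f : continuous f -> locint f.
Proof. by move=> cf; apply: locint_bd; [exact: continuous_measurable_leb|exact: cont_locbd]. Qed.


Definition vol a b : R := \prod_i (b ord0 i - a ord0 i).

Lemma vol_ge0 a b : (forall i, a ord0 i <= b ord0 i) -> 0 <= vol a b.
Proof. by move=> ab; apply: prodr_ge0 => i _; rewrite subr_ge0. Qed.

Lemma vol_gt0 a b : (forall i, a ord0 i < b ord0 i) -> 0 < vol a b.
Proof. by move=> ab; apply: prodr_gt0 => i _; rewrite subr_gt0. Qed.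

(** The closed box is a cover, which gives the upper bound. For the lower one, closed boxes with
    sides shortened by the factor [1 - 1 / (k + 2)] lie inside, and their volumes tend to that of
    the box. *)
Lemma leb_hbox a b : (forall i, a ord0 i <= b ord0 i) -> mu (hbox a b) = (vol a b)%:E.
Proof.
move=> ab; apply/eqP; rewrite eq_le; apply/andP; split; first exact: leb_hbox_le.
have [/existsP[i /eqP abi]|/existsPn ab'] := boolP [exists i, a ord0 i == b ord0 i].
  by rewrite /vol (bigD1 i)//= abi subrr mul0r; exact: outer_measure_ge0.
have {}ab' i : a ord0 i < b ord0 i by rewrite lt_neqAle ab' ab.
pose s k : V := \row_i (b ord0 i - (b ord0 i - a ord0 i) / k.+2%:R).
have k1 (k : nat) : (k.+2%:R^-1 : R) <= 1 by rewrite invf_le1 ?ler1n.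
have as_ k i : a ord0 i <= s k ord0 i.
  by rewrite mxE; move: (_^-1) (k1 k) => x x1; have := ab i; nra.
have H k : ((\prod_i ((b ord0 i - a ord0 i) * (1 - k.+2%:R^-1)))%:E <= mu (hbox a b))%E.
  have := leb_box_ge (as_ k).
  rewrite (eq_bigr (fun i => (b ord0 i - a ord0 i) * (1 - k.+2%:R^-1))); last by move=> i _; rewrite !mxE; ring.
  move=> /le_trans; apply; apply: le_outer_measure => z zs i; have /andP[h1 h2] := zs i.
  rewrite h1 /=; apply: le_lt_trans h2 _; rewrite mxE.
  have : 0 < (k.+2%:R^-1 : R) by rewrite invr_gt0.
  by move: (_^-1) => x x0; have := ab' i; nra.
have v0 : 0 < vol a b by exact: vol_gt0.
have fin : mu (hbox a b) \is a fin_num by rewrite ge0_fin_numE// leb_hbox_fin.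
rewrite -(fineK fin) lee_fin leNgt; apply/negP => lt.
set m := fine _ in lt.
have [k hk] : exists k : nat, n%:R * vol a b / (vol a b - m) < k.+2%:R :> R.
  exists (Num.bound (n%:R * vol a b / (vol a b - m))).
  apply: (lt_trans (archi_boundP _)); last by rewrite ltr_nat.
  by rewrite divr_ge0 ?mulr_ge0// ?subr_ge0 ltW.
have := H k; rewrite -(fineK fin) -/m lee_fin big_split /= prodr_const card_ord => {}H.
have x1 : 0 <= (1 : R) - k.+2%:R^-1 by rewrite subr_ge0.
(* Bernoulli's inequality. *)
have B : 1 - n%:R * k.+2%:R^-1 <= ((1 : R) - k.+2%:R^-1) ^+ n.
  move: (k.+2%:R^-1) (k1 k) (invr_ge0 (k.+2%:R : R)) x1 => x xle; rewrite ler0n => x0 x1.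
  elim: n => [|j IH]; first by rewrite mul0r subr0 expr0.
  rewrite exprS; apply: (@le_trans _ _ ((1 - x) * (1 - j%:R * x))); last exact: ler_wpM2l.
  have : 0 <= j%:R * x ^+ 2 by rewrite mulr_ge0// sqr_ge0.
  by rewrite -[j.+1]addn1 natrD; nra.
move: hk; rewrite ltr_pdivrMr ?subr_gt0// => hk.
have k20 : 0 < (k.+2%:R : R) by [].
have : vol a b * (1 - n%:R * k.+2%:R^-1) <= m by apply: le_trans H; rewrite ler_wpM2l// ltW.
rewrite -(ler_pM2r k20) mulrBr mulr1 mulrBl mulrA -[_ * _ / _ * _]mulrA mulVf ?gt_eqF// mulr1.
by nra.
Qed.

Definition lower (x : V) (r : R) : V := \row_i (x ord0 i - r).
Definition upper (x : V) (r : R) : V := \row_i (x ord0 i + r).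
Definition qbox x (r : R) := hbox (lower x r) (upper x r).

Lemma qboxP x r z : qbox x r z <-> forall i, x ord0 i - r <= z ord0 i < x ord0 i + r.
Proof. by split => h i; have := h i; rewrite !mxE. Qed.

Lemma hbox_in_qbox a b x : exists r, 0 < r /\ hbox a b `<=` qbox x r.
Proof.
exists (1 + \sum_i (`|a ord0 i - x ord0 i| + `|b ord0 i - x ord0 i|)).
have s0 i : 0 <= `|a ord0 i - x ord0 i| + `|b ord0 i - x ord0 i| by rewrite addr_ge0.
split; first by rewrite ltr_pwDl// sumr_ge0.
move=> z zab; apply/qboxP => i; rewrite (bigD1 i)//=.
have S0 : 0 <= \sum_(j < n | j != i) (`|a ord0 j - x ord0 j| + `|b ord0 j - x ord0 j|).
  by rewrite sumr_ge0.
have /andP[h1 h2] := zab i.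
have := ler_norm (x ord0 i - a ord0 i); rewrite distrC.
have := ler_norm (b ord0 i - x ord0 i); have := normr_ge0 (a ord0 i - x ord0 i).
by have := normr_ge0 (b ord0 i - x ord0 i); lra.
Qed.

Lemma locintD f g : locint f -> locint g -> locint (fun z => f z + g z).
Proof.
move=> [mf If] [mg Ig]; split => [|a b]; first exact: measurable_funD.
rewrite (_ : EFin \o _ = (EFin \o f) \+ (EFin \o g))%E//.
by apply: integrableD => //; exact: measurable_hbox.
Qed.

Lemma locint_dom g f : measurable_fun [set: lebT R n] (g : lebT R n -> R) -> locint f ->
  (forall z, `|g z| <= f z) -> locint g.
Proof.
move=> mg [mf If] gf; split => // a b.
apply: (le_integrable (measurable_hbox a b) _ _ (If a b)).
  by apply/measurable_EFinP; exact: measurable_funS mg.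
by move=> z _ /=; rewrite lee_fin; apply: le_trans (gf z) (ler_norm _).
Qed.

Lemma locintZ c f : locint f -> locint (fun z => c * f z).
Proof.
move=> [mf If]; split => [|a b]; first exact: measurable_funM.
rewrite (_ : EFin \o _ = (fun z => c%:E * (EFin \o f) z)%E)//.
by apply: integrableZl => //; exact: measurable_hbox.
Qed.

Lemma locint_abs f : locint f -> locint (fun z => `|f z|).
Proof.
move=> [mf If]; split => [|a b]; first exact: measurableT_comp.
by apply: integrable_norm.
Qed.

Lemma locintM g f : measurable_fun [set: lebT R n] (g : lebT R n -> R) -> locbd g -> locint f ->
  locint (fun z => g z * f z).
Proof.
move=> mg bg [mf If]; split => [|a b]; first exact: measurable_funM.
have [M gM] := bg a b.
have IM : mu.-integrable (hbox a b) (fun z => M%:E * (EFin \o (fun z => `|f z|)%R) z)%E.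
  by apply: integrableZl; [exact: measurable_hbox|exact: integrable_norm].
apply: (le_integrable (measurable_hbox a b) _ _ IM).
  by apply/measurable_EFinP/measurable_funM; [exact: measurable_funS mg|exact: measurable_funS mf].
move=> z zab /=; rewrite lee_fin normrM [leRHS]ger0_norm; last first.
  by rewrite mulr_ge0// (le_trans _ (gM z zab)).
by rewrite ler_wpM2r// gM.
Qed.

Lemma locintN f : locint f -> locint (fun z => - f z).
Proof.
move=> h; apply: (locint_dom _ (locint_abs h)) => [|z]; last by rewrite normrN.
by case: h => mf _; exact: measurableT_comp.
Qed.

Lemma locintB f g : locint f -> locint g -> locint (fun z => f z - g z).
Proof. by move=> hf hg; exact: (locintD hf (locintN hg)). Qed.

Lemma locint_cst c : locint (fun=> c).
Proof. by apply: locint_cont; exact: cst_continuous. Qed.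

Lemma ibox_le a b f g : locint f -> locint g -> (forall z, hbox a b z -> f z <= g z) ->
  ibox a b f <= ibox a b g.
Proof. by move=> [_ If] [_ Ig] fg; apply: le_Rintegral => //; exact: measurable_hbox. Qed.

Lemma ibox_ge0 a b f : (forall z, hbox a b z -> 0 <= f z) -> 0 <= ibox a b f.
Proof. by move=> h; apply: Rintegral_ge0. Qed.

Lemma ibox_eq a b f g : (forall z, hbox a b z -> f z = g z) -> ibox a b f = ibox a b g.
Proof. by move=> fg; apply: eq_Rintegral => z; rewrite inE => /fg. Qed.

Lemma iboxD a b f g : locint f -> locint g ->
  ibox a b (fun z => f z + g z) = ibox a b f + ibox a b g.
Proof. by move=> [_ If] [_ Ig]; apply: RintegralD => //; exact: measurable_hbox. Qed.

Lemma iboxB a b f g : locint f -> locint g ->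
  ibox a b (fun z => f z - g z) = ibox a b f - ibox a b g.
Proof. by move=> [_ If] [_ Ig]; apply: RintegralB => //; exact: measurable_hbox. Qed.

Lemma iboxZ a b c f : locint f -> ibox a b (fun z => c * f z) = c * ibox a b f.
Proof. by move=> [_ If]; apply: RintegralZl => //; exact: measurable_hbox. Qed.

Lemma iboxN a b f : locint f -> ibox a b (fun z => - f z) = - ibox a b f.
Proof.
move=> If; rewrite -mulN1r -iboxZ//; apply: ibox_eq => z _; by rewrite mulN1r.
Qed.

Lemma ibox_abs a b f : locint f -> `|ibox a b f| <= ibox a b (fun z => `|f z|).
Proof. by move=> [_ If]; apply: le_normr_Rintegral => //; exact: measurable_hbox. Qed.

Lemma ibox_cst a b c : (forall i, a ord0 i <= b ord0 i) -> ibox a b (fun=> c) = c * vol a b.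
Proof.
move=> ab; rewrite /ibox Rintegral_cst; last exact: measurable_hbox.
by have -> := leb_hbox ab.
Qed.

Lemma ibox_split a b i c f : a ord0 i <= c <= b ord0 i -> locint f ->
  ibox a b f = ibox a (upd b i c) f + ibox (upd a i c) b f.
Proof.
move=> /andP[ac cb] [_ If].
have E : hbox a b = hbox a (upd b i c) `|` hbox (upd a i c) b.
  apply/seteqP; split => [z zab|z [h j|h j]].
  + have [zc|cz] := ltP (z ord0 i) c; [left|right] => j; rewrite mxE; case: eqP => [->|_]; have := zab j => // /andP[].
      by rewrite zc; have := zab i => /andP[-> _].
    by rewrite cz; have := zab i => /andP[_ ->].
  + have := h j; rewrite mxE; case: eqP => [->|//] /andP[-> /= h2]; exact: lt_le_trans cb.
  + have := h j; rewrite mxE; case: eqP => [->|//] /andP[h2 ->]; by rewrite (le_trans ac).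
rewrite /ibox -Rintegral_setU -?E //; try exact: measurable_hbox.
apply/eqP; rewrite -subset0 => z [/(_ i) + /(_ i)].
by rewrite !mxE eqxx => /andP[_ h1] /andP[h2 _]; rewrite ltNge h2 in h1.
Qed.

Lemma ibox_sub a b a' b' f : locint f -> hbox a b `<=` hbox a' b' ->
  (forall z, hbox a' b' z -> 0 <= f z) -> ibox a b f <= ibox a' b' f.
Proof.
move=> [mf If] sub f0; apply: fine_le.
- exact/integrable_fin_num/If/measurable_hbox.
- exact/integrable_fin_num/If/measurable_hbox.
- apply: (@ge0_subset_integral _ _ _ mu _ _ (measurable_hbox a b) (measurable_hbox a' b') _ _ _ sub).
  by apply/measurable_EFinP; exact: measurable_funS mf.
  by move=> z /f0; rewrite lee_fin.
Qed.

Lemma ibox_mkcond (D : set V) a b f : (forall z, D z -> ~ hbox a b z -> f z = 0) ->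
  \int[mu]_(z in D) f z = ibox a b (fun z => if z \in D then f z else 0).
Proof.
move=> h; rewrite /ibox Rintegral_mkcond [RHS]Rintegral_mkcond; congr (Rintegral _ _ _).
apply/funext => z; rewrite /patch; case: ifPn => zD; case: ifPn => zH => //.
by apply: h; [move: zD; rewrite inE|move: zH; rewrite notin_setE].
Qed.

Lemma ibox_supp a b a' b' f : hbox a b `<=` hbox a' b' -> (forall z, ~ hbox a b z -> f z = 0) ->
  ibox a' b' f = ibox a b f.
Proof.
move=> sub h; rewrite {1}/ibox (ibox_mkcond (a := a) (b := b)); last by move=> z _; exact: h.
by apply: ibox_eq => z /sub zab; rewrite mem_set.
Qed.

Lemma ibox_setT a b f : (forall z, ~ hbox a b z -> f z = 0) -> \int[mu]_z f z = ibox a b f.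
Proof.
move=> h; rewrite (ibox_mkcond (a := a) (b := b)); last by move=> z _; exact: h.
by apply: ibox_eq => z _; rewrite mem_set.
Qed.
End leb.

(* [lra] inspects every hypothesis, up to conversion: keep only the (in)equalities. *)
Ltac fast_lra := first
  [ solve [repeat match goal with H := _ |- _ =>
        lazymatch type of H with
        | forall Gam, _ -> locint _ => fail
        | _ => clearbody H
        end end;
      repeat match goal with H : ?T |- _ =>
        lazymatch T with
        | is_true _ => fail
        | _ = _ => fail
        | forall Gam, _ -> locint _ => fail
        | _ => clear H
        end
      end; lra]
  | lra].

(** * Continuously differentiable functions *)

Section c1.
Context (R : realType) (n : nat).
Local Notation V := 'rV[R]_n.
Implicit Types (a b x y z h : V) (f g : V -> R) (c d e s t : R) (i j : 'I_n).

Lemma contD (T : topologicalType) (u v : T -> R) : continuous u -> continuous v -> continuous (fun p => u p + v p).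
Proof. by move=> cu cv x; have := @continuousD _ _ _ u v x (cu x) (cv x). Qed.

Lemma contM (T : topologicalType) (u v : T -> R) : continuous u -> continuous v -> continuous (fun p => u p * v p).
Proof. by move=> cu cv x; have := @continuousM _ _ u v x (cu x) (cv x). Qed.

Lemma contN (T : topologicalType) (u : T -> R) : continuous u -> continuous (fun p => - u p).
Proof. by move=> cu x; have := @continuousN _ _ _ u x (cu x). Qed.

Lemma contB (T : topologicalType) (u v : T -> R) : continuous u -> continuous v -> continuous (fun p => u p - v p).
Proof. by move=> cu cv; exact: (contD cu (contN cv)). Qed.

Lemma cont_comp (T U : topologicalType) (S : topologicalType) (u : T -> U) (v : U -> S) :
  continuous u -> continuous v -> continuous (fun p => v (u p)).
Proof. by move=> cu cv x; have := @continuous_comp _ _ _ u v x (cu x) (cv (u x)). Qed.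

Lemma cont_prod (T : topologicalType) (I : finType) (P : pred I) (u : I -> T -> R) :
  (forall k, continuous (u k)) -> continuous (fun p => \prod_(k | P k) u k p).
Proof.
move=> cu; elim: (index_enum I) => [|k r IH].
  by under eq_fun do rewrite big_nil; exact: cst_continuous.
under eq_fun do rewrite big_cons; case: (P k) => //; exact: contM.
Qed.

(** Only [x] is confined to the box; [y] may lie outside, as shifts and mollifications require. *)
Lemma unif_cont f a b e : continuous f -> 0 < e ->
  exists2 d : R, 0 < d & forall x y, box (a, b) x -> (forall j, `|y ord0 j - x ord0 j| < d) -> `|f y - f x| < e.
Proof.
move=> cf e0.
have /compact_near_coveringP := @compact_box R n a b.
move=> /(_ R (0^'+) (fun d x => forall y, (forall j, `|y ord0 j - x ord0 j| < d) -> `|f y - f x| < e)).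
have H x : box (a, b) x -> \forall w \near (x : V) & d \near (0 : R)^'+,
    forall y, (forall j, `|y ord0 j - (w : V) ord0 j| < d) -> `|f y - f w| < e.
  move=> _.
  have : nbhs x [set y | `|f y - f x| < e / 2].
    have e20 : 0 < e / 2 by rewrite divr_gt0.
    have /cvgrPdist_lt/(_ _ e20) := cf x.
    by apply: filterS => y; rewrite distrC.
  move=> /nbhs_coordP[d d0 hd].
  exists ([set w : V | forall j, `|w ord0 j - x ord0 j| < d / 2], [set d' : R | d' < d / 2]).
    split => /=.
      by apply/nbhs_coordP; exists (d / 2); rewrite ?divr_gt0.
    by apply: nbhs_right_lt; rewrite divr_gt0.
  move=> [x' d'] /= [hx hd'] y hy.
  have h1 : `|f y - f x| < e / 2.
    apply: hd => j; have := hy j; have := hx j.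
    have := ler_normD (y ord0 j - x' ord0 j) (x' ord0 j - x ord0 j).
    by rewrite addrA subrK; lra.
  have h2 : `|f x' - f x| < e / 2 by apply: hd => j; have := hx j; lra.
  have := ler_normB (f y - f x) (f x' - f x).
  by rewrite opprB addrA subrK; lra.
move=> /(_ _ H) {H} h.
have [d [d0 hd]] : exists d : R, 0 < d /\ (box (a, b) `<=` (fun x => forall y, (forall j, `|y ord0 j - x ord0 j| < d) -> `|f y - f x| < e)).
  have [d] := @filter_ex _ _ (at_right_proper_filter (0:R)) _ (filterI (nbhs_right_gt (0 : R)) h).
  by move=> [d0 hd]; exists d.
by exists d => // x y xab; exact: hd.
Qed.

Definition vdir (i : 'I_n) : V := delta_mx ord0 i.

Lemma vdirE z t i j : (z + t *: vdir i) ord0 j = z ord0 j + t * (j == i)%:R.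
Proof. by rewrite !mxE eqxx. Qed.

(** The partial derivatives are carried as an explicit family, so that product and chain rules are
    computations on it. *)
Definition is_C1 f (D : 'I_n -> V -> R) :=
  [/\ continuous f, forall i, continuous (D i) & forall i z, is_derive z (vdir i) f (D i z)].

Lemma is_derive_line f z i t d : is_derive (z + t *: vdir i) (vdir i) f d <->
  is_derive t 1 (fun s : R => f (z + s *: vdir i)) d.
Proof.
have E : (fun h : R => h^-1 *: (f (h *: vdir i + (z + t *: vdir i)) - f (z + t *: vdir i))) =
  (fun h : R => h^-1 *: ((fun s : R => f (z + s *: vdir i)) (h *: 1 + t) - (fun s : R => f (z + s *: vdir i)) t)).
  apply/funext => h; congr (_ *: (f _ - _)).
  by rewrite /= addrCA -scalerDl /GRing.scale /= mulr1.
split => -[ex va].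
- split; first by move: ex; rewrite /derivable E.
  by rewrite -va /derive E.
- split; first by rewrite /derivable E.
  by rewrite -va /derive E.
Qed.

Lemma C1_line f D z i t : is_C1 f D ->
  is_derive (t : R) 1 (fun s : R => f (z + s *: vdir i)) (D i (z + t *: vdir i)).
Proof. by move=> [_ _ h]; apply/is_derive_line. Qed.

Lemma C1_cst c : is_C1 (fun=> c) (fun _ _ => 0).
Proof. by split => [|i|i z]; [exact: cst_continuous|exact: cst_continuous|exact: is_derive_cst]. Qed.

Lemma C1D f g Df Dg : is_C1 f Df -> is_C1 g Dg -> is_C1 (fun z => f z + g z) (fun i z => Df i z + Dg i z).
Proof.
move=> [cf cDf df] [cg cDg dg]; by split => [|i|i z]; [exact: contD|exact: contD|exact: is_deriveD].
Qed.

Lemma C1M f g Df Dg : is_C1 f Df -> is_C1 g Dg ->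
  is_C1 (fun z => f z * g z) (fun i z => Df i z * g z + f z * Dg i z).
Proof.
move=> [cf cDf df] [cg cDg dg]; split => [|i|i z]; first exact: contM.
- by apply: contD; exact: contM.
- have := is_deriveM (df i z) (dg i z).
  by rewrite /GRing.scale /= addrC [g z * _]mulrC.
Qed.

Definition is_C1R (F F' : R -> R) := continuous F' /\ forall t : R, is_derive t 1 F (F' t).

Lemma C1R_cont F F' : is_C1R F F' -> continuous F.
Proof.
move=> [_ dF] t; apply: differentiable_continuous; apply/derivable1_diffP.
exact: (@ex_derive _ _ _ _ _ _ _ (dF t)).
Qed.

Lemma C1_comp F F' f D : is_C1R F F' -> is_C1 f D ->
  is_C1 (fun z => F (f z)) (fun i z => F' (f z) * D i z).
Proof.
move=> CF Cf; have [cF' dF] := CF; have cF := C1R_cont CF; have [cf cD df] := Cf.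
split => [|i|i z]; first exact: (cont_comp cf cF).
- exact: (contM (cont_comp cf cF') (cD i)).
- have := C1_line z i 0 Cf; have := @is_derive_line (fun z => F (f z)) z i 0 (F' (f z) * D i z).
  rewrite scale0r addr0 => -> h.
  have := @is_derive1_comp _ F (fun s : R => f (z + s *: vdir i)) 0 (F' (f z)) (D i z).
  by apply => //; rewrite scale0r addr0; exact: dF.
Qed.

Lemma C1_prod (u u' : 'I_n -> R -> R) : (forall j, is_C1R (u j) (u' j)) ->
  is_C1 (fun z => \prod_j u j (z ord0 j))
        (fun i z => u' i (z ord0 i) * \prod_(j | j != i) u j (z ord0 j)).
Proof.
move=> Cu.
have cc j : continuous (fun z : V => u j (z ord0 j)).
  exact: (cont_comp (@coord_continuous R 1 n ord0 j) (C1R_cont (Cu j))).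
have cP (P : pred 'I_n) : continuous (fun z : V => \prod_(j | P j) u j (z ord0 j)).
  exact: cont_prod.
split => [|i|i z]; first exact: cP.
- apply: contM; last exact: cP.
  exact: (cont_comp (@coord_continuous R 1 n ord0 i) (proj1 (Cu i))).
- have E : (fun s : R => \prod_j u j ((z + s *: vdir i) ord0 j)) =
     (fun s : R => u i (s + z ord0 i) * \prod_(j | j != i) u j (z ord0 j)).
    apply/funext => s; rewrite (bigD1 i)//= vdirE eqxx mulr1 addrC; congr (_ * _).
    by apply: eq_bigr => j ji; rewrite vdirE (negbTE ji) mulr0 addr0.
  have := @is_derive_line (fun z : V => \prod_j u j (z ord0 j)) z i 0 (u' i (z ord0 i) * \prod_(j | j != i) u j (z ord0 j)).
  rewrite E scale0r addr0 => ->.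
  have h1 : is_derive (0 : R) 1 (fun s : R => u i (s + z ord0 i)) (u' i (z ord0 i)).
    have := @is_derive1_comp _ (u i) (fun s : R => s + z ord0 i) 0 (u' i (z ord0 i)) 1.
    rewrite add0r mulr1; apply; first by case: (Cu i).
    by rewrite -[X in is_derive _ _ _ X]addr0; apply: is_deriveD.
  have := is_deriveM h1 (is_derive_cst (\prod_(j | j != i) u j (z ord0 j)) (0:R) 1).
  by rewrite scaler0 add0r /GRing.scale /= [u' i _ * _]mulrC.
Qed.

(** The mean value theorem along a coordinate line, with the oscillation of the derivative as the
    error. *)
Lemma C1_increment f D z i t e : is_C1 f D ->
  (forall s, `|s| <= `|t| -> `|D i (z + s *: vdir i) - D i z| <= e) ->
  `|f (z + t *: vdir i) - f z - t * D i z| <= `|t| * e.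
Proof.
move=> Cf he; have [cf cD _] := Cf.
pose F s := f (z + s *: vdir i).
have F0 : F 0 = f z by rewrite /F scale0r addr0.
have dF s : is_derive s 1 F (D i (z + s *: vdir i)) by exact: C1_line.
have cF : continuous F.
  by move=> s; apply: differentiable_continuous; apply/derivable1_diffP; exact: (@ex_derive _ _ _ _ _ _ _ (dF s)).
suff [s st E] : exists2 s, `|s| <= `|t| & F t - F 0 = D i (z + s *: vdir i) * t.
  rewrite -/(F t) -F0 E mulrC -mulrBr normrM; apply: ler_wpM2l => //; exact: he.
have [t0|t0|->] := ltgtP t 0.
- have [|s st E] := @MVT _ F (fun s => D i (z + s *: vdir i)) t 0 t0 (fun s _ => dF s).
    exact: continuous_subspaceT.
  move: st; rewrite in_itv /= => /andP[h1 h2]; exists s; first by rewrite !ltr0_norm//; lra.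
  by rewrite -opprB E sub0r mulrN opprK.
- have [|s st E] := @MVT _ F (fun s => D i (z + s *: vdir i)) 0 t t0 (fun s _ => dF s).
    exact: continuous_subspaceT.
  move: st; rewrite in_itv /= => /andP[h1 h2]; exists s; first by rewrite !gtr0_norm//; lra.
  by rewrite E subr0.
- by exists 0 => //; rewrite subrr mulr0.
Qed.
Local Notation mu := (lebesgue_n R n).

Lemma integrable_supp f a b : locint f -> (forall z, ~ hbox a b z -> f z = 0) ->
  mu.-integrable setT (EFin \o f).
Proof.
move=> [mf If] f0.
have := If a b; rewrite (integrable_mkcond _ (measurable_hbox a b)).
rewrite (_ : (EFin \o f) \_ (hbox a b) = EFin \o f)//; apply/funext => z; rewrite /patch.
by case: ifPn => //; rewrite notin_setE => /f0 /= ->.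
Qed.

Definition shiftc a c : V := \row_i (a ord0 i + c).

Lemma cont_shift f h : continuous f -> continuous (fun z => f (z + h)).
Proof.
move=> cf; apply: (cont_comp _ cf) => z; apply: continuousD; [exact: cvg_id|exact: cst_continuous].
Qed.

Lemma ibox_shift f a b a' b' h : continuous f -> (forall z, ~ hbox a b z -> f z = 0) ->
  (forall z, ~ hbox a' b' z -> f z = 0 /\ f (z + h) = 0) ->
  ibox a' b' (fun z => f (z + h)) = ibox a' b' f.
Proof.
move=> cf f0 f1.
have cfh := @cont_shift _ h cf.
rewrite -(ibox_setT (a := a') (b := b') (f := f)); last by move=> z /f1[].
rewrite -(ibox_setT (a := a') (b := b')); last by move=> z /f1[].
apply: Rintegral_shift; first exact: continuous_measurable_leb.
by apply: (@integrable_supp _ a' b'); [exact: locint_cont|move=> z /f1[]].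
Qed.

(* Translation invariance makes the integral of a difference quotient vanish. *)
Lemma ibox_C1_partial f D a b i : is_C1 f D -> (forall i, a ord0 i <= b ord0 i) ->
  (forall z, ~ hbox a b z -> f z = 0) -> (forall z, ~ hbox a b z -> D i z = 0) ->
  ibox a b (D i) = 0.
Proof.
move=> Cf ab f0 D0; have [cf cD _] := Cf.
pose A := shiftc a (-1); pose B := shiftc b 1.
have AB j : A ord0 j <= B ord0 j by rewrite !mxE; have := ab j; lra.
have sub : hbox a b `<=` hbox A B.
  by apply: hbox_sub => j; rewrite !mxE; lra.
rewrite -(ibox_supp sub D0).
apply/eqP; rewrite -normr_eq0 eq_le normr_ge0 andbT.
apply/ler_addgt0Pl => e e0; rewrite addr0.
have v1 : 0 < vol A B + 1 by rewrite ltr_wpDl// vol_ge0.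
have [d d0 hd] := @unif_cont (D i) A B (e / (vol A B + 1)) (cD i) (divr_gt0 e0 v1).
(* Below [d], to control the error of the difference quotient, and below 1, to keep the shifted
   support in the enlarged box. *)
pose t := Num.min (d / 2) (1 / 2).
have t0 : 0 < t by rewrite lt_min !divr_gt0.
have td : t < d by apply: (@le_lt_trans _ _ (d / 2)); [rewrite ge_min lexx|lra].
have t1 : t < 1 by apply: (@le_lt_trans _ _ (1 / 2)); [rewrite ge_min lexx orbT|lra].
have out z : ~ hbox A B z -> f z = 0 /\ f (z + t *: vdir i) = 0.
  move=> nz; split; apply: f0 => zab; apply: nz; first exact: sub.
  move=> j; have := zab j; rewrite vdirE !mxE; case: eqP => _; rewrite ?mulr1 ?mulr0; lra.
have E := ibox_shift cf f0 out.
have lf := locint_cont cf.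
have cfh := @cont_shift _ (t *: vdir i) cf.
have lfh := locint_cont cfh.
have lD := locint_cont (cD i).
have H : ibox A B (fun z => (f (z + t *: vdir i) - f z) - t * D i z) = - (t * ibox A B (D i)).
  rewrite iboxB; [|exact: locintB|exact: locintZ].
  by rewrite iboxB// E subrr sub0r iboxZ.
have H2 : `|t * ibox A B (D i)| <= t * e.
  rewrite -normrN -H; apply: le_trans (ibox_abs _ _ _) _.
    by apply: locintB; [exact: locintB|exact: locintZ].
  apply: (@le_trans _ _ (ibox A B (fun=> t * (e / (vol A B + 1))))).
    apply: ibox_le; [|exact: locint_cst|].
      by apply: locint_abs; apply: locintB; [exact: locintB|exact: locintZ].
    move=> z zAB; rewrite -[X in X * (e / _)](gtr0_norm t0); apply: (C1_increment Cf) => s st.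
    apply/ltW; apply: hd; first exact: hbox_box.
    move=> j; rewrite vdirE addrC addKr; move: st; rewrite (gtr0_norm t0) => st.
    by case: eqP => _; rewrite ?mulr1 ?mulr0 ?normr0//; exact: le_lt_trans td.
  rewrite ibox_cst// -mulrA ler_pM2l// -mulrA ger_pMr// mulrC ler_pdivrMr// mul1r; lra.
by move: H2; rewrite normrM gtr0_norm// ler_pM2l.
Qed.
End c1.

(** * Smooth bumps and mollification *)

Section cbump.
Context (R : realType).
Implicit Types (f g : R -> R) (s t c d e : R).

Fixpoint Ck k f : Prop := match k with
  | 0%N => continuous f
  | k'.+1 => (forall t, derivable f t 1) /\ Ck k' (f^`())%classic
  end.

Definition smoothR f := forall k, Ck k f.

Lemma is_derive_cont f t d : is_derive t 1 f d -> {for t, continuous f}.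
Proof.
move=> df; apply: differentiable_continuous; apply/derivable1_diffP.
exact: (@ex_derive _ _ _ _ _ _ _ df).
Qed.

Lemma CkS k f : Ck k.+1 f -> Ck k f.
Proof.
elim: k f => [|k IH] f [df h] /=.
  by move=> t; apply: differentiable_continuous; apply/derivable1_diffP.
by split => //; exact: IH.
Qed.

Lemma derive1_is f t d : is_derive t 1 f d -> f^`()%classic t = d.
Proof. by move=> h; rewrite derive1E (@derive_val _ _ _ _ _ _ _ h). Qed.

Lemma is_derive1E f t : derivable f t 1 -> is_derive t 1 f (f^`()%classic t).
Proof. by move=> h; rewrite derive1E; exact: derivableP. Qed.

Lemma Ck_deriv k f f' : (forall t, is_derive t 1 f (f' t)) -> Ck k f' -> Ck k.+1 f.
Proof.
move=> df Cf'; split => [t|]; first exact: (@ex_derive _ _ _ _ _ _ _ (df t)).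
by rewrite (_ : f^`()%classic = f')//; apply/funext => t; exact: derive1_is.
Qed.

Lemma Ck_cst k c : Ck k (fun=> c).
Proof.
elim: k c => [|k IH] c; first exact: cst_continuous.
by apply: (@Ck_deriv _ _ (fun=> 0)) => // t; exact: is_derive_cst.
Qed.

Lemma CkD k f g : Ck k f -> Ck k g -> Ck k (fun t => f t + g t).
Proof.
elim: k f g => [|k IH] f g; first exact: contD.
move=> [df Cf] [dg Cg]; apply: (@Ck_deriv _ _ (fun t => f^`()%classic t + g^`()%classic t)); last exact: IH.
by move=> t; apply: is_deriveD; exact: is_derive1E.
Qed.

Lemma CkM k f g : Ck k f -> Ck k g -> Ck k (fun t => f t * g t).
Proof.
elim: k f g => [|k IH] f g; first exact: contM.
move=> Cf Cg; have [df Cf'] := Cf; have [dg Cg'] := Cg.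
apply: (@Ck_deriv _ _ (fun t => f t * g^`()%classic t + g t * f^`()%classic t)).
  by move=> t; apply: is_deriveM; exact: is_derive1E.
by apply: CkD; apply: IH => //; exact: CkS.
Qed.

Lemma Ck_affine k f c d : Ck k f -> Ck k (fun t => f (c * t + d)).
Proof.
have da t : is_derive t 1 (fun t => c * t + d) c.
  rewrite -[X in is_derive _ _ _ X]addr0; apply: is_deriveD.
  rewrite -[X in is_derive _ _ _ X]mulr1; exact: is_deriveZ.
elim: k f => [|k IH] f.
  move=> cf; apply: (cont_comp _ cf) => t; exact: is_derive_cont (da t).
move=> [df Cf]; apply: (@Ck_deriv _ _ (fun t => f^`()%classic (c * t + d) * c)).
  by move=> t; apply: is_derive1_comp; exact: is_derive1E.
exact: (CkM (IH _ Cf) (Ck_cst k c)).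
Qed.

(** The derivatives of exp(-1/t) are combinations of these functions, which turns its smoothness
    into an induction on the order. *)
Definition flat k t : R := if 0 < t then t^-1 ^+ k * expR (- t^-1) else 0.

(** The exponential of x is at least (x / m)^m; with m = k + 2 two powers of [t] are left over, and
    these make the derivative at 0 vanish. *)
Lemma flat_le k t : 0 < t -> flat k t <= (k.+2%:R ^+ k.+2) * t ^+ 2.
Proof.
move=> t0; rewrite /flat t0; set m := k.+2.
have m0 : 0 < (m%:R : R) by [].
have t10 : 0 < t^-1 by rewrite invr_gt0.
rewrite expRN ler_pdivrMr ?expR_gt0//.
have : (t^-1 / m%:R) ^+ m <= expR t^-1.
  rewrite -[X in expR X](divfK (lt0r_neq0 m0)) expRM_natr.
  rewrite lerXn2r ?nnegrE ?expR_ge0 ?divr_ge0 ?ltW//.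
  by apply: lt_le_trans (expR_ge1Dx _); rewrite ltrDr.
rewrite expr_div_n ler_pdivrMr ?exprn_gt0// => h.
have t20 : 0 < t ^+ 2 by rewrite exprn_gt0.
have -> : t^-1 ^+ k = t ^+ 2 * t^-1 ^+ m.
  by rewrite /m -[k.+2]addn2 exprD mulrCA -exprMn mulfV ?gt_eqF// expr1n mulr1.
have -> : m%:R ^+ m * t ^+ 2 * expR t^-1 = t ^+ 2 * (expR t^-1 * m%:R ^+ m) by ring.
by rewrite ler_pM2l.
Qed.

Lemma flat_ge0 k t : 0 <= flat k t.
Proof. by rewrite /flat; case: ifP => // t0; rewrite mulr_ge0 ?expR_ge0// exprn_ge0// invr_ge0 ltW. Qed.

Lemma is_derive_est f t d : (forall e, 0 < e -> exists2 r : R, 0 < r & forall h, `|h| < r -> `|f (t + h) - f t - h * d| <= e * `|h|) ->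
  is_derive t 1 f d.
Proof.
move=> H.
suff cv : (fun h => h^-1 *: (f (h *: 1 + t) - f t)) @ (0 : R)^' --> d.
  split; first by apply/cvg_ex; exists d.
  by apply: cvg_lim.
apply/cvgrPdist_le => e e0; have [r r0 hr] := H _ e0.
near=> h.
have h0 : h != 0 by near: h; exact: nbhs_dnbhs_neq.
have hlt : `|h| < r by near: h; apply: dnbhs0_lt.
have := hr _ hlt; rewrite /GRing.scale /= mulr1 [h + t]addrC => le.
rewrite -normrN opprB.
have -> : h^-1 * (f (t + h) - f t) - d = h^-1 * (f (t + h) - f t - h * d).
  by rewrite [RHS]mulrBr [h^-1 * (h * d)]mulrA mulVf// mul1r.
by rewrite normrM normfV ler_pdivrMl ?normr_gt0// [X in _ <= X]mulrC.
Unshelve. all: by end_near. Qed.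

Lemma flat_derive k t : is_derive t 1 (flat k) (flat k.+2 t - k%:R * flat k.+1 t).
Proof.
have [t0|t0|->] := ltgtP t 0.
- rewrite /flat ltNge (ltW t0) /= mulr0 subr0.
  have d0 : is_derive t 1 (fun=> 0 : R) 0 by exact: is_derive_cst.
  apply: (near_eq_is_derive _ d0).
  near=> s; rewrite ifF//; apply/negbTE; rewrite -leNgt; apply/ltW.
  by near: s; apply: lt_nbhsl.
- pose F (t : R) := t^-1 ^+ k * expR (- t^-1).
  have dF : is_derive t 1 F (flat k.+2 t - k%:R * flat k.+1 t).
    have dv : is_derive t 1 (fun t : R => t^-1) (- t ^- 2).
      by have := is_deriveV (lt0r_neq0 t0) (is_derive_id t (1 : R)); rewrite /GRing.scale /= mulr1.
    have dX : is_derive t 1 (fun t : R => t^-1 ^+ k) (k%:R * t^-1 ^+ k.-1 * (- t ^- 2)).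
      have := @is_deriveX _ _ (fun t : R => t^-1) k t 1 _ dv; rewrite /GRing.scale /=.
      congr is_derive; apply/funext => s {F}; elim: k => [|k IH]; first by rewrite !expr0.
      by rewrite !exprS -IH.
    have dE : is_derive t 1 (fun t : R => expR (- t^-1)) (expR (- t^-1) * t ^- 2).
      have dN : is_derive t 1 (fun t : R => - t^-1) (t ^- 2).
        by rewrite -[X in is_derive _ _ _ X]opprK; apply: is_deriveN.
      have dx : is_derive (- t^-1) 1 expR (expR (- t^-1)) by exact: is_derive_expR.
      exact: (@is_derive1_comp _ expR (fun t : R => - t^-1) t (expR (- t^-1)) (t ^- 2) dx dN).
    have := is_deriveM dX dE; congr is_derive.
    rewrite /flat t0 /GRing.scale /= -[t ^- 2]exprVn.
    case: k {F dX} => [|k]; first by rewrite !mul0r !mulr0 addr0 subr0; ring.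
    by rewrite /= !exprS; ring.
  apply: (near_eq_is_derive _ dF).
  near=> s; rewrite /flat /F ifT//; near: s; exact: lt_nbhsr.
- rewrite /flat ltxx mulr0 subr0.
  apply: is_derive_est => e e0.
  pose C : R := k.+2%:R ^+ k.+2.
  have C0 : 0 < C by rewrite exprn_gt0.
  exists (e / C); first by rewrite divr_gt0.
  move=> h hlt; rewrite add0r mulr0 subr0 ltxx subr0.
  case: ifPn => h0; last by rewrite normr0 mulr_ge0// ltW.
  have := flat_le k h0; have := flat_ge0 k h; rewrite /flat h0 => p0 ple.
  rewrite ger0_norm// gtr0_norm//; apply: le_trans ple _.
  rewrite -/C expr2 mulrA ler_pM2r//; move: hlt; rewrite gtr0_norm// ltr_pdivlMr// => /ltW.
  by rewrite mulrC.
Unshelve. all: by end_near. Qed.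

Lemma smooth_flat k : smoothR (flat k).
Proof.
move=> j; elim: j k => [|j IH] k.
  by move=> t; exact: is_derive_cont (flat_derive k t).
apply: (@Ck_deriv _ _ (fun t => flat k.+2 t + (- k%:R) * flat k.+1 t)).
  by move=> t; rewrite mulNr; exact: flat_derive.
apply: CkD; first exact: IH.
exact: (CkM (Ck_cst j (- k%:R)) (IH k.+1)).
Qed.

Definition cbump t : R := flat 0 (t + 1) * flat 0 (1 - t).

Lemma smooth_bump : smoothR cbump.
Proof.
move=> k; apply: CkM.
  have := @Ck_affine k (flat 0) 1 1 (smooth_flat 0 k).
  by congr Ck; apply/funext => t; rewrite mul1r.
have := @Ck_affine k (flat 0) (-1) 1 (smooth_flat 0 k).
by congr Ck; apply/funext => t; rewrite mulN1r addrC.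
Qed.

Lemma bumpN t : cbump (- t) = cbump t.
Proof. by rewrite /cbump opprK mulrC; congr (flat _ _ * flat _ _); rewrite addrC. Qed.

Lemma bump_supp t : 1 <= `|t| -> cbump t = 0.
Proof.
rewrite /cbump /flat ler_normr => /orP[h|h].
  by rewrite [X in _ * X]ifF ?mulr0//; apply/negbTE; rewrite -leNgt; lra.
by rewrite ifF ?mul0r//; apply/negbTE; rewrite -leNgt; lra.
Qed.

Lemma bump_ge0 t : 0 <= cbump t.
Proof. by rewrite mulr_ge0// flat_ge0. Qed.

Lemma bump_half t : `|t| <= 1 / 2 -> expR (- 2) ^+ 2 <= cbump t.
Proof.
have H s : 1 / 2 <= s -> expR (- 2) <= flat 0 s.
  move=> s2; have s0 : 0 < s by lra.
  rewrite /flat s0 expr0 mul1r ler_expR lerN2 -[leRHS]invrK lef_pV2 ?posrE ?invr_gt0//; lra.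
rewrite ler_norml => /andP[h1 h2]; rewrite expr2; apply: ler_pM; rewrite ?expR_ge0//; apply: H; lra.
Qed.
End cbump.

Section mollifier.
Context (R : realType) (n : nat).
Local Notation V := 'rV[R]_n.
Local Notation mu := (lebesgue_n R n).
Implicit Types (a b x y z h : V) (f g : V -> R) (c d e s t : R) (i j : 'I_n).

Lemma smoothR_C1R (u : R -> R) : smoothR u -> is_C1R u (u^`()%classic).
Proof.
move=> su; split; first by have [] := su 1%N.
by move=> t; apply: is_derive1E; have [+ _] := su 1%N; apply.
Qed.

Lemma smoothR_derive (u : R -> R) : smoothR u -> smoothR (u^`()%classic).
Proof. by move=> su k; have [] := su k.+1. Qed.

(** A partial derivative of a product of one-variable functions is again such a product, with one
    factor replaced; the induction runs over the list of derivatives. *)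
Lemma smooth_prod (u : 'I_n -> R -> R) : (forall j, smoothR (u j)) ->
  smooth (fun z : V => \prod_j u j (z ord0 j)).
Proof.
move=> su s.
suff [v [sv ->]] : exists v : 'I_n -> R -> R, (forall j, smoothR (v j)) /\
    foldr (@partial_derive R n) (fun z : V => \prod_j u j (z ord0 j)) s = (fun z : V => \prod_j v j (z ord0 j)).
  have [cP _ dP] := C1_prod (fun j => smoothR_C1R (sv j)).
  by split => // i z; exact: (@ex_derive _ _ _ _ _ _ _ (dP i z)).
elim: s => [|i s [v [sv E]]] /=; first by exists u.
exists (fun j => if j == i then (v i)^`()%classic else v j); split.
  by move=> j; case: eqP => _ //; exact: smoothR_derive.
rewrite E; apply/funext => z; rewrite /partial_derive.
have [_ _ dP] := C1_prod (fun j => smoothR_C1R (sv j)).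
rewrite (@derive_val _ _ _ _ _ _ _ (dP i z)) [RHS](bigD1 i)//= eqxx; congr (_ * _).
by apply: eq_bigr => j /negbTE ->.
Qed.
End mollifier.

(** * Convolution with a compactly supported kernel, and induction along bisections *)

Section convolution.
Context (R : realType) (n : nat).
Local Notation V := 'rV[R]_n.
Local Notation mu := (lebesgue_n R n).
Implicit Types (a b p q x y z h w : V) (f g phi K : V -> R) (c d e s t r : R) (i j : 'I_n).

Lemma cont_est f : (forall x e, 0 < e -> exists2 d : R, 0 < d &
   forall y, (forall j, `|y ord0 j - x ord0 j| < d) -> `|f y - f x| < e) -> continuous f.
Proof.
move=> H x; apply/(@cvgrPdist_lt _ _ V (nbhs x) (nbhs_filter x) f (f x)) => e e0.
have [d d0 hd] := H x e e0; apply/nbhs_coordP; exists d => // y /hd.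
by rewrite distrC.
Qed.

(** Dividing by [t + 1] and not by [t] avoids the case [t = 0]. This is how most of the small
    parameters below are absorbed. *)
Lemma div_succ_lt e t : 0 < e -> 0 <= t -> e / (t + 1) * t < e.
Proof. by move=> e0 t0; rewrite mulrAC ltr_pdivrMr ?ltr_wpDl//; nra. Qed.

Definition suppr phi r := forall w, (exists j, r <= `|w ord0 j|) -> phi w = 0.

Lemma unif_cont_supp phi r e : continuous phi -> suppr phi r -> 0 < e ->
  exists2 d : R, 0 < d & forall x y, (forall j, `|y ord0 j - x ord0 j| < d) -> `|phi y - phi x| < e.
Proof.
move=> cp sp e0.
have [d d0 hd] := @unif_cont R n phi (const_mx (- (r + 1))) (const_mx (r + 1)) e cp e0.
exists (Num.min d 1); first by rewrite lt_min d0 ltr01.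
move=> x y xy.
have xy1 j : `|y ord0 j - x ord0 j| < d by apply: lt_le_trans (xy j) _; rewrite ge_min lexx.
have xy2 j : `|y ord0 j - x ord0 j| < 1 by apply: lt_le_trans (xy j) _; rewrite ge_min lexx orbT.
have [h|/existsNP[j hj]] := pselect (forall j, `|x ord0 j| <= r + 1).
  by apply: hd => // j /=; rewrite !mxE; have := h j; rewrite ler_norml => /andP[-> ->].
move: hj => /negP; rewrite -ltNge => hj.
rewrite (sp x) ?(sp y) ?subrr ?normr0//; exists j; last by apply: ltW; lra.
have := lerB_normD (x ord0 j) (y ord0 j - x ord0 j); rewrite addrCA subrr addr0 => h1.
by have := xy2 j; lra.
Qed.

Lemma suppr_le phi r s : r <= s -> suppr phi r -> suppr phi s.
Proof. by move=> rs sp w [j hj]; apply: sp; exists j; exact: le_trans hj. Qed.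

Lemma cont_refl phi z : continuous phi -> continuous (fun y => phi (z - y)).
Proof.
move=> cp; apply: (cont_comp _ cp) => y.
by apply: continuousB; [exact: cst_continuous|exact: cvg_id].
Qed.

Lemma locint_ker f K : locint f -> continuous K -> locint (fun y => K y * f y).
Proof.
move=> lf cK; apply: locintM => //; [exact: continuous_measurable_leb|exact: cont_locbd].
Qed.

Lemma ibox_ker_le a b K f e : locint f -> continuous K -> (forall y, hbox a b y -> `|K y| <= e) ->
  `|ibox a b (fun y => K y * f y)| <= e * ibox a b (fun y => `|f y|).
Proof.
move=> lf cK hK; apply: (le_trans (ibox_abs _ _ (locint_ker lf cK))).
rewrite -iboxZ; last exact: locint_abs.
apply: ibox_le => [||y yab]; first exact/locint_abs/locint_ker.
  by apply: locintZ; exact: locint_abs.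
by rewrite normrM ler_wpM2r// hK.
Qed.

Definition convol f phi z := \int[mu]_y (phi (z - y) * f y).

Lemma convol_ibox f phi r z a b : suppr phi r ->
  (forall y, (forall j, `|y ord0 j - z ord0 j| < r) -> hbox a b y) ->
  convol f phi z = ibox a b (fun y => phi (z - y) * f y).
Proof.
move=> sp sub; apply: ibox_setT => y nab; rewrite sp ?mul0r//.
have /existsNP[j hj] : ~ (forall j, `|y ord0 j - z ord0 j| < r) by move=> /sub.
by exists j; rewrite !mxE -normrN opprB leNgt; apply/negP.
Qed.

Lemma near_qbox x z r s : (forall j, `|z ord0 j - x ord0 j| <= s) ->
  forall y, (forall j, `|y ord0 j - z ord0 j| < r) -> qbox x (r + s) y.
Proof.
move=> zx y yz; apply/qboxP => j; have := zx j; have := yz j.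
by rewrite ltr_norml ler_norml => /andP[? ?] /andP[? ?]; lra.
Qed.

Lemma convol_cont f phi r : locint f -> continuous phi -> suppr phi r -> continuous (convol f phi).
Proof.
move=> lf cp sp; apply: cont_est => z0 e e0.
pose a := lower z0 (r + 1); pose b := upper z0 (r + 1).
pose I := ibox a b (fun y => `|f y|).
have I0 : 0 <= I by apply: ibox_ge0.
have eI : 0 < e / (I + 1) by rewrite divr_gt0// ltr_wpDl.
have [d d0 hd] := unif_cont_supp cp sp eI.
exists (Num.min d 1); first by rewrite lt_min d0 ltr01.
move=> z zz.
have z1 j : `|z ord0 j - z0 ord0 j| < d by apply: lt_le_trans (zz j) _; rewrite ge_min lexx.
have z2 j : `|z ord0 j - z0 ord0 j| <= 1 by apply/ltW/(lt_le_trans (zz j)); rewrite ge_min lexx orbT.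
rewrite (convol_ibox _ (a := a) (b := b) sp); last exact: near_qbox.
rewrite (convol_ibox _ (a := a) (b := b) sp); last first.
  by apply: near_qbox => j; rewrite subrr normr0.
rewrite -iboxB; [|exact/locint_ker/cont_refl|exact/locint_ker/cont_refl].
rewrite (ibox_eq (g := fun y => (phi (z - y) - phi (z0 - y)) * f y)); last by move=> y _; rewrite mulrBl.
apply: (@le_lt_trans _ _ (e / (I + 1) * I)).
  apply: ibox_ker_le => //; first by apply: contB; exact: cont_refl.
  by move=> y _; apply/ltW/hd => j; rewrite !mxE; have := z1 j; congr (`|_| < _); ring.
exact: div_succ_lt.
Qed.

Lemma is_derive_lineW f z i d : (forall e, 0 < e -> exists2 r : R, 0 < r & forall h : R, `|h| < r ->
   `|f (z + h *: vdir R i) - f z - h * d| <= e * `|h|) -> is_derive z (vdir R i) f d.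
Proof.
move=> H; have := @is_derive_line R n f z i 0 d; rewrite scale0r addr0 => ->.
by apply: is_derive_est => e e0; have [r r0 hr] := H e e0; exists r => // h /hr; rewrite add0r scale0r addr0.
Qed.

(** All derivatives fall on the kernel, so that local integrability of [f] suffices. *)
Lemma convol_C1 f phi Dphi r : locint f -> is_C1 phi Dphi -> suppr phi r -> (forall i, suppr (Dphi i) r) ->
  is_C1 (convol f phi) (fun i => convol f (Dphi i)).
Proof.
move=> lf Cp sp sD; have [cp cD _] := Cp.
split => [|i|i z]; first exact: convol_cont sp.
  exact: (convol_cont lf (cD i) (sD i)).
apply: is_derive_lineW => e e0.
pose a := lower z (r + 1); pose b := upper z (r + 1).
pose I := ibox a b (fun y => `|f y|).
have I0 : 0 <= I by apply: ibox_ge0.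
have eI : 0 < e / (I + 1) by rewrite divr_gt0// ltr_wpDl.
have [d d0 hd] := unif_cont_supp (cD i) (sD i) eI.
exists (Num.min d 1); first by rewrite lt_min d0 ltr01.
move=> h hlt.
have h1 : `|h| < d by apply: lt_le_trans hlt _; rewrite ge_min lexx.
have h2 : `|h| < 1 by apply: (lt_le_trans hlt); rewrite ge_min lexx orbT.
have z2 j : `|(z + h *: vdir R i) ord0 j - z ord0 j| <= 1.
  by rewrite vdirE addrC addKr; case: eqP => _; rewrite ?mulr1 ?mulr0 ?normr0// ltW.
have z3 j : `|z ord0 j - z ord0 j| <= 1 by rewrite subrr normr0.
rewrite (convol_ibox _ (a := a) (b := b) sp); last exact: near_qbox.
rewrite (convol_ibox _ (a := a) (b := b) sp); last exact: near_qbox.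
rewrite (convol_ibox _ (a := a) (b := b) (sD i)); last exact: near_qbox.
have l1 := locint_ker lf (@cont_refl _ (z + h *: vdir R i) cp).
have l2 := locint_ker lf (@cont_refl _ z cp).
have l3 := locint_ker lf (@cont_refl _ z (cD i)).
rewrite -iboxB// -iboxZ// -iboxB; [|exact: locintB|exact: locintZ].
pose K y := phi (z + h *: vdir R i - y) - phi (z - y) - h * Dphi i (z - y).
rewrite (ibox_eq (g := fun y => K y * f y)); last by move=> y _; rewrite /K; ring.
apply: (@le_trans _ _ (`|h| * (e / (I + 1)) * I)); last first.
  by rewrite -mulrA mulrC; apply: ler_wpM2r => //; apply/ltW/div_succ_lt.
apply: ibox_ker_le => //.
  apply: contB; first by apply: contB; exact: cont_refl.
  by apply: contM; [exact: cst_continuous|exact/cont_refl/cD].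
move=> y _; rewrite /K.
have -> : z + h *: vdir R i - y = (z - y) + h *: vdir R i by rewrite addrAC.
apply: (C1_increment Cp) => t th; apply/ltW/hd => j; rewrite vdirE addrC addKr.
by case: eqP => _; rewrite ?mulr1 ?mulr0 ?normr0//; exact: le_lt_trans h1.
Qed.

(** The number [k i] counts the halvings that side [i] may still undergo before it is shorter than
    [d]; each bisection lowers the sum of these numbers. *)
Lemma bisect_ind (P : V -> V -> Prop) (d : R) a b : 0 < d -> (forall i, a ord0 i <= b ord0 i) ->
  (forall p q, (forall i, [/\ a ord0 i <= p ord0 i, p ord0 i <= q ord0 i & q ord0 i <= b ord0 i]) ->
     (forall i, q ord0 i - p ord0 i < d) -> P p q) ->
  (forall p q i c, (forall i, [/\ a ord0 i <= p ord0 i, p ord0 i <= q ord0 i & q ord0 i <= b ord0 i]) ->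
     p ord0 i <= c <= q ord0 i -> P p (upd q i c) -> P (upd p i c) q -> P p q) ->
  P a b.
Proof.
move=> d0 ab leaf step.
pose Q p q := forall i, [/\ a ord0 i <= p ord0 i, p ord0 i <= q ord0 i & q ord0 i <= b ord0 i].
suff H : forall N (k : 'I_n -> nat) p q, (\sum_i k i <= N)%N -> Q p q ->
    (forall i, q ord0 i - p ord0 i < d * 2 ^+ k i) -> P p q.
  have /choice[k hk] : forall i, exists k : nat, b ord0 i - a ord0 i < d * 2 ^+ k.
    move=> i; exists (Num.bound ((b ord0 i - a ord0 i) / d)).
    rewrite mulrC -ltr_pdivrMr//; apply: (lt_trans (archi_boundP _)).
      by rewrite divr_ge0 ?subr_ge0// ltW.
    by rewrite -natrX ltr_nat ltn_expl.
  by apply: (H _ k a b (leqnn _)) => // i; split.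
elim => [|N IH] k p q kN Qpq hk.
  apply: leaf => // i; have := hk i.
  have -> : k i = 0%N by apply/eqP; rewrite -leqn0 (leq_trans _ kN)// (bigD1 i)//= leq_addr.
  by rewrite mulr1.
have [/existsP[i ki]|/existsPn h] := boolP [exists i, (0 < k i)%N]; last first.
  by apply: leaf => // i; have := hk i; have := h i; rewrite -eqn0Ngt => /eqP ->; rewrite mulr1.
pose c := (p ord0 i + q ord0 i) / 2.
have [pq1 pq2 pq3] := Qpq i.
pose k' j := if j == i then (k i).-1 else k j.
have kE : k i = (k i).-1.+1 by rewrite prednK.
have k'N : (\sum_i k' i <= N)%N.
  have S1 : (\sum_j k j = k i + \sum_(j | j != i) k j)%N by rewrite (bigD1 i).
  have S2 : (\sum_j k' j = (k i).-1 + \sum_(j | j != i) k j)%N.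
    rewrite (bigD1 i)//= {1}/k' eqxx; congr addn.
    by apply: eq_bigr => j /negbTE; rewrite /k' => ->.
  by rewrite S2 -ltnS -addSn -kE -S1.
have hc : p ord0 i <= c <= q ord0 i by rewrite /c; apply/andP; split; fast_lra.
have hk' : q ord0 i - p ord0 i < d * 2 ^+ (k i).-1 * 2 by rewrite -mulrA -exprSr -kE.
apply: (step p q i c) => //; apply: (IH k') => // j.
- rewrite mxE; have [r1 r2 r3] := Qpq j; case: eqP => [->|_]; split => //; rewrite /c; fast_lra.
- by rewrite mxE /k'; case: eqP => [->|_ //]; rewrite /c; fast_lra.
- rewrite mxE; have [r1 r2 r3] := Qpq j; case: eqP => [->|_]; split => //; rewrite /c; fast_lra.
- by rewrite mxE /k'; case: eqP => [->|_ //]; rewrite /c; fast_lra.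
Qed.
End convolution.

(** * Moving a convolution from one factor of an integral to the other *)

Section exchange.
Context (R : realType) (n : nat).
Local Notation V := 'rV[R]_n.
Local Notation mu := (lebesgue_n R n).
Implicit Types (a b p q x y z w : V) (f g h phi K : V -> R) (c d e s t r : R) (i j : 'I_n).

Lemma vol_split a b i c : a ord0 i <= c <= b ord0 i -> (forall i, a ord0 i <= b ord0 i) ->
  vol a b = vol a (upd b i c) + vol (upd a i c) b.
Proof.
move=> abc ab; have := @ibox_split R n a b i c (fun=> 1) abc (locint_cst n 1).
rewrite !ibox_cst ?mul1r// => j; rewrite mxE; case: eqP => // ->; by case/andP: abc.
Qed.

Lemma suppr_bounded phi r : continuous phi -> suppr phi r -> exists M, forall w, `|phi w| <= M.
Proof.
move=> cp sp; have [M hM] := @cont_bounded_box R n phi (const_mx (- r)) (const_mx r) cp.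
exists (Num.max M 0) => w; have [h|/existsNP[j hj]] := pselect (forall j, `|w ord0 j| <= r).
  rewrite le_max hM// => j /=; rewrite !mxE; by have := h j; rewrite ler_norml.
rewrite sp ?normr0 ?le_max ?lexx ?orbT//; exists j; apply: ltW; rewrite ltNge; exact/negP.
Qed.

(** An instance of Fubini's theorem, obtained by Riemann sums: on a small box both sides agree up to
    a small multiple of its volume, and such an error is additive under bisection. *)
Lemma convol_exchange g h phi r a b : locint g -> continuous h -> (forall z, ~ hbox a b z -> h z = 0) ->
  continuous phi -> suppr phi r -> (forall w, phi (- w) = phi w) -> (forall i, a ord0 i <= b ord0 i) ->
  ibox a b (fun z => h z * convol g phi z) =
  ibox (shiftc a (- r)) (shiftc b r) (fun y => convol h phi y * g y).
Proof.
move=> lg ch h0 cp sp ev ab.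
set A := shiftc a (- r); set B := shiftc b r.
have cg := convol_cont lg cp sp.
pose H z := h z * convol g phi z.
have cH : continuous H by exact: contM.
pose I := ibox A B (fun y => `|g y|).
have I0 : 0 <= I by apply: ibox_ge0.
have [M1 hM1] := suppr_bounded cp sp.
have [M2 hM2] := @cont_bounded_box R n h a b ch.
pose M := `|M1| + `|M2| + 1.
have M0 : 0 < M by rewrite ltr_wpDl// addr_ge0.
have hphi w : `|phi w| <= M by apply: (le_trans (hM1 w)); have := ler_norm M1; have := normr_ge0 M2; rewrite /M; fast_lra.
have hh z : box (a, b) z -> `|h z| <= M.
  by move=> /hM2 hz; apply: (le_trans hz); have := ler_norm M2; have := normr_ge0 M1; rewrite /M; fast_lra.
(* The convolution of [phi] with [h] restricted to a box; it is additive when the box is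
   bisected. *)
pose inner p q y := ibox p q (fun z => phi (y - z) * h z).
have lin y : locint (fun z => phi (y - z) * h z).
  by apply: locint_ker; [exact: locint_cont|exact: cont_refl].
have cinner p q : continuous (inner p q).
  pose h1 z := \1_(hbox p q) z * h z.
  have mI : measurable_fun [set: lebT R n] ((fun z => \1_(hbox p q) z) : lebT R n -> R).
    exact/measurable_indic/measurable_hbox.
  have l1 : locint h1.
    apply: locintM => //; last exact: locint_cont.
    move=> a' b'; exists 1 => z _; rewrite indicE; case: (_ \in _); by rewrite ?normr1 ?normr0.
  suff -> : inner p q = convol h1 phi by exact: convol_cont l1 cp sp.
  apply/esym/funext => y.
  rewrite /convol (ibox_setT (a := p) (b := q)); last first.
    by move=> z nz; rewrite /h1 indicE memNset// mul0r mulr0.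
  by apply: ibox_eq => z zpq; rewrite /h1 indicE mem_set// mul1r.
have lig p q : locint (fun y => inner p q y * g y) by exact: locint_ker.
(* The error is measured in units of volume, so that the claims for two halves add up to the claim
   for the box. *)
pose P p q e := `|ibox p q H - ibox A B (fun y => inner p q y * g y)| <= e * vol p q.
have key e : 0 < e -> P a b e.
  move=> e0.
  have e1 : 0 < e / 2 by rewrite divr_gt0.
  have e2 : 0 < (e / 2) / (I + 1) by rewrite divr_gt0// ltr_wpDl.
  have e3 : 0 < (e / 2) / (I + 1) / (2 * M) by rewrite divr_gt0// mulr_gt0.
  have [d1 d10 hd1] := @unif_cont R n H a b _ cH e1.
  have [d2 d20 hd2] := @unif_cont R n h a b _ ch e3.
  have [d3 d30 hd3] := unif_cont_supp cp sp e3.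
  apply: (@bisect_ind R n (fun p q => P p q e) (Num.min d1 (Num.min d2 d3))) => //.
  - by rewrite !lt_min d10 d20.
  - move=> p q pq hpq.
    have pp : box (a, b) p by move=> i; have [-> h2 h3] := pq i; exact: le_trans h3.
    have pq' i : p ord0 i <= q ord0 i by have [] := pq i.
    have sub : hbox p q `<=` hbox a b by apply: hbox_sub => i; have [] := pq i.
    have close z i : hbox p q z -> `|z ord0 i - p ord0 i| < Num.min d1 (Num.min d2 d3).
      move=> zpq; apply: le_lt_trans (hpq i); have /andP[h1 h2] := zpq i.
      by rewrite ger0_norm ?subr_ge0// lerD2r ltW.
    have vpq : 0 <= vol p q by exact: vol_ge0.
    have T1 : `|ibox p q H - vol p q * H p| <= e / 2 * vol p q.
      rewrite -[vol p q * _]mulrC -[H p * _]ibox_cst// -iboxB; [|exact: locint_cont|exact: locint_cst].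
      apply: le_trans (ibox_abs _ _ _) _; first by apply: locintB; [exact: locint_cont|exact: locint_cst].
      rewrite -ibox_cst//; apply: ibox_le; [|exact: locint_cst|].
        by apply/locint_abs/locintB; [exact: locint_cont|exact: locint_cst].
      move=> z zpq; apply/ltW/hd1 => // i; apply: lt_le_trans (close z i zpq) _.
      by rewrite ge_min lexx.
    have T2 y : `|inner p q y - vol p q * (phi (y - p) * h p)| <= (e / 2) / (I + 1) * vol p q.
      rewrite -[vol p q * _]mulrC -[phi _ * _ * _]ibox_cst// -iboxB//; last exact: locint_cst.
      apply: le_trans (ibox_abs _ _ _) _; first by apply: locintB => //; exact: locint_cst.
      rewrite -ibox_cst//; apply: ibox_le; [|exact: locint_cst|].
        by apply/locint_abs/locintB => //; exact: locint_cst.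
      move=> z zpq.
      have -> : phi (y - z) * h z - phi (y - p) * h p =
         phi (y - z) * (h z - h p) + (phi (y - z) - phi (y - p)) * h p by ring.
      apply: (le_trans (ler_normD _ _)); rewrite !normrM.
      have q1 : `|h z - h p| <= (e / 2) / (I + 1) / (2 * M).
        apply/ltW/hd2 => // i; apply: lt_le_trans (close z i zpq) _.
        by rewrite !ge_min lexx orbT.
      have q2 : `|phi (y - z) - phi (y - p)| <= (e / 2) / (I + 1) / (2 * M).
        apply/ltW/hd3 => i; rewrite -normrN; apply: le_lt_trans (lt_le_trans (close z i zpq) _).
          by rewrite !mxE; apply/eqP/eqP; rewrite le_eqVlt; apply/orP; left; apply/eqP; congr (`|_|); ring.
        by rewrite !ge_min lexx !orbT.
      have q3 := hphi (y - z); have q4 := hh p pp.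
      have E : (e / 2) / (I + 1) / (2 * M) * M *+ 2 = (e / 2) / (I + 1).
        by rewrite -mulr_natr -!mulrA [M * 2]mulrC mulVf ?mulr1//; rewrite gt_eqF// mulr_gt0.
      move: q1 q2 E; set X := _ / (2 * M); set Y := _ / (I + 1) => q1 q2 <-.
      rewrite mulr2n; apply: lerD; first by rewrite mulrC; apply: ler_pM.
      exact: ler_pM.
    (* The Riemann terms at the corner [p] agree on the two sides because [phi] is even. *)
    have E3 : ibox A B (fun y => vol p q * (phi (y - p) * h p) * g y) = vol p q * H p.
      rewrite /H (convol_ibox _ (a := A) (b := B) sp); last first.
        move=> y yp i; have := yp i; have := pq i; rewrite !mxE ltr_norml => -[? ? ?] /andP[? ?].
        by apply/andP; split; fast_lra.
      have lk := locint_ker lg (@cont_refl _ _ _ p cp).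
      rewrite -(iboxZ _ _ _ lk) -(iboxZ _ _ _ (locintZ _ lk)).
      apply: ibox_eq => y _; rewrite -[phi (y - p)]ev opprB; ring.
    have l4 : locint (fun y => vol p q * (phi (y - p) * h p) * g y).
      apply: (locint_ker lg); apply: contM; first exact: cst_continuous.
      by apply: contM; [exact: (@cont_shift _ _ _ (- p) cp)|exact: cst_continuous].
    rewrite /P -[X in `|X|](_ : (ibox p q H - vol p q * H p) -
      (ibox A B (fun y => inner p q y * g y) - vol p q * H p) = _); last by ring.
    apply: (le_trans (ler_normB _ _)).
    rewrite [X in X * vol p q](_ : e = e / 2 + e / 2); last by field.
    rewrite mulrDl; apply: lerD => //.
    rewrite -E3 -iboxB//.
    rewrite (ibox_eq (g := fun y => (inner p q y - vol p q * (phi (y - p) * h p)) * g y)); last first.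
      by move=> y _; rewrite mulrBl.
    apply: (@le_trans _ _ ((e / 2) / (I + 1) * vol p q * I)).
      apply: (ibox_ker_le lg); last by move=> y _; exact: T2.
      apply: contB; first exact: cinner.
      apply: contM; first exact: cst_continuous.
      by apply: contM; [exact: (@cont_shift _ _ _ (- p) cp)|exact: cst_continuous].
    by rewrite mulrAC; apply: ler_wpM2r => //; apply/ltW/div_succ_lt.
  - move=> p q i c pq pcq P1 P2; rewrite /P.
    have pq' j : p ord0 j <= q ord0 j by have [] := pq j.
    rewrite (ibox_split pcq (locint_cont cH)).
    rewrite (ibox_eq (a := A) (b := B) (g := fun y => inner p (upd q i c) y * g y + inner (upd p i c) q y * g y)); last first.
      by move=> y _; rewrite -mulrDl /inner -ibox_split.
    rewrite iboxD// (vol_split pcq)// mulrDr opprD addrACA.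
    by apply: (le_trans (ler_normD _ _)); exact: lerD.
have inE y : inner a b y = convol h phi y.
  by rewrite /convol (ibox_setT (a := a) (b := b))// => z nz; rewrite h0// mulr0.
rewrite -(ibox_eq (a := A) (b := B) (f := fun y => inner a b y * g y)); last by move=> y _; rewrite inE.
apply/eqP; rewrite -subr_eq0 -normr_eq0 eq_le normr_ge0 andbT.
apply/ler_addgt0Pl => e e0; rewrite addr0.
have v0 := vol_ge0 ab.
apply: (le_trans (key (e / (vol a b + 1)) _)); first by rewrite divr_gt0// ltr_wpDl.
by apply/ltW/div_succ_lt.
Qed.
End exchange.

(** * The chain rule for weak gradients *)

Section kernel.
Context (R : realType) (n : nat).
Local Notation V := 'rV[R]_n.
Local Notation mu := (lebesgue_n R n).
Implicit Types (a b p q x y z w : V) (f g h phi K : V -> R) (c d e s t r : R) (i j : 'I_n).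

Definition sbump s t : R := cbump (s^-1 * t).

Lemma smooth_sbump s : smoothR (sbump s).
Proof.
move=> k; have := @Ck_affine _ k (@cbump R) (s^-1) 0 (smooth_bump R k).
by congr Ck; apply/funext => t; rewrite addr0.
Qed.

Definition kern s w : R := \prod_j sbump s (w ord0 j).
Definition dkern s i w : R := (sbump s)^`()%classic (w ord0 i) * \prod_(j | j != i) sbump s (w ord0 j).

Lemma kern_C1 s : is_C1 (kern s) (dkern s).
Proof.
exact: (@C1_prod R n (fun=> sbump s) (fun=> (sbump s)^`()%classic)
  (fun=> smoothR_C1R (@smooth_sbump s))).
Qed.

Lemma nqbox x r z : ~ qbox x r z -> exists j, r <= `|z ord0 j - x ord0 j|.
Proof.
move=> nq; have /existsNP[j hj] : ~ (forall j, x ord0 j - r <= z ord0 j < x ord0 j + r) by move=> /qboxP.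
exists j; rewrite leNgt; apply/negP; rewrite ltr_norml => /andP[h1 h2].
by apply: hj; apply/andP; split; lra.
Qed.

Lemma sbump_supp s t : 0 < s -> s <= `|t| -> sbump s t = 0.
Proof.
move=> s0 st; apply: bump_supp; rewrite normrM gtr0_norm ?invr_gt0//.
by rewrite ler_pdivlMl// mulr1.
Qed.

Lemma kern_supp s : 0 < s -> suppr (kern s) s.
Proof. by move=> s0 w [j hj]; rewrite /kern (bigD1 j)//= sbump_supp// mul0r. Qed.

(** The radius is [2 * s] and not [s] so that the coordinate has a whole neighbourhood on which the
    bump vanishes, and hence a zero derivative. *)
Lemma dkern_supp s i : 0 < s -> suppr (dkern s i) (2 * s).
Proof.
move=> s0 w [j hj]; have hs : s < `|w ord0 j| by apply: lt_le_trans hj; lra.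
have [ji|ji] := eqVneq j i; last first.
  by rewrite /dkern (bigD1 j)//= sbump_supp ?mul0r ?mulr0// ltW.
rewrite /dkern -ji (_ : (sbump s)^`()%classic (w ord0 j) = 0) ?mul0r//.
apply: derive1_is; have d0 : is_derive (w ord0 j) 1 (fun=> 0 : R) 0 by exact: is_derive_cst.
apply: (near_eq_is_derive _ d0).
near=> t; rewrite sbump_supp//; apply/ltW; near: t.
exact: (@cvgr_gt _ _ _ _ _ `|w ord0 j| (@norm_continuous _ _ (w ord0 j)) _ hs).
Unshelve. all: by end_near. Qed.

Lemma kernN s w : kern s (- w) = kern s w.
Proof. by apply: eq_bigr => j _; rewrite /sbump !mxE mulrN bumpN. Qed.

Lemma kern_ge0 s w : 0 <= kern s w.
Proof. by apply: prodr_ge0 => j _; exact: bump_ge0. Qed.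

Definition kmass s := convol (fun=> 1) (kern s) (0 : V).

Lemma convol_kern1 s z : 0 < s -> convol (fun=> 1) (kern s) z = kmass s.
Proof.
move=> s0; rewrite /kmass /convol.
have [cf _ _] := kern_C1 s.
have E w : \int[mu]_y (kern s (w - y) * 1) = \int[mu]_y kern s (y + - w).
  by apply: eq_Rintegral => y _; rewrite mulr1 -kernN opprB.
rewrite !E !(@Rintegral_shift R n (kern s))//; try exact: continuous_measurable_leb.
- apply: (@integrable_supp _ _ _ (lower 0 s) (upper 0 s)).
    by apply: locint_cont; exact: (@cont_shift _ _ _ (- 0) cf).
  move=> y ny; rewrite oppr0 addr0; apply: kern_supp => //.
  by have [j hj] := nqbox ny; exists j; rewrite mxE subr0 in hj.
- apply: (@integrable_supp _ _ _ (lower z s) (upper z s)).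
    by apply: locint_cont; exact: (@cont_shift _ _ _ (- z) cf).
  move=> y ny; apply: kern_supp => //.
  by have [j hj] := nqbox ny; exists j; rewrite !mxE.
Qed.

Lemma kmass_gt0 s : 0 < s -> 0 < kmass s.
Proof.
move=> s0.
pose a := lower (0 : V) s; pose b := upper (0 : V) s.
pose a' := lower (0 : V) (s / 2); pose b' := upper (0 : V) (s / 2).
have [cf _ _] := kern_C1 s.
have lk : locint (fun y => kern s (0 - y) * 1).
  by apply: locint_ker; [exact: locint_cst|exact: cont_refl].
rewrite /kmass (convol_ibox _ (a := a) (b := b) (kern_supp s0)); last first.
  by move=> y h; apply/qboxP => j; have := h j; rewrite !mxE ltr_norml => /andP[? ?]; apply/andP; split; lra.
apply: (@lt_le_trans _ _ (ibox a' b' (fun=> (expR (- 2) ^+ 2) ^+ n))).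
  rewrite ibox_cst; last by move=> j; rewrite !mxE; lra.
  by rewrite mulr_gt0 ?exprn_gt0 ?expR_gt0// vol_gt0// => j; rewrite !mxE; lra.
apply: (@le_trans _ _ (ibox a' b' (fun y => kern s (0 - y) * 1))).
  apply: ibox_le => //; first exact: locint_cst.
  move=> y /qboxP yab; rewrite mulr1 sub0r kernN.
  rewrite -[X in _ ^+ X]card_ord -prodr_const; apply: ler_prod => j _.
  rewrite exprn_ge0 ?expR_ge0//=; apply: bump_half.
  rewrite normrM gtr0_norm ?invr_gt0// ler_pdivrMl//.
  by have := yab j; rewrite mxE ler_norml => /andP[? ?]; apply/andP; split; lra.
apply: ibox_sub => //; first by apply: hbox_sub => j; rewrite !mxE; lra.
by move=> y _; rewrite mulr1 kern_ge0.
Qed.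

Lemma kern_test s z (Om : set V) : 0 < s -> (forall y, (forall j, `|y ord0 j - z ord0 j| <= s) -> Om y) ->
  test_function Om (fun y => kern s (z - y)).
Proof.
move=> s0 sub; split.
  have -> : (fun y => kern s (z - y)) = (fun y => \prod_j (fun t => sbump s (z ord0 j - t)) (y ord0 j)).
    by apply/funext => y; apply: eq_bigr => j _; rewrite !mxE.
  apply: (@smooth_prod R n (fun j t => sbump s (z ord0 j - t))) => j k.
  have := @Ck_affine _ k (sbump s) (-1) (z ord0 j) (smooth_sbump s k).
  by congr Ck; apply/funext => t; rewrite mulN1r addrC.
exists (box (lower z s, upper z s)); split; first exact: compact_box.
  by move=> y hy; apply: sub => j; have := hy j; rewrite /= !mxE ler_norml => /andP[? ?]; apply/andP; split; lra.
move=> y ny; apply: kern_supp => //.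
have /existsNP[j hj] : ~ (forall j, `|y ord0 j - z ord0 j| <= s).
  move=> h; apply: ny => j; have := h j; rewrite /= !mxE ler_norml => /andP[? ?]; apply/andP; split; lra.
by exists j; rewrite -normrN !mxE opprB leNgt; apply/negP => /ltW.
Qed.

Lemma kern_partial s z i y : partial_derive i (fun y => kern s (z - y)) y = - dkern s i (z - y).
Proof.
have [_ _ /(_ i (z - y)) dk] := kern_C1 s.
suff : is_derive y (vdir R i) (fun y => kern s (z - y)) (- dkern s i (z - y)).
  by move=> h; rewrite /partial_derive -[RHS](@derive_val _ _ _ _ _ _ _ h).
have := @is_derive_line R n (fun y => kern s (z - y)) y i 0 (- dkern s i (z - y)).
rewrite scale0r addr0 => ->.
have := @is_derive_line R n (kern s) (z - y) i 0 (dkern s i (z - y)).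
rewrite scale0r addr0 => -[h _]; have {}h := h dk.
have dN : is_derive (0 : R) 1 (fun t : R => - t) (-1) by exact: is_deriveN.
have h' : is_derive (- 0 : R) 1 (fun t : R => kern s (z - y + t *: vdir R i)) (dkern s i (z - y)) by rewrite oppr0.
have := @is_derive1_comp _ _ _ 0 _ _ h' dN.
rewrite mulrN1; congr is_derive; apply/funext => t /=.
by congr (kern s _); rewrite scaleNr opprD addrA.
Qed.

(* The weak gradient is only ever tested against mollifying kernels. *)
Lemma weak_gradient_kern (Gam : set V) (u : V -> R) (G : V -> V) s z i :
  locint u -> weak_gradient (~` Gam) u G -> 0 < s -> (forall y, (forall j, `|y ord0 j - z ord0 j| <= s) -> ~ Gam y) ->
  convol u (dkern s i) z = convol (fun y => G y ord0 i) (kern s) z.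
Proof.
move=> lu [_ wg] s0 sub.
have := wg _ (kern_test s0 sub) i.
pose a := lower z s; pose b := upper z s.
(* The closed cube of radius [s] misses Gam, so the kernel and its derivative vanish on Gam and both
   integrals extend to the whole space. *)
have far y : Gam y -> exists j, s < `|(z - y) ord0 j|.
  move=> Gy; have /existsNP[j hj] : ~ (forall j, `|y ord0 j - z ord0 j| <= s) by move=> /sub.
  by exists j; rewrite -normrN !mxE opprB ltNge; apply/negP.
have k0 y : Gam y -> kern s (z - y) = 0.
  by move=> /far[j hj]; apply: kern_supp => //; exists j; exact: ltW.
have dk0 y : Gam y -> dkern s i (z - y) = 0.
  move=> /far[j hj]; rewrite /dkern; have [ji|ji] := eqVneq j i; last first.
    by rewrite (bigD1 j)//= sbump_supp ?mul0r ?mulr0// ltW.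
  rewrite -ji (_ : (sbump s)^`()%classic _ = 0) ?mul0r//; apply: derive1_is.
  have d0 : is_derive ((z - y) ord0 j) 1 (fun=> 0 : R) 0 by exact: is_derive_cst.
  apply: (near_eq_is_derive _ d0); near=> t; rewrite sbump_supp//; apply/ltW; near: t.
  exact: (@cvgr_gt _ _ _ _ _ `|(z - y) ord0 j| (@norm_continuous _ _ _) _ hj).
rewrite Rintegral_mkcond [X in _ = - X -> _]Rintegral_mkcond.
rewrite (_ : (fun y => u y * _) \_ (~` Gam) = fun y => - (dkern s i (z - y) * u y)); last first.
  apply/funext => y; rewrite /patch; case: ifPn => [_|]; first by rewrite kern_partial mulrN mulrC.
  by rewrite notin_setE => /contrapT /dk0 ->; rewrite mul0r oppr0.
rewrite (_ : (fun y => G y ord0 i * _) \_ (~` Gam) = fun y => kern s (z - y) * G y ord0 i); last first.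
  apply/funext => y; rewrite /patch; case: ifPn => [_|]; first by rewrite mulrC.
  by rewrite notin_setE => /contrapT /k0 ->; rewrite mul0r.
rewrite -/(convol _ _ _) => /eqP.
rewrite (_ : \int[mu]_y _ = - convol u (dkern s i) z) ?eqr_opp; first by move=> /eqP.
have supp y : ~ qbox z (2 * s) y -> dkern s i (z - y) = 0.
  move=> /nqbox[j hj]; apply: (@dkern_supp s i s0); exists j.
  by rewrite !mxE -normrN opprB.
rewrite /convol !(ibox_setT (a := lower z (2 * s)) (b := upper z (2 * s))); last 2 first.
- by move=> y /supp ->; rewrite mul0r.
- by move=> y /supp ->; rewrite mul0r oppr0.
apply: iboxN; apply: locint_ker lu _; apply: cont_refl.
by have [_ cD _] := kern_C1 s; exact: cD.
Unshelve. all: by end_near. Qed.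

Lemma unif_cont_comp (F : R -> R) (u : V -> R) a b e : continuous F -> continuous u -> 0 < e ->
  exists2 d : R, 0 < d & forall z c, box (a, b) z -> `|c - u z| < d -> `|F c - F (u z)| < e.
Proof.
move=> cF cu e0; have [M hM] := cont_bounded_box a b cu.
pose f (x : 'rV[R]_1) := F (x ord0 ord0).
have cf : continuous f := cont_comp (@coord_continuous R 1 1 ord0 ord0) cF.
have [d d0 hd] := @unif_cont R 1 f (const_mx (- M)) (const_mx M) e cf e0.
exists d => // z c zab cz.
have := hd (const_mx (u z)) (const_mx c); rewrite /f !mxE; apply => [j|j].
  by rewrite /= !mxE -ler_norml; exact: hM.
by rewrite !mxE.
Qed.

Lemma mollify_close f s z c e : 0 < s -> locint f ->
  (forall y, (forall j, `|y ord0 j - z ord0 j| < s) -> `|f y - c| <= e) ->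
  `|(kmass s)^-1 * convol f (kern s) z - c| <= e.
Proof.
move=> s0 lf hf; have m0 := kmass_gt0 s0.
have [ck _ _] := kern_C1 s.
have lk := locint_ker (locint_cst n c) (@cont_refl _ _ _ z ck).
have lkf := locint_ker lf (@cont_refl _ _ _ z ck).
pose a := lower z s; pose b := upper z s.
have sub y : (forall j, `|y ord0 j - z ord0 j| < s) -> hbox a b y.
  by move=> h; apply/qboxP => j; have := h j; rewrite ltr_norml => /andP[? ?]; apply/andP; split; lra.
have E1 : kmass s = ibox a b (fun y => kern s (z - y)).
  rewrite -(convol_kern1 z s0) (convol_ibox _ (a := a) (b := b) (kern_supp s0))//.
  by apply: ibox_eq => y _; rewrite mulr1.
have E : (kmass s)^-1 * convol f (kern s) z - c = (kmass s)^-1 * ibox a b (fun y => (f y - c) * kern s (z - y)).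
  rewrite (convol_ibox _ (a := a) (b := b) (kern_supp s0))//.
  rewrite (ibox_eq (f := fun y => (f y - c) * kern s (z - y)) (g := fun y => kern s (z - y) * f y - kern s (z - y) * c)); last first.
    by move=> y _; ring.
  rewrite (iboxB _ _ lkf lk) mulrBr (ibox_eq (f := fun y => kern s (z - y) * c) (g := fun y => c * kern s (z - y))).
    have lk1 : locint (fun y => kern s (z - y)) by apply: locint_cont; exact: cont_refl.
    by rewrite (iboxZ _ _ _ lk1) -E1 [c * _]mulrC mulKf// gt_eqF.
  by move=> y _; rewrite mulrC.
rewrite E normrM gtr0_norm ?invr_gt0// ler_pdivrMl// mulrC.
rewrite E1 -iboxZ; last by apply: locint_cont; exact: cont_refl.
have lE : locint (fun y => (f y - c) * kern s (z - y)).
  rewrite (_ : (fun y => _) = (fun y => kern s (z - y) * f y - kern s (z - y) * c)).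
    exact: locintB.
  by apply/funext => y; ring.
apply: (le_trans (ibox_abs _ _ lE)); apply: ibox_le; first exact: locint_abs.
  by apply: locintZ; apply: locint_cont; exact: cont_refl.
move=> y yab; rewrite normrM [X in _ * X]ger0_norm ?kern_ge0//.
have [h|/existsNP[j hj]] := pselect (forall j, `|y ord0 j - z ord0 j| < s).
  by apply: ler_wpM2r; [exact: kern_ge0|exact: hf].
rewrite (kern_supp s0) ?mulr0//; exists j; rewrite !mxE -normrN opprB leNgt; exact/negP.
Qed.

(* By mollifying [u] at a scale [s -> 0]. *)
Lemma chain_rule (Gam : set V) (u : V -> R) (G : 'I_n -> V -> R) (F F' : R -> R) phi Dphi i a b t :
  continuous u -> locint (G i) ->
  (forall s z, 0 < s -> (forall y, (forall j, `|y ord0 j - z ord0 j| <= s) -> ~ Gam y) ->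
     convol u (dkern s i) z = convol (G i) (kern s) z) ->
  is_C1R F F' -> is_C1 phi Dphi -> (forall i, a ord0 i <= b ord0 i) ->
  (forall z, ~ hbox a b z -> phi z = 0) -> (forall z, ~ hbox a b z -> Dphi i z = 0) ->
  0 < t ->
  (forall z y, phi z != 0 -> Gam y -> (forall j, `|y ord0 j - z ord0 j| <= t) ->
     forall c, `|c - u z| < t -> F' c = 0) ->
  ibox a b (fun z => F (u z) * Dphi i z) = - ibox a b (fun z => F' (u z) * G i z * phi z).
Proof.
move=> cu lG wk CF Cphi ab phi0 Dphi0 t0 hF; have [cF' _] := CF; have cF := C1R_cont CF.
have [cphi cDphi _] := Cphi; have lu := locint_cont cu.
pose A := shiftc a (-1); pose B := shiftc b 1.
have AB j : A ord0 j <= B ord0 j by rewrite !mxE; have := ab j; fast_lra.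
pose I := ibox A B (fun y => `|G i y|).
have I0 : 0 <= I by apply: ibox_ge0.
pose J := ibox a b (fun y => `|Dphi i y|).
have J0 : 0 <= J by apply: ibox_ge0.
pose H z := F' (u z) * phi z.
have cH : continuous H by apply: contM => //; exact: (cont_comp cu cF').
have H0 z : ~ hbox a b z -> H z = 0 by move=> /phi0 h; rewrite /H h mulr0.
have E0 : ibox a b (fun z => F' (u z) * G i z * phi z) = ibox A B (fun z => H z * G i z).
  rewrite (ibox_supp (a := a) (b := b) (a' := A) (b' := B)).
  - by apply: ibox_eq => z _; rewrite /H; ring.
  - by apply: hbox_sub => j; rewrite !mxE; fast_lra.
  - by move=> z /H0 ->; rewrite mul0r.
apply/eqP; rewrite E0 -subr_eq0 opprK -normr_eq0 eq_le normr_ge0 andbT.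
apply/ler_addgt0Pl => e e0; rewrite addr0.
have e1 : 0 < (e / 2) / (J + 1) by rewrite !divr_gt0// ltr_wpDl.
have e2 : 0 < (e / 2) / (I + 1) by rewrite !divr_gt0// ltr_wpDl.
have [M hM] := cont_bounded_box a b cphi.
have e3 : 0 < (e / 2) / (I + 1) / 2 / (`|M| + 1) by rewrite !divr_gt0// ltr_wpDl.
have e22 : 0 < (e / 2) / (I + 1) / 2 by rewrite divr_gt0.
have [d1 d10 hd1] := @unif_cont_comp F u a b _ cF cu e1.
have [d2 d20 hd2] := @unif_cont_comp F' u a b _ cF' cu e3.
have [d3 d30 hd3] := @unif_cont R n H A B _ cH e22.
pose v := Num.min t (Num.min d1 d2).
have v0 : 0 < v by rewrite !lt_min t0 d10.
have v20 : 0 < v / 2 by rewrite divr_gt0.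
have [d4 d40 hd4] := @unif_cont R n u a b _ cu v20.
(* The bound by 1 keeps the mollified supports in the enlarged box, the bound by [t] lets [hF] act
   on cubes of radius [s], [d3] controls the oscillation of [H], and [d4] that of [u], hence the
   distance from [us] to [u]. *)
pose s := Num.min (Num.min 1 t) (Num.min d3 d4).
have s0 : 0 < s by rewrite !lt_min t0 d30 d40 ltr01.
have s1 : s <= 1 by rewrite !ge_min lexx.
have st : s <= t by rewrite !ge_min lexx orbT.
have s3 : s <= d3 by rewrite !ge_min lexx !orbT.
have s4 : s <= d4 by rewrite !ge_min lexx !orbT.
have m0 := kmass_gt0 s0.
pose us z := (kmass s)^-1 * convol u (kern s) z.
have hus z : hbox a b z -> `|us z - u z| < v.
  move=> zab; apply: (@le_lt_trans _ _ (v / 2)); last by fast_lra.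
  apply: mollify_close => // y hy; apply/ltW/hd4; first exact: hbox_box.
  by move=> j; exact: lt_le_trans (hy j) s4.
have Cus : is_C1 us (fun i z => (kmass s)^-1 * convol u (dkern s i) z).
  have := C1M (C1_cst n (kmass s)^-1) (convol_C1 lu (kern_C1 s) (suppr_le _ (kern_supp s0)) (fun i => @dkern_supp s i s0)).
  have s2 : s <= 2 * s by fast_lra.
  move=> /(_ s2) [h1 h2 h3]; split => // [j|j z].
    apply: contM; first exact: cst_continuous.
    have [_ cD _] := kern_C1 s.
    exact: (convol_cont lu (cD j) (@dkern_supp s j s0)).
  by have := h3 j z; rewrite mul0r add0r.
have cus : continuous us by case: Cus.
pose Hs z := F' (us z) * phi z.
have cHs : continuous Hs by apply: contM => //; exact: (cont_comp cus cF').
have Hs0 z : ~ hbox a b z -> Hs z = 0 by move=> /phi0 h; rewrite /Hs h mulr0.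
have CFp := C1M (C1_comp CF Cus) Cphi.
have lFD : locint (fun z => F (us z) * Dphi i z).
  by apply: locint_cont; apply: contM => //; exact: (cont_comp cus cF).
have lFD' : locint (fun z => F (u z) * Dphi i z).
  by apply: locint_cont; apply: contM => //; exact: (cont_comp cu cF).
have [ck _ _] := kern_C1 s.
have cGk := convol_cont lG ck (kern_supp s0).
have E1 : ibox a b (fun z => F (us z) * Dphi i z) = - (kmass s)^-1 * ibox a b (fun z => Hs z * convol (G i) (kern s) z).
  have /= := @ibox_C1_partial R n _ _ a b i CFp ab.
  set D := fun z : V => _ => H1.
  have {H1} : ibox a b D = 0.
    by apply: H1 => z nz; rewrite /D /= phi0// ?Dphi0// !mulr0 ?addr0.
  have DE z : D z = (kmass s)^-1 * (Hs z * convol (G i) (kern s) z) + F (us z) * Dphi i z.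
    rewrite /D; congr (_ + _); have [p0|p0] := eqVneq (phi z) 0.
      by rewrite /Hs p0 !mulr0 mul0r mulr0.
    have zab : hbox a b z by apply: contrapT => /phi0; exact/eqP.
    have [[y [Gy hy]]|h] := pselect (exists y, Gam y /\ forall j, `|y ord0 j - z ord0 j| <= s).
      rewrite /Hs (hF z y p0 Gy) ?mul0r ?mulr0//.
        by move=> j; exact: le_trans st.
      by apply: lt_le_trans (hus z zab) _; rewrite ge_min lexx.
    rewrite wk//; first by rewrite /Hs; ring.
    by move=> y hy Gy; apply: h; exists y.
  rewrite (ibox_eq (g := fun z => (kmass s)^-1 * (Hs z * convol (G i) (kern s) z) + F (us z) * Dphi i z)); last by move=> z _; exact: DE.
  have l1 : locint (fun z => Hs z * convol (G i) (kern s) z) by apply: locint_cont; exact: contM.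
  rewrite (iboxD _ _ (locintZ _ l1) lFD) (iboxZ _ _ _ l1).
  by move=> /eqP; rewrite addrC addr_eq0 mulNr => /eqP.
(* The mollifier moves from the merely integrable [G i] to the continuous [Hs]; afterwards only
   continuous functions have to be compared. *)
have E2 : ibox a b (fun z => Hs z * convol (G i) (kern s) z) = ibox A B (fun y => convol Hs (kern s) y * G i y).
  rewrite (convol_exchange lG cHs Hs0 ck (kern_supp s0) (@kernN s) ab).
  rewrite (ibox_supp (a := shiftc a (- s)) (b := shiftc b s) (a' := A) (b' := B))//.
    by apply: hbox_sub => j; rewrite !mxE; fast_lra.
  move=> y ny; rewrite /convol (ibox_setT (a := a) (b := b)); last by move=> z /Hs0 ->; rewrite mulr0.
  rewrite (ibox_eq (g := fun=> 0)) ?ibox_cst ?mul0r// => z zab.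
  rewrite (kern_supp s0) ?mul0r//.
  have /existsNP[j hj] : ~ (forall j, `|(y - z) ord0 j| < s).
    move=> h; apply: ny => j; have := h j; have := zab j; rewrite !mxE ltr_norml => /andP[? ?] /andP[? ?].
    by apply/andP; split; fast_lra.
  by exists j; rewrite leNgt; exact/negP.
have -> : ibox a b (fun z => F (u z) * Dphi i z) + ibox A B (fun z => H z * G i z) =
   ibox a b (fun z => (F (u z) - F (us z)) * Dphi i z) +
   ibox A B (fun z => (H z - (kmass s)^-1 * convol Hs (kern s) z) * G i z).
  have lHG : locint (fun z => H z * G i z) by exact: locint_ker.
  have lcG : locint (fun y => convol Hs (kern s) y * G i y).
    apply: locint_ker => //; exact: (convol_cont (locint_cont cHs) ck (kern_supp s0)).
  rewrite (ibox_eq (f := fun z => (F (u z) - F (us z)) * Dphi i z) (g := fun z => F (u z) * Dphi i z - F (us z) * Dphi i z)); last by move=> z _; ring.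
  rewrite (ibox_eq (f := fun z => (H z - (kmass s)^-1 * convol Hs (kern s) z) * G i z)
     (g := fun z => H z * G i z - (kmass s)^-1 * (convol Hs (kern s) z * G i z))); last by move=> z _; ring.
  rewrite (iboxB _ _ lFD' lFD) (iboxB _ _ lHG (locintZ _ lcG)) (iboxZ _ _ _ lcG) E1 E2; ring.
apply: (le_trans (ler_normD _ _)).
have -> : e = e / 2 + e / 2 by field.
apply: lerD.
  apply: (@le_trans _ _ ((e / 2) / (J + 1) * J)); last by apply/ltW/div_succ_lt; rewrite // divr_gt0.
  apply: ibox_ker_le; first exact: locint_cont.
    by apply: contB; [exact: (cont_comp cu cF)|exact: (cont_comp cus cF)].
  move=> z zab; rewrite distrC; apply/ltW/hd1; first exact: hbox_box.
  by apply: lt_le_trans (hus z zab) _; rewrite !ge_min lexx orbT.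
apply: (@le_trans _ _ ((e / 2) / (I + 1) * I)); last by apply/ltW/div_succ_lt; rewrite // divr_gt0.
apply: ibox_ker_le => //.
  apply: contB => //; apply: contM; first exact: cst_continuous.
  exact: (convol_cont (locint_cont cHs) ck (kern_supp s0)).
move=> y yAB; rewrite distrC; apply: mollify_close => //; first exact: locint_cont.
move=> z zy.
have -> : Hs z - H y = (Hs z - H z) + (H z - H y) by ring.
apply: (le_trans (ler_normD _ _)).
have -> : (e / 2) / (I + 1) = (e / 2) / (I + 1) / 2 + (e / 2) / (I + 1) / 2 by field; rewrite gt_eqF// ltr_wpDl.
apply: lerD; last first.
  by apply/ltW/hd3; [exact: hbox_box|move=> j; exact: lt_le_trans (zy j) s3].
rewrite /Hs /H -mulrBl normrM.
have [zab|/phi0 ->] := pselect (hbox a b z); last by rewrite normr0 mulr0 ltW.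
have h1 : `|F' (us z) - F' (u z)| <= (e / 2) / (I + 1) / 2 / (`|M| + 1).
  by apply/ltW/hd2; [exact: hbox_box|apply: lt_le_trans (hus z zab) _; rewrite !ge_min lexx !orbT].
have h2 : `|phi z| <= `|M| by apply: (le_trans (hM z (hbox_box zab))); exact: ler_norm.
apply: (le_trans (ler_pM _ _ h1 h2)) => //.
by apply/ltW/div_succ_lt.
Qed.
End kernel.

(** * Euclidean distance to a set *)

Section euclid.
Context (R : realType) (n : nat).
Local Notation V := 'rV[R]_n.
Implicit Types (u v x y z p : V) (r s t c e : R) (i j : 'I_n) (S X Y Gam : set V).

Lemma dotp_ge0 u : 0 <= dotp u u.
Proof. by apply: sumr_ge0 => i _; exact: sqr_ge0. Qed.

Lemma enorm_ge0 u : 0 <= enorm u.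
Proof. exact: sqrtr_ge0. Qed.

Lemma enorm_sqr u : enorm u ^+ 2 = dotp u u.
Proof. by rewrite sqr_sqrtr// dotp_ge0. Qed.

Lemma coord_le_enorm u i : `|u ord0 i| <= enorm u.
Proof.
rewrite -ler_sqr ?nnegrE ?enorm_ge0// enorm_sqr /dotp (bigD1 i)//= real_normK ?num_real//.
by rewrite expr2 lerDl sumr_ge0// => j _; exact: sqr_ge0.
Qed.

(** The crude factor [n] is the price of passing from cubes, on which integrals are taken, to
    Euclidean balls, in which Gam is measured. *)
Lemma enorm_le_sum u c : (forall i, `|u ord0 i| <= c) -> enorm u <= n%:R * c.
Proof.
move=> h; have [n0|n0] := posnP n.
  rewrite /enorm /dotp big1 ?sqrtr0 => [|i _]; first by rewrite [in n%:R]n0 mul0r.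
  by have := ltn_ord i; rewrite [X in (_ < X)%N]n0.
have c0 : 0 <= c by apply: le_trans (h (Ordinal n0)).
have n1 : 1 <= n%:R :> R by rewrite ler1n.
rewrite -ler_sqr ?nnegrE ?enorm_ge0 ?mulr_ge0// enorm_sqr /dotp.
apply: (@le_trans _ _ (\sum_(i < n) c ^+ 2)).
  by apply: ler_sum => i _; rewrite -expr2 -real_normK ?num_real// lerXn2r ?nnegrE.
have -> : \sum_(i < n) c ^+ 2 = n%:R * c ^+ 2 by rewrite sumr_const card_ord mulr_natl.
by rewrite exprMn; have := sqr_ge0 c; nra.
Qed.

Lemma dotp_CS u v : dotp u v <= enorm u * enorm v.
Proof.
have key (t : R) : 0 <= dotp u u - 2 * t * dotp u v + t ^+ 2 * dotp v v.
  have -> : dotp u u - 2 * t * dotp u v + t ^+ 2 * dotp v v = \sum_i (u ord0 i - t * v ord0 i) ^+ 2.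
    rewrite /dotp !mulr_sumr -sumrB -big_split /=; apply: eq_bigr => i _; ring.
  by apply: sumr_ge0 => i _; exact: sqr_ge0.
have A0 := enorm_ge0 u; have B0 := enorm_ge0 v.
(* With this [t] both squares equal the square of the norm of [u], and what remains is linear in the
   scalar product. *)
have := key (enorm u / enorm v); rewrite -!enorm_sqr.
have [v0|v0] := eqVneq (enorm v) 0.
  move=> _; have vz i : v ord0 i = 0.
    by apply/eqP; rewrite -normr_eq0 eq_le normr_ge0 andbT -v0 coord_le_enorm.
  by rewrite v0 mulr0 /dotp big1// => i _; rewrite vz mulr0.
have [u0|u0] := eqVneq (enorm u) 0.
  move=> _; have uz i : u ord0 i = 0.
    by apply/eqP; rewrite -normr_eq0 eq_le normr_ge0 andbT -u0 coord_le_enorm.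
  by rewrite u0 mul0r /dotp big1// => i _; rewrite uz mul0r.
have vp : 0 < enorm v by rewrite lt_neqAle eq_sym v0.
have up : 0 < enorm u by rewrite lt_neqAle eq_sym u0.
rewrite expr_div_n mulfVK ?expf_neq0// => h.
have : 2 * (enorm u / enorm v) * dotp u v <= 2 * enorm u ^+ 2 by lra.
rewrite -mulrA ler_pM2l// -mulrA expr2 ler_pM2l// mulrC ler_pdivrMr//.
Qed.

Lemma enormN u : enorm (- u) = enorm u.
Proof. by congr Num.sqrt; apply: eq_bigr => i _; rewrite !mxE mulrNN. Qed.

Lemma enormB u v : enorm (u - v) = enorm (v - u).
Proof. by rewrite -enormN opprB. Qed.

Lemma enormD u v : enorm (u + v) <= enorm u + enorm v.
Proof.
rewrite -ler_sqr ?nnegrE ?addr_ge0 ?enorm_ge0// sqrrD !enorm_sqr.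
have -> : dotp (u + v) (u + v) = dotp u u + 2 * dotp u v + dotp v v.
  by rewrite /dotp mulr_sumr -!big_split /=; apply: eq_bigr => i _; rewrite !mxE; ring.
by rewrite -mulr_natl; have := dotp_CS u v; lra.
Qed.

Lemma enorm_tri x y z : enorm (x - z) <= enorm (x - y) + enorm (y - z).
Proof. by have := enormD (x - y) (y - z); rewrite addrA subrK. Qed.

Lemma enorm0 : enorm (0 : V) = 0.
Proof. by rewrite /enorm /dotp big1 ?sqrtr0// => i _; rewrite mxE mul0r. Qed.

Lemma cont_sum (T : topologicalType) (I : finType) (f : I -> T -> R) :
  (forall k, continuous (f k)) -> continuous (fun q => \sum_k f k q).
Proof.
move=> cu; elim: (index_enum I) => [|k r IH].
  by under eq_fun do rewrite big_nil; exact: cst_continuous.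
by under eq_fun do rewrite big_cons; exact: contD.
Qed.

Lemma enorm_cont : continuous (@enorm R n).
Proof.
apply: (@cont_comp _ _ _ (fun u : V => dotp u u) Num.sqrt); last exact: sqrt_continuous.
by apply: cont_sum => i; apply: contM; exact: coord_continuous.
Qed.

Lemma enorm_subl_cont y : continuous (fun z : V => enorm (z - y)).
Proof. exact: (@cont_shift R n (@enorm R n) (- y) enorm_cont). Qed.

Lemma eball_open x r : open (eball x r).
Proof.
have := @open_comp _ _ (fun z : V => enorm (z - x)) [set t : R | t < r] (fun z _ => @enorm_subl_cont x z) (@open_lt _ r).
exact.
Qed.

Lemma eball_qbox x r : eball x r `<=` qbox x r.
Proof.
move=> z zr; apply/qboxP => i; have := coord_le_enorm (z - x) i.
by rewrite /eball /= in zr; rewrite !mxE ler_norml => /andP[? ?]; apply/andP; split; lra.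
Qed.

Lemma qbox_enorm x r z : qbox x r z -> enorm (z - x) <= n%:R * r.
Proof.
move=> /qboxP zr; apply: enorm_le_sum => i; have := zr i; rewrite !mxE ler_norml.
by move=> /andP[? ?]; apply/andP; split; lra.
Qed.

Definition del Gam z := edist_set Gam z.

Lemma del_ge0 Gam z : 0 <= del Gam z.
Proof.
have [->|/set0P[y Gy]] := eqVneq Gam set0; first by rewrite /del /edist_set image_set0 inf0.
apply: lb_le_inf; first by exists (enorm (z - y)), y.
by move=> _ [p _ <-]; exact: enorm_ge0.
Qed.

Lemma del_le Gam z y : Gam y -> del Gam z <= enorm (z - y).
Proof.
move=> Gy; apply: ge_inf; last by exists y.
by exists 0 => _ [p _ <-]; exact: enorm_ge0.
Qed.

Lemma del_lt Gam z c : Gam !=set0 -> del Gam z < c -> exists2 y, Gam y & enorm (z - y) < c.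
Proof.
move=> [y0 Gy0] h.
have hi : has_inf [set enorm (z - y) | y in Gam].
  by split; [exists (enorm (z - y0)), y0|exists 0 => _ [p _ <-]; exact: enorm_ge0].
have e0 : 0 < c - del Gam z by rewrite subr_gt0.
have [_ [y Gy <-] hy] := inf_adherent e0 hi.
by exists y => //; apply: lt_le_trans hy _; rewrite /del; lra.
Qed.

Lemma del_lip Gam z p : Gam !=set0 -> del Gam z <= del Gam p + enorm (z - p).
Proof.
move=> G0; apply/ler_addgt0Pl => e e0.
have [y Gy hy] : exists2 y, Gam y & enorm (p - y) < del Gam p + e by apply: del_lt => //; lra.
by have := del_le z Gy; have := enorm_tri z p y; lra.
Qed.

Lemma del_gt0 Gam z : Gam !=set0 -> closed Gam -> ~ Gam z -> 0 < del Gam z.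
Proof.
move=> G0 cG nG; rewrite lt_neqAle del_ge0 andbT eq_sym; apply/eqP => d0; apply: nG.
rewrite (closure_id Gam).1//; move=> B /nbhs_coordP[e e0 he].
have [y Gy hy] : exists2 y, Gam y & enorm (z - y) < e by apply: del_lt => //; rewrite d0.
exists y; split => //; apply: he => j; apply: le_lt_trans hy.
by have := coord_le_enorm (z - y) j; rewrite !mxE distrC.
Qed.

Lemma del0 Gam z : Gam z -> del Gam z = 0.
Proof.
by move=> Gz; apply/eqP; rewrite eq_le del_ge0 andbT; have := del_le z Gz; rewrite subrr enorm0.
Qed.

Lemma lip_cont (f : V -> R) L : 0 <= L -> (forall z p, `|f z - f p| <= L * enorm (z - p)) -> continuous f.
Proof.
move=> L0 H; have key x e : 0 < e -> exists2 d : R, 0 < d & forall y, (forall j, `|y ord0 j - x ord0 j| < d) -> `|f y - f x| < e.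
  move=> e0; have LN : 0 < L * n%:R + 1 by rewrite ltr_wpDl// mulr_ge0.
  exists (e / (L * n%:R + 1)); first by rewrite divr_gt0.
  move=> y hy; apply: (le_lt_trans (H y x)).
  apply: (@le_lt_trans _ _ (L * (n%:R * (e / (L * n%:R + 1))))).
    by apply: ler_wpM2l => //; apply: enorm_le_sum => i; rewrite !mxE; exact: ltW.
  have -> : L * (n%:R * (e / (L * n%:R + 1))) = e / (L * n%:R + 1) * (L * n%:R) by ring.
  by apply: div_succ_lt => //; exact: mulr_ge0.
move=> x; apply/(@cvgrPdist_lt _ _ V (nbhs x) (nbhs_filter x) f (f x)) => e e0.
have [d d0 hd] := key x e e0; apply/nbhs_coordP; exists d => // y /hd.
by rewrite distrC.
Qed.

Lemma del_cont Gam : Gam !=set0 -> continuous (del Gam).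
Proof.
move=> G0; apply: (@lip_cont _ 1) => // z p; rewrite mul1r ler_norml.
by have := del_lip z p G0; have := del_lip p z G0; rewrite enormB => ? ?; apply/andP; split; lra.
Qed.
End euclid.

(** * Hausdorff measure and the weight *)

Section hausdorff_borel.
Context (R : realType) (n : nat) (d : R).
Local Notation V := 'rV[R]_n.
Local Notation nu := (@hausdorff_outer R n d).
Implicit Types (x y z p : V) (r s t c e : R) (i j : 'I_n) (X Y Z : set V).
Local Open Scope ereal_scope.

Let hc (e : R) X : \bar R := hausdorff_content d e X.

Lemma hausdorff_content_mono (e e' : R) X : (e <= e')%R -> hc e' X <= hc e X.
Proof.
move=> ee; apply: le_ereal_inf_tmp => _ [D [cD DP XD] <-].
apply: ereal_inf_lbound; exists D => //; split => //.
by move=> F /DP sF x y Fx Fy; apply: le_trans ee; exact: sF.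
Qed.

(** A set of diameter at most [e] cannot meet both [X] and [Y], so a cover of the union splits into
    disjoint covers of the two. *)
Lemma hausdorff_content_sep (r e : R) X Y : (e < r)%R ->
  (forall x y, X x -> Y y -> (r <= enorm (x - y))%R) -> hc e X + hc e Y <= hc e (X `|` Y).
Proof.
move=> er sep; apply: le_ereal_inf_tmp => _ [D [cD DP XD] <-].
pose DX := [set F | D F /\ exists2 x, X x & F x].
pose DY := [set F | D F /\ exists2 y, Y y & F y].
have dis : [disjoint DX & DY].
  apply/disj_setPS => F [[DF [x Xx Fx]] [_ [y Yy Fy]]].
  have := DP _ DF x y Fx Fy; have := sep _ _ Xx Yy => h1 h2.
  by have := le_lt_trans (le_trans h1 h2) er; rewrite ltxx.
have v0 F : 0 <= (ediam F `^ d)%:E by rewrite lee_fin powR_ge0.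
apply: (@le_trans _ _ (\esum_(F in DX) (ediam F `^ d)%:E + \esum_(F in DY) (ediam F `^ d)%:E)).
  apply: leeD; apply: ereal_inf_lbound.
    exists DX => //; split.
    - by apply: sub_countable cD; apply: subset_card_le => F [].
    - by move=> F [/DP].
    - by move=> x Xx; have [|F DF Fx] := XD x; [left|exists F => //; split => //; exists x].
  exists DY => //; split.
  - by apply: sub_countable cD; apply: subset_card_le => F [].
  - by move=> F [/DP].
  - by move=> x Xx; have [|F DF Fx] := XD x; [right|exists F => //; split => //; exists x].
rewrite esum_mkcond [X in _ + X]esum_mkcond [leRHS]esum_mkcond -esumD; last 2 first.
  by move=> F _; case: ifP.
  by move=> F _; case: ifP.
apply: le_esum => F _.
have [hX|hX] := boolP (F \in DX); have [hY|hY] := boolP (F \in DY).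
- by move/disj_setPS: dis => /(_ F); move: hX hY; rewrite !inE => ? ? [].
- by rewrite adde0 mem_set//; move: hX; rewrite inE => -[].
- by rewrite add0e mem_set//; move: hY; rewrite inE => -[].
- by rewrite adde0; case: ifP.
Qed.

(** The additivity of a metric outer measure on separated sets. The two suprema over scales are
    treated independently, with the smaller of the two scales used on the union. *)
Lemma hausdorff_sep (r : R) X Y : (0 < r)%R -> nu X < +oo -> nu Y < +oo ->
  (forall x y, X x -> Y y -> (r <= enorm (x - y))%R) -> nu X + nu Y <= nu (X `|` Y).
Proof.
move=> r0 fX fY sep.
have H e1 e2 : (0 < e1)%R -> (0 < e2)%R -> hc e1 X + hc e2 Y <= nu (X `|` Y).
  move=> e10 e20; pose e := Num.min (r / 2)%R (Num.min e1 e2).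
  have e0 : (0 < e)%R by rewrite !lt_min divr_gt0// e10.
  have er : (e < r)%R by apply: (@le_lt_trans _ _ (r / 2)%R); [rewrite ge_min lexx|lra].
  apply: (@le_trans _ _ (hc e X + hc e Y)).
    by apply: leeD; apply: hausdorff_content_mono; rewrite !ge_min lexx ?orbT.
  apply: (le_trans (hausdorff_content_sep er sep)).
  by apply: ereal_sup_ubound; exists e.
have fin Z : nu Z < +oo -> nu Z \is a fin_num by move=> ?; rewrite ge0_fin_numE// hausdorff_outer_ge0.
rewrite -leeBrDr ?fin//; apply: ge_ereal_sup => _ [e1 e10 <-].
rewrite leeBrDr ?fin// addeC.
have hfin : hc e1 X \is a fin_num.
  rewrite ge0_fin_numE; last by apply: cover_outer_ge0 => ?; exact: powR_ge0.
  by apply: le_lt_trans fX; apply: ereal_sup_ubound; exists e1.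
rewrite -leeBrDr//; apply: ge_ereal_sup => _ [e2 e20 <-].
by rewrite leeBrDr// addeC; exact: H.
Qed.

(** Caratheodory's criterion for metric outer measures. The half-space is approximated by the points
    at depth at least 2^(-K) below the hyperplane, which are separated from the complement; what is
    missing is a tail of dyadic slabs, and the series of their measures converges. *)
Lemma measurable_coord_lt_haus i c : measurable ([set z : V | (z ord0 i < c)%R] : set (@hausT R n d)).
Proof.
apply: le_caratheodory_measurable => X.
have [Xoo|Xfin'] := eqVneq (nu X) +oo.
  by apply: (le_trans (leey _)); rewrite -Xoo.
have Xfin : nu X < +oo by rewrite ltey.
have sfin Z : Z `<=` X -> nu Z < +oo by move=> ZX; apply: le_lt_trans Xfin; exact: le_hausdorff_outer.
set H := [set z : V | (z ord0 i < c)%R].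
pose D k : set V := [set z | X z /\ (z ord0 i <= c - 2^-1 ^+ k)%R].
pose Rg k : set V := [set z | X z /\ (c - 2^-1 ^+ k < z ord0 i <= c - 2^-1 ^+ k.+1)%R].
have half k l : (k <= l)%N -> (2^-1 ^+ l <= 2^-1 ^+ k :> R)%R.
  by move=> kl; apply: ler_wiXn2l => //; lra.
have pos k : (0 < 2^-1 ^+ k :> R)%R by rewrite exprn_gt0// invr_gt0.
have sep (k l : nat) x y : (k.+1 < l)%N -> Rg k x -> Rg l y -> (2^-1 ^+ k.+1 - 2^-1 ^+ k.+2 <= enorm (x - y))%R.
  move=> kl [_ /andP[_ h1]] [_ /andP[h2 _]]; apply: le_trans (coord_le_enorm _ i).
  rewrite !mxE distrC; apply: le_trans (ler_norm _).
  by have := half _ _ kl; lra.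
(* The slabs whose index has the parity of [b]: slabs of equal parity are separated, so their
   measures add up to at most that of [X]. *)
pose s b K := \bigcup_(k in [set k | (k < K)%N]) Rg (k.*2 + b)%N.
have sum b K : \sum_(0 <= k < K) nu (Rg (k.*2 + b)%N) <= nu (s b K).
  elim: K => [|K IH]; first by rewrite big_nil hausdorff_outer_ge0.
  rewrite big_nat_recr//=; apply: (@le_trans _ _ (nu (s b K) + nu (Rg (K.*2 + b)%N))); first exact: leeD.
  apply: (@le_trans _ _ (nu (s b K `|` Rg (K.*2 + b)%N))); last first.
    apply: le_hausdorff_outer => z [[k /= kK h]|h]; [exists k => //=; exact: ltnW|by exists K => /=].
  case: K {IH} => [|K].
    rewrite (_ : s b 0%N = set0); first by rewrite hausdorff_outer0 add0e set0U.
    by apply/seteqP; split => // z [].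
  apply: (@hausdorff_sep (2^-1 ^+ (K.*2 + b).+1 - 2^-1 ^+ (K.*2 + b).+2)%R).
  - by rewrite subr_gt0 [ltLHS]exprS; have := pos (K.*2 + b).+1; lra.
  - by apply: sfin => z [k _ []].
  - by apply: sfin => z [].
  - move=> x y [k /= kK hx] hy; apply: le_trans (sep _ _ _ _ _ hx hy); last first.
      by rewrite doubleS !addSn !ltnS leq_add2r leq_double.
    rewrite ![(2^-1 ^+ (_ .+2))%R]exprS.
    have := half (k.*2 + b).+1 (K.*2 + b).+1; rewrite ltnS leq_add2r leq_double => /(_ kK).
    lra.
have part K : \sum_(0 <= k < K.*2) nu (Rg k) =
    \sum_(0 <= k < K) nu (Rg (k.*2 + 0)%N) + \sum_(0 <= k < K) nu (Rg (k.*2 + 1)%N).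
  elim: K => [|K IH]; first by rewrite !big_nil adde0.
  by rewrite doubleS !big_nat_recr//= IH addn0 addn1 !addeA; congr (_ + _); rewrite -!addeA; congr (_ + _); rewrite addeC.
have nu0 k : 0 <= nu (Rg k) by exact: hausdorff_outer_ge0.
have tot : \sum_(0 <= k <oo) nu (Rg k) < +oo.
  apply: (@le_lt_trans _ _ (nu X + nu X)); last by rewrite lte_add_pinfty.
  apply: lime_le; first exact: is_cvg_nneseries.
  apply: nearW => K; apply: (@le_trans _ _ (\sum_(0 <= k < K.*2) nu (Rg k))).
    by apply: lee_sum_nneg_natr => //; rewrite -addnn leq_addr.
  rewrite part; apply: leeD; apply: (le_trans (sum _ _)); apply: le_hausdorff_outer => z [k _ []] //.
have tail := nneseries_tail_cvg tot (fun k _ => nu0 k).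
apply/lee_addgt0Pr => e e0.
have [K hK] : exists K : nat, \sum_(K <= k <oo) nu (Rg k) <= e%:E.
  have nb : nbhs (0 : \bar R) [set x | x < e%:E].
    by exists e => //= r; rewrite /ball_ /= sub0r normrN lte_fin => h; exact: le_lt_trans (ler_norm _) h.
  have [K _ hK] := tail _ nb; exists K; apply/ltW; exact: hK (leqnn K).
have sub : X `&` H `<=` D K `|` \bigcup_(k in ~` `I_K) Rg k.
  move=> z [Xz]; rewrite /H /= => zc.
  have [h|h] := leP (z ord0 i) (c - 2^-1 ^+ K)%R; [by left|right].
  pose k1 := Num.bound (c - z ord0 i)^-1%R.
  have Pk : exists k, (z ord0 i <= c - 2^-1 ^+ k)%R.
    exists k1; rewrite lerBrDr addrC -lerBrDr exprVn -[leRHS]invrK lef_pV2 ?posrE ?invr_gt0 ?subr_gt0 ?exprn_gt0//.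
    apply: (@le_trans _ _ k1%:R); first by apply/ltW/archi_boundP; rewrite invr_ge0 subr_ge0 ltW.
    by rewrite -natrX ler_nat ltnW// ltn_expl.
  pose k := ex_minn Pk.
  have [hk kmin] : (z ord0 i <= c - 2^-1 ^+ k)%R /\ forall m, (z ord0 i <= c - 2^-1 ^+ m)%R -> (k <= m)%N.
    by rewrite /k; case: ex_minnP.
  have Kk : (K < k)%N.
    rewrite ltnNge; apply/negP => kK; have := lt_le_trans h hk.
    by rewrite ltrD2l ltrN2 ltNge half.
  exists k.-1 => /=; first by apply/negP; rewrite -leqNgt -ltnS prednK// (leq_ltn_trans _ Kk).
  split => //; rewrite prednK ?(leq_ltn_trans _ Kk)// hk andbT ltNge; apply/negP => /kmin.
  by rewrite leqNgt prednK ?leqnn// (leq_ltn_trans _ Kk).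
have DB : nu (D K) + nu (X `&` ~` H) <= nu X.
  apply: (@le_trans _ _ (nu (D K `|` (X `&` ~` H)))); last first.
    by apply: le_hausdorff_outer => z [[]|[]].
  apply: (hausdorff_sep (pos K)); [by apply: sfin => z []|by apply: sfin => z []|].
  move=> x y [_ h1] [_ /negP]; rewrite -leNgt => h2.
  apply: le_trans (coord_le_enorm _ i); rewrite !mxE distrC; apply: le_trans (ler_norm _); lra.
have AE : nu (X `&` H) <= nu (D K) + e%:E.
  apply: (@le_trans _ _ (nu (D K `|` \bigcup_(k in ~` `I_K) Rg k))).
    exact: le_hausdorff_outer.
  apply: (le_trans (@outer_measureU2 _ _ (nu : {outer_measure set V -> \bar R}) _ _)); apply: leeD => //; apply: le_trans hK.
  exact: (@outer_measure_sigma_subadditive_tail _ _ (nu : {outer_measure set V -> \bar R})).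
apply: (@le_trans _ _ (nu (D K) + e%:E + nu (X `&` ~` H))).
  by apply: leeD; [exact: AE|exact: lexx].
by rewrite addeAC; apply: leeD; [exact: DB|exact: lexx].
Qed.

Lemma measurable_hbox_haus (a b : V) : measurable (hbox a b : set (@hausT R n d)).
Proof.
have -> : hbox a b = \bigcap_(i in [set: 'I_n]) ([set z : V | (z ord0 i < b ord0 i)%R] `\` [set z : V | (z ord0 i < a ord0 i)%R]).
  apply/seteqP; split => [x h i _|x h i].
    have /andP[h1 h2] := h i; split => //=; apply/negP; by rewrite -leNgt.
  by have [h1 /= /negP] := h i I; rewrite -leNgt => h2; rewrite h2.
apply: fin_bigcap_measurable => [|i _]; first exact: finite_finset.
apply: measurableD; exact: measurable_coord_lt_haus.
Qed.

Lemma measurable_open_haus (U : set V) : open U -> measurable (U : set (@hausT R n d)).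
Proof.
move=> /open_hboxes[F hF ->].
apply: countable_bigcupT_measurable; first exact: countableP.
move=> pq; have [->|[a [b ->]]] := hF pq; [exact: measurable0|exact: measurable_hbox_haus].
Qed.
End hausdorff_borel.

(** * Integrals estimated over dyadic layers *)

Section layers.
Context d0 (T : measurableType d0) (R : realType) (m : {measure set T -> \bar R}).
Local Open Scope ereal_scope.

(** The integral of a nonnegative function is a supremum over the simple functions below it, and
    such a supremum is monotone whatever the functions are. *)
Lemma le_integral_nonmeas (D : set T) (f g : T -> \bar R) : (forall x, D x -> 0 <= f x) ->
  (forall x, D x -> f x <= g x) -> \int[m]_(x in D) f x <= \int[m]_(x in D) g x.
Proof.
move=> f0 fg; rewrite !ge0_integralE//; last by move=> x Dx; exact: le_trans (f0 _ Dx) (fg _ Dx).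
apply: ge_ereal_sup => _ [h hf <-]; apply: ereal_sup_ubound; exists h => //= x.
apply: le_trans (hf x) _; rewrite /patch; case: ifPn => // /set_mem; exact: fg.
Qed.

Lemma eseries_half (b : R) : (0 <= b)%R -> \sum_(j <oo) (b * 2^-1 ^+ j)%:E = (2 * b)%:E.
Proof.
move=> b0; have := @cvg_geometric_eseries_half R (2 * b) 0.
rewrite expr0 divr1 => /cvg_lim <-//; apply: congr_lim; apply/funext => N.
apply: eq_bigr => i _; congr EFin; rewrite exprVn addn1 natrX exprS invfM mulrA.
by rewrite [in RHS](mulrC 2%R) mulfK.
Qed.

Lemma integral_scale_indic (D E : set T) (c : R) : (0 <= c)%R -> measurable D -> measurable E ->
  \int[m]_(x in D) (c * \1_E x)%:E = c%:E * m (D `&` E).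
Proof.
move=> c0 mD mE; under eq_integral => x _ do rewrite EFinM.
rewrite ge0_integralZl//; last by apply/measurable_EFinP; exact: measurable_indic.
by rewrite integral_indic// setIC.
Qed.

(** On each layer the function is bounded by a constant, and constant times measure decays
    geometrically. There are two families because a kernel such as |x - y|^(-d-1) needs shells
    shrinking to a point and shells growing to infinity. *)
Lemma layer_integral2 (D : set T) (f : T -> \bar R) (E1 E2 : nat -> set T) (c1 c2 : nat -> R) (b1 b2 : R) :
  measurable D -> (forall j, measurable (E1 j)) -> (forall j, measurable (E2 j)) ->
  (forall j, (0 <= c1 j)%R) -> (forall j, (0 <= c2 j)%R) -> (0 <= b1)%R -> (0 <= b2)%R ->
  (forall x, D x -> 0 <= f x) ->
  (forall x, D x -> [\/ f x = 0, exists2 j, E1 j x & f x <= (c1 j)%:E | exists2 j, E2 j x & f x <= (c2 j)%:E]) ->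
  (forall j, (c1 j)%:E * m (D `&` E1 j) <= (b1 * 2^-1 ^+ j)%:E) ->
  (forall j, (c2 j)%:E * m (D `&` E2 j) <= (b2 * 2^-1 ^+ j)%:E) ->
  \int[m]_(x in D) f x <= (2 * (b1 + b2))%:E.
Proof.
move=> mD mE1 mE2 c10 c20 b10 b20 f0 fE cE1 cE2.
pose h j x := (c1 j * \1_(E1 j) x)%:E + (c2 j * \1_(E2 j) x)%:E.
have hI1 j x : 0 <= (c1 j * \1_(E1 j) x)%:E by rewrite lee_fin mulr_ge0// indicE.
have hI2 j x : 0 <= (c2 j * \1_(E2 j) x)%:E by rewrite lee_fin mulr_ge0// indicE.
have h0 j x : 0 <= h j x by exact: adde_ge0.
have mh1 j : measurable_fun D (fun x => (c1 j * \1_(E1 j) x)%:E).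
  by apply/measurable_EFinP; apply: measurable_funM => //; exact: measurable_indic.
have mh2 j : measurable_fun D (fun x => (c2 j * \1_(E2 j) x)%:E).
  by apply/measurable_EFinP; apply: measurable_funM => //; exact: measurable_indic.

apply: (@le_trans _ _ (\int[m]_(x in D) \sum_(j <oo) h j x)).
  apply: le_integral_nonmeas => // x Dx; have [->|[j Ejx fj]|[j Ejx fj]] := fE _ Dx.
  - exact: nneseries_ge0.
  - apply: le_trans fj _; rewrite (@nneseriesD1 _ _ j)// /h indicE mem_set// mulr1.
    by rewrite -addeA leeDl// adde_ge0//; apply: nneseries_ge0 => k *; exact: h0.
  - apply: le_trans fj _; rewrite (@nneseriesD1 _ _ j)// /h [X in _ + (_ * X)%:E + _]indicE mem_set// mulr1.
    by rewrite -addeA addeCA leeDl// adde_ge0//; apply: nneseries_ge0 => k *; exact: h0.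
rewrite integral_nneseries//; last by move=> j; exact: emeasurable_funD.
rewrite -eseries_half ?addr_ge0//; apply: lee_nneseries => [j _ _|j _]; first exact: integral_ge0.
rewrite ge0_integralD// !integral_scale_indic// mulrDl EFinD; exact: leeD.
Qed.

Lemma layer_integral (D : set T) (f : T -> \bar R) (E : nat -> set T) (c : nat -> R) (b : R) :
  measurable D -> (forall j, measurable (E j)) -> (forall j, (0 <= c j)%R) -> (0 <= b)%R ->
  (forall x, D x -> 0 <= f x) ->
  (forall x, D x -> f x = 0 \/ exists2 j, E j x & f x <= (c j)%:E) ->
  (forall j, (c j)%:E * m (D `&` E j) <= (b * 2^-1 ^+ j)%:E) ->
  \int[m]_(x in D) f x <= (2 * b)%:E.
Proof.
move=> mD mE c0 b0 f0 fE cE; rewrite -[b]addr0.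
apply: (@layer_integral2 D f E (fun=> set0) c (fun=> 0%R) b 0%R) => // [x Dx|j].
  by have [h|h] := fE x Dx; [apply: Or31|apply: Or32].
by rewrite mul0e mul0r.
Qed.

End layers.

(** * Nets in an Ahlfors regular set and the volume of its neighbourhoods *)

Section nets.
Context (R : realType) (n : nat) (d : R).
Local Notation V := 'rV[R]_n.
Local Notation sg := (hausdorff n d).
Implicit Types (x y z p : V) (r s t c e : R) (i j : 'I_n) (X Y Z Gam : set V).

Lemma separated_count (P : nat -> Prop) (M : nat) : P 0%N -> (forall N, P N -> (N <= M)%N) ->
  exists2 N, P N & ~ P N.+1.
Proof.
move=> P0 PM; apply: contrapT => H.
have PP N : P N by elim: N => // N IH; apply: contrapT => h; apply: H; exists N.
by have := PM _ (PP M.+1); rewrite ltnn.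
Qed.

Lemma measurable_ball_haus Gam x r : closed Gam -> measurable (Gam `&` eball x r : set (@hausT R n d)).
Proof.
move=> cG; apply: measurableI; last exact/measurable_open_haus/eball_open.
rewrite -(setCK Gam); apply: measurableC; apply: measurable_open_haus; exact: closed_openC.
Qed.

Lemma separated_measure Gam C0 t (p : nat -> V) N : closed Gam -> 1 <= C0 -> ahlfors_regular Gam d C0 -> 0 < t ->
  (forall k, (k < N)%N -> Gam (p k)) ->
  (forall k l, (k < N)%N -> (l < N)%N -> k != l -> t <= enorm (p k - p l)) ->
  ((N%:R * (C0^-1 * (t / 2) `^ d))%:E <= sg (\big[setU/set0]_(k < N) (Gam `&` eball (p k) (t / 2))))%E.
Proof.
move=> cG C01 AR t0; elim: N => [|N IH] Gp sep; first by rewrite big_ord0 mul0r measure0.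
rewrite big_ord_recr /=; set A := \big[_/_]_(_ < _) _; set B := _ `&` eball (p N) _.
have -> : (hausdorff_outer d (A `|` B) = hausdorff_outer d A + hausdorff_outer d B)%E.
  apply: (@measureU _ _ _ sg A B).
- by apply: bigsetU_measurable => k _; exact: measurable_ball_haus.
- exact: measurable_ball_haus.
- rewrite -subset0 => y [+ [_ yN]]; rewrite /A -(bigcup_mkord N (fun k => Gam `&` eball (p k) (t / 2))) => -[k /= kN [_ yk]].
  have := sep k N (ltn_trans kN (ltnSn N)) (ltnSn N).
  rewrite (ltn_eqF kN) => /(_ isT); rewrite /eball /= in yN yk.
  by have := enorm_tri (p k) y (p N); rewrite (enormB (p k) y); lra.
rewrite -natr1 mulrDl mul1r EFinD leeD//.
  by apply: IH => [k kN|k l kN lN]; [apply: Gp; rewrite ltnS ltnW|apply: sep; rewrite ltnS ltnW].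
have t20 : 0 < t / 2 by lra.
by have [] := AR _ _ (Gp N (ltnSn N)) t20.
Qed.

(** A maximal [t]-separated subset is a net. The balls of radius [t / 2] around its points are
    disjoint and lie in a ball of radius [2 * r], so that regularity gives
    [N * (t / 2)^d <= C0^2 * (2 * r)^d]: this is the constant [C0^2 * 4^d]. *)
Lemma net (C0 : R) : 1 <= C0 -> 0 <= d -> exists2 K : R, 0 < K & forall Gam, closed Gam -> ahlfors_regular Gam d C0 ->
  forall x r t, Gam x -> 0 < t -> t <= r -> exists (N : nat) (p : nat -> V),
  [/\ N%:R <= K * (r / t) `^ d, (forall k, (k < N)%N -> Gam (p k)) &
      forall y, Gam y -> eball x r y -> exists2 k, (k < N)%N & enorm (y - p k) < t].
Proof.
move=> C01 d0; have C00 : 0 < C0 by lra.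
exists (C0 ^+ 2 * 4 `^ d); first by rewrite mulr_gt0 ?exprn_gt0// powR_gt0//; lra.
move=> Gam cG AR x r t Gx t0 tr; have r0 : 0 < r by lra.
pose P N := exists p : nat -> V, (forall k, (k < N)%N -> (Gam `&` eball x r) (p k)) /\
  (forall k l, (k < N)%N -> (l < N)%N -> k != l -> t <= enorm (p k - p l)).
have PK N : P N -> N%:R <= C0 ^+ 2 * 4 `^ d * (r / t) `^ d.
  move=> [p [Gp sp]].
  have := separated_measure cG C01 AR t0 (fun k kN => (Gp k kN).1) sp.
  have H : (sg (\big[setU/set0]_(k < N) (Gam `&` eball (p k) (t / 2))) <= sg (Gam `&` eball x (2 * r)))%E.
    apply: le_outer_measure; rewrite -(bigcup_mkord N (fun k => Gam `&` eball (p k) (t / 2))) => y [k /= kN [Gy yk]]; split=> //.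
    have [_] := Gp k kN; rewrite /eball /= in yk *; have := enorm_tri y (p k) x; lra.
  have [_ H2] := AR x (2 * r) Gx (mulr_gt0 (ltr0Sn _ 1) r0).
  move=> /le_trans/(_ (le_trans H H2)); rewrite lee_fin.
  have -> : (2 * r) `^ d = 4 `^ d * (r / t) `^ d * (t / 2) `^ d.
    by rewrite -!powRM; [congr (_ `^ _); field; lra|rewrite ?mulr_ge0 ?divr_ge0 ?invr_ge0; lra..].
  rewrite -[in X in _ -> X]mulrA.
  have := @powR_gt0 _ (t / 2) d (divr_gt0 t0 (ltr0Sn _ 1)).
  move: (_ `^ d) (4 `^ d * _) => s q s0; rewrite !mulrA ler_pM2r// => h.
  have -> : N%:R = (N%:R / C0) * C0 by rewrite divfK// gt_eqF.
  have -> : C0 ^+ 2 * q = C0 * q * C0 by ring.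
  by rewrite ler_pM2r.
have [] := @separated_count P (Num.bound (C0 ^+ 2 * 4 `^ d * (r / t) `^ d)).
- by exists (fun=> 0); split.
- move=> N /PK NK; rewrite -(ler_nat R); apply: le_trans NK _; apply/ltW.
  by apply: archi_boundP; rewrite !mulr_ge0 ?powR_ge0 ?exprn_ge0//; lra.
move=> N PN PSN; have [p [Gp sp]] := PN; exists N, p; split.
- exact: PK.
- by move=> k /Gp[].
move=> y Gy yr; apply: contrapT => H; apply: PSN.
have ty k : (k < N)%N -> t <= enorm (y - p k).
  by move=> kN; rewrite leNgt; apply/negP => h; apply: H; exists k.
exists (fun k => if (k < N)%N then p k else y); split => [k|k l].
  by case: ifPn => [/Gp//|].
have LT m : (m < N.+1)%N -> m = N \/ (m < N)%N.
  by rewrite ltnS leq_eqVlt => /orP[/eqP|]; [left|right].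
move=> /LT[->|kN] /LT[->|lN] kl; rewrite ?ltnn ?kN ?lN.
- by rewrite eqxx in kl.
- exact: ty.
- by rewrite enormB; exact: ty.
- exact: sp.
Qed.

Lemma leb_qbox x r : 0 <= r -> lebesgue_n R n (qbox x r) = ((2 * r) ^+ n)%:E.
Proof.
move=> r0; rewrite /qbox leb_hbox; last by move=> i; rewrite !mxE; lra.
congr EFin; rewrite /vol (eq_bigr (fun=> 2 * r)) ?prodr_const ?card_ord// => i _; rewrite !mxE; ring.
Qed.

(** The points of the cube within [t] of Gam are covered by the cubes of radius [2 * t] around a
    [t]-net, and there are about [(r / t)^d] of them. *)
Lemma tube (C0 : R) : 1 <= C0 -> 0 <= d -> exists2 K : R, 0 < K & forall Gam, closed Gam -> ahlfors_regular Gam d C0 ->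
  Gam !=set0 -> forall x r t, 0 < t -> t <= r ->
  (lebesgue_n R n (qbox x r `&` [set z : V | (del Gam z < t)%R]) <= (K * r `^ d * t `^ (n%:R - d))%:E)%E.
Proof.
move=> C01 d0; have [K1 K10 H1] := net C01 d0; pose q : R := 2 * n%:R + 3.
have q0 : 0 < q by rewrite /q; have := ler0n R n; fast_lra.
exists (K1 * q `^ d * 4 ^+ n); first by rewrite !mulr_gt0 ?powR_gt0 ?exprn_gt0.
move=> Gam cG AR G0 x r t t0 tr; have r0 : 0 < r by fast_lra.
have nr0 : 0 <= n%:R * r by rewrite mulr_ge0// ltW.
set E := _ `&` _.
have [->|/set0P[z0 [Qz0 /= dz0]]] := eqVneq E set0.
  by rewrite measure0 lee_fin !mulr_ge0 ?powR_ge0 ?exprn_ge0// ltW.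
have [y0 Gy0 zy0] := del_lt G0 dz0.
have [] := H1 _ cG AR y0 (q * r) t Gy0 t0; first by rewrite /q; nra.
move=> N [p [NK Gp cov]].
have EP : E `<=` \big[setU/set0]_(k < N) qbox (p k) (2 * t).
  move=> z [Qz /= dz]; have [y Gy zy] := del_lt G0 dz.
  have [] := cov y Gy.
    rewrite /eball /=; have := qbox_enorm Qz; have := qbox_enorm Qz0.
    have := enorm_tri y z y0; have := enorm_tri z z0 y0; have := enorm_tri z x z0.
    by rewrite (enormB x z0) (enormB y z) /q; nra.
  move=> k kN yk; rewrite -(bigcup_mkord N (fun k => qbox (p k) (2 * t))); exists k => //=; apply: eball_qbox.
  by rewrite /eball /=; have := enorm_tri z y (p k); fast_lra.
apply: le_trans (le_outer_measure (lebesgue_n R n) _ _ EP) _.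
apply: (@le_trans _ _ (\sum_(k < N) ((4 * t) ^+ n)%:E)%E).
  apply: le_trans (outer_measure_subadditive (lebesgue_n R n) (fun k => qbox (p k) (2 * t)) N) _.
  apply: lee_sum => k _; rewrite leb_qbox; last fast_lra.
  by rewrite lee_fin; have -> : 2 * (2 * t) = 4 * t by ring.
rewrite sumEFin sumr_const card_ord -(mulr_natl _ N) lee_fin.
apply: le_trans (ler_wpM2r _ NK) _; first by rewrite exprn_ge0//; fast_lra.
rewrite le_eqVlt; apply/orP; left; apply/eqP.
rewrite exprMn -!(@powR_mulrn _ t n); last fast_lra.
have -> : t `^ n%:R = t `^ (n%:R - d) * t `^ d.
  by rewrite -powRD ?subrK//; apply/implyP => _; rewrite gt_eqF.
have E1 : (q * r / t) `^ d * t `^ d = q `^ d * r `^ d.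
  by rewrite -powRM ?divfK ?gt_eqF ?powRM//; rewrite ?divr_ge0 ?mulr_ge0//; fast_lra.
rewrite (_ : K1 * q `^ d * 4 ^+ n * r `^ d * t `^ (n%:R - d) =
  K1 * (q `^ d * r `^ d) * 4 ^+ n * t `^ (n%:R - d)); last by ring.
rewrite -E1; ring.
Qed.

End nets.

(** * Mass and A1 property of the weight *)

Section weight.
Context (R : realType) (n : nat) (d C0 : R).
Hypotheses (n0 : (0 < n)%N) (d0 : 0 < d) (dn : d < n%:R - 1) (C01 : 1 <= C0).
Local Notation V := 'rV[R]_n.
Local Notation mu := (lebesgue_n R n).
Local Notation a := (n%:R - 1 - d).
Implicit Types (x y z p q : V) (r s t c e l : R) (X Y Z Gam : set V).

Definition regular_set Gam := [/\ Gam !=set0, closed Gam & ahlfors_regular Gam d C0].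

Lemma weightE Gam z : weight Gam d z = (del Gam z) `^ (- a).
Proof. by rewrite /weight /del; congr (_ `^ _); ring. Qed.

Lemma a_gt0 : 0 < a. Proof. by rewrite subr_gt0. Qed.

Lemma weight_ge0 Gam z : 0 <= weight Gam d z. Proof. exact: powR_ge0. Qed.

(** A nonzero power of 0 is 0 by convention, so the weight vanishes on Gam instead of being
    infinite. For this reason lower bounds for the weight are stated off Gam. *)
Lemma weight0 Gam z : Gam z -> weight Gam d z = 0.
Proof. by move=> Gz; rewrite weightE del0// powR0// oppr_eq0 gt_eqF// a_gt0. Qed.

Lemma weight_gt0 Gam z : regular_set Gam -> ~ Gam z -> 0 < weight Gam d z.
Proof. by move=> [G0 cG _] Gz; rewrite weightE powR_gt0// del_gt0. Qed.

Lemma powR_decr s t b : 0 < s -> s <= t -> 0 <= b -> t `^ (- b) <= s `^ (- b).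
Proof.
move=> s0 st b0; rewrite !powRN lef_pV2 ?posrE ?powR_gt0//; last exact: lt_le_trans st.
by apply: ge0_ler_powR => //; rewrite ?nnegrE; lra.
Qed.

Lemma weight_le Gam z s : 0 < s -> s <= del Gam z -> weight Gam d z <= s `^ (- a).
Proof. by move=> s0 sz; rewrite weightE powR_decr// ltW// a_gt0. Qed.

Lemma weight_ge Gam z s : regular_set Gam -> ~ Gam z -> del Gam z <= s -> s `^ (- a) <= weight Gam d z.
Proof. by move=> [G0 cG _] Gz sz; rewrite weightE powR_decr ?del_gt0// ltW// a_gt0. Qed.

Lemma measurable_weight Gam : Gam !=set0 -> measurable_fun [set: lebT R n] (weight Gam d : lebT R n -> R).
Proof.
move=> G0; have H := @measurable_powR R (d + 1 - n%:R).
have H2 := continuous_measurable_leb (del_cont G0).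
exact: (measurableT_comp H H2).
Qed.

Lemma half_expr_small e : 0 < e -> exists N, 2^-1 ^+ N < e.
Proof.
move=> e0; have h : `|2^-1 : R| < 1 by rewrite ger0_norm ?invr_ge0//; lra.
have := cvg_geometric (1 : R) h; move=> /cvgrPdist_lt/(_ e e0) [N _ /(_ N (leqnn N))] /=.
rewrite mul1r sub0r normrN ger0_norm ?exprn_ge0 ?invr_ge0// => H; by exists N.
Qed.

Lemma dyadic s r : 0 < s -> s < r -> exists j, r * 2^-1 ^+ j.+1 <= s < r * 2^-1 ^+ j.
Proof.
move=> s0 sr; have r0 : 0 < r by lra.
have [N hN] := half_expr_small (divr_gt0 s0 r0).
have ex : exists j, r * 2^-1 ^+ j.+1 <= s.
  exists N; rewrite exprS; move: hN; rewrite ltr_pdivlMr// => hN.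
  have : 0 <= (2^-1 : R) ^+ N by rewrite exprn_ge0 ?invr_ge0.
  by move: (2^-1 ^+ N) hN => u; nra.
have [j hj jm] := ex_minnP ex; exists j; rewrite hj /=.
case: j hj jm => [|j] hj jm; first by rewrite expr0 mulr1.
by rewrite ltNge; apply/negP => /jm; rewrite ltnn.
Qed.

(** Where the distance to Gam is about [h = r / 2^j] the weight is about [h^(-a)], and by [tube]
    this layer has volume at most a multiple of [r^d * h^(n-d)]. Since n - d - a = 1, the product is
    [r^d * h], a geometric series. *)
Lemma weight_mass : exists2 K : R, 0 < K & forall Gam, regular_set Gam -> forall x r, 0 < r ->
  (\int[mu]_(z in qbox x r) (weight Gam d z)%:E <= (K * r `^ (d + 1))%:E)%E.
Proof.
have a0 := a_gt0; have [K1 K10 H1] := tube n C01 (ltW d0).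
exists (2 * (K1 * 2 `^ (n%:R - d) + 2 ^+ n)); first by rewrite mulr_gt0// addr_gt0 ?mulr_gt0 ?powR_gt0 ?exprn_gt0.
move=> Gam [G0 cG AR] x r r0; rewrite -mulrA.
pose h j : R := r * 2^-1 ^+ j.
have h0 j : 0 < h j by rewrite mulr_gt0// exprn_gt0// invr_gt0.
(* Layer 0 takes the points at distance at least [r] from Gam, hence the shift of the index. *)
pose E j : set V := if j is j'.+1 then [set z : V | del Gam z < h j'] else setT.
have mE j : measurable (E j : set (lebT R n)).
  case: j => [|j]; first exact: measurableT.
  apply: measurable_open; have := @open_comp _ _ (del Gam) [set t : R | t < h j] (fun z _ => del_cont G0 (x:=z)) (@open_lt _ (h j)).
  exact.
apply: (@layer_integral _ (lebT R n) R mu (qbox x r) (fun z => (weight Gam d z)%:E) E (fun j => (h j) `^ (- a))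
  ((K1 * 2 `^ (n%:R - d) + 2 ^+ n) * r `^ (d + 1))).
- exact: measurable_hbox.
- exact: mE.
- by move=> j; exact: powR_ge0.
- by rewrite mulr_ge0 ?powR_ge0// addr_ge0 ?mulr_ge0 ?powR_ge0 ?exprn_ge0//; exact: ltW.
- by move=> z _; rewrite lee_fin weight_ge0.
- move=> z _; have [Gz|Gz] := pselect (Gam z); first by left; rewrite weight0.
  right; have [rz|zr] := leP r (del Gam z).
    by exists 0%N => //; rewrite lee_fin weight_le// /h expr0 mulr1.
  have [j /andP[j1 j2]] := dyadic (del_gt0 G0 cG Gz) zr.
  by exists j.+1 => //; rewrite lee_fin weight_le.
- case=> [|j].
    rewrite /E setIT leb_qbox ?(ltW r0)// -EFinM lee_fin /h !expr0 !mulr1.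
    have -> : r `^ (- a) * (2 * r) ^+ n = 2 ^+ n * r `^ (d + 1).
      rewrite exprMn -(powR_mulrn _ (ltW r0)).
      have -> : r `^ (d + 1) = r `^ (- a) * r `^ n%:R; last by ring.
      by rewrite -powRD; [congr (_ `^ _); ring|apply/implyP => _; rewrite gt_eqF].
    by apply: ler_wpM2r; rewrite ?powR_ge0// lerDr mulr_ge0 ?powR_ge0// ltW.
  have hr : h j <= r.
    by rewrite /h -[leRHS]mulr1 ler_pM2l// exprn_ile1//; lra.
  apply: (@le_trans _ _ ((h j.+1) `^ (- a) * (K1 * r `^ d * (h j) `^ (n%:R - d)))%:E).
    rewrite EFinM; apply: lee_wpmul2l; first by rewrite lee_fin powR_ge0.
    exact: (H1 _ cG AR G0 x r (h j) (h0 j) hr).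
  rewrite lee_fin.
  have -> : h j = 2 * h j.+1 by rewrite /h exprS; field.
  rewrite powRM//; last exact: ltW.
  have -> : (h j.+1) `^ (- a) * (K1 * r `^ d * (2 `^ (n%:R - d) * h j.+1 `^ (n%:R - d))) =
    K1 * 2 `^ (n%:R - d) * r `^ d * (h j.+1 `^ (n%:R - d) * h j.+1 `^ (- a)) by ring.
  rewrite -powRD; last by apply/implyP => _; rewrite gt_eqF.
  have -> : n%:R - d + - a = 1 by ring.
  rewrite powRr1; last exact: ltW.
  rewrite /h powRD; last by apply/implyP => _; rewrite gt_eqF.
  rewrite powRr1; last exact: ltW.
  rewrite [leLHS](_ : _ = K1 * 2 `^ (n%:R - d) * (r `^ d * r) * 2^-1 ^+ j.+1); last by ring.
  apply: ler_wpM2r; first by rewrite exprn_ge0 ?invr_ge0.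
  apply: ler_wpM2r; first by rewrite mulr_ge0 ?powR_ge0// ltW.
  by rewrite lerDl exprn_ge0.
Qed.

Lemma locint_weight Gam : regular_set Gam -> locint (weight Gam d).
Proof.
move=> rG; have [G0 cG AR] := rG; split; first exact: measurable_weight.
move=> p q; have [r [r0 pqr]] := hbox_in_qbox p q 0.
apply: (@integrableS _ _ _ mu (qbox 0 r)) => //; [exact: measurable_hbox|exact: measurable_hbox|].
have [K K0 H] := weight_mass.
apply/integrableP; split.
  by apply/measurable_EFinP; apply: measurable_funTS; exact: measurable_weight.
under eq_integral => z _ do rewrite /= ger0_norm ?weight_ge0//.
by apply: le_lt_trans (H _ rG 0 r r0) _; rewrite ltry.
Qed.

Lemma ibox_weight : exists2 K : R, 0 < K & forall Gam, regular_set Gam -> forall x r, 0 < r ->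
  ibox (lower x r) (upper x r) (weight Gam d) <= K * r `^ (d + 1).
Proof.
have [K K0 H] := weight_mass; exists K => // Gam rG x r r0.
rewrite -lee_fin /ibox /Rintegral fineK; first exact: H.
by apply: integrable_fin_num; [exact: measurable_hbox|have [_] := locint_weight rG].
Qed.

(** If [z] is within [4 * n * r] of Gam, the bound for the mass suffices because the weight at [z]
    is large. Otherwise two points of the cube differ by at most [2 * n * r], less than half the
    distance from [z] to Gam, and the weight is almost constant on the cube. *)
Lemma weight_A1 : exists2 K : R, 0 < K & forall Gam, regular_set Gam -> forall x r z, 0 < r ->
  qbox x r z -> ~ Gam z -> ibox (lower x r) (upper x r) (weight Gam d) <= K * r ^+ n * weight Gam d z.
Proof.
have a0 := a_gt0; have [K1 K10 H1] := ibox_weight; pose m : R := 4 * n%:R.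
have m0 : 0 < m by rewrite /m mulr_gt0// ltr0n.
exists (K1 * m `^ a + 2 ^+ n * 2 `^ a); first by rewrite addr_gt0 ?mulr_gt0 ?powR_gt0 ?exprn_gt0.
move=> Gam rG x r z r0 Qz Gz; have [G0 cG AR] := rG; have w0 := weight_gt0 rG Gz.
have [dz|dz] := leP (del Gam z) (m * r).
  apply: (le_trans (H1 _ rG x r r0)).
  have := weight_ge rG Gz dz; rewrite powRM ?(ltW m0) ?(ltW r0)// => wz.
  have -> : r `^ (d + 1) = m `^ a * r ^+ n * (m `^ (- a) * r `^ (- a)).
    rewrite powRN; have -> : r `^ (d + 1) = r ^+ n * r `^ (- a).
      rewrite -(powR_mulrn _ (ltW r0)) -powRD; last by apply/implyP => _; rewrite gt_eqF.
      congr (_ `^ _); ring.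
    field; by rewrite gt_eqF// powR_gt0.
  apply: (@le_trans _ _ (K1 * m `^ a * r ^+ n * weight Gam d z)).
    rewrite !mulrA -[leLHS]mulrA; apply: ler_wpM2l => //.
    by rewrite !mulr_ge0 ?powR_ge0 ?exprn_ge0// ltW.
  apply: ler_wpM2r; first exact: ltW.
  by apply: ler_wpM2r; rewrite ?exprn_ge0 ?lerDl ?mulr_ge0 ?powR_ge0 ?exprn_ge0// ltW.
apply: (@le_trans _ _ (ibox (lower x r) (upper x r) (fun=> 2 `^ a * weight Gam d z))).
  apply: ibox_le; [exact: locint_weight|exact: locint_cst|move=> y Qy].
  have dy : del Gam z / 2 <= del Gam y.
    have := del_lip z y G0; have := qbox_enorm Qz; have := qbox_enorm Qy.
    have := enorm_tri z x y; rewrite (enormB x y); move: dz; rewrite /m; lra.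
  have dz0 := del_gt0 G0 cG Gz.
  apply: le_trans (weight_le _ dy) _; first by rewrite divr_gt0.
  rewrite powRM ?invr_ge0//; last exact: ltW.
  by rewrite weightE mulrC -powR_inv1// -powRrM mulrN mulN1r opprK.
rewrite ibox_cst; last by move=> i; rewrite !mxE; lra.
have -> : vol (lower x r) (upper x r) = 2 ^+ n * r ^+ n.
  rewrite -exprMn /vol (eq_bigr (fun=> 2 * r)) ?prodr_const ?card_ord// => i _; rewrite !mxE; ring.
have -> : 2 `^ a * weight Gam d z * (2 ^+ n * r ^+ n) = 2 ^+ n * 2 `^ a * r ^+ n * weight Gam d z by ring.
apply: ler_wpM2r; first exact: ltW.
by apply: ler_wpM2r; rewrite ?exprn_ge0 ?lerDr ?mulr_ge0 ?powR_ge0 ?exprn_ge0// ltW.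
Qed.

Lemma leb_null Gam : regular_set Gam -> forall x r, 0 < r -> mu (qbox x r `&` Gam) = 0%E.
Proof.
move=> [G0 cG AR] x r r0; have [K K0 H] := tube n C01 (ltW d0).
apply/eqP; rewrite eq_le measure_ge0 andbT; apply/lee_addgt0Pr => e e0; rewrite add0e.
have nd : 0 < n%:R - d by have := a_gt0; lra.
have H0 : 0 < e / (K * r `^ d) by rewrite divr_gt0// mulr_gt0// powR_gt0.
pose t := Num.min r ((e / (K * r `^ d)) `^ (n%:R - d)^-1).
have t0 : 0 < t by rewrite /t lt_min r0 powR_gt0.
apply: le_trans (_ : (mu (qbox x r `&` [set z : V | (del Gam z < t)%R]) <= _)%E).
  by apply: le_outer_measure => z [Qz Gz]; split=> //=; rewrite del0.
apply: le_trans (H _ cG AR G0 x r t t0 _) _; first by rewrite /t ge_min lexx.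
rewrite lee_fin -ler_pdivlMl ?mulr_gt0 ?powR_gt0// mulrC.
have <- : ((e / (K * r `^ d)) `^ (n%:R - d)^-1) `^ (n%:R - d) = e / (K * r `^ d).
  by rewrite -powRrM mulVf ?gt_eqF// powRr1// ltW.
apply: ge0_ler_powR; rewrite ?nnegrE ?powR_ge0 ?(ltW nd) ?(ltW t0)//.
by rewrite /t ge_min lexx orbT.
Qed.

End weight.

(** * Averages over boxes *)

Section spline.
Context (R : realType).
Implicit Types (F G : R -> R) (s t c d e p l : R).

Lemma C1R_D F F' G G' : is_C1R F F' -> is_C1R G G' -> is_C1R (fun t => F t + G t) (fun t => F' t + G' t).
Proof. by move=> [cF dF] [cG dG]; split; [exact: contD|move=> t; exact: is_deriveD]. Qed.

Lemma C1R_Z c F F' : is_C1R F F' -> is_C1R (fun t => c * F t) (fun t => c * F' t).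
Proof.
move=> [cF dF]; split => [|t]; first by apply: contM => //; exact: cst_continuous.
exact: is_deriveZ.
Qed.

Lemma C1R_affine c d F F' : is_C1R F F' -> is_C1R (fun t => F (c * t + d)) (fun t => c * F' (c * t + d)).
Proof.
move=> [cF dF].
have da t : is_derive t 1 (fun t => c * t + d) c.
  rewrite -[X in is_derive _ _ _ X]addr0; apply: is_deriveD.
  rewrite -[X in is_derive _ _ _ X]mulr1; exact: is_deriveZ.
have ca : continuous (fun t => c * t + d) by move=> t; exact: is_derive_cont (da t).
split => [|t]; first by apply: contM; [exact: cst_continuous|exact: (cont_comp ca cF)].
rewrite mulrC; exact: (@is_derive1_comp _ F (fun t => c * t + d) t (F' (c * t + d)) c (dF _) (da t)).
Qed.

Lemma C1R_id : is_C1R (fun t => t) (fun=> 1).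
Proof. by split => [|t]; [exact: cst_continuous|exact: is_derive_id]. Qed.

Lemma C1R_M F F' G G' : is_C1R F F' -> is_C1R G G' -> is_C1R (fun t => F t * G t) (fun t => F' t * G t + F t * G' t).
Proof.
move=> CF CG; have cF := C1R_cont CF; have cG := C1R_cont CG; case: CF => cF' dF; case: CG => cG' dG.
split => [|t]; first by apply: contD; exact: contM.
have := is_deriveM (dF t) (dG t).
by rewrite /GRing.scale /= addrC (mulrC (G t)).
Qed.

Definition pos t := Num.max 0 t.
Definition posq t := pos t ^+ 2.
Definition posc t := t * posq t.

Lemma pos_ge0 t : 0 <= pos t. Proof. by rewrite le_max lexx. Qed.
Lemma pos_le0 t : t <= 0 -> pos t = 0. Proof. by move=> ?; apply/max_idPl. Qed.
Lemma pos_id t : 0 <= t -> pos t = t. Proof. by move=> ?; apply/max_idPr. Qed.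

Lemma pos_cont : continuous pos.
Proof. by move=> t; apply: continuous_max; [exact: cst_continuous|exact: cvg_id]. Qed.

Lemma posq_C1 : is_C1R posq (fun t => 2 * pos t).
Proof.
split => [|t]; first by apply: contM; [exact: cst_continuous|exact: pos_cont].
apply: is_derive_est => e e0; exists e => // h /ltW he.
have E : `|posq (t + h) - posq t - h * (2 * pos t)| <= `|h| * `|h|.
  have -> : `|h| * `|h| = h * h by rewrite -normrM ger0_norm// -expr2 sqr_ge0.
  rewrite /posq; case: (leP 0 t) => t0; case: (leP 0 (t + h)) => th.
  - by rewrite !pos_id// ler_norml; apply/andP; split; nra.
  - by rewrite (pos_id t0) pos_le0 ?(ltW th)// ler_norml; apply/andP; split; nra.
  - by rewrite (pos_id th) pos_le0 ?(ltW t0)// ler_norml; apply/andP; split; nra.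
  - by rewrite !pos_le0 ?(ltW t0) ?(ltW th)// ler_norml; apply/andP; split; nra.
by apply: le_trans E _; apply: ler_wpM2r.
Qed.

Lemma posc_C1 : is_C1R posc (fun t => 3 * posq t).
Proof.
have := C1R_M C1R_id posq_C1; congr is_C1R; apply/funext => t.
by rewrite /posq; case: (leP 0 t) => t0; [rewrite pos_id//; ring|rewrite pos_le0 ?(ltW t0)//; ring].
Qed.

Definition thirds (f : R -> R) t := f t - 3 * f (t - 1 / 3) + 3 * f (t - 2 / 3) - f (t - 1).

(** The quadratic B-spline on [0, 1], normalized to have integral 1: its primitive [ispl] climbs
    from 0 to 1. The third difference of squares is C^1, as much as test functions need, and
    explicit enough for numerical bounds. *)
Definition spl t := 27 / 2 * thirds posq t.
Definition dspl t := 27 / 2 * thirds (fun t => 2 * pos t) t.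
Definition ispl t := 9 / 2 * thirds posc t.

Lemma C1R_thirds F F' : is_C1R F F' -> is_C1R (thirds F) (thirds F').
Proof.
move=> CF; have S c := @C1R_affine 1 (- c) F F' CF.
have := C1R_D (C1R_D (C1R_D CF (C1R_Z (- 3) (S (1 / 3)))) (C1R_Z 3 (S (2 / 3)))) (C1R_Z (- 1) (S 1)).
by congr is_C1R; apply/funext => t; rewrite /thirds !mul1r; ring.
Qed.

Lemma spl_C1 : is_C1R spl dspl. Proof. exact/C1R_Z/C1R_thirds/posq_C1. Qed.

Lemma ispl_C1 : is_C1R ispl spl.
Proof.
have := C1R_Z (9 / 2) (C1R_thirds posc_C1); congr is_C1R; apply/funext => t.
rewrite /spl /thirds; lra.
Qed.

Lemma thirds_le0 f t : (forall s, s <= 0 -> f s = 0) -> t <= 0 -> thirds f t = 0.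
Proof. by move=> H t0; rewrite /thirds !H; lra. Qed.

Lemma spl_out t : t <= 0 \/ 1 <= t -> spl t = 0.
Proof.
rewrite /spl => -[t0|t1]; first by rewrite thirds_le0 ?mulr0// => s s0; rewrite /posq pos_le0// expr0n.
by rewrite /thirds /posq !pos_id; [field|lra..].
Qed.

Lemma ispl_le0 t : t <= 0 -> ispl t = 0.
Proof.
move=> t0; rewrite /ispl thirds_le0 ?mulr0// => s s0; rewrite /posc /posq pos_le0// expr0n mulr0//.
Qed.

Lemma ispl_ge1 t : 1 <= t -> ispl t = 1.
Proof. by move=> t1; rewrite /ispl /thirds /posc /posq !pos_id; [field|lra..]. Qed.

Lemma spl_cases t : [\/ t <= 0 \/ 1 <= t, 0 <= t <= 1 / 3, 1 / 3 <= t <= 2 / 3 | 2 / 3 <= t <= 1].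
Proof.
have [h|h] := leP t 0; first by constructor 1; left.
have [h1|h1] := leP t (1 / 3); first by constructor 2; apply/andP; split=> //; lra.
have [h2|h2] := leP t (2 / 3); first by constructor 3; apply/andP; split=> //; lra.
have [h3|h3] := leP t 1; first by constructor 4; apply/andP; split=> //; lra.
by constructor 1; right; exact: ltW.
Qed.

Lemma spl_mid t : 1 / 3 <= t <= 2 / 3 -> 3 / 2 <= spl t.
Proof.
move=> /andP[h1 h2]; rewrite /spl /thirds /posq.
rewrite (pos_id (t := t)) ?(pos_id (t := t - 1 / 3)) ?(pos_le0 (t := t - 2 / 3)) ?(pos_le0 (t := t - 1)); [nra|lra..].
Qed.

Lemma spl_bounds t : 0 <= spl t <= 9 / 4.
Proof.
have [h|/andP[h1 h2]|/andP[h1 h2]|/andP[h1 h2]] := spl_cases t; first by rewrite spl_out//; lra.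
- rewrite /spl /thirds /posq (pos_id (t := t)) ?(pos_le0 (t := t - 1 / 3)) ?(pos_le0 (t := t - 2 / 3)) ?(pos_le0 (t := t - 1)); [|lra..].
  by apply/andP; split; nra.
- rewrite /spl /thirds /posq (pos_id (t := t)) ?(pos_id (t := t - 1 / 3)) ?(pos_le0 (t := t - 2 / 3)) ?(pos_le0 (t := t - 1)); [|lra..].
  by have := sqr_ge0 (t - 1 / 2); rewrite expr0n /= => h; apply/andP; split; nra.
- rewrite /spl /thirds /posq (pos_id (t := t)) ?(pos_id (t := t - 1 / 3)) ?(pos_id (t := t - 2 / 3)) ?(pos_le0 (t := t - 1)); [|lra..].
  by apply/andP; split; nra.
Qed.

Lemma posc_bound t : t <= 1 -> 0 <= posc t <= 1.
Proof.
move=> t1; rewrite /posc /posq; case: (leP 0 t) => t0; last by rewrite pos_le0 ?(ltW t0)// expr0n mulr0 lexx ler01.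
rewrite pos_id//; rewrite mulr_ge0 ?sqr_ge0//= -exprS exprn_ile1//.
Qed.

Lemma ispl_bound t : `|ispl t| <= 36.
Proof.
have [h|h] := leP 1 t; first by rewrite ispl_ge1// normr1; lra.
have H s : 0 <= s -> 0 <= posc (t - s) <= 1 by move=> s0; apply: posc_bound; lra.
have := H 0 (lexx _); rewrite subr0 => /andP[? ?].
have /andP[? ?] := H (1 / 3) ltac:(lra); have /andP[? ?] := H (2 / 3) ltac:(lra).
have /andP[? ?] := H 1 ltac:(lra).
by rewrite /ispl /thirds ler_norml; apply/andP; split; lra.
Qed.

End spline.

(** * Trees of bisected boxes *)

Section tree.
Context (R : realType) (n : nat).
Local Notation V := 'rV[R]_n.
Implicit Types (x y z p q a b : V) (r s t c e l : R) (S : {set 'I_n}).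

(** The shapes that occur between a cube of side [l] and one of side [l / 2] when one side is halved
    at a time: [S] is the set of sides still to be halved. *)
Definition tbox l S p q := forall i, q ord0 i - p ord0 i = if i \in S then l else l / 2.

Definition bsub p q a b := forall i, a ord0 i <= p ord0 i /\ q ord0 i <= b ord0 i.

Lemma bsub_hbox p q a b : bsub p q a b -> hbox p q `<=` hbox a b.
Proof. by move=> H; apply: hbox_sub => i; have [] := H i. Qed.

Lemma tbox_lt l S p q i : 0 < l -> tbox l S p q -> l / 2 <= q ord0 i - p ord0 i <= l.
Proof. by move=> l0 H; rewrite H; case: ifP => _; lra. Qed.

Lemma tbox_left l S p q i : tbox l S p q -> i \in S -> tbox l (S :\ i) p (upd q i (p ord0 i + l / 2)).
Proof.
move=> H iS j; rewrite !inE; have [->|ji] := eqVneq j i; first by rewrite upd_eq /=; lra.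
by rewrite upd_neq// H.
Qed.

Lemma tbox_right l S p q i : tbox l S p q -> i \in S -> tbox l (S :\ i) (upd p i (p ord0 i + l / 2)) q.
Proof.
move=> H iS j; rewrite !inE; have [->|ji] := eqVneq j i; last by rewrite upd_neq// H.
by rewrite upd_eq; have := H i; rewrite iS => ? /=; lra.
Qed.

(** The number argument of [P] counts the long sides. When none is left the same box is reread as a
    cube of side [l / 2] with [n] long sides; this is the second rule. Leaves have sides between
    [e / 2] and [e], a lower bound that [small_support_poincare] uses. *)
Lemma tree_ind (P : R -> nat -> V -> V -> Prop) e a b : 0 < e ->
  (forall l p q, e / 2 <= l -> l < e -> tbox l (finset.setTfor 'I_n) p q -> bsub p q a b -> P l n p q) ->
  (forall l p q, e <= l -> tbox l finset.set0 p q -> bsub p q a b -> P (l / 2) n p q -> P l 0%N p q) ->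
  (forall l S p q i, e <= l -> i \in S -> tbox l S p q -> bsub p q a b ->
     P l #|S|.-1 p (upd q i (p ord0 i + l / 2)) -> P l #|S|.-1 (upd p i (p ord0 i + l / 2)) q -> P l #|S| p q) ->
  forall l p q, e / 2 <= l -> tbox l (finset.setTfor 'I_n) p q -> bsub p q a b -> P l n p q.
Proof.
move=> e0 leaf shape step l p q le.
have [N lN] : exists N : nat, l < e * 2 ^+ N.
  have [N hN] := half_expr_small (divr_gt0 e0 (lt_le_trans (divr_gt0 e0 (ltr0Sn _ 1)) le)).
  exists N; move: hN; rewrite ltr_pdivlMr; last by apply: lt_le_trans le; lra.
  by rewrite exprVn mulrC ltr_pdivrMr// exprn_gt0.
elim: N l p q le lN => [|N IH] l p q le lN tb sub; first by apply: leaf => //; rewrite expr0 mulr1 in lN.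
have [lte|el] := ltP l e; first exact: leaf.
suff H k S : #|S| = k -> forall p q, tbox l S p q -> bsub p q a b -> P l k p q.
  by apply: (H n (finset.setTfor 'I_n)) => //; rewrite cardsT card_ord.
elim: k S => [|k IHk] S Sk {tb sub}p {}q tb sub.
  have S0 : S = finset.set0 by apply/eqP; rewrite -cards_eq0 Sk.
  rewrite S0 in tb; apply: shape => //; apply: IH => //; first lra.
    by move: lN; rewrite exprS; lra.
  by move=> i; rewrite tb !inE.
have [i iS] : exists i, i \in S by apply/set0Pn; rewrite -cards_eq0 Sk.
have cS : #|S :\ i| = k by have := cardsD1 i S; rewrite iS Sk add1n => -[].
have l0 : 0 < l by lra.
have c12 : p ord0 i <= p ord0 i + l / 2 /\ p ord0 i + l / 2 <= q ord0 i.
  by have := tb i; rewrite iS; lra.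
rewrite -Sk; apply: (step l S p q i) => //; rewrite Sk /=; apply: (IHk (S :\ i)) => //.
- exact: tbox_left.
- by move=> j; have [? ?] := sub j; rewrite mxE; case: eqP => // ji; subst j; lra.
- exact: tbox_right.
- by move=> j; have [? ?] := sub j; rewrite mxE; case: eqP => // ji; subst j; lra.
Qed.

End tree.

(** * Averages against spline bumps *)

Section averages.
Context (R : realType) (n : nat).
Local Notation V := 'rV[R]_n.
Implicit Types (x y z p q a b : V) (r s t c e l : R) (f gb : V -> R) (g : 'I_n -> V -> R) (S : {set 'I_n}).

Definition psi p q z := \prod_j (spl ((z ord0 j - p ord0 j) / (q ord0 j - p ord0 j)) / (q ord0 j - p ord0 j)).

(** A bump replaces the indicator of the box so that the difference of the averages over a half and
    over the whole can be integrated by parts. *)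
Definition avg p q f := ibox p q (fun z => psi p q z * f z) / ibox p q (psi p q).

(** The weak gradient on a box, tested against C^1 functions, since the test functions [hat] are
    splines and not smooth. *)
Definition wd p q f g := forall phi Dphi i, is_C1 phi Dphi -> (forall z, ~ hbox p q z -> phi z = 0) ->
  (forall z, ~ hbox p q z -> Dphi i z = 0) ->
  ibox p q (fun z => f z * Dphi i z) = - ibox p q (fun z => g i z * phi z).

Lemma wd_sub a b p q f g : wd a b f g -> hbox p q `<=` hbox a b -> wd p q f g.
Proof.
move=> H sub phi Dphi i C1 p0 Dp0.
have := H phi Dphi i C1 (fun z hz => p0 z (fun h => hz (sub z h))) (fun z hz => Dp0 z (fun h => hz (sub z h))).
rewrite (ibox_supp sub); last by move=> z /Dp0 ->; rewrite mulr0.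
by rewrite (ibox_supp sub)// => z /p0 ->; rewrite mulr0.
Qed.

Lemma wd_cst p q : (forall i, p ord0 i <= q ord0 i) -> wd p q (fun=> 1) (fun _ _ => 0).
Proof.
move=> pq phi Dphi i C1 p0 Dp0.
rewrite (@ibox_eq R n p q _ (Dphi i)) => [|z _]; last by rewrite mul1r.
rewrite (ibox_C1_partial C1 pq p0 Dp0) (@ibox_eq R n p q _ (fun=> 0)) => [|z _]; last by rewrite mul0r.
by rewrite ibox_cst// mul0r oppr0.
Qed.

Definition splj (s t u : R) := spl ((u - s) / (t - s)) / (t - s).
Definition dsplj (s t u : R) := dspl ((u - s) / (t - s)) / (t - s) ^+ 2.
Definition isplj (s t u : R) := ispl ((u - s) / (t - s)).

Lemma splj_C1 s t : is_C1R (splj s t) (dsplj s t).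
Proof.
have := C1R_Z (t - s)^-1 (C1R_affine (t - s)^-1 (- s / (t - s)) (@spl_C1 R)).
have E u : (t - s)^-1 * u + - s / (t - s) = (u - s) / (t - s) by ring.
by congr is_C1R; apply/funext => u; rewrite E /splj /dsplj ?expr2 ?invfM; ring.
Qed.

Lemma isplj_C1 s t : is_C1R (isplj s t) (splj s t).
Proof.
have := C1R_affine (t - s)^-1 (- s / (t - s)) (@ispl_C1 R).
have E u : (t - s)^-1 * u + - s / (t - s) = (u - s) / (t - s) by ring.
congr is_C1R; apply/funext => u; rewrite E//; exact: mulrC.
Qed.

Lemma arg_out s t u : s < t -> ~~ (s <= u < t) -> (u - s) / (t - s) <= 0 \/ 1 <= (u - s) / (t - s).
Proof.
move=> st; rewrite negb_and -ltNge -leNgt => /orP[h|h]; [left|right].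
  by rewrite pmulr_lle0 ?invr_gt0; lra.
by rewrite ler_pdivlMr; lra.
Qed.

Lemma splj_out s t u : s < t -> ~~ (s <= u < t) -> splj s t u = 0.
Proof. by move=> st h; rewrite /splj spl_out ?mul0r//; exact: arg_out. Qed.

Lemma splj_ge0 s t u : s < t -> 0 <= splj s t u.
Proof. by move=> st; rewrite divr_ge0//; [have /andP[] := spl_bounds ((u - s) / (t - s))|lra]. Qed.

Lemma splj_le s t u l : 0 < l -> l / 2 <= t - s -> splj s t u <= 9 / 2 / l.
Proof.
move=> l0 lt; have ts : 0 < t - s by lra.
have -> : 9 / 2 / l = 9 / 4 / (l / 2) by field; lra.
rewrite /splj; apply: ler_pM.
- by have /andP[] := spl_bounds ((u - s) / (t - s)).
- by rewrite invr_ge0 ltW.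
- by have /andP[] := spl_bounds ((u - s) / (t - s)).
- by rewrite lef_pV2// posrE; lra.
Qed.

Lemma psi_splj p q z : psi p q z = \prod_j splj (p ord0 j) (q ord0 j) (z ord0 j).
Proof. by []. Qed.

Lemma psi_cont p q : continuous (psi p q).
Proof.
by have [] := @C1_prod R n (fun j => splj (p ord0 j) (q ord0 j)) (fun j => dsplj (p ord0 j) (q ord0 j)) (fun j => splj_C1 _ _).
Qed.

Lemma psi_ge0 p q z : (forall i, p ord0 i < q ord0 i) -> 0 <= psi p q z.
Proof. by move=> pq; apply: prodr_ge0 => j _; exact: splj_ge0. Qed.

Lemma psi_out p q z : (forall i, p ord0 i < q ord0 i) -> ~ hbox p q z -> psi p q z = 0.
Proof.
by move=> pq /existsNP[j /negP hj]; rewrite psi_splj (bigD1 j)//= splj_out ?mul0r.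
Qed.

(** On the middle third of each side the normalized spline is at least 3/2, which leaves a factor
    1/2 per coordinate. *)
Lemma ibox_psi_ge p q : (forall i, p ord0 i < q ord0 i) -> 2^-1 ^+ n <= ibox p q (psi p q).
Proof.
move=> pq; pose len i := q ord0 i - p ord0 i.
have len0 i : 0 < len i by rewrite subr_gt0.
pose p' : V := \row_i (p ord0 i + len i / 3); pose q' : V := \row_i (p ord0 i + 2 * len i / 3).
have sub : hbox p' q' `<=` hbox p q.
  by apply: hbox_sub => i; rewrite !mxE; have := len0 i; rewrite /len; lra.
have lp := locint_cont (@psi_cont p q).
apply: le_trans (ibox_sub lp sub (fun z _ => psi_ge0 z pq)).
apply: (@le_trans _ _ (ibox p' q' (fun=> \prod_i (3 / 2 / len i)))).
  rewrite ibox_cst; last by move=> i; rewrite !mxE; have := len0 i; lra.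
  rewrite /vol -big_split /= -[X in _ ^+ X](card_ord n) -prodr_const.
  rewrite le_eqVlt; apply/orP; left; apply/eqP; apply: eq_bigr => i _; rewrite !mxE.
  by field; rewrite gt_eqF.
apply: ibox_le => //; first exact: locint_cst.
move=> z hz; rewrite /psi; apply: ler_prod => j _; rewrite divr_ge0 ?(ltW (len0 j))//=.
rewrite ler_pM2r ?invr_gt0//; apply: spl_mid.
have := hz j; rewrite !mxE => /andP[h1 h2].
rewrite ler_pdivlMr ?ler_pdivrMr ?len0//; apply/andP; split; move: h1 h2; rewrite /len; lra.
Qed.

Lemma avg_near p q f c e : (forall i, p ord0 i < q ord0 i) -> locint f ->
  (forall z, hbox p q z -> `|f z - c| <= e) -> `|avg p q f - c| <= e.
Proof.
move=> pq lf H; have P0 : 0 < ibox p q (psi p q).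
  by apply: lt_le_trans (ibox_psi_ge pq); rewrite exprn_gt0// invr_gt0.
have lp := locint_cont (@psi_cont p q).
have lpf : locint (fun z => psi p q z * f z) := locint_ker lf (@psi_cont p q).
rewrite /avg ler_distl.
apply/andP; split.
- rewrite ler_pdivlMr// -iboxZ//; apply: ibox_le; [exact: (locintZ _ lp)|exact: lpf|move=> z hz].
  rewrite mulrC; apply: ler_wpM2l; first exact: psi_ge0.
  by have := H _ hz; rewrite ler_distl => /andP[].
- rewrite ler_pdivrMr// -iboxZ//; apply: ibox_le; [exact: lpf|exact: (locintZ _ lp)|move=> z hz].
  rewrite [leRHS]mulrC; apply: ler_wpM2l; first exact: psi_ge0.
  by have := H _ hz; rewrite ler_distl => /andP[].
Qed.

Lemma upd_id p i : upd p i (p ord0 i) = p.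
Proof. by apply/rowP => j; rewrite mxE; case: eqP => // ->. Qed.

Section hat.
Variables (p q : V) (i : 'I_n) (s t : R).
Let u j := if j == i then fun x : R => isplj s t x - isplj (p ord0 i) (q ord0 i) x else splj (p ord0 j) (q ord0 j).
Let u' j := if j == i then fun x : R => splj s t x - splj (p ord0 i) (q ord0 i) x else dsplj (p ord0 j) (q ord0 j).
(** The antiderivative, in direction [i], of the difference between the bumps of the half box and of
    the box. It vanishes outside the box because the two bumps have the same integral along
    direction [i]. *)
Definition hat z := \prod_j u j (z ord0 j).
Definition dhat k z := u' k (z ord0 k) * \prod_(j | j != k) u j (z ord0 j).

Lemma hat_C1 : is_C1 hat dhat.
Proof.
apply: (@C1_prod R n u u') => j; rewrite /u /u'; case: eqP => _; last exact: splj_C1.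
have := C1R_D (isplj_C1 s t) (C1R_Z (-1) (isplj_C1 (p ord0 i) (q ord0 i))).
by congr is_C1R; apply/funext => x; rewrite mulN1r.
Qed.

Lemma dhatE z : dhat i z = psi (upd p i s) (upd q i t) z - psi p q z.
Proof.
rewrite /dhat /u' eqxx mulrBl !psi_splj; congr (_ - _).
  rewrite [RHS](bigD1 i)//= !upd_eq; congr (_ * _); apply: eq_bigr => j ji.
  by rewrite /u (negbTE ji) !upd_neq.
rewrite [RHS](bigD1 i)//=; congr (_ * _); apply: eq_bigr => j ji.
by rewrite /u (negbTE ji).
Qed.

Hypotheses (pq : forall j, p ord0 j < q ord0 j) (ps : p ord0 i <= s) (st : s < t) (tq : t <= q ord0 i).

Lemma hat_out z : ~ hbox p q z -> hat z = 0.
Proof.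
have [p1 [p2 p3]] : p ord0 i <= s /\ s < t /\ t <= q ord0 i by [].
move=> /existsNP[j /negP hj]; rewrite /hat (bigD1 j)//= /u; case: eqP => [ji|_]; last by rewrite splj_out ?mul0r.
move: hj; rewrite ji negb_and -ltNge -leNgt => /orP[h|h]; rewrite /isplj.
  by rewrite !ispl_le0 ?subrr ?mul0r//; have pqi := pq i; rewrite pmulr_lle0 ?invr_gt0; lra.
by rewrite !ispl_ge1 ?subrr ?mul0r//; have pqi := pq i; rewrite ler_pdivlMr; lra.
Qed.

Lemma dhat_out z : ~ hbox p q z -> dhat i z = 0.
Proof.
have [p1 [p2 p3]] : p ord0 i <= s /\ s < t /\ t <= q ord0 i by [].
move=> hz; rewrite dhatE !psi_out ?subrr//.
- move=> j; rewrite !mxE; case: eqP => // _.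
- move=> h; apply: hz => j; have := h j; rewrite !mxE; case: eqP => // -> /andP[h1 h2].
  by apply/andP; split; lra.
Qed.

(** Each of the two primitives in direction [i] is at most 36, and every other factor is at most
    [9 / 2 / l]. *)
Lemma hat_le z l : 0 < l -> (forall j, l / 2 <= q ord0 j - p ord0 j) ->
  `|hat z| <= 72 * (9 / 2) ^+ n.-1 / l ^+ n.-1.
Proof.
move=> l0 lpq; rewrite /hat (bigD1 i)//= normrM normr_prod {1}/u eqxx -mulrA.
apply: ler_pM => //; first exact: prodr_ge0.
  apply: le_trans (ler_normB _ _) _; have := ispl_bound ((z ord0 i - s) / (t - s)).
  by have := ispl_bound ((z ord0 i - p ord0 i) / (q ord0 i - p ord0 i)); rewrite /isplj; lra.
rewrite -expr_div_n.
have <- : #|[pred j : 'I_n | j != i]| = n.-1 by rewrite cardC1 card_ord.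
rewrite -prodr_const; apply: ler_prod => j ji; rewrite normr_ge0 /u (negbTE ji) /=.
by rewrite ger0_norm ?splj_le ?splj_ge0.
Qed.
End hat.

(** The difference of the two averages is the integral of [f] against a derivative of [hat], that
    is, minus the integral of the gradient against [hat]. *)
Lemma avg_half : exists2 K : R, 0 < K & forall l S p q i s t f g gb, 0 < l -> tbox l S p q -> i \in S ->
  p ord0 i <= s -> t <= q ord0 i -> t - s = l / 2 ->
  wd p q f g -> locint f -> locint (g i) -> locint gb -> (forall z, `|g i z| <= gb z) ->
  `|avg (upd p i s) (upd q i t) f - avg p q f| <= K / l ^+ n.-1 * ibox p q gb.
Proof.
exists (2 ^+ n * (72 * (9 / 2) ^+ n.-1)); first by rewrite !mulr_gt0 ?exprn_gt0//; lra.
move=> l S p q i s t f g gb l0 tb iS ps tq ts W lf lg lgb ggb.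
have st : s < t by lra.
have pq j : p ord0 j < q ord0 j by have /andP[] := tbox_lt j l0 tb; lra.
have pqW j : p ord0 j <= q ord0 j := ltW (pq j).
set p' := upd p i s; set q' := upd q i t.
have pq' j : p' ord0 j < q' ord0 j by rewrite !mxE; case: eqP.
have sub : hbox p' q' `<=` hbox p q.
  by apply: hbox_sub => j; rewrite !mxE; case: eqP => // ->.
have C1 := hat_C1 p q i s t.
have ho := @hat_out p q i s t pq ps st tq; have dho := @dhat_out p q i s t pq ps st tq.
have lpsi f' a' b' : locint f' -> locint (fun z => psi a' b' z * f' z).
  by move=> lf'; exact: locint_ker lf' (@psi_cont a' b').
have key f' : locint f' -> ibox p q (fun z => f' z * dhat p q i s t i z) =
    ibox p' q' (fun z => psi p' q' z * f' z) - ibox p q (fun z => psi p q z * f' z).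
  move=> lf'; rewrite -(@ibox_supp R n p' q' p q (fun z => psi p' q' z * f' z) sub); last first.
    by move=> z h; rewrite psi_out// mul0r.
  rewrite -iboxB; [|exact: (lpsi f' p' q' lf')|exact: (lpsi f' p q lf')].
  by apply: ibox_eq => z _; rewrite dhatE; ring.
(* The same identity with [f = 1] shows that the two bumps have equal integrals, so that the
   averages share their denominator. *)
have eP : ibox p' q' (psi p' q') = ibox p q (psi p q).
  have := wd_cst pqW C1 ho dho; rewrite key; last exact: locint_cst.
  have -> : ibox p q (fun z => 0 * hat p q i s t z) = 0.
    by rewrite (@ibox_eq R n p q _ (fun=> 0)) => [|z _]; rewrite ?ibox_cst ?mul0r.
  rewrite oppr0 => /eqP; rewrite subr_eq0 => /eqP.
  by under eq_fun do rewrite mulr1; under [in RHS]eq_fun do rewrite mulr1.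
have P2 := ibox_psi_ge pq; set P := ibox p q (psi p q) in P2 *.
have P0 : 0 < P by apply: lt_le_trans P2; rewrite exprn_gt0// invr_gt0.
rewrite /avg eP -/P -mulrBl normrM -key// (W _ _ _ C1 ho dho) normrN (ger0_norm (x := P^-1)); last by rewrite invr_ge0 ltW.
rewrite ler_pdivrMr//.
have I0 : 0 <= ibox p q gb by apply: ibox_ge0 => z _; exact: le_trans (ggb z).
set M := 72 * (9 / 2) ^+ n.-1; have M0 : 0 <= M / l ^+ n.-1.
  by rewrite /M divr_ge0// ?mulr_ge0// ?exprn_ge0//; lra.
have lgh : locint (fun z => g i z * hat p q i s t z).
  have [ch _ _] := C1; have := locint_ker lg ch; congr locint; apply/funext => z; exact: mulrC.
apply: (@le_trans _ _ (M / l ^+ n.-1 * ibox p q gb)).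
  apply: le_trans (ibox_abs _ _ lgh) _; rewrite -iboxZ//.
  apply: ibox_le; [exact: locint_abs|exact: locintZ|move=> z _].
  rewrite normrM mulrC; apply: ler_pM => //; apply: hat_le => // j.
  by have /andP[] := tbox_lt j l0 tb.
have -> : 2 ^+ n * M / l ^+ n.-1 * ibox p q gb * P = (M / l ^+ n.-1 * ibox p q gb) * (2 ^+ n * P) by ring.
apply: ler_peMr; first exact: mulr_ge0.
by rewrite -ler_pdivrMl ?exprn_gt0// mulr1 -exprVn.
Qed.

End averages.

(** * Poincare inequalities *)

Section poincare.
Context (R : realType) (n : nat) (d C0 : R).
Hypotheses (n0 : (0 < n)%N) (d0 : 0 < d) (dn : d < n%:R - 1) (C01 : 1 <= C0).
Local Notation V := 'rV[R]_n.
Local Notation mu := (lebesgue_n R n).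
Local Notation a := (n%:R - 1 - d).
Local Notation full := (finset.setTfor 'I_n).
Local Notation reg := (regular_set d C0).
Local Notation w Gam := (weight Gam d).
Implicit Types (x y z p q : V) (r s t c e l : R) (X Y Z Gam : set V) (f gb : V -> R) (g : 'I_n -> V -> R) (S : {set 'I_n}).

Let C0_gt0 : 0 < C0 := lt_le_trans ltr01 C01.

Let lw Gam (rG : reg Gam) : locint (w Gam) := locint_weight d0 dn C01 rG.

Lemma tbox_qbox l S p q : 0 < l -> tbox l S p q -> hbox p q `<=` qbox p l.
Proof.
move=> l0 tb; apply: hbox_sub => i; rewrite !mxE; have /andP[] := tbox_lt i l0 tb; lra.
Qed.

Lemma ibox_weight_tbox : exists2 K, 0 < K & forall Gam, reg Gam -> forall l S p q, 0 < l -> tbox l S p q ->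
  ibox p q (w Gam) <= K * l `^ (d + 1).
Proof.
have [K K0 H] := ibox_weight d0 dn C01; exists K => // Gam rG l S p q l0 tb.
by apply: le_trans (H _ rG p l l0); apply: ibox_sub (lw rG) (tbox_qbox l0 tb) _ => z _; exact: weight_ge0.
Qed.

Lemma weight_A1_tbox : exists2 K, 0 < K & forall Gam, reg Gam -> forall l S p q z, 0 < l -> tbox l S p q ->
  hbox p q z -> ~ Gam z -> ibox p q (w Gam) <= K * l ^+ n * w Gam z.
Proof.
have [K K0 H] := weight_A1 n0 d0 dn C01; exists K => // Gam rG l S p q z l0 tb hz Gz.
apply: le_trans (H _ rG p l z l0 (tbox_qbox l0 tb hz) Gz).
by apply: ibox_sub (lw rG) (tbox_qbox l0 tb) _ => y _; exact: weight_ge0.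
Qed.

(** By this product an unweighted integral of the gradient, as in [avg_half], multiplied by the mass
    of the box becomes a weighted one. On Gam both sides vanish. *)
Lemma A1_product : exists2 K, 0 < K & forall Gam, reg Gam -> forall l S p q gb, 0 < l -> tbox l S p q ->
  locint gb -> locint (fun z => gb z * w Gam z) -> (forall z, 0 <= gb z) -> (forall z, Gam z -> gb z = 0) ->
  ibox p q gb * ibox p q (w Gam) <= K * l ^+ n * ibox p q (fun z => gb z * w Gam z).
Proof.
have [K K0 H] := weight_A1_tbox; exists K => // Gam rG l S p q gb l0 tb lg lgw g0 gG.
rewrite mulrC -!iboxZ//; apply: ibox_le; [exact: locintZ|exact: locintZ|move=> z hz].
have [Gz|Gz] := pselect (Gam z); first by rewrite gG// !(mul0r, mulr0).
have := H _ rG _ _ _ _ _ l0 tb hz Gz; have := g0 z.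
move: (ibox p q _) (w Gam z) (gb z) => I wz gz gz0 hI.
by rewrite mulrC (_ : K * l ^+ n * (gz * wz) = gz * (K * l ^+ n * wz)) ?ler_wpM2l//; ring.
Qed.

Lemma locint_normB f c : continuous f -> continuous (fun z => `|f z - c|).
Proof.
move=> cf; apply: (cont_comp (v := fun t : R => `|t|)); last exact: norm_continuous.
by apply: contB => //; exact: cst_continuous.
Qed.

Let lfw Gam f : reg Gam -> continuous f -> locint (fun z => f z * w Gam z).
Proof. by move=> rG cf; exact: locint_ker (lw rG) cf. Qed.

Lemma ler_eps s t b : 0 <= b -> (forall e, 0 < e -> s <= t + e * b) -> s <= t.
Proof.
move=> b0 H; apply/ler_addgt0Pr => e e0.
have eb : 0 < e / (b + 1) by rewrite divr_gt0//; lra.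
apply: le_trans (H _ eb) _; rewrite lerD2l; apply: ltW; exact: div_succ_lt.
Qed.

Lemma halves_sum f p q i l S : tbox l S p q -> 0 < l -> i \in S -> locint f ->
  ibox p q f = ibox p (upd q i (p ord0 i + l / 2)) f + ibox (upd p i (p ord0 i + l / 2)) q f.
Proof. by move=> tb l0 iS lf; apply: ibox_split => //; have := tb i; rewrite iS; lra. Qed.

Lemma avg_left : exists2 K : R, 0 < K & forall l S p q i f g gb, 0 < l -> tbox l S p q -> i \in S ->
  wd p q f g -> locint f -> locint (g i) -> locint gb -> (forall z, `|g i z| <= gb z) ->
  `|avg p (upd q i (p ord0 i + l / 2)) f - avg p q f| <= K / l ^+ n.-1 * ibox p q gb /\
  `|avg (upd p i (p ord0 i + l / 2)) q f - avg p q f| <= K / l ^+ n.-1 * ibox p q gb.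
Proof.
have [K K0 H] := avg_half R n; exists K => // l S p q i f g gb l0 tb iS W lf lg lgb ggb.
have qi : q ord0 i = p ord0 i + l by have := tb i; rewrite iS; lra.
split.
  rewrite -[X in avg X _ f - _](upd_id p i); apply: (H l S p q i _ _ f g gb) => //; rewrite ?qi; lra.
rewrite -[X in avg _ X f - _](upd_id q i); apply: (H l S p q i _ _ f g gb) => //; rewrite ?qi; lra.
Qed.

(** Averages are followed down the tree of bisections. One bisection changes the average at a cost
    of [K1 * K2 * l] times the weighted gradient of the box. The factor [(n + s) * l], with [s] long
    sides, drops by exactly [l] each time, and it is unchanged when [s = 0] at side [l] is reread as
    [s = n] at side [l / 2]. On the leaves the function oscillates by at most [e]. *)
Lemma poincare : exists2 K, 0 < K & forall Gam, reg Gam -> forall l p q f g gb, 0 < l -> tbox l full p q ->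
  wd p q f g -> continuous f -> (forall i, locint (g i)) -> locint gb -> locint (fun z => gb z * w Gam z) ->
  (forall i z, `|g i z| <= gb z) -> (forall z, Gam z -> gb z = 0) ->
  ibox p q (fun z => `|f z - avg p q f| * w Gam z) <= K * l * ibox p q (fun z => gb z * w Gam z).
Proof.
have [K1 K10 H1] := avg_left; have [K2 K20 H2] := A1_product.
exists (K1 * K2 * (2 * n%:R)); first by rewrite !mulr_gt0// ltr0n.
move=> Gam rG l p q f g gb l0 tb W cf lg lgb lgw ggb gG.
have gb0 z : 0 <= gb z by apply: le_trans (ggb (Ordinal n0) z).
have w0 := weight_ge0 d Gam.
apply: (@ler_eps _ _ (ibox p q (w Gam))); first by apply: ibox_ge0.
move=> e e0; have e20 : 0 < e / 2 by fast_lra.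
have [del0 del00 Hdel] := @unif_cont R n f p q (e / 2) cf e20.
pose P (l : R) (s : nat) p q := ibox p q (fun z => `|f z - avg p q f| * w Gam z) <=
  K1 * K2 * ((n%:R + s%:R) * l) * ibox p q (fun z => gb z * w Gam z) + e * ibox p q (w Gam).
suff : P l n p q by rewrite /P (_ : (n%:R + n%:R) * l = 2 * n%:R * l) ?mulrA//; ring.
have sub0 : bsub p q p q by move=> i; split.
have lf := locint_cont cf.
have lF p' q' : locint (fun z => `|f z - avg p' q' f| * w Gam z) by apply: lfw => //; exact: locint_normB.
apply: (@tree_ind R n P (Num.min del0 l) p q) tb sub0.
- by rewrite lt_min del00.
- move=> l' p' q' hl' hl tb sub; have l'0 : 0 < l' by move: hl'; rewrite minEle; case: ifP; fast_lra.
  have pq' j : p' ord0 j < q' ord0 j by have := tb j; rewrite inE; fast_lra.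
  have hd : l' < del0 by move: hl; rewrite lt_min => /andP[].
  have near z y : hbox p' q' z -> hbox p' q' y -> `|f y - f z| <= e / 2.
    move=> hz hy; apply: ltW; apply: Hdel => [|j]; first exact/hbox_box/(bsub_hbox sub).
    have := hz j; have := hy j; have := tb j; rewrite inE => ? /andP[? ?] /andP[? ?].
    by rewrite ltr_norml; apply/andP; split; fast_lra.
  rewrite /P; apply: (@le_trans _ _ (e * ibox p' q' (w Gam))); last first.
    rewrite lerDr; apply: mulr_ge0; last by apply: ibox_ge0 => z _; exact: mulr_ge0.
    by apply: mulr_ge0; apply: mulr_ge0; rewrite ?addr_ge0 ?ler0n// ltW.
  rewrite -iboxZ; last exact: lw.
  apply: ibox_le; [exact: lF|exact/locintZ/lw|move=> z hz].
  apply: ler_wpM2r => //.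
  have : `|avg p' q' f - f z| <= e / 2 by apply: avg_near => // y hy; exact: near.
  by rewrite distrC; fast_lra.
- move=> l' p' q' _ tb sub; rewrite /P.
  by rewrite (_ : (n%:R + n%:R) * (l' / 2) = (n%:R + 0%:R) * l') //; field.
- move=> l' S p' q' i hl' iS tb sub; have l'0 : 0 < l' by move: hl'; rewrite minEle; case: ifP; fast_lra.
  rewrite /P; set c := p' ord0 i + l' / 2.
  have hsub := bsub_hbox sub.
  have [h1 h2] := H1 l' S p' q' i f g gb l'0 tb iS (wd_sub W hsub) lf (lg i) lgb (ggb i).
  have h3 := H2 _ rG l' S p' q' gb l'0 tb lgb lgw gb0 gG.
  set D := K1 / l' ^+ n.-1 * ibox p' q' gb in h1 h2.
  have step p1 q1 : `|avg p1 q1 f - avg p' q' f| <= D ->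
     ibox p1 q1 (fun z => `|f z - avg p' q' f| * w Gam z) <=
     ibox p1 q1 (fun z => `|f z - avg p1 q1 f| * w Gam z) + D * ibox p1 q1 (w Gam).
    move=> hD; rewrite -iboxZ; last exact: lw.
    rewrite -iboxD; [|exact: lF|exact/locintZ/lw].
    apply: ibox_le; [exact: lF|apply: locintD; [exact: lF|exact/locintZ/lw]|move=> z _].
    rewrite -mulrDl; apply: ler_wpM2r => //.
    have -> : f z - avg p' q' f = (f z - avg p1 q1 f) + (avg p1 q1 f - avg p' q' f) by ring.
    by apply: le_trans (ler_normD _ _) _; rewrite lerD2l.
  have s1 := step _ _ h1; have s2 := step _ _ h2; move=> i1 i2.
  rewrite (halves_sum tb l'0 iS (lF p' q')) (halves_sum tb l'0 iS lgw) (halves_sum tb l'0 iS (lw rG)) -/c.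
  have hDw : D * ibox p' q' (w Gam) <= K1 * K2 * l' * ibox p' q' (fun z => gb z * w Gam z).
    have -> : D * ibox p' q' (w Gam) = K1 / l' ^+ n.-1 * (ibox p' q' gb * ibox p' q' (w Gam)) by rewrite /D; ring.
    apply: le_trans (ler_wpM2l _ h3) _; first by rewrite divr_ge0 ?exprn_ge0 ?(ltW K10) ?(ltW l'0).
    rewrite le_eqVlt; apply/orP; left; apply/eqP.
    rewrite -{2}(prednK n0) exprS; field; rewrite expf_neq0// gt_eqF//.
  rewrite (halves_sum tb l'0 iS lgw) (halves_sum tb l'0 iS (lw rG)) -/c in hDw.
  have cS : (#|S|)%:R = (#|S|.-1)%:R + 1 :> R.
    by rewrite natr1 prednK//; apply/card_gt0P; exists i.
  rewrite cS; move: i1 i2 s1 s2 hDw; rewrite -/c /P.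
  set A1 := ibox p' _ (fun z => gb z * _); set A2 := ibox _ q' (fun z => gb z * _).
  set W1 := ibox p' _ (w Gam); set W2 := ibox _ q' (w Gam).
  set X1 := ibox p' _ (fun z => `|f z - avg p' (upd q' i c) f| * _).
  set X2 := ibox _ q' (fun z => `|f z - avg (upd p' i c) q' f| * _).
  set Y1 := ibox p' _ (fun z => `|f z - avg p' q' f| * _).
  set Y2 := ibox _ q' (fun z => `|f z - avg p' q' f| * _).
  move=> i1 i2 s1 s2 hDw; set m := (#|S|.-1)%:R in i1 i2 *.
  have -> : K1 * K2 * ((n%:R + (m + 1)) * l') * (A1 + A2) + e * (W1 + W2) =
    (K1 * K2 * ((n%:R + m) * l') * A1 + e * W1) + (K1 * K2 * ((n%:R + m) * l') * A2 + e * W2)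
     + K1 * K2 * l' * (A1 + A2) by ring.
  rewrite mulrDr in hDw; fast_lra.
- have : Num.min del0 l <= l by rewrite ge_min lexx orbT.
  fast_lra.
Qed.

Definition sgb Gam p q : R := fine (hausdorff_outer d (Gam `&` hbox p q)).

Lemma sgb_bound Gam l S p q : reg Gam -> 0 < l -> tbox l S p q ->
  (hausdorff_outer d (Gam `&` hbox p q) <= (C0 * ((2 * n%:R + 1) * l) `^ d)%:E)%E.
Proof.
move=> [G0 cG AR] l0 tb; have nl : 0 <= n%:R * l by rewrite mulr_ge0// ltW.
have [E|/set0P[y [Gy Qy]]] := eqVneq (Gam `&` hbox p q) set0.
  by rewrite E outer_measure0 lee_fin mulr_ge0 ?powR_ge0// ltW.
have r0 : 0 < (2 * n%:R + 1) * l by nra.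
have [_ h] := AR y _ Gy r0; apply: le_trans h; apply: le_outer_measure => z [Gz Qz]; split => //.
have hz := qbox_enorm (tbox_qbox l0 tb Qz); have hy := qbox_enorm (tbox_qbox l0 tb Qy).
by rewrite /eball /=; have := enorm_tri z p y; rewrite (enormB p y); lra.
Qed.

Lemma sgb_le Gam l S p q : reg Gam -> 0 < l -> tbox l S p q -> sgb Gam p q <= C0 * (2 * n%:R + 1) `^ d * l `^ d.
Proof.
move=> rG l0 tb; have h := sgb_bound rG l0 tb; have := ler0n R n => hn.
rewrite -mulrA -powRM ?(ltW l0) ?addr_ge0 ?mulr_ge0//.
rewrite -lee_fin /sgb fineK// ge0_fin_numE; last exact: outer_measure_ge0.
exact: le_lt_trans h (ltry _).
Qed.

Lemma sgb_ge0 Gam p q : 0 <= sgb Gam p q.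
Proof. by apply: fine_ge0; exact: outer_measure_ge0. Qed.

Lemma sgb0 Gam p q : Gam `&` hbox p q = set0 -> sgb Gam p q = 0.
Proof. by rewrite /sgb => ->; rewrite outer_measure0. Qed.

Lemma sgb_halves Gam l S p q i : reg Gam -> 0 < l -> tbox l S p q -> i \in S ->
  sgb Gam p q = sgb Gam p (upd q i (p ord0 i + l / 2)) + sgb Gam (upd p i (p ord0 i + l / 2)) q.
Proof.
move=> rG l0 tb iS; set c := p ord0 i + _; have [G0 cG _] := rG.
have hi : q ord0 i - p ord0 i = l by rewrite tb iS.
have E : Gam `&` hbox p q = (Gam `&` hbox p (upd q i c)) `|` (Gam `&` hbox (upd p i c) q).
  rewrite -setIUr; congr (_ `&` _); apply/seteqP; split => z.
    move=> hz; have /andP[h1 h2] := hz i; have [zc|zc] := ltP (z ord0 i) c; [left|right] => j; rewrite mxE.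
      by case: eqP => [->|_]; [rewrite h1 zc|exact: hz].
    by case: eqP => [->|_]; [rewrite h2 zc|exact: hz].
  move=> [|] hz j; have := hz j; have := hz i; rewrite !mxE !eqxx /c => /andP[h1 h2]; case: eqP => // ->.
    by move=> _; apply/andP; split; lra.
  by move=> _; apply/andP; split; lra.
have mG p' q' : measurable (Gam `&` hbox p' q' : set (@hausT R n d)).
  apply: measurableI; last exact: measurable_hbox_haus.
  rewrite -(setCK Gam); apply: measurableC; apply: measurable_open_haus; exact: closed_openC.
have dis : (Gam `&` hbox p (upd q i c)) `&` (Gam `&` hbox (upd p i c) q) = set0.
  rewrite -subset0 => z [[_ /(_ i) /andP[_ +]] [_ /(_ i) /andP[+ _]]]; rewrite !upd_eq; lra.
have fin p' q' : hbox p' q' `<=` hbox p q -> (hausdorff_outer d (Gam `&` hbox p' q') \is a fin_num).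
  move=> sub; rewrite ge0_fin_numE; last exact: outer_measure_ge0.
  apply: le_lt_trans (ltry (C0 * ((2 * n%:R + 1) * l) `^ d)).
  apply: le_trans (sgb_bound rG l0 tb); apply: le_outer_measure; exact: setIS.
rewrite /sgb E; have := @measureU _ _ _ (hausdorff n d) _ _ (mG p (upd q i c)) (mG (upd p i c) q) dis.
move=> /= h; rewrite [X in fine X]h fineD//; apply: fin.
  by apply: hbox_sub => j; rewrite ?mxE//; case: eqP => // ->; rewrite /c; lra.
by apply: hbox_sub => j; rewrite ?mxE//; case: eqP => // ->; rewrite /c; lra.
Qed.

Lemma a_pos : 0 < a. Proof. exact: a_gt0. Qed.

Lemma powR2_gt1 : 1 < 2 `^ a.
Proof.
have := @gt0_ltr_powR R a a_pos 1 2; rewrite !nnegrE powR1 => -> //; lra.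
Qed.

(** A box that meets Gam lies within [n * l] of it, and the weight decreases with the distance. *)
Lemma weight_near Gam l S p q y z : reg Gam -> 0 < l -> tbox l S p q -> Gam y -> hbox p q y -> hbox p q z -> ~ Gam z ->
  n%:R `^ (- a) * l `^ (- a) <= w Gam z.
Proof.
move=> rG l0 tb Gy hy hz Gz; rewrite -powRM ?(ltW l0)//.
apply: (weight_ge dn rG Gz); apply: le_trans (del_le z Gy) _; apply: enorm_le_sum => j.
rewrite !mxE; have := hz j; have := hy j; have := tbox_lt j l0 tb => /andP[_ ?] /andP[? ?] /andP[? ?].
by rewrite ler_norml; apply/andP; split; lra.
Qed.

(** The arithmetic of one bisection in [trace_average]: surface measures [s1] and [s2], absolute
    averages [t1] and [t2] on the halves, energies [j1] and [j2], and change of average [D]. *)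
Lemma split_estimate s1 s2 t t1 t2 D j1 j2 k e : 0 <= s1 -> 0 <= s2 -> t <= t1 + D -> t <= t2 + D ->
  s1 * t1 <= j1 + e * s1 -> s2 * t2 <= j2 + e * s2 -> (s1 + s2) * D <= k ->
  (s1 + s2) * t <= j1 + j2 + k + e * (s1 + s2).
Proof.
move=> s10 s20 h1 h2; have := ler_wpM2l s10 h1; have := ler_wpM2l s20 h2.
rewrite !mulrDr !mulrDl; lra.
Qed.

(* The factor [l^-a (n / (2^a - 1) + (n - s))], where [s] sides of the box are equal to [l] and the others
   to [l / 2], increases by [l^-a] at every bisection: this pays for the change of the average. *)
Lemma trace_average : exists2 K, 0 < K & forall Gam, reg Gam -> forall l p q f g gb, 0 < l -> tbox l full p q ->
  wd p q f g -> continuous f -> (forall i, locint (g i)) -> locint gb -> locint (fun z => gb z * w Gam z) ->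
  (forall i z, `|g i z| <= gb z) -> (forall z, Gam z -> gb z = 0) -> (forall z, Gam z -> hbox p q z -> f z = 0) ->
  sgb Gam p q * `|avg p q f| <= K * ibox p q (fun z => gb z * w Gam z).
Proof.
have [K1 K10 H1] := avg_left; have a0 := a_pos; have two := powR2_gt1.
pose K' := K1 * (C0 * (2 * n%:R + 1) `^ d).
(* The term [n / (2^a - 1)] makes [2^a * h n = h 0], so that [l^(-a) * h s] is unchanged when a
   fully halved box is reread as a cube of side [l / 2]. *)
pose h (s : nat) : R := n%:R / (2 `^ a - 1) + (n%:R - s%:R).
have K'0 : 0 < K' by rewrite !mulr_gt0 ?powR_gt0 ?ltr_wpDl ?mulr_ge0.
have n0R : 0 < n%:R :> R by rewrite ltr0n.
have nn0 : 0 < n%:R `^ (- a) :> R by rewrite powR_gt0.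
have hM (s : nat) : h s <= h 0%N by rewrite /h lerD2l subr0 gerBl.
have h0 : 0 <= h 0%N by rewrite /h addr_ge0 ?divr_ge0 ?subr0//; fast_lra.
pose K := K' * h 0%N / n%:R `^ (- a) + 1.
have K0 : 0 < K by rewrite ltr_pwDr// divr_ge0 ?mulr_ge0//; exact: ltW.
exists K => // Gam rG l p q f g gb l0 tb W cf lg lgb lgw ggb gG f0.
have gb0 z : 0 <= gb z by apply: le_trans (ggb (Ordinal n0) z).
have w0 := weight_ge0 d Gam; have lf := locint_cont cf.
have [E|/set0P ne] := eqVneq (Gam `&` hbox p q) set0.
  rewrite (sgb0 E) mul0r mulr_ge0 ?(ltW K0)//.
  by apply: ibox_ge0 => z _; exact: mulr_ge0.
(* The energy density that has not been spent yet. On boxes that meet Gam it is nonnegative, by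
   [weight_near] and the choice of [K]. *)
pose J (l : R) (s : nat) z := K * (gb z * w Gam z) - K' * (l `^ (- a) * h s) * gb z.
have lJ l' (s : nat) : locint (J l' s).
  by apply: locintB; apply: locintZ.
have Jge l' S p' q' y (s : nat) : 0 < l' -> tbox l' S p' q' -> Gam y -> hbox p' q' y ->
   forall z, hbox p' q' z -> 0 <= J l' s z.
  move=> l'0 tb' Gy hy z hz; rewrite /J.
  have [Gz|Gz] := pselect (Gam z); first by rewrite gG// !(mulr0, mul0r) subrr.
  have wz := weight_near rG l'0 tb' Gy hy hz Gz.
  rewrite subr_ge0 (mulrC (K' * _)) (mulrCA K); apply: ler_wpM2l => //.
  have l'a : 0 < l' `^ (- a) by rewrite powR_gt0.
  apply: (@le_trans _ _ (K * (n%:R `^ (- a) * l' `^ (- a)))); last by apply: ler_wpM2l wz; exact: ltW.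
  have -> : K * (n%:R `^ (- a) * l' `^ (- a)) = (K' * h 0%N + n%:R `^ (- a)) * l' `^ (- a).
    by rewrite /K; field; rewrite gt_eqF.
  rewrite mulrCA [leRHS]mulrC; apply: ler_wpM2l; first exact: ltW.
  by rewrite -[leLHS]addr0; apply: lerD; [apply: ler_wpM2l => //|]; exact: ltW.
apply: (@le_trans _ _ (ibox p q (J l n))); last first.
  rewrite -iboxZ//; apply: ibox_le; [exact: lJ|exact: locintZ|move=> z _].
  have hn : 0 <= h n by rewrite /h subrr addr0 divr_ge0//; fast_lra.
  by rewrite /J gerBl; apply: mulr_ge0 => //; apply: mulr_ge0; [exact: ltW|apply: mulr_ge0 => //; exact: powR_ge0].
apply: (@ler_eps _ _ (sgb Gam p q)); first exact: sgb_ge0.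
move=> e e0; have [del0 del00 Hdel] := @unif_cont R n f p q e cf e0.
(* The claim concerns only boxes that meet Gam. A half that misses Gam has no surface measure, and
   there [J] is nonnegative because the parent meets Gam. *)
pose P (l : R) (s : nat) p q := Gam `&` hbox p q !=set0 ->
  sgb Gam p q * `|avg p q f| <= ibox p q (J l s) + e * sgb Gam p q.
suff : P l n p q by apply.
have sub0 : bsub p q p q by move=> i; split.
apply: (@tree_ind R n P (Num.min del0 l) p q) tb sub0.
- by rewrite lt_min del00.
- move=> l' p' q' hl' hl tb' sub [y [Gy hy]]; have l'0 : 0 < l' by move: hl'; rewrite minEle; case: ifP; fast_lra.
  have pq' j : p' ord0 j < q' ord0 j by have := tb' j; rewrite inE; fast_lra.
  have hd : l' < del0 by move: hl; rewrite lt_min => /andP[].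
  have fy : f y = 0 by apply: f0 => //; exact: (bsub_hbox sub).
  have : `|avg p' q' f - 0| <= e.
    apply: avg_near => // z hz; rewrite -fy; apply: ltW; apply: Hdel => [|j]; first exact/hbox_box/(bsub_hbox sub).
    have := hz j; have := hy j; have := tb' j; rewrite inE => ? /andP[? ?] /andP[? ?].
    by rewrite ltr_norml; apply/andP; split; fast_lra.
  rewrite subr0 => h1; apply: (@le_trans _ _ (e * sgb Gam p' q')).
    by rewrite mulrC; apply: ler_wpM2r h1; exact: sgb_ge0.
  rewrite lerDr; apply: ibox_ge0; exact: Jge tb' Gy hy.
- move=> l' p' q' hl' tb' sub; rewrite /P.
  have l'0 : 0 < l' by move: hl'; rewrite minEle; case: ifP; fast_lra.
  rewrite (_ : J (l' / 2) n = J l' 0%N) //.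
  apply/funext => z; rewrite /J; congr (_ - _ * _ * _).
  rewrite powRM ?invr_ge0 ?(ltW l'0)// -(powR_inv1 (a := 2))// -powRrM mulrN mulN1r opprK /h subrr subr0 addr0.
  by field; rewrite gt_eqF// subr_gt0.
- move=> l' S p' q' i hl' iS tb' sub; have l'0 : 0 < l' by move: hl'; rewrite minEle; case: ifP; fast_lra.
  rewrite /P; set c := p' ord0 i + l' / 2; move=> i1 i2 [y [Gy hy]].
  have hsub := bsub_hbox sub.
  have [h1 h2] := H1 l' S p' q' i f g gb l'0 tb' iS (wd_sub W hsub) lf (lg i) lgb (ggb i).
  set D := K1 / l' ^+ n.-1 * ibox p' q' gb in h1 h2; rewrite -/c in h1 h2.
  have sg0 := sgb_ge0 Gam; have Jg := Jge l' S p' q' y #|S|.-1 l'0 tb' Gy hy.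
  have sub1 : hbox p' (upd q' i c) `<=` hbox p' q'.
    by apply: hbox_sub => j; rewrite ?mxE//; case: eqP => // ->; have := tb' i; rewrite iS /c; fast_lra.
  have sub2 : hbox (upd p' i c) q' `<=` hbox p' q'.
    by apply: hbox_sub => j; rewrite ?mxE//; case: eqP => // ->; rewrite /c; fast_lra.
  have I1 : sgb Gam p' (upd q' i c) * `|avg p' (upd q' i c) f| <=
     ibox p' (upd q' i c) (J l' #|S|.-1) + e * sgb Gam p' (upd q' i c).
    have [E|/set0P ne1] := eqVneq (Gam `&` hbox p' (upd q' i c)) set0; last exact: i1.
    by rewrite (sgb0 E) mul0r mulr0 addr0; apply: ibox_ge0 => z /sub1; exact: Jg.
  have I2 : sgb Gam (upd p' i c) q' * `|avg (upd p' i c) q' f| <=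
     ibox (upd p' i c) q' (J l' #|S|.-1) + e * sgb Gam (upd p' i c) q'.
    have [E|/set0P ne1] := eqVneq (Gam `&` hbox (upd p' i c) q') set0; last exact: i2.
    by rewrite (sgb0 E) mul0r mulr0 addr0; apply: ibox_ge0 => z /sub2; exact: Jg.
  have sgS := sgb_halves rG l'0 tb' iS; have sgl := sgb_le rG l'0 tb'.
  have SD : sgb Gam p' q' * D <= K' * l' `^ (- a) * ibox p' q' gb.
    have D0 : 0 <= D by rewrite mulr_ge0 ?divr_ge0 ?exprn_ge0 ?(ltW l'0) ?(ltW K10)//; exact: ibox_ge0.
    apply: le_trans (ler_wpM2r D0 sgl) _; rewrite /D /K' le_eqVlt; apply/orP; left; apply/eqP.
    have -> : l' `^ (- a) = l' `^ d / l' ^+ n.-1.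
      rewrite -(powR_mulrn _ (ltW l'0)) -powRB; last by apply/implyP => _; rewrite gt_eqF.
      congr (_ `^ _); rewrite -subn1 natrB//; ring.
    ring.
  have JE : ibox p' q' (J l' #|S|) = ibox p' q' (J l' #|S|.-1) + K' * l' `^ (- a) * ibox p' q' gb.
    rewrite -iboxZ// -iboxD; [|exact: lJ|exact: locintZ].
    apply: ibox_eq => z _; rewrite /J /h.
    have -> : (#|S|)%:R = (#|S|.-1)%:R + 1 :> R by rewrite natr1 prednK//; apply/card_gt0P; exists i.
    ring.
  rewrite JE (halves_sum tb' l'0 iS (lJ _ _)) -/c.
  have A1 : `|avg p' q' f| <= `|avg p' (upd q' i c) f| + D.
    by have := lerB_dist (avg p' q' f) (avg p' (upd q' i c) f); move: h1; rewrite distrC; fast_lra.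
  have A2 : `|avg p' q' f| <= `|avg (upd p' i c) q' f| + D.
    by have := lerB_dist (avg p' q' f) (avg (upd p' i c) q' f); move: h2; rewrite distrC; fast_lra.
  rewrite -/c in sgS; rewrite sgS in SD *.
  exact: (split_estimate (sg0 _ _) (sg0 _ _) A1 A2 I1 I2 SD).
- have : Num.min del0 l <= l by rewrite ge_min lexx orbT.
  fast_lra.
Qed.

(** One scalar [gb] dominates all partial derivatives; it is 0 on Gam, where the weight is 0 too. *)
Definition grad_bound Gam p q f gb := [/\ continuous f, locint gb, locint (fun z => gb z * w Gam z),
  (forall z, Gam z -> gb z = 0) &
  exists g, [/\ wd p q f g, (forall i, locint (g i)) & forall i z, `|g i z| <= gb z]].

Lemma grad_bound_ge0 Gam p q f gb z : grad_bound Gam p q f gb -> 0 <= gb z.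
Proof. by move=> [_ _ _ _ [g [_ _ H]]]; apply: le_trans (H (Ordinal n0) z). Qed.

Lemma grad_bound_sub Gam p q p' q' f gb : grad_bound Gam p q f gb -> hbox p' q' `<=` hbox p q ->
  grad_bound Gam p' q' f gb.
Proof.
by move=> [h1 h2 h3 h4 [g [h5 h6 h7]]] sub; split=> //; exists g; split => //; exact: wd_sub sub.
Qed.

Lemma qbox_tbox x r : tbox (2 * r) full (lower x r) (upper x r).
Proof. by move=> i; rewrite !mxE inE; ring. Qed.

Lemma trace_poincare : exists2 K, 0 < K & forall Gam, reg Gam -> forall x r f gb, Gam x -> 0 < r ->
  grad_bound Gam (lower x r) (upper x r) f gb -> (forall z, Gam z -> qbox x r z -> f z = 0) ->
  ibox (lower x r) (upper x r) (fun z => `|f z| * w Gam z) <=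
  K * r * ibox (lower x r) (upper x r) (fun z => gb z * w Gam z).
Proof.
have [K1 K10 H1] := poincare; have [K2 K20 H2] := trace_average; have [K3 K30 H3] := ibox_weight_tbox.
exists (2 * K1 + C0 * K2 * K3 * 2 `^ (d + 1)).
  by rewrite addr_gt0 ?mulr_gt0 ?powR_gt0.
move=> Gam rG x r f gb Gx r0 gB f0; have [cf lgb lgw gG [g [W lg ggb]]] := gB.
have l0 : 0 < 2 * r by lra.
have tb := qbox_tbox x r; have w0 := weight_ge0 d Gam.
have h1 := H1 _ rG _ _ _ _ _ _ l0 tb W cf lg lgb lgw ggb gG.
have h2 := H2 _ rG _ _ _ _ _ _ l0 tb W cf lg lgb lgw ggb gG f0.
have h3 := H3 _ rG _ _ _ _ l0 tb.
set I := ibox _ _ (fun z => gb z * _) in h1 h2 *; set A := avg _ _ _ in h1 h2.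
have I0 : 0 <= I by apply: ibox_ge0 => z _; rewrite mulr_ge0// (grad_bound_ge0 z gB).
have rd : 0 < r `^ d by rewrite powR_gt0.
have sg : C0^-1 * r `^ d <= sgb Gam (lower x r) (upper x r).
  have [G0 cG AR] := rG; have [h _] := AR x r Gx r0.
  rewrite -lee_fin /sgb fineK; last first.
    rewrite ge0_fin_numE; last exact: outer_measure_ge0.
    exact: le_lt_trans (sgb_bound rG l0 tb) (ltry _).
  apply: le_trans h _; apply: le_outer_measure; apply: setIS; exact: eball_qbox.
have A0 : r `^ d * `|A| <= C0 * K2 * I.
  have : C0^-1 * r `^ d * `|A| <= K2 * I by apply: le_trans h2; apply: ler_wpM2r.
  by rewrite -!mulrA -(ler_pM2l C0_gt0) (mulrA C0 C0^-1) mulfV ?gt_eqF// mul1r.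
apply: (@le_trans _ _ (ibox (lower x r) (upper x r) (fun z => `|f z - A| * w Gam z + `|A| * w Gam z))).
  apply: ibox_le.
  - apply: lfw => //; apply: (cont_comp (v := fun t : R => `|t|) cf); exact: norm_continuous.
  - by apply: locintD; [apply: lfw => //; exact: locint_normB|exact/locintZ/lw].
  - move=> z _; rewrite -mulrDl; apply: ler_wpM2r => //.
    by have := ler_normD (f z - A) A; rewrite subrK.
rewrite iboxD; [|by apply: lfw => //; exact: locint_normB|exact/locintZ/lw].
rewrite iboxZ; last exact: lw.
have h4 : `|A| * ibox (lower x r) (upper x r) (w Gam) <= `|A| * (K3 * (2 `^ (d + 1) * (r `^ d * r))).
  apply: ler_wpM2l => //; apply: le_trans h3 _; rewrite powRM ?(ltW r0)// powRD; last by apply/implyP => _; rewrite gt_eqF.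
  rewrite (powRD (x := r)); last by apply/implyP => _; rewrite gt_eqF.
  by rewrite !powRr1// ltW.
have h5 : `|A| * (K3 * (2 `^ (d + 1) * (r `^ d * r))) <= C0 * K2 * I * (K3 * 2 `^ (d + 1) * r).
  rewrite (_ : `|A| * _ = r `^ d * `|A| * (K3 * 2 `^ (d + 1) * r)); last by ring.
  by apply: ler_wpM2r A0; rewrite !mulr_ge0 ?powR_ge0// ltW.
rewrite (_ : _ * r * I = K1 * (2 * r) * I + C0 * K2 * I * (K3 * 2 `^ (d + 1) * r)); last by ring.
lra.
Qed.

Lemma ibox_indic_null Gam p q : reg Gam -> ibox p q (\1_Gam : V -> R) = 0.
Proof.
move=> rG; have [G0 cG _] := rG; have [r [r0 sub]] := hbox_in_qbox p q 0.
have mG : measurable (Gam : set (lebT R n)).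
  by rewrite -(setCK Gam); apply: measurableC; apply: measurable_open; exact: closed_openC.
rewrite /ibox /Rintegral integral_indic//; last exact: measurable_hbox.
suff -> : mu (Gam `&` hbox p q) = 0%E by [].
apply/eqP; rewrite eq_le measure_ge0 andbT -(leb_null d0 dn C01 rG 0 r0).
by apply: le_outer_measure => z [Gz /sub].
Qed.

Lemma locint_indic (D : set V) : measurable (D : set (lebT R n)) -> locint (\1_D : V -> R).
Proof.
move=> mD; apply: locint_bd; first exact: measurable_indic.
by move=> p q; exists 1 => z _; rewrite indicE ger0_norm ?ler0n// lern1 leq_b1.
Qed.

(** The A1 inequality integrated over the smaller box. It holds pointwise only off Gam, which is a
    null set, hence the factor [1 - \1_Gam] in the integrand. *)
Lemma mass_ratio : exists2 K, 0 < K & forall Gam, reg Gam -> forall l S p q p' q', 0 < l -> tbox l S p q ->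
  (forall i, p' ord0 i <= q' ord0 i) -> hbox p' q' `<=` hbox p q ->
  vol p' q' * ibox p q (w Gam) <= K * l ^+ n * ibox p' q' (w Gam).
Proof.
have [K K0 H] := weight_A1_tbox; exists K => // Gam rG l S p q p' q' l0 tb pq' sub.
have [G0 cG _] := rG; have lG : locint (\1_Gam : V -> R).
  by apply: locint_indic; rewrite -(setCK Gam); apply: measurableC; apply: measurable_open; exact: closed_openC.
set m := ibox p q _.
have -> : vol p' q' * m = ibox p' q' (fun z => m * (1 - \1_Gam z)).
  rewrite iboxZ; last by apply: locintB => //; exact: locint_cst.
  rewrite iboxB//; last exact: locint_cst.
  by rewrite ibox_cst// (ibox_indic_null _ _ rG) subr0 mul1r mulrC.
rewrite -iboxZ; last exact: lw.
apply: ibox_le; [apply: locintZ; apply: locintB => //; exact: locint_cst|exact/locintZ/lw|move=> z hz].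
rewrite indicE; have [Gz|Gz] := pselect (Gam z); first by rewrite mem_set// subrr mulr0 (weight0 dn Gz) mulr0.
rewrite memNset// subr0 mulr1; exact: (H _ rG _ _ _ _ _ l0 tb (sub z hz) Gz).
Qed.

Definition above f (k : R) : V -> R := \1_[set y : V | k < f y].

Lemma aboveT f k z : k < f z -> above f k z = 1. Proof. by move=> h; rewrite /above indicE mem_set. Qed.
Lemma aboveF f k z : f z <= k -> above f k z = 0.
Proof. by move=> h; rewrite /above indicE memNset//= ltNge h. Qed.
Lemma above_ge0 f k z : 0 <= above f k z. Proof. by rewrite /above indicE. Qed.
Lemma above_le1 f k z : above f k z <= 1. Proof. by rewrite /above indicE lern1 leq_b1. Qed.

Lemma measurable_above f k : continuous f -> measurable_fun [set: lebT R n] (above f k : lebT R n -> R).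
Proof.
move=> cf; apply: measurable_indic; apply: measurable_open.
have := @open_comp _ _ f [set t : R | k < t] (fun z _ => cf z) (@open_gt _ k); exact.
Qed.

Lemma locint_above Gam f k : reg Gam -> continuous f -> locint (fun z => above f k z * w Gam z).
Proof.
move=> rG cf; apply: locint_dom (lw rG) _.
  by apply: measurable_funM; [exact: measurable_above|case: (lw rG)].
move=> z; rewrite ger0_norm ?mulr_ge0 ?above_ge0 ?weight_ge0//.
by rewrite ler_piMl ?weight_ge0 ?above_le1.
Qed.

(** This takes the place of Sobolev's inequality. The box is subdivided down to side about
    [2^(-N) * l]; if the support of [f] is small enough, [f] vanishes on at least half the mass of
    every small box, and Poincare there has the constant of the small scale. *)
Lemma small_support_poincare : exists2 Kc : R * R, 0 < Kc.1 /\ 0 < Kc.2 &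
  forall Gam, reg Gam -> forall l p q f gb (N : nat), 0 < l -> tbox l full p q ->
  grad_bound Gam p q f gb -> (forall z, 0 <= f z) ->
  ibox p q (fun z => above f 0 z * w Gam z) <= Kc.2 * (2^-1 ^+ n) ^+ N * ibox p q (w Gam) ->
  ibox p q (fun z => f z * w Gam z) <= Kc.1 * 2^-1 ^+ N * l * ibox p q (fun z => gb z * w Gam z).
Proof.
have [K1 K10 H1] := poincare; have [K2 K20 H2] := mass_ratio.
exists (3 * K1, (2 ^+ n * 2 * K2)^-1); first by rewrite /= invr_gt0 !mulr_gt0 ?exprn_gt0.
move=> Gam rG l p q f gb N l0 tb gB f0 /= small.
have w0 := weight_ge0 d Gam; have gb0 z := grad_bound_ge0 z gB.
have [cf lgb lgw gG _] := gB.
set e := 2^-1 ^+ N * l; have e0 : 0 < e by rewrite mulr_gt0// exprn_gt0// invr_gt0.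
have lfW : locint (fun z => f z * w Gam z) := lfw rG cf.
pose P (l : R) (s : nat) p q := ibox p q (fun z => f z * w Gam z) <= 3 * K1 * e * ibox p q (fun z => gb z * w Gam z).
suff : P l n p q by rewrite /P /e !mulrA.
have sub0 : bsub p q p q by move=> i; split.
have tb0 := tb.
apply: (@tree_ind R n P e p q) tb sub0 => //.
- move=> l' p' q' l'e l'e2 tb' sub; have l'0 : 0 < l' by fast_lra.
  have pq' j : p' ord0 j < q' ord0 j by have := tb' j; rewrite inE; fast_lra.
  have hsub := bsub_hbox sub; have gB' := grad_bound_sub gB hsub; have [_ _ _ _ [g [W lg ggb]]] := gB'.
  have h1 := H1 _ rG _ _ _ _ _ _ l'0 tb' W cf lg lgb lgw ggb gG.
  have h2 := H2 _ rG _ _ _ _ _ _ l0 tb0 (fun i => ltW (pq' i)) hsub.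
  set A := avg p' q' f in h1; set I := ibox p' q' (fun z => gb z * _) in h1.
  have I0 : 0 <= I by apply: ibox_ge0 => z _; exact: mulr_ge0.
  set m' := ibox p' q' (w Gam) in h2; set m := ibox p q (w Gam) in h2 small.
  have m0 : 0 <= m by apply: ibox_ge0.
  have m'0 : 0 <= m' by apply: ibox_ge0.
  (* By [mass_ratio] a leaf has at least twice the mass of the whole support of [f]; its sides are
     at least [e / 2]. *)
  have small' : ibox p' q' (fun z => above f 0 z * w Gam z) <= m' / 2.
    apply: (@le_trans _ _ (ibox p q (fun z => above f 0 z * w Gam z))).
      by apply: ibox_sub hsub _ => [|z _]; [exact: locint_above|rewrite mulr_ge0 ?above_ge0].
    apply: le_trans small _.
    have V1 : (e / 2) ^+ n <= vol p' q'.
      rewrite /vol -[X in _ ^+ X](card_ord n) -prodr_const; apply: ler_prod => i _.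
      by rewrite tb' inE l'e andbT; fast_lra.
    have := le_trans (ler_wpM2r m0 V1) h2.
    have -> : (e / 2) ^+ n = (2^-1 ^+ n) ^+ N * l ^+ n / 2 ^+ n.
      by rewrite /e !exprMn (exprAC 2^-1 N n) -(exprVn 2 n).
    set u := (2^-1 ^+ n) ^+ N; have ln0 : 0 < l ^+ n by rewrite exprn_gt0.
    have tn0 : 0 < (2 : R) ^+ n by rewrite exprn_gt0.
    move=> h; rewrite (_ : _^-1 * u * m = (l ^+ n)^-1 * K2^-1 / 2 * (u * l ^+ n / 2 ^+ n * m)); last first.
      by field; rewrite !gt_eqF.
    apply: le_trans (ler_wpM2l _ h) _; first by rewrite !mulr_ge0 ?invr_ge0// ltW.
    rewrite le_eqVlt; apply/orP; left; apply/eqP; by field; rewrite !gt_eqF.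
  (* On the half of the mass where [f] vanishes, |f - A| equals |A|. *)
  have Am : `|A| * (m' / 2) <= K1 * l' * I.
    apply: le_trans h1; apply: (@le_trans _ _ (ibox p' q' (fun z => `|A| * (w Gam z - above f 0 z * w Gam z)))).
      rewrite iboxZ; last by apply: locintB; [exact: lw|exact: locint_above].
      rewrite iboxB; [|exact: lw|exact: locint_above].
      by apply: ler_wpM2l => //; rewrite -/m'; fast_lra.
    apply: ibox_le; [apply: locintZ; apply: locintB; [exact: lw|exact: locint_above]|by apply: lfw => //; exact: locint_normB|].
    move=> z _; have [fz|fz] := leP (f z) 0.
      rewrite aboveF// mul0r subr0.
      have -> : f z = 0 by apply/eqP; rewrite eq_le fz f0.
      by rewrite sub0r normrN.
    by rewrite aboveT// mul1r subrr mulr0 mulr_ge0.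
  rewrite /P -/I.
  apply: (@le_trans _ _ (ibox p' q' (fun z => `|f z - A| * w Gam z + `|A| * w Gam z))).
    apply: ibox_le; first exact: lfW.
      by apply: locintD; [apply: lfw => //; exact: locint_normB|exact/locintZ/lw].
    move=> z _; rewrite -mulrDl; apply: ler_wpM2r => //.
    have := ler_normD (f z - A) A; rewrite subrK; apply: le_trans; exact: ler_norm.
  rewrite iboxD; [|by apply: lfw => //; exact: locint_normB|exact/locintZ/lw].
  rewrite iboxZ; last exact: lw.
  have : K1 * l' * I <= K1 * e * I.
    by apply: ler_wpM2r => //; apply: ler_wpM2l; exact: ltW.
  rewrite -/m'; move: h1 Am; set X := ibox _ _ _; fast_lra.
- move=> l' S p' q' i el' iS tb' sub; rewrite /P => i1 i2.
  have l'0 : 0 < l' by fast_lra.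
  by rewrite (halves_sum tb' l'0 iS lfW) (halves_sum tb' l'0 iS lgw) mulrDr lerD.
- rewrite /e ler_pdivrMr//; rewrite mulrC; apply: (@le_trans _ _ l); last fast_lra.
  by rewrite ger_pMr// exprn_ile1//; fast_lra.
Qed.

End poincare.

(** * Solutions and their energy *)

Section testing.
Context (R : realType) (n : nat).
Local Notation V := 'rV[R]_n.
Local Notation mu := (lebesgue_n R n).
Implicit Types (x y z p q a b : V) (r s t c e l : R) (Gam : set V) (f u v phi eta : V -> R) (G : V -> V) (i j : 'I_n).

Lemma compact_measurable_leb (K : set V) : compact K -> measurable (K : set (lebT R n)).
Proof.
move=> cK; rewrite -(setCK K); apply: measurableC; apply: measurable_open; apply: closed_openC.
by apply: compact_closed cK; exact: norm_hausdorff.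
Qed.

Lemma compact_hbox (K : set V) : compact K -> exists2 ab : V * V, (forall i, ab.1 ord0 i <= ab.2 ord0 i) & K `<=` hbox ab.1 ab.2.
Proof.
move=> /compact_bounded[M [Mr HM]]; pose N := `|M| + 1.
have N0 : M < N by rewrite /N; have := ler_norm M; lra.
have N00 : 0 < N by rewrite /N; have := normr_ge0 M; lra.
exists (lower 0 (N + 1), upper 0 (N + 1)) => /=; first by move=> i; rewrite !mxE; lra.
move=> z /(HM _ N0) h i; rewrite !mxE.
have : `|z ord0 i| <= N.
  apply: le_trans h; rewrite {2}/Num.norm /= mx_normrE.
  exact: (le_bigmax 0 (fun ij : 'I_1 * 'I_n => `|z ij.1 ij.2|) (ord0, i)).
by rewrite ler_norml => /andP[? ?]; apply/andP; split; lra.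
Qed.

Lemma locint_L1loc f (Om : set V) : locint f -> L1loc Om f.
Proof.
move=> [mf If] K cK _; have [[a b] _ sub] := compact_hbox cK.
exact: (@integrableS _ _ _ mu (hbox a b)) (measurable_hbox a b) (compact_measurable_leb cK) sub (If a b).
Qed.

Lemma compact_del (Gam : set V) (K : set V) : Gam !=set0 -> closed Gam -> compact K -> K `<=` ~` Gam ->
  exists2 t, 0 < t & forall z y, K z -> Gam y -> ~ (forall j, `|y ord0 j - z ord0 j| <= t).
Proof.
move=> G0 cG cK sub.
have cI : compact (del Gam @` K).
  by apply: continuous_compact => //; apply: continuous_subspaceT; exact: del_cont.
have clI := compact_closed (@norm_hausdorff R R) cI.
have : nbhs (0 : R) (~` (del Gam @` K)).
  apply: open_nbhs_nbhs; split; first exact: closed_openC.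
  by move=> [z Kz dz]; have := del_gt0 G0 cG (sub z Kz); rewrite dz ltxx.
move=> /nbhs_ballP[e /= e0 he].
have n1 : 0 < n%:R + 1 :> R by rewrite ltr_wpDl.
exists (e / (n%:R + 1)); first by rewrite divr_gt0.
move=> z y Kz Gy h; apply: (he (del Gam z)); last by exists z.
rewrite /ball /= sub0r normrN ger0_norm ?del_ge0//.
apply: le_lt_trans (del_le z Gy) _; rewrite enormB.
apply: (@le_lt_trans _ _ (n%:R * (e / (n%:R + 1)))).
  by apply: enorm_le_sum => j; rewrite !mxE.
rewrite mulrA ltr_pdivrMr// mulrC ltr_pM2l//; lra.
Qed.

Lemma test_C1 (Gam : set V) phi : Gam !=set0 -> closed Gam -> test_function (~` Gam) phi ->
  exists a b t, [/\ is_C1 phi (fun i => partial_derive i phi), (forall i, a ord0 i <= b ord0 i),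
    (forall z, (~ hbox a b z) \/ Gam z -> phi z = 0 /\ forall i, partial_derive i phi z = 0), 0 < t &
    forall z y, phi z != 0 -> Gam y -> ~ (forall j, `|y ord0 j - z ord0 j| <= t)].
Proof.
move=> G0 cG [sm [K [cK KG phi0]]]; have [[a b] /= ab sub] := compact_hbox cK.
have [t t0 ht] := compact_del G0 cG cK KG.
exists a, b, t; split => //.
- split; first by have [] := sm [::].
  + by move=> i; have [] := sm [:: i].
  + by move=> i z; have [_ /(_ i z)] := sm [::] => h; split.
- move=> z hz; have nK : ~ K z by case: hz => [h /sub//|Gz /KG].
  split => [|i]; first exact: phi0.
  have oK : open (~` K) by apply: closed_openC; apply: compact_closed cK; exact: norm_hausdorff.
  have d0 : is_derive z (vdir R i) (fun=> 0 : R) 0 by exact: is_derive_cst.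
  suff h : is_derive z (vdir R i) phi 0 by rewrite /partial_derive; exact: (@derive_val _ _ _ _ _ _ _ h).
  apply: (near_eq_is_derive _ d0).
  by have := @open_nbhs_nbhs _ z _ (conj oK nK); apply: filterS => y /phi0 ->.
- move=> z y pz Gy; apply: ht => //; apply: contrapT => nK; by rewrite phi0 ?eqxx in pz.
Qed.

Lemma Om_ibox (Gam : set V) a b f : (forall z, (~ hbox a b z) \/ Gam z -> f z = 0) ->
  \int[mu]_(z in ~` Gam) f z = ibox a b f.
Proof.
move=> h; rewrite (ibox_mkcond (a := a) (b := b)); last by move=> z _ nz; apply: h; left.
apply: ibox_eq => z _; case: ifPn => //; rewrite notin_setE => /contrapT Gz.
by rewrite h//; right.
Qed.

(** The chain rule with test function [phi * eta]. As [phi] is supported at a positive distance from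
    Gam, the condition of [chain_rule] near Gam holds vacuously. *)
Lemma weak_gradient_comp Gam u G (F F' : R -> R) eta Deta : Gam !=set0 -> closed Gam -> continuous u ->
  (forall i, locint (fun z => G z ord0 i)) -> weak_gradient (~` Gam) u G -> is_C1R F F' -> is_C1 eta Deta ->
  weak_gradient (~` Gam) (fun z => F (u z) * eta z)
    (fun z => \row_i (F' (u z) * eta z * G z ord0 i + F (u z) * Deta i z)).
Proof.
move=> G0 cG cu lG wg CF Ce; have [ce cD _] := Ce; have cF := C1R_cont CF; have [cF' _] := CF.
have cFu : continuous (fun z => F (u z)) := cont_comp cu cF.
have cF'u : continuous (fun z => F' (u z)) := cont_comp cu cF'.
have l1 i : locint (fun z => F' (u z) * eta z * G z ord0 i) := locint_ker (lG i) (contM cF'u ce).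
have l2 i : locint (fun z => F (u z) * Deta i z) := locint_cont (contM cFu (cD i)).
split => [i|phi tphi i].
  apply: locint_L1loc; rewrite (_ : (fun z => _) = (fun z => F' (u z) * eta z * G z ord0 i + F (u z) * Deta i z)).
    exact: locintD (l1 i) (l2 i).
  by apply/funext => z; rewrite mxE.
have [a [b [t [Cp ab phi0 t0 ht]]]] := test_C1 G0 cG tphi; have [cp cdp _] := Cp.
have Cep := C1M Cp Ce.
have := @chain_rule R n Gam u (fun i z => G z ord0 i) F F' _ _ i a b t cu (lG i) _ CF Cep ab _ _ t0 _.
move=> H; rewrite (Om_ibox (a := a) (b := b)); last by move=> z /phi0[_ ->]; rewrite mulr0.
rewrite (Om_ibox (a := a) (b := b)); last by move=> z /phi0[-> _]; rewrite mulr0.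
have {}H := H (fun s z hs sub => @weak_gradient_kern R n Gam u G s z i (locint_cont cu) wg hs sub).
have {}H : ibox a b (fun z => F (u z) * (partial_derive i phi z * eta z + phi z * Deta i z)) =
   - ibox a b (fun z => F' (u z) * G z ord0 i * (phi z * eta z)).
  apply: H.
  - by move=> z nz; have [-> _] := phi0 z (or_introl nz); rewrite mul0r.
  - by move=> z nz; have [-> ->] := phi0 z (or_introl nz); rewrite !mul0r addr0.
  - move=> z y pz Gy h; exfalso; apply: ht Gy h; apply: contra pz => /eqP ->; by rewrite mul0r.
have l3 : locint (fun z => F (u z) * eta z * partial_derive i phi z).
  by apply: locint_cont; apply: contM => //; exact: contM.
have l4 : locint (fun z => F (u z) * Deta i z * phi z) by apply: locint_cont; apply: contM => //; exact: contM.
have l5 : locint (fun z => F' (u z) * eta z * G z ord0 i * phi z).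
  have := locint_ker (l1 i) cp; congr locint; apply/funext => z; exact: mulrC.
have E1 : ibox a b (fun z => F (u z) * (partial_derive i phi z * eta z + phi z * Deta i z)) =
   ibox a b (fun z => F (u z) * eta z * partial_derive i phi z) + ibox a b (fun z => F (u z) * Deta i z * phi z).
  by rewrite -iboxD//; apply: ibox_eq => z _; ring.
have E2 : ibox a b (fun z => F' (u z) * G z ord0 i * (phi z * eta z)) =
   ibox a b (fun z => F' (u z) * eta z * G z ord0 i * phi z).
  by apply: ibox_eq => z _; ring.
have E3 : ibox a b (fun z => (\row_i0 (F' (u z) * eta z * G z ord0 i0 + F (u z) * Deta i0 z)) ord0 i * phi z) =
  ibox a b (fun z => F' (u z) * eta z * G z ord0 i * phi z) + ibox a b (fun z => F (u z) * Deta i z * phi z).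
  by rewrite -iboxD//; apply: ibox_eq => z _; rewrite mxE; ring.
rewrite E3; move: H; rewrite E1 E2; lra.
Qed.

Lemma measurable_eball x r : measurable (eball x r : set (lebT R n)).
Proof. exact/measurable_open/eball_open. Qed.

Lemma has_trace0 v x : continuous v -> v x = 0 -> has_trace v x 0.
Proof.
move=> cv vx; apply/cvgrPdist_le => e e0.
have [del0 del00 Hd] : exists2 t : R, 0 < t & forall y, (forall j, `|y ord0 j - x ord0 j| < t) -> `|v y| <= e.
  have : nbhs x [set y | `|v y| < e].
    have := cv x; rewrite /continuous_at vx => /cvgrPdist_lt/(_ e e0).
    by apply: filterS => y; rewrite sub0r normrN.
  by move=> /nbhs_coordP[t t0 ht]; exists t => // y /ht /ltW.
near=> r.
have r0 : 0 < r by near: r; exact: nbhs_right_gt.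
have rd : r < del0 by near: r; exact: nbhs_right_lt.
rewrite sub0r normrN /ball_average normrM normfV.
set m := fine _; have m0 : 0 <= m by apply: fine_ge0; exact: measure_ge0.
have lv : locint (fun z => if z \in eball x r then v z else 0).
  have := @locintM R n (\1_(eball x r)) v; rewrite (_ : (fun z => \1_(eball x r) z * v z) = (fun z => if z \in eball x r then v z else 0)).
    apply; [exact/measurable_indic/measurable_eball| |exact: locint_cont].
    by move=> a b; exists 1 => z _; rewrite indicE ger0_norm ?ler0n// lern1 leq_b1.
  by apply/funext => z; rewrite indicE; case: ifP => _; rewrite ?mul1r ?mul0r.
have I : `|\int[mu]_(z in eball x r) v z| <= e * m.
  rewrite (ibox_mkcond (a := lower x r) (b := upper x r)); last by move=> z zr []; exact: eball_qbox.
  apply: le_trans (ibox_abs _ _ lv) _.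
  have li : locint (\1_(eball x r) : V -> R).
    apply: locint_bd; first exact/measurable_indic/measurable_eball.
    by move=> a b; exists 1 => z _; rewrite indicE ger0_norm ?ler0n// lern1 leq_b1.
  apply: (@le_trans _ _ (ibox (lower x r) (upper x r) (fun z => e * \1_(eball x r) z))).
    apply: ibox_le; [exact: locint_abs|exact: locintZ|move=> z _].
    rewrite indicE; case: ifPn => [/set_mem zr|_]; last by rewrite normr0 mulr0.
    rewrite mulr1; apply: Hd => j; have := coord_le_enorm (z - x) j; rewrite !mxE.
    by rewrite /eball /= in zr; lra.
  rewrite iboxZ// ler_wpM2l ?(ltW e0)// /ibox /Rintegral integral_indic//; [|exact: measurable_hbox|exact: measurable_eball].
  by rewrite /m setIidl//; exact: eball_qbox.
rewrite (ger0_norm m0); have [m00|m00] := eqVneq m 0; first by rewrite m00 invr0 mul0r ltW.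
rewrite mulrC ler_pdivrMr// lt_neqAle eq_sym m00; exact: m0.
Unshelve. all: by end_near. Qed.

Lemma locint_dom_loc f g : measurable_fun [set: lebT R n] (g : lebT R n -> R) -> locint f ->
  (forall a b, exists C, forall z, hbox a b z -> `|g z| <= C * f z) -> locint g.
Proof.
move=> mg [mf If] H; split => // a b; have [C HC] := H a b.
apply: (le_integrable (measurable_hbox a b) _ _ (integrableZl (measurable_hbox a b) C (If a b))).
  by apply/measurable_EFinP; exact: measurable_funS mg.
by move=> z hz /=; rewrite lee_fin; apply: le_trans (HC z hz) (ler_norm _).
Qed.

(** The complement of Gam is exhausted by the compact sets of bounded points at distance at least
    [1 / (k + 1)] from Gam. *)
Lemma measurable_L1loc (Gam : set V) f : Gam !=set0 -> closed Gam -> L1loc (~` Gam) f ->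
  (forall z, Gam z -> f z = 0) -> measurable_fun [set: lebT R n] (f : lebT R n -> R).
Proof.
move=> G0 cG Lf f0.
pose K (k : nat) : set V := [set z : V | (forall j, `|z ord0 j| <= k%:R) /\ k.+1%:R^-1 <= del Gam z].
have cK k : compact (K k).
  apply: (@subclosed_compact _ _ (box (const_mx (- k%:R), const_mx k%:R))).
  - apply: closedI.
      have E : (fun z : V => forall j : 'I_n, `|z ord0 j| <= k%:R) = box (const_mx (- k%:R), const_mx k%:R).
        by apply/seteqP; split => z h j; have := h j; rewrite /= !mxE ler_norml.
      rewrite [X in closed X]E; exact: compact_closed (@norm_hausdorff _ _) (@compact_box _ _ _ _).
    have := @preimage_closed _ _ (del Gam) [set t : R | k.+1%:R^-1 <= t] (fun z _ => del_cont G0 (x:=z)) (@closed_ge _ _); exact.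
  - exact: compact_box.
  - by move=> z [h _] j; have := h j; rewrite /= !mxE ler_norml.
have KO k : K k `<=` ~` Gam.
  by move=> z [_ h] Gz; move: h; rewrite del0// leNgt invr_gt0 ltr0Sn.
have UK : \bigcup_k K k = ~` Gam.
  apply/seteqP; split => [z [k _ /KO]//|z Gz].
  have dz := del_gt0 G0 cG Gz.
  have [N1 hN1] : exists N : nat, (del Gam z)^-1 < N%:R by exists (Num.bound (del Gam z)^-1); apply: archi_boundP; rewrite invr_ge0 ltW.
  pose s := \sum_j `|z ord0 j|; have s0 : 0 <= s by exact: sumr_ge0.
  have hN2 := archi_boundP s0; set N2 := Num.bound s in hN2.
  exists (maxn N1 N2) => //; split => [j|].
    apply: (@le_trans _ _ s); first by rewrite /s (bigD1 j)//= lerDl sumr_ge0.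
    by apply: le_trans (ltW hN2) _; rewrite ler_nat leq_maxr.
  rewrite -[leRHS]invrK lef_pV2 ?posrE ?invr_gt0//.
  by apply: le_trans (ltW hN1) _; rewrite ler_nat; apply: leq_trans (leq_maxl _ N2) _.
have mO : measurable_fun (~` Gam : set (lebT R n)) (f : lebT R n -> R).
  rewrite -UK; apply/measurable_fun_bigcup => [k|k]; first exact: compact_measurable_leb.
  by apply/measurable_EFinP; have /integrableP[] := Lf _ (cK k) (KO k).
have mG : measurable (Gam : set (lebT R n)).
  by rewrite -(setCK Gam); apply: measurableC; apply: measurable_open; exact: closed_openC.
rewrite -(setUv Gam); apply/measurable_funU; [exact: mG|exact: measurableC|split=> //].
have h0 : measurable_fun (Gam : set (lebT R n)) ((fun=> 0) : lebT R n -> R) by exact: measurable_cst.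
by apply: eq_measurable_fun h0 => z /set_mem /f0 ->.
Qed.

Lemma measurable_enorm G : (forall i, measurable_fun [set: lebT R n] ((fun z => G z ord0 i) : lebT R n -> R)) ->
  measurable_fun [set: lebT R n] ((fun z => enorm (G z)) : lebT R n -> R).
Proof.
move=> mG; have ms : measurable_fun [set: lebT R n] ((fun z => dotp (G z) (G z)) : lebT R n -> R).
  by apply: measurable_sum => i; exact: measurable_funM.
have := measurableT_comp (continuous_measurable_fun (@sqrt_continuous R)) ms; exact.
Qed.

Lemma row_enorm_cont (D : 'I_n -> V -> R) : (forall i, continuous (D i)) -> continuous (fun z => enorm (\row_i D i z : V)).
Proof.
move=> cD; rewrite (_ : (fun z => _) = (fun z => Num.sqrt (\sum_i D i z * D i z))); last first.
  by apply/funext => z; rewrite /enorm /dotp; congr Num.sqrt; apply: eq_bigr => i _; rewrite !mxE.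
apply: (cont_comp _ (@sqrt_continuous R)); apply: cont_sum => i; exact: contM.
Qed.

Lemma dotpDr (x y z : V) : dotp x (y + z) = dotp x y + dotp x z.
Proof. by rewrite /dotp -big_split /=; apply: eq_bigr => i _; rewrite mxE mulrDr. Qed.

Lemma dotpZr (x y : V) c : dotp x (c *: y) = c * dotp x y.
Proof. by rewrite /dotp mulr_sumr; apply: eq_bigr => i _; rewrite mxE mulrCA. Qed.

Lemma enormZ c (x : V) : enorm (c *: x) = `|c| * enorm x.
Proof.
rewrite /enorm -[in RHS]sqrtr_sqr -sqrtrM ?sqr_ge0//; congr Num.sqrt.
by rewrite /dotp mulr_sumr; apply: eq_bigr => i _; rewrite !mxE; ring.
Qed.

Lemma enormD_sqr (x y : V) : enorm (x + y) ^+ 2 <= 2 * enorm x ^+ 2 + 2 * enorm y ^+ 2.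
Proof.
have := enormD x y; have := enorm_ge0 x; have := enorm_ge0 y; have := enorm_ge0 (x + y).
move: (enorm (x + y)) (enorm x) (enorm y) => s t r s0 r0 t0 h; have := sqr_ge0 (t - r); nra.
Qed.

End testing.

(** * Weak solutions: gradient bounds and the energy inequality *)

Section sol.
Context (R : realType) (n : nat) (d C0 C1 : R).
Hypotheses (n0 : (0 < n)%N) (d0 : 0 < d) (dn : d < n%:R - 1) (C01 : 1 <= C0) (C11 : 1 <= C1).
Local Notation V := 'rV[R]_n.
Local Notation mu := (lebesgue_n R n).
Local Notation reg := (regular_set d C0).
Local Notation w Gam := (weight Gam d).
Implicit Types (x y z p q : V) (r s t c e l k : R) (Gam : set V) (f u v eta : V -> R) (G : V -> V) (A : V -> 'M[R]_n).

(** The gradient is set to 0 on Gam, so that integrals over the complement and over the whole space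
    agree. The energy is finite over the whole space, which also serves as the condition at
    infinity. *)
Definition sol Gam A u G := [/\ continuous u, (exists M, forall z, `|u z| <= M), weak_gradient (~` Gam) u G,
  [/\ forall z, Gam z -> G z = 0,
      forall i, measurable_fun [set: lebT R n] ((fun z => G z ord0 i) : lebT R n -> R) &
      mu.-integrable setT (fun z => (enorm (G z) ^+ 2 * w Gam z)%:E)] &
  forall v Gv, in_W0 Gam d v -> weak_gradient (~` Gam) v Gv ->
    \int[mu]_(z in ~` Gam) dotp (mulmv (A z) (G z)) (Gv z) = 0].

Definition setting Gam A := reg Gam /\ weighted_elliptic Gam d C1 A.

Let lw Gam (rG : reg Gam) : locint (w Gam) := locint_weight d0 dn C01 rG.

(** A qualitative bound, since the distance to Gam is bounded on a box. It serves local
    integrability of the gradient and [mass_zero], never a constant of an estimate. *)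
Lemma weight_lower Gam p q : reg Gam -> exists2 c, 0 < c & forall z, hbox p q z -> ~ Gam z -> c <= w Gam z.
Proof.
move=> rG; have [G0 cG AR] := rG; have [M HM] := @cont_bounded_box R n (del Gam) p q (del_cont G0).
pose M' := `|M| + 1; have M'0 : 0 < M' by rewrite /M'; have := normr_ge0 M; lra.
exists (M' `^ (- (n%:R - 1 - d))); first exact: powR_gt0.
move=> z hz Gz; apply: weight_ge rG Gz _ => //.
have := HM z (hbox_box hz); have := ler_norm (del Gam z); have := ler_norm M; rewrite /M'; lra.
Qed.

Section one_solution.
Variables (Gam : set V) (A : V -> 'M[R]_n) (u : V -> R) (G : V -> V).
Hypotheses (sA : setting Gam A) (su : sol Gam A u G).

Let rG : reg Gam. Proof. by case: sA. Qed.
Let w0 z : 0 <= w Gam z. Proof. exact: weight_ge0. Qed.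
Let cu : continuous u. Proof. by case: su. Qed.
Let GG z : Gam z -> G z = 0. Proof. by case: su => _ _ _ [h _ _] _; exact: h. Qed.
Let mG i : measurable_fun [set: lebT R n] ((fun z => G z ord0 i) : lebT R n -> R).
Proof. by case: su => _ _ _ [_ h _] _; exact: h. Qed.
Let eG : mu.-integrable setT (fun z => (enorm (G z) ^+ 2 * w Gam z)%:E).
Proof. by case: su => _ _ _ [_ _ h] _. Qed.
Let mw : measurable_fun [set: lebT R n] (w Gam : lebT R n -> R). Proof. by have [] := lw rG. Qed.

Lemma sol_energy : locint (fun z => enorm (G z) ^+ 2 * w Gam z).
Proof.
split; first by apply/measurable_EFinP; have /integrableP[] := eG.
move=> p q; apply: (@integrableS _ _ _ mu setT) => //; exact: measurable_hbox.
Qed.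

Lemma sol_Gw : locint (fun z => enorm (G z) * w Gam z).
Proof.
apply: (locint_dom _ (locintD sol_energy (lw rG))).
  exact: (measurable_funM (measurable_enorm mG) mw).
move=> z; rewrite ger0_norm ?mulr_ge0 ?enorm_ge0//.
rewrite -[X in _ + X]mul1r -mulrDl; apply: ler_wpM2r => //.
have := enorm_ge0 (G z); move: (enorm _) => t; nra.
Qed.

Lemma sol_G : locint (fun z => enorm (G z)).
Proof.
apply: (locint_dom_loc _ sol_Gw); first exact: measurable_enorm.
move=> p q; have [c c0 hc] := weight_lower p q rG; exists c^-1 => z hz.
rewrite ger0_norm ?enorm_ge0//; have [Gz|Gz] := pselect (Gam z).
  by rewrite GG// enorm0 mul0r mulr0.
by rewrite mulrCA ler_peMr ?enorm_ge0// -ler_pdivrMl ?invr_gt0// mulr1 invrK hc.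
Qed.

Lemma sol_Gi i : locint (fun z => G z ord0 i).
Proof. by apply: locint_dom sol_G _ => // z; exact: coord_le_enorm. Qed.

(** The weak gradient of F(u) eta is valid across Gam: near the part of Gam that matters [u] is at
    most about [k], where [F'] vanishes, and this is the condition that [chain_rule] asks for. The
    term with the gradient of [eta] is absent by assumption. *)
Lemma sol_grad_bound (F F' : R -> R) eta Deta p q k e t0 : is_C1R F F' -> is_C1 eta Deta ->
  0 < e -> (forall c, c <= k + e -> F' c = 0) -> 0 < t0 -> (forall i, p ord0 i <= q ord0 i) ->
  (forall z y, hbox p q z -> eta z != 0 -> Gam y -> (forall j, `|y ord0 j - z ord0 j| <= t0) -> u y <= k) ->
  (forall i z, F (u z) * Deta i z = 0) ->
  grad_bound d Gam p q (fun z => F (u z) * eta z) (fun z => `|F' (u z) * eta z| * enorm (G z)).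
Proof.
move=> CF Ce e0 hF t00 pq hb FD; have [ce cD _] := Ce; have cF := C1R_cont CF; have [cF' _] := CF.
have cF'e : continuous (fun z => `|F' (u z) * eta z|).
  apply: (cont_comp (v := fun t : R => `|t|)); last exact: norm_continuous.
  by apply: contM => //; exact: cont_comp cu cF'.
split.
- by apply: contM => //; exact: cont_comp cu cF.
- exact: locint_ker sol_G cF'e.
- have := locint_ker sol_Gw cF'e; congr locint; apply/funext => z; exact: mulrA.
- by move=> z /GG ->; rewrite enorm0 mulr0.
exists (fun i z => F' (u z) * eta z * G z ord0 i); split; last first.
- by move=> i z; rewrite normrM ler_wpM2l// coord_le_enorm.
- by move=> i; apply: locint_ker (sol_Gi i) _; apply: contM => //; exact: cont_comp cu cF'.
move=> phi Dphi i Cp p0 Dp0.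
have [s0 s00 hs] := @unif_cont R n u p q (e / 2) cu ltac:(lra).
have [s1 s10 hs1] := @unif_cont R n u p q (e / 2) cu ltac:(lra).
pose t := Num.min (Num.min t0 (s0 / 2)) (e / 2).
have tt0 : t <= t0 by rewrite /t !ge_min lexx.
have ts0 : t < s0 by have : t <= s0 / 2 by [rewrite /t !ge_min lexx orbT]; lra.
have te : t <= e / 2 by rewrite /t ge_min lexx orbT.
have t_gt0 : 0 < t by rewrite /t !lt_min t00 /=; apply/andP; split; lra.
have [_ _ wg _ _] := su.
have Cep := C1M Ce Cp.
have := @chain_rule R n Gam u (fun i z => G z ord0 i) F F' _ _ i p q t cu (sol_Gi i) _ CF Cep pq _ _ t_gt0 _.
move=> H; have {}H := H (fun s z hs sub => @weak_gradient_kern R n Gam u G s z i (locint_cont cu) wg hs sub).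
rewrite (@ibox_eq R n p q (fun z => F (u z) * eta z * Dphi i z)
  (fun z => F (u z) * (Deta i z * phi z + eta z * Dphi i z))); last first.
  by move=> z _; rewrite mulrDr !mulrA FD mul0r add0r.
rewrite H.
- by congr (- _); apply: ibox_eq => z _; ring.
- by move=> z nz; rewrite p0// mulr0.
- by move=> z nz; rewrite p0// Dp0// !mulr0 addr0.
move=> z y ez Gy hy c hc.
have hz : hbox p q z by apply: contrapT => nz; rewrite p0 ?mulr0 ?eqxx in ez.
have ez' : eta z != 0 by apply: contraNneq ez => ->; rewrite mul0r.
have uy := hb z y hz ez' Gy (fun j => le_trans (hy j) tt0).
have := hs z y (hbox_box hz) (fun j => le_lt_trans (hy j) ts0).
move=> h; apply: hF; move: h hc te; rewrite !ltr_norml => /andP[? ?] /andP[? ?] ?; lra.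
Qed.

Section test_energy.
Variables (F F' : R -> R) (eta : V -> R) (Deta : 'I_n -> V -> R) (p q : V) (B : R).
Hypotheses (CF : is_C1R F F') (Ce : is_C1 eta Deta) (F'B : forall t, 0 <= F' t <= B)
  (eta01 : forall z, 0 <= eta z <= 1) (De : forall i z, ~ hbox p q z -> Deta i z = 0)
  (FG : forall z, Gam z -> F (u z) * eta z = 0).

Let v z := F (u z) * eta z.
Let D z : V := \row_i Deta i z.
Let Gv z := F' (u z) * eta z *: G z + F (u z) *: D z.

Let ceta : continuous eta. Proof. by case: Ce. Qed.
Let cFu : continuous (fun z => F (u z)). Proof. exact: cont_comp cu (C1R_cont CF). Qed.
Let cF'u : continuous (fun z => F' (u z)). Proof. by have [h _] := CF; exact: cont_comp cu h. Qed.
Let cD : continuous (fun z => enorm (D z)). Proof. by have [_ h _] := Ce; exact: row_enorm_cont. Qed.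
Let D0 z : ~ hbox p q z -> enorm (D z) = 0.
Proof.
move=> nz; rewrite (_ : D z = 0) ?enorm0//.
by apply/rowP => i; rewrite !mxE De.
Qed.
Let B0 : 0 <= B. Proof. have /andP[h1 h2] := F'B 0; exact: le_trans h1 h2. Qed.

Let wgv : weak_gradient (~` Gam) v Gv.
Proof.
have [G0 cG _] := rG; have [_ _ wg _ _] := su.
have := weak_gradient_comp G0 cG cu sol_Gi wg CF Ce; congr weak_gradient.
by apply/funext => z; apply/rowP => i; rewrite !mxE.
Qed.

Let FDw : mu.-integrable setT (fun z => ((F (u z) * F (u z)) * (enorm (D z) * enorm (D z)) * w Gam z)%:E).
Proof.
apply: (@integrable_supp R n (fun z => (F (u z) * F (u z)) * (enorm (D z) * enorm (D z)) * w Gam z) p q).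
  apply: locint_ker (lw rG) _; apply: contM; exact: contM.
by move=> z nz; rewrite D0// mulr0 mulr0 mul0r.
Qed.

Lemma test_in_W0 : in_W0 Gam d v.
Proof.
split; last first.
  apply: aeW => x Gx; apply: has_trace0; first exact: contM.
  exact: FG.
split; first by apply: locint_L1loc; apply: locint_cont; exact: contM.
exists Gv; split => //.
pose g z := 2 * B ^+ 2 * (enorm (G z) ^+ 2 * w Gam z) + 2 * ((F (u z) * F (u z)) * (enorm (D z) * enorm (D z)) * w Gam z).
have Ig : mu.-integrable setT (EFin \o g).
  rewrite (_ : EFin \o g = fun z => ((2 * B ^+ 2)%:E * (enorm (G z) ^+ 2 * w Gam z)%:E + 2%:E * ((F (u z) * F (u z)) * (enorm (D z) * enorm (D z)) * w Gam z)%:E)%E).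
    by apply: integrableD => //; exact: integrableZl.
  by apply/funext => z; rewrite /= EFinD !EFinM.
have gv z : enorm (Gv z) ^+ 2 * w Gam z <= g z.
  have -> : g z = (2 * B ^+ 2 * enorm (G z) ^+ 2 + 2 * ((F (u z) * F (u z)) * (enorm (D z) * enorm (D z)))) * w Gam z.
    by rewrite /g; ring.
  apply: ler_wpM2r => //.
  apply: le_trans (enormD_sqr _ _) _; apply: lerD; rewrite enormZ.
    rewrite exprMn mulrA; apply: ler_wpM2r; first exact: sqr_ge0.
    have /andP[h1 h2] := F'B (u z); have /andP[h3 h4] := eta01 z.
    rewrite ler_pM2l// ler_sqr ?nnegrE// normrM !ger0_norm//.
    by rewrite -[leRHS]mulr1; apply: ler_pM.
  by rewrite le_eqVlt; apply/orP; left; apply/eqP; rewrite exprMn real_normK ?num_real//; ring.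
have gv0 z : (0 <= (enorm (Gv z) ^+ 2 * w Gam z)%:E)%E by rewrite lee_fin mulr_ge0 ?sqr_ge0.
apply: (@le_lt_trans _ _ (\int[mu]_(z in ~` Gam) (g z)%:E)%E).
  by apply: le_integral_nonmeas => z _ //; rewrite lee_fin.
have [G0 cG _] := rG.
have mO : measurable (~` Gam : set (lebT R n)) by apply: measurable_open; exact: closed_openC.
have := @integrableS _ _ _ mu setT (~` Gam) (EFin \o g) measurableT mO (@subsetT _ _) Ig.
move=> /integrableP[_]; apply: le_lt_trans; apply: le_integral_nonmeas => z _.
  by rewrite lee_fin; apply: le_trans (gv z); rewrite mulr_ge0 ?sqr_ge0.
by rewrite lee_fin ler_norm.
Qed.

Let AG z i : R := (mulmv (A z) (G z)) ord0 i.

Let mAG i : measurable_fun [set: lebT R n] ((fun z => AG z i) : lebT R n -> R).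
Proof.
have [G0 cG _] := rG; have [_ [mA _]] := sA.
have mGam : measurable (Gam : set (lebT R n)).
  by rewrite -(setCK Gam); apply: measurableC; apply: measurable_open; exact: closed_openC.
rewrite -(setUv Gam); apply/measurable_funU; [exact: mGam|exact: measurableC|split].
  have h0 : measurable_fun (Gam : set (lebT R n)) ((fun=> 0) : lebT R n -> R) by exact: measurable_cst.
  apply: eq_measurable_fun h0.
  by move=> z /set_mem Gz; rewrite /AG GG// /mulmv mul0mx mxE.
rewrite (_ : (fun z => AG z i) = (fun z => \sum_j G z ord0 j * A z i j)).
  apply: measurable_sum => j; apply: measurable_funM; [exact: measurable_funTS (mG j)|exact: mA].
by apply/funext => z; rewrite /AG /mulmv mxE; apply: eq_bigr => j _; rewrite mxE.
Qed.

Let ell1 z (zeta : V) : `|dotp (mulmv (A z) (G z)) zeta| <= C1 * (w Gam z * enorm (G z) * enorm zeta).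
Proof.
have [_ [_ H]] := sA; have [Gz|Gz] := pselect (Gam z); last by rewrite !mulrA; exact: (H z Gz).1.
rewrite GG// /mulmv mul0mx (_ : dotp 0 zeta = 0); last by rewrite /dotp big1// => i _; rewrite mxE mul0r.
by rewrite enorm0 mulr0 mul0r mulr0 normr0.
Qed.

Let ell2 z : C1^-1 * (enorm (G z) ^+ 2 * w Gam z) <= dotp (mulmv (A z) (G z)) (G z).
Proof.
have [_ [_ H]] := sA; have [Gz|Gz] := pselect (Gam z); last by rewrite (mulrC (_ ^+ 2)) mulrA; exact: (H z Gz).2.
by rewrite GG// /mulmv mul0mx enorm0 expr0n /= mul0r mulr0 /dotp big1// => i _; rewrite mxE mul0r.
Qed.

(** The equation is tested with F(u) eta, whose trace is 0. Ellipticity from below bounds the term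
    with [F'], ellipticity from above the term with the gradient of [eta]; each contributes one
    factor [C1]. *)
Lemma energy_ineq : \int[mu]_z (F' (u z) * eta z * (enorm (G z) ^+ 2 * w Gam z)) <=
  C1 ^+ 2 * ibox p q (fun z => `|F (u z)| * enorm (D z) * (enorm (G z) * w Gam z)).
Proof.
have [G0 cG _] := rG; have C10 : 0 < C1 by exact: lt_le_trans C11.
pose E z := enorm (G z) ^+ 2 * w Gam z.
pose X1 z := F' (u z) * eta z * dotp (mulmv (A z) (G z)) (G z).
pose X2 z := F (u z) * dotp (mulmv (A z) (G z)) (D z).
pose Y z := `|F (u z)| * enorm (D z) * (enorm (G z) * w Gam z).
have bd z : 0 <= F' (u z) * eta z <= B.
  have /andP[h1 h2] := F'B (u z); have /andP[h3 h4] := eta01 z; rewrite mulr_ge0//=.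
  by rewrite -[leRHS]mulr1; apply: ler_pM.
have E0 z : 0 <= E z by rewrite mulr_ge0 ?sqr_ge0.
have mdot (H : V -> V) : (forall i, measurable_fun [set: lebT R n] ((fun z => H z ord0 i) : lebT R n -> R)) ->
    measurable_fun [set: lebT R n] ((fun z => dotp (mulmv (A z) (G z)) (H z)) : lebT R n -> R).
  by move=> mH; apply: measurable_sum => i; exact: measurable_funM (mAG i) (mH i).
have mFe : measurable_fun [set: lebT R n] ((fun z => F' (u z) * eta z) : lebT R n -> R).
  by apply: continuous_measurable_leb; exact: contM.
have Ie : mu.-integrable setT (EFin \o (fun z => F' (u z) * eta z * E z)).
  apply: (le_integrable measurableT _ _ (integrableZl measurableT B eG)).
    apply/measurable_EFinP; apply: (measurable_funM mFe); apply/measurable_EFinP; by case/integrableP: eG.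
  move=> z _ /=; rewrite lee_fin; have /andP[h1 h2] := bd z.
  rewrite !ger0_norm ?(mulr_ge0 B0 (E0 z)) ?(mulr_ge0 h1 (E0 z))//; exact: ler_wpM2r.
have I1 : mu.-integrable setT (EFin \o X1).
  apply: (le_integrable measurableT _ _ (integrableZl measurableT (B * C1) eG)).
    by apply/measurable_EFinP; exact: (measurable_funM mFe (mdot G mG)).
  move=> z _ /=; rewrite lee_fin; have /andP[h1 h2] := bd z.
  apply: (@le_trans _ _ (B * (C1 * E z))); last by rewrite mulrA; exact: ler_norm.
  rewrite /X1 normrM (ger0_norm h1).
  apply: ler_pM => //; apply: le_trans (ell1 z (G z)) _; rewrite ler_pM2l// le_eqVlt; apply/orP; left; apply/eqP; rewrite /E; ring.
have lY : locint Y.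
  apply: locint_ker sol_Gw _; apply: contM => //.
  exact: (cont_comp (v := fun t : R => `|t|) cFu (@norm_continuous _ _)).
have Y0 z : ~ hbox p q z -> Y z = 0 by move=> nz; rewrite /Y D0// mulr0 mul0r.
have IY : mu.-integrable setT (EFin \o Y) := integrable_supp lY Y0.
have XY z : `|X2 z| <= C1 * Y z.
  rewrite /X2 normrM; apply: le_trans (ler_wpM2l (normr_ge0 _) (ell1 z (D z))) _.
  by rewrite le_eqVlt; apply/orP; left; apply/eqP; rewrite /Y; ring.
have I2 : mu.-integrable setT (EFin \o X2).
  apply: (le_integrable measurableT _ _ (integrableZl measurableT C1 IY)).
    apply/measurable_EFinP; apply: measurable_funM; first exact: continuous_measurable_leb.
    apply: mdot => i; rewrite (_ : (fun z => _) = Deta i); last by apply/funext => z; rewrite mxE.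
    by apply: continuous_measurable_leb; case: Ce.
  by move=> z _ /=; rewrite lee_fin; apply: le_trans (XY z) (ler_norm _).
have key : \int[mu]_z X1 z + \int[mu]_z X2 z = 0.
  have [_ _ _ _ H] := su; rewrite -RintegralD// -(H v Gv test_in_W0 wgv).
  rewrite [RHS]Rintegral_mkcond; congr (Rintegral _ _ _); apply/funext => z; rewrite /patch.
  case: ifPn => [_|]; first by rewrite /X1 /X2 /Gv dotpDr !dotpZr.
  rewrite notin_setE => /contrapT Gz; rewrite /X1 /X2 GG// /mulmv mul0mx /dotp.
  by rewrite !big1 ?mulr0 ?addr0// => i _; rewrite mxE mul0r.
have L1 : C1^-1 * \int[mu]_z (F' (u z) * eta z * E z) <= \int[mu]_z X1 z.
  rewrite -RintegralZl//; apply: le_Rintegral => //.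
    by rewrite (_ : EFin \o _ = fun z => (C1^-1%:E * (EFin \o (fun z => (F' (u z) * eta z * E z)%R)) z)%E)//; exact: integrableZl.
  by move=> z _; have /andP[h1 h2] := bd z; rewrite /X1 (mulrCA C1^-1); apply: (ler_wpM2l h1); exact: ell2.
have L2 : - (\int[mu]_z X2 z) <= C1 * (\int[mu]_z Y z).
  apply: le_trans (ler_norm _) _; rewrite normrN.
  apply: le_trans (le_normr_Rintegral measurableT I2) _; rewrite -RintegralZl//.
  apply: le_Rintegral => //; first exact: integrable_norm.
  by rewrite (_ : EFin \o _ = fun z => (C1%:E * (EFin \o Y) z)%E)//; exact: integrableZl.
rewrite -(ibox_setT Y0) -/(E _); move: key L1 L2.
set J1 := \int[mu]_z X1 z; set J2 := \int[mu]_z X2 z; set JY := \int[mu]_z Y z; set JE := \int[mu]_z _ => key L1 L2.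
have h : C1^-1 * JE <= C1 * JY by lra.
have := ler_wpM2l (ltW C10) h; rewrite mulrA mulfV ?gt_eqF// mul1r mulrA -expr2; exact.
Qed.

End test_energy.
End one_solution.
End sol.

(** * De Giorgi iteration *)

Section cutoff.
Context (R : realType) (n : nat).
Local Notation V := 'rV[R]_n.
Implicit Types (x y z p q : V) (r s t c e l k : R).

Definition halves (f : R -> R) t := f t - 2 * f (t - 1 / 2) + f (t - 1).
(** A C^1 quadratic spline that climbs from 0 to 1 on [0, 1]. *)
Definition step t := 2 * halves (@posq R) t.
Definition dstep t := 2 * halves (fun t => 2 * pos t) t.

Lemma step_C1 : is_C1R step dstep.
Proof.
apply: C1R_Z; have S c := @C1R_affine R 1 (- c) _ _ (@posq_C1 R).
have := C1R_D (C1R_D (@posq_C1 R) (C1R_Z (- 2) (S (1 / 2)))) (S 1).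
by congr is_C1R; apply/funext => t; rewrite /halves !mul1r; ring.
Qed.

Lemma step_le0 t : t <= 0 -> step t = 0 /\ dstep t = 0.
Proof. by move=> t0; rewrite /step /dstep /halves /posq !pos_le0; [rewrite expr0n /=; split; ring|lra..]. Qed.

Lemma step_ge1 t : 1 <= t -> step t = 1 /\ dstep t = 0.
Proof. by move=> t0; rewrite /step /dstep /halves /posq !pos_id; [split; field|lra..]. Qed.

Lemma step_bounds t : 0 <= step t <= 1 /\ 0 <= dstep t <= 2.
Proof.
have [h|h] := leP t 0; first by have [-> ->] := step_le0 h; rewrite !lexx !ler01 ler0n.
have [h1|h1] := leP 1 t; first by have [-> ->] := step_ge1 h1; rewrite !lexx !ler01 ler0n.
rewrite /step /dstep /halves /posq; have [h2|h2] := leP t (1 / 2).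
  rewrite (pos_id (t := t)) ?(pos_le0 (t := t - 1 / 2)) ?(pos_le0 (t := t - 1)); [|lra..].
  by rewrite expr0n /=; split; apply/andP; split; nra.
rewrite (pos_id (t := t)) ?(pos_id (t := t - 1 / 2)) ?(pos_le0 (t := t - 1)); [|lra..].
by rewrite expr0n /=; split; apply/andP; split; nra.
Qed.

Lemma level_fun k1 k2 : k1 < k2 -> exists F F', [/\ is_C1R F F', (forall t, 0 <= F t <= 1),
  (forall t, 0 <= F' t <= 2 / (k2 - k1)), (forall t, t <= k1 -> F t = 0 /\ F' t = 0) &
  (forall t, k2 <= t -> F t = 1 /\ F' t = 0)].
Proof.
move=> kk; pose D := k2 - k1; have D0 : 0 < D by rewrite /D; lra.
exists (fun t => step (D^-1 * t + - (k1 / D))), (fun t => D^-1 * dstep (D^-1 * t + - (k1 / D))).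
have E t : D^-1 * t + - (k1 / D) = (t - k1) / D by field; lra.
split => [|t|t|t tk|t tk]; first exact/C1R_affine/step_C1.
- by have [] := step_bounds (D^-1 * t + - (k1 / D)).
- have [_ /andP[h1 h2]] := step_bounds (D^-1 * t + - (k1 / D)).
  by rewrite mulr_ge0 ?invr_ge0 ?(ltW D0)//= mulrC ler_pM2r// invr_gt0.
- rewrite E; have [-> ->] : step ((t - k1) / D) = 0 /\ dstep ((t - k1) / D) = 0; last by rewrite mulr0.
  by apply: step_le0; rewrite pmulr_lle0 ?invr_gt0; lra.
- rewrite E; have [-> ->] : step ((t - k1) / D) = 1 /\ dstep ((t - k1) / D) = 0; last by rewrite mulr0.
  by apply: step_ge1; rewrite ler_pdivlMr// /D; lra.
Qed.

Lemma prod_le1 (I : finType) (P : pred I) (f : I -> R) : (forall i, 0 <= f i <= 1) -> \prod_(i | P i) f i <= 1.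
Proof.
move=> f01; suff /andP[] : 0 <= \prod_(i | P i) f i <= 1 by [].
elim/big_ind: _ => [|s t /andP[s0 s1] /andP[t0 t1]|i _]; [by rewrite ler01 lexx| |exact: f01].
by rewrite mulr_ge0//= -[leRHS]mulr1; apply: ler_pM.
Qed.

Lemma cube_cutoff x r s : 0 < r -> r < s -> exists (zeta : V -> R) (D : 'I_n -> V -> R),
  [/\ is_C1 zeta D, (forall z, 0 <= zeta z <= 1), (forall z, qbox x r z -> zeta z = 1),
   (forall z, ~ qbox x s z -> zeta z = 0 /\ forall i, D i z = 0) &
   forall z, enorm (\row_i D i z : V) <= n%:R * (4 / (s - r))].
Proof.
move=> r0 rs; pose D := s - r; have D0 : 0 < D by rewrite /D; lra.
pose a (j : 'I_n) t := step (- D^-1 * t + (x ord0 j + s) / D).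
pose b (j : 'I_n) t := step (D^-1 * t + - ((x ord0 j - s) / D)).
pose a' (j : 'I_n) t := - D^-1 * dstep (- D^-1 * t + (x ord0 j + s) / D).
pose b' (j : 'I_n) t := D^-1 * dstep (D^-1 * t + - ((x ord0 j - s) / D)).
have Ea j t : - D^-1 * t + (x ord0 j + s) / D = (x ord0 j + s - t) / D by ring.
have Eb j t : D^-1 * t + - ((x ord0 j - s) / D) = (t - (x ord0 j - s)) / D by ring.
pose v j t := a j t * b j t; pose v' j t := a' j t * b j t + a j t * b' j t.
have Cv j : is_C1R (v j) (v' j) by apply: C1R_M; apply: C1R_affine; exact: step_C1.
have a01 j t : 0 <= a j t <= 1 by have [] := step_bounds (- D^-1 * t + (x ord0 j + s) / D).
have b01 j t : 0 <= b j t <= 1 by have [] := step_bounds (D^-1 * t + - ((x ord0 j - s) / D)).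
have v01 j t : 0 <= v j t <= 1.
  have /andP[h1 h2] := a01 j t; have /andP[h3 h4] := b01 j t; rewrite /v mulr_ge0//=.
  by rewrite -[leRHS]mulr1; apply: ler_pM.
have a'2 j t : `|a' j t| <= 2 / D.
  have [_ /andP[h1 h2]] := step_bounds (- D^-1 * t + (x ord0 j + s) / D).
  by rewrite normrM normrN (ger0_norm h1) (ger0_norm (x := D^-1)) ?invr_ge0 ?(ltW D0)// mulrC ler_pM2r// invr_gt0.
have b'2 j t : `|b' j t| <= 2 / D.
  have [_ /andP[h1 h2]] := step_bounds (D^-1 * t + - ((x ord0 j - s) / D)).
  by rewrite normrM (ger0_norm h1) (ger0_norm (x := D^-1)) ?invr_ge0 ?(ltW D0)// mulrC ler_pM2r// invr_gt0.
have v'4 j t : `|v' j t| <= 4 / D.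
  apply: le_trans (ler_normD _ _) _; rewrite (normrM (a' j t)) (normrM (a j t)).
  have /andP[h1 h2] := a01 j t; have /andP[h3 h4] := b01 j t.
  rewrite (ger0_norm h1) (ger0_norm h3).
  have -> : 4 / D = 2 / D * 1 + 1 * (2 / D) by ring.
  by apply: lerD; apply: ler_pM.
have out j t : s <= `|t - x ord0 j| -> v j t = 0 /\ v' j t = 0.
  rewrite ler_normr => /orP[h|h].
    have [e1 e2] : step ((x ord0 j + s - t) / D) = 0 /\ dstep ((x ord0 j + s - t) / D) = 0.
      by apply: step_le0; rewrite pmulr_lle0 ?invr_gt0//; lra.
    by rewrite /v /v' /a /a' Ea e1 e2 !(mulr0, mul0r, addr0).
  have [e1 e2] : step ((t - (x ord0 j - s)) / D) = 0 /\ dstep ((t - (x ord0 j - s)) / D) = 0.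
    by apply: step_le0; rewrite pmulr_lle0 ?invr_gt0//; lra.
  by rewrite /v /v' /b /b' Eb e1 e2 !(mulr0, mul0r, addr0).
exists (fun z => \prod_j v j (z ord0 j)), (fun i z => v' i (z ord0 i) * \prod_(j | j != i) v j (z ord0 j)).
split.
- exact: C1_prod.
- by move=> z; apply/andP; split; [apply: prodr_ge0 => j _; have /andP[] := v01 j (z ord0 j)|exact: prod_le1].
- move=> z hz; apply: big1 => j _; have := hz j; rewrite !mxE => /andP[h1 h2].
  rewrite /v /a /b Ea Eb; have [-> _] : step ((x ord0 j + s - z ord0 j) / D) = 1 /\ dstep ((x ord0 j + s - z ord0 j) / D) = 0.
    by apply: step_ge1; rewrite ler_pdivlMr// /D; lra.
  have [-> _] : step ((z ord0 j - (x ord0 j - s)) / D) = 1 /\ dstep ((z ord0 j - (x ord0 j - s)) / D) = 0.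
    by apply: step_ge1; rewrite ler_pdivlMr// /D; lra.
  by rewrite mulr1.
- move=> z /nqbox[j /out[e1 e2]]; split; first by rewrite (bigD1 j)//= e1 mul0r.
  move=> i; have [->|ji] := eqVneq i j; first by rewrite e2 mul0r.
  by rewrite (bigD1 j) 1?eq_sym//= e1 mul0r mulr0.
- move=> z; apply: enorm_le_sum => i; rewrite mxE normrM -[leRHS]mulr1; apply: ler_pM => //.
  rewrite ger0_norm; first exact: prod_le1.
  by apply: prodr_ge0 => j _; have /andP[] := v01 j (z ord0 j).
Qed.

End cutoff.

(** * Caccioppoli's inequality, De Giorgi's lemma, abstract growth lemma *)

Section degiorgi.
Context (R : realType) (n : nat) (d C0 C1 : R).
Hypotheses (n0 : (0 < n)%N) (d0 : 0 < d) (dn : d < n%:R - 1) (C01 : 1 <= C0) (C11 : 1 <= C1).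
Local Notation V := 'rV[R]_n.
Local Notation mu := (lebesgue_n R n).
Local Notation reg := (regular_set d C0).
Local Notation w Gam := (weight Gam d).
Local Notation set_ := (setting d C0 C1).
Implicit Types (x y z p q : V) (r s t c e l k H T : R) (Gam : set V) (f u v eta : V -> R) (G : V -> V) (A : V -> 'M[R]_n).

Definition iq x r f := ibox (lower x r) (upper x r) f.

Let lw Gam (rG : reg Gam) : locint (w Gam) := locint_weight d0 dn C01 rG.

(** If [u] exceeded [k] at [z], it would do so on a small box with corner [z], where the weight is
    bounded below. The small box extends only upwards from [z], because [z] may lie on a lower face
    of the half-open box. *)
Lemma mass_zero Gam u p q k : reg Gam -> continuous u -> ibox p q (fun z => above u k z * w Gam z) <= 0 ->
  forall z, hbox p q z -> ~ Gam z -> u z <= k.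
Proof.
move=> rG cu I0 z hz Gz; rewrite leNgt; apply/negP => uz.
have [G0 cG _] := rG.
have oU : nbhs z ((~` Gam) `&` [set y | k < u y]).
  apply: open_nbhs_nbhs; split=> //; apply: openI; first exact: closed_openC.
  have := @open_comp _ _ u [set t : R | k < t] (fun z _ => cu z) (@open_gt _ k); exact.
have /nbhs_coordP[e e0 he] := oU.
have dz : 0 < del Gam z by exact: del_gt0.
pose m := \big[Num.min/e]_j (q ord0 j - z ord0 j).
have m0 : 0 < m.
  rewrite /m; elim/big_ind: _ => // [s t s0 t0|j _]; first by rewrite lt_min s0.
  by have /andP[_] := hz j; lra.
have mj j : m <= q ord0 j - z ord0 j by exact: (bigmin_le_cond e (fun j => q ord0 j - z ord0 j)).
have me : m <= e by exact: bigmin_le_id.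
pose z' : V := \row_j (z ord0 j + m).
have zz' j : z ord0 j < z' ord0 j by rewrite mxE; lra.
have sub : hbox z z' `<=` hbox p q.
  by apply: hbox_sub => j; have /andP[? ?] := hz j; rewrite ?mxE; have := mj j; lra.
have near y : hbox z z' y -> ~ Gam y /\ k < u y.
  move=> hy; suff : ((~` Gam) `&` [set y | k < u y]) y by [].
  apply: he => j; have /andP[h1] := hy j; rewrite mxE => h2; rewrite ltr_norml; apply/andP; split; lra.
have [c c0 hc] := weight_lower dn z z' rG.
have : 0 < c * vol z z' by rewrite mulr_gt0// vol_gt0.
rewrite ltNge => /negP; apply; apply: le_trans I0.
rewrite -ibox_cst => [|i]; last exact: ltW.
have la := locint_above d0 dn C01 k rG cu.
apply: (@le_trans _ _ (ibox z z' (fun z => above u k z * w Gam z))).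
  apply: ibox_le; [exact: locint_cst|exact: la|move=> y hy].
  by have [Gy uy] := near y hy; rewrite aboveT// mul1r hc.
apply: ibox_sub la sub _ => y _; by rewrite mulr_ge0 ?above_ge0 ?weight_ge0.
Qed.

Lemma iq_above_le Gam u x r k k' : reg Gam -> continuous u -> k <= k' ->
  iq x r (fun z => above u k' z * w Gam z) <= iq x r (fun z => above u k z * w Gam z).
Proof.
move=> rG cu kk; apply: ibox_le; [exact: (locint_above d0 dn C01 k' rG)|exact: (locint_above d0 dn C01 k rG)|move=> z _].
apply: ler_wpM2r; first exact: weight_ge0.
have [h|h] := leP (u z) k'; first by rewrite aboveF ?above_ge0.
by rewrite !aboveT//; exact: le_lt_trans h.
Qed.

Lemma qbox_mono x r s : r <= s -> qbox x r `<=` qbox x s.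
Proof. by move=> rs; apply: hbox_sub => i; rewrite !mxE; lra. Qed.

Lemma iq_sub Gam x r s f : r <= s -> locint f -> (forall z, 0 <= f z) -> iq x r f <= iq x s f.
Proof. by move=> rs lf f0; apply: ibox_sub lf (qbox_mono rs) _ => z _; exact: f0. Qed.

Lemma doubling : exists2 K, 0 < K & forall Gam, reg Gam -> forall x r s, 0 < r -> r <= s -> s <= 2 * r ->
  iq x s (w Gam) <= K * iq x r (w Gam).
Proof.
have [K K0 H] := mass_ratio n0 d0 dn C01; exists (K * 2 ^+ n); first by rewrite mulr_gt0// exprn_gt0.
move=> Gam rG x r s r0 rs s2.
have s0 : 0 < 2 * s by lra.
have lo i : lower x r ord0 i <= upper x r ord0 i by rewrite !mxE; lra.
have := H _ rG _ _ _ _ _ _ s0 (qbox_tbox x s) lo (qbox_mono rs).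
have -> : vol (lower x r) (upper x r) = (2 * r) ^+ n.
  by rewrite /vol (eq_bigr (fun=> 2 * r)) ?prodr_const ?card_ord// => i _; rewrite !mxE; ring.
have r2 : 0 < (2 * r) ^+ n by rewrite exprn_gt0// mulr_gt0.
have I0 : 0 <= iq x r (w Gam) by apply: ibox_ge0 => z _; exact: weight_ge0.
have sr : (2 * s) ^+ n <= 2 ^+ n * (2 * r) ^+ n by rewrite -exprMn lerXn2r ?nnegrE//; lra.
rewrite -/(iq x s _) -/(iq x r _) => h; rewrite -(ler_pM2l r2); apply: le_trans h _.
rewrite (_ : _ * (K * _ * _) = K * (2 ^+ n * (2 * r) ^+ n) * iq x r (w Gam)); last by ring.
by apply: ler_wpM2r => //; rewrite ler_pM2l.
Qed.

(** The multiplier [F'] has to be continuous, so it is a ramp from 0 at level [k] to 1 at level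
    [k']; hence energy above [k'] is bounded by mass above [k]. The constant does not see the width
    of the ramp, because F(t) is at most F'(t) times the positive part of t - k. *)
Lemma cacc : exists2 K, 0 < K & forall Gam A u G x r s k k' S, set_ Gam A -> sol d Gam A u G ->
  0 < r -> r < s -> k < k' -> 0 <= S -> (forall z, qbox x s z -> u z <= k + S) ->
  (forall z, Gam z -> qbox x s z -> u z <= k) ->
  iq x r (fun z => above u k' z * (enorm (G z) ^+ 2 * w Gam z)) <=
  K * (S / (s - r)) ^+ 2 * iq x s (fun z => above u k z * w Gam z).
Proof.
have C10 : 0 < C1 by exact: lt_le_trans C11.
have nR : 0 < n%:R :> R by rewrite ltr0n.
exists (4 * C1 ^+ 4 * (n%:R * 4) ^+ 2); first by rewrite !mulr_gt0// exprn_gt0// mulr_gt0.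
move=> Gam A u G x r s k k' S sA su r0 rs kk S0 uS uG.
have rG : reg Gam by case: sA. have cu : continuous u by case: su.
have [zeta [D [Cz z01 z1 zout Dle]]] := cube_cutoff x r0 rs.
set L := n%:R * (4 / (s - r)) in Dle.
pose e := k' - k; have e0 : 0 < e by rewrite /e; fast_lra.
pose F t := (2 * e)^-1 * (posq (t - k) - posq (t - k')).
pose F' t := e^-1 * (pos (t - k) - pos (t - k')).
have CF : is_C1R F F'.
  have S' c := @C1R_affine R 1 (- c) _ _ (@posq_C1 R).
  have := C1R_Z (2 * e)^-1 (C1R_D (S' k) (C1R_Z (-1) (S' k'))).
  by congr is_C1R; apply/funext => t; rewrite /F /F' !mul1r; [ring|field; fast_lra].
have Ff t : [/\ 0 <= F' t <= 1, 0 <= F t, F t <= F' t * pos (t - k), F' t <= (k < t)%R%:R & k' <= t -> F' t = 1].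
  rewrite /F /F' /posq; have [h|h] := leP t k.
    rewrite !pos_le0; [|fast_lra..]; rewrite expr0n /= !subrr !mulr0 !lexx ler01; split=> // h'; fast_lra.
  have [h1|h1] := leP k' t.
    rewrite !pos_id; [|fast_lra..].
    have -> : t - k - (t - k') = e by rewrite /e; ring.
    rewrite mulVf ?gt_eqF// mul1r.
    have -> : (2 * e)^-1 * ((t - k) ^+ 2 - (t - k') ^+ 2) = (t - k) - e / 2 by rewrite /e; field; rewrite -/e; fast_lra.
    by rewrite /e !lexx; split => //; fast_lra.
  rewrite (pos_id (t := t - k)) ?(pos_le0 (t := t - k')); [|fast_lra..].
  rewrite subr0 expr0n subr0; set y := t - k; have y0 : 0 < y by rewrite /y; fast_lra.
  have ye : e^-1 * y <= 1 by rewrite mulrC ler_pdivrMr// /y /e; fast_lra.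
  have ye0 : 0 <= e^-1 * y by rewrite mulr_ge0 ?invr_ge0 ?ltW.
  split=> //; first by rewrite ye0.
    by rewrite mulr_ge0 ?sqr_ge0 ?invr_ge0 ?mulr_ge0 ?ltW.
  rewrite -mulrA -expr2; apply: ler_wpM2r; first exact: sqr_ge0.
  by rewrite lef_pV2 ?posrE; fast_lra.
have Ce := C1M Cz Cz; have [cz cD _] := Cz.
have eta01 z : 0 <= zeta z * zeta z <= 1.
  by have /andP[h1 h2] := z01 z; rewrite mulr_ge0//= -[leRHS]mulr1; apply: ler_pM.
pose p := lower x s; pose q := upper x s.
have De i z : ~ hbox p q z -> D i z * zeta z + zeta z * D i z = 0.
  by move=> /zout[-> ->]; rewrite !mul0r addr0.
have FG z : Gam z -> F (u z) * (zeta z * zeta z) = 0.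
  move=> Gz; have [hz|/zout[-> _]] := pselect (qbox x s z); last by rewrite !mulr0.
  by rewrite /F /posq !pos_le0 ?subrr ?mulr0 ?mul0r//; have := uG z Gz hz; fast_lra.
have := energy_ineq d0 dn C01 C11 sA su CF Ce (fun t => let: And5 h _ _ _ _ := Ff t in h) eta01 De FG.
pose E z := enorm (G z) ^+ 2 * w Gam z.
pose X z := F' (u z) * (zeta z * zeta z) * E z.
have X0 z : ~ hbox p q z -> X z = 0 by rewrite /X => /zout[-> _]; rewrite !mulr0 mul0r.
rewrite (ibox_setT (a := p) (b := q) (f := X) X0).
have lE := sol_energy su; have w0 := weight_ge0 d Gam.
have E0 z : 0 <= E z by rewrite mulr_ge0 ?sqr_ge0.
have cF' : continuous (fun z => F' (u z)) by have [h _] := CF; exact: cont_comp cu h.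
have cF : continuous (fun z => F (u z)) := cont_comp cu (C1R_cont CF).
have lX : locint X by apply: locint_ker lE _; apply: contM => //; exact: contM.
have la := locint_above d0 dn C01 k rG cu.
set Y := (fun z => _ * _ * (_ * w Gam z)).
have cDD : continuous (fun z => enorm (\row_i (D i z * zeta z + zeta z * D i z) : V)).
  by apply: row_enorm_cont => i; apply: contD; exact: contM.
have lY : locint Y.
  apply: locint_ker (sol_Gw d0 dn C01 sA su) _; apply: contM => //.
  exact: (cont_comp (v := fun t : R => `|t|) cF (@norm_continuous _ _)).
have YX z : hbox p q z -> C1 ^+ 2 * Y z <= 1 / 2 * X z + 2 * C1 ^+ 4 * L ^+ 2 * S ^+ 2 * (above u k z * w Gam z).
  move=> hz; have [/andP[f0 f1] F0 FF fk _] := Ff (u z); have /andP[zz0 zz1] := z01 z.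
  rewrite /Y; have -> : \row_i (D i z * zeta z + zeta z * D i z) = (2 * zeta z) *: (\row_i D i z : V).
    by apply/rowP => i; rewrite !mxE; ring.
  rewrite enormZ (ger0_norm F0) ger0_norm ?mulr_ge0// /X /E.
  set g := enorm (G z); set dd := enorm _; have g0 : 0 <= g by exact: enorm_ge0.
  have dd0 : 0 <= dd by exact: enorm_ge0. have ddL : dd <= L by exact: Dle.
  set P := pos (u z - k); have P0 : 0 <= P by exact: pos_ge0.
  have PS : P <= S.
    rewrite /P; have := uS z hz => h; have [h'|h'] := leP (u z - k) 0; first by rewrite pos_le0.
    by rewrite pos_id; fast_lra.
  have fa : F' (u z) <= above u k z.
    apply: le_trans fk _; have [h|h] := leP (u z) k; first exact: above_ge0.
    by rewrite aboveT.
  have L0 : 0 <= L by exact: le_trans ddL.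
  have s1 : C1 ^+ 2 * (F (u z) * (2 * zeta z * dd) * (g * w Gam z)) <=
     F' (u z) * w Gam z * (1 / 2 * (zeta z * g) ^+ 2 + 2 * C1 ^+ 4 * (P * dd) ^+ 2).
    apply: (@le_trans _ _ (C1 ^+ 2 * (F' (u z) * P * (2 * zeta z * dd) * (g * w Gam z)))).
      by rewrite ler_pM2l ?exprn_gt0//; apply: ler_wpM2r; [rewrite mulr_ge0|apply: ler_wpM2r => //; rewrite !mulr_ge0].
    (* Young's inequality, as a completed square; half of the energy is then absorbed on the
       left. *)
    rewrite -subr_ge0 (_ : _ - _ = F' (u z) * w Gam z * (2^-1 * (zeta z * g - 2 * C1 ^+ 2 * (P * dd)) ^+ 2)); last by field.
    by apply: mulr_ge0; [exact: mulr_ge0|apply: mulr_ge0; [rewrite invr_ge0|exact: sqr_ge0]].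
  apply: le_trans s1 _; rewrite mulrDr; apply: lerD.
    by rewrite le_eqVlt; apply/orP; left; apply/eqP; ring.
  rewrite (_ : _ * (above u k z * w Gam z) = above u k z * w Gam z * (2 * C1 ^+ 4 * (S * L) ^+ 2)); last by ring.
  have C14 : 0 < 2 * C1 ^+ 4 by rewrite mulr_gt0// exprn_gt0.
  apply: ler_pM.
  - exact: mulr_ge0.
  - by apply: mulr_ge0; [exact: ltW|exact: sqr_ge0].
  - exact: ler_wpM2r.
  - have PD : P * dd <= S * L by apply: ler_pM.
    have PD0 : 0 <= P * dd by apply: mulr_ge0.
    rewrite ler_pM2l//; apply: lerXn2r; rewrite ?nnegrE//; exact: le_trans PD0 PD.
have hY : C1 ^+ 2 * ibox p q Y <= 1 / 2 * ibox p q X + 2 * C1 ^+ 4 * L ^+ 2 * S ^+ 2 * ibox p q (fun z => above u k z * w Gam z).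
  rewrite -(iboxZ _ _ _ lY) -(iboxZ _ _ _ lX) -(iboxZ _ _ _ la) -iboxD; [|exact: locintZ|exact: locintZ].
  apply: ibox_le; [exact: locintZ|apply: locintD; exact: locintZ|exact: YX].
move=> h; have {h hY}h : ibox p q X <= 4 * C1 ^+ 4 * L ^+ 2 * S ^+ 2 * ibox p q (fun z => above u k z * w Gam z).
  by move: (le_trans h hY); fast_lra.
have -> : 4 * C1 ^+ 4 * (n%:R * 4) ^+ 2 * (S / (s - r)) ^+ 2 = 4 * C1 ^+ 4 * L ^+ 2 * S ^+ 2.
  by rewrite /L; field; fast_lra.
apply: le_trans h.
apply: (@le_trans _ _ (iq x r X)); last first.
  apply: iq_sub => //; first exact: ltW.
  move=> z; have [/andP[f0 _] _ _ _ _] := Ff (u z); have /andP[zz0 _] := eta01 z.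
  by rewrite /X; apply: mulr_ge0 => //; exact: mulr_ge0.
have laE : locint (fun z => above u k' z * E z).
  apply: locintM lE; first exact: measurable_above.
  by move=> a b; exists 1 => z _; rewrite ger0_norm ?above_ge0 ?above_le1.
apply: ibox_le; [exact: laE|exact: lX|move=> z hz].
have [/andP[f0 _] _ _ _ f1] := Ff (u z).
rewrite /X (z1 z hz) !mulr1; apply: (ler_wpM2r (E0 z)).
have [h|h] := leP (u z) k'; first by rewrite aboveF.
by rewrite aboveT// f1// ltW.
Qed.

(** [F'] lives on the shell where [u] is between [k1] and [k2]. Young's inequality with parameter
    [th] bounds the gradient of F(u) by energy plus the mass of the shell, a difference that
    telescopes in [growth]. *)
Lemma level_energy Gam A u G p q k k1 k2 t0 : set_ Gam A -> sol d Gam A u G -> k < k1 -> k1 < k2 -> 0 < t0 ->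
  (forall i, p ord0 i <= q ord0 i) ->
  (forall z y, hbox p q z -> Gam y -> (forall j, `|y ord0 j - z ord0 j| <= t0) -> u y <= k) ->
  exists F gb, [/\ grad_bound d Gam p q (fun z => F (u z)) gb, (forall t, 0 <= F t <= 1),
    (forall t, t <= k1 -> F t = 0), (forall t, k2 <= t -> F t = 1) &
    forall th, 0 < th -> ibox p q (fun z => gb z * w Gam z) <= 2 / (k2 - k1) *
      (th / 2 * ibox p q (fun z => above u k1 z * (enorm (G z) ^+ 2 * w Gam z)) +
       (2 * th)^-1 * (ibox p q (fun z => above u k1 z * w Gam z) - ibox p q (fun z => above u k2 z * w Gam z)))].
Proof.
move=> sA su kk1 kk2 t00 pq hb; have rG : reg Gam by case: sA. have cu : continuous u by case: su.
have [F [F' [CF F01 F'b F0 F1]]] := level_fun kk2.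
have e0 : 0 < k1 - k by fast_lra.
have F'0 c : c <= k + (k1 - k) -> F' c = 0 by move=> h; have [_ ->//] : F c = 0 /\ F' c = 0 by apply: F0; fast_lra.
have gB := sol_grad_bound d0 dn C01 sA su CF (@C1_cst R n 1) e0 F'0 t00 pq
  (fun z y hz _ => hb z y hz) (fun i z => mulr0 _).
exists F, (fun z => `|F' (u z) * 1| * enorm (G z)); split.
- by move: gB; congr grad_bound; apply/funext => z; rewrite mulr1.
- exact: F01.
- by move=> t /F0[].
- by move=> t /F1[].
move=> th th0; pose E z := enorm (G z) ^+ 2 * w Gam z.
have w0 := weight_ge0 d Gam; have lE := sol_energy su.
have la k' := locint_above d0 dn C01 k' rG cu.
have laE : locint (fun z => above u k1 z * E z).
  apply: locintM lE; first exact: measurable_above.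
  by move=> a b; exists 1 => z _; rewrite ger0_norm ?above_ge0 ?above_le1.
have [_ _ lgw _ _] := gB.
have l1 := locintZ (th / 2) laE; have l2 := locintB (la k1) (la k2); have l3 := locintZ (2 * th)^-1 l2.
rewrite -(iboxB _ _ (la k1) (la k2)) -(iboxZ _ _ _ laE) -(iboxZ _ _ _ l2) -(iboxD _ _ l1 l3) -(iboxZ _ _ _ (locintD l1 l3)).
apply: ibox_le; [exact: lgw|exact: (locintZ _ (locintD l1 l3))|move=> z _].
rewrite mulr1; have /andP[f0 f1] := F'b (u z); rewrite ger0_norm//.
have k20 : 0 < k2 - k1 by fast_lra.
have g0 := enorm_ge0 (G z).
have [h|h] := leP (u z) k1.
  have [_ ->] := F0 _ h; rewrite !mul0r !aboveF//; last fast_lra.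
  by rewrite !mul0r subrr !mulr0 addr0 mulr0.
have [h2|h2] := leP k2 (u z).
  have [_ ->] := F1 _ h2; rewrite !mul0r; apply: mulr_ge0; first by rewrite divr_ge0// ltW.
  apply: addr_ge0; apply: mulr_ge0; rewrite ?divr_ge0 ?invr_ge0 ?mulr_ge0 ?above_ge0 ?sqr_ge0 ?(ltW th0)//.
  by rewrite aboveT// mul1r -[X in X - _]mul1r -mulrBl mulr_ge0// subr_ge0 above_le1.
rewrite aboveT// (aboveF (ltW h2)) !mul1r mul0r subr0.
rewrite -mulrA; apply: ler_pM => //; first exact: mulr_ge0.
rewrite /E mulrA -mulrDl; apply: ler_wpM2r => //.
rewrite -subr_ge0 (_ : _ - _ = (2 * th)^-1 * (th * enorm (G z) - 1) ^+ 2); last by field; rewrite gt_eqF.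
by rewrite mulr_ge0 ?sqr_ge0// invr_ge0 mulr_ge0// ltW.
Qed.

Lemma iq_ge0 x r f : (forall z, 0 <= f z) -> 0 <= iq x r f.
Proof. by move=> f0; apply: ibox_ge0. Qed.

(** If the level set has relative mass about 2^(-nP), [small_support_poincare] applies to F(u) at
    scale 2^(-P) r, and [cacc] bounds the energy. The gain 2^(-P) competes with the loss r H / (D (s
    - r)) from shrinking cube and level step. *)
Lemma small_step : exists2 K : R * R, 0 < K.1 /\ 0 < K.2 &
  forall Gam A u G x r s k k0 H (P : nat), set_ Gam A -> sol d Gam A u G -> 0 < r -> r < s -> k < k0 -> 0 < H ->
  (forall z, qbox x s z -> u z <= k0 + H) -> (forall z, Gam z -> qbox x s z -> u z <= k) ->
  forall D, 0 < D ->
  iq x s (fun z => above u k0 z * w Gam z) <= K.2 * (2^-1 ^+ n) ^+ P * iq x r (w Gam) ->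
  iq x r (fun z => above u (k0 + D) z * w Gam z) <=
    K.1 * 2^-1 ^+ P * r * H / (D * (s - r)) * iq x s (fun z => above u k0 z * w Gam z).
Proof.
have [Kc Kc0 HC] := cacc; have [[K1 c1] /= [K10 c10] HF] := small_support_poincare n0 d0 dn C01.
exists (K1 * 4 * (Kc + 1), c1); first by rewrite /= !mulr_gt0//; fast_lra.
move=> Gam A u G x r s k k0 H P sA su r0 rs kk H0 uH uG D D0 /= small.
have rG : reg Gam by case: sA. have cu : continuous u by case: su.
have w0 := weight_ge0 d Gam.
pose k1 := k0 + D / 2; pose k2 := k0 + D.
have sr0 : 0 < s - r by fast_lra.
have lo i : lower x r ord0 i <= upper x r ord0 i by rewrite !mxE; fast_lra.
have hb z y : hbox (lower x r) (upper x r) z -> Gam y -> (forall j, `|y ord0 j - z ord0 j| <= (s - r) / 2) -> u y <= k.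
  move=> hz Gy h; apply: uG => // j; have := hz j; have := h j; rewrite !mxE ler_norml => /andP[? ?] /andP[? ?].
  by apply/andP; split; fast_lra.
have k01 : k < k1 by rewrite /k1; fast_lra.
have k12 : k1 < k2 by rewrite /k1 /k2; fast_lra.
have kk1 : k0 < k1 by rewrite /k1; fast_lra.
have t00 : 0 < (s - r) / 2 by fast_lra.
have [F [gb [gB F01 F0 F1 en]]] := level_energy sA su k01 k12 t00 lo hb.
have [cf _ _ _ _] := gB.
set M := iq x s _ in small *; have M0 : 0 <= M by apply: iq_ge0 => z; rewrite mulr_ge0 ?above_ge0.
have la k' := locint_above d0 dn C01 k' rG cu.
have m1 : iq x r (fun z => above u k1 z * w Gam z) <= M.
  apply: le_trans (iq_above_le x r rG cu (ltW kk1)) _; apply: (@iq_sub Gam) => //; first exact: ltW.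
  by move=> z; rewrite mulr_ge0 ?above_ge0.
have r20 : 0 < 2 * r by fast_lra.
have small' : ibox (lower x r) (upper x r) (fun z => above (fun z => F (u z)) 0 z * w Gam z) <=
    c1 * (2^-1 ^+ n) ^+ P * ibox (lower x r) (upper x r) (w Gam).
  apply: le_trans small; apply: le_trans m1; apply: ibox_le; [exact: (locint_above d0 dn C01 0 rG cf)|exact: la|].
  move=> z _; apply: ler_wpM2r => //; have [h|h] := leP (u z) k1.
    by rewrite !aboveF// F0.
  by rewrite [leRHS]aboveT// above_le1.
have Fge0 z : 0 <= F (u z) by have /andP[] := F01 (u z).
have := HF _ rG _ _ _ _ _ P r20 (qbox_tbox x r) gB Fge0 small'.
set J := ibox _ _ (fun z => gb z * _) => hF.
have uH' z : qbox x s z -> u z <= k0 + H by exact: uH.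
have uk0 z : Gam z -> qbox x s z -> u z <= k0 by move=> Gz hz; have := uG z Gz hz; fast_lra.
have cE := HC _ _ _ _ x r s k0 k1 H sA su r0 rs kk1 (ltW H0) uH' uk0.
(* The value that gives the energy term and the shell term of [level_energy] the same order. *)
pose th := (s - r) / H; have th0 : 0 < th by rewrite divr_gt0.
have := en th th0; rewrite -/J -/(iq x r _) -/(iq x r _) -/(iq x r _) => hJ.
have m2 : 0 <= iq x r (fun z => above u k2 z * w Gam z) by apply: iq_ge0 => z; rewrite mulr_ge0 ?above_ge0.
have {}hJ : J <= 2 * (Kc + 1) * H / (D * (s - r)) * M.
  apply: le_trans hJ _.
  have D2 : k2 - k1 = D / 2 by rewrite /k1 /k2; field.
  rewrite D2 (_ : _ / (D * (s - r)) * M = 2 / (D / 2) * (th / 2 * (Kc * (H / (s - r)) ^+ 2 * M) + (2 * th)^-1 * M)); last first.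
    by rewrite /th; field; rewrite !gt_eqF.
  apply: ler_wpM2l; first by rewrite !divr_ge0 ?ltW// divr_gt0.
  apply: lerD; apply: ler_wpM2l.
  - by rewrite divr_ge0// ltW.
  - exact: cE.
  - by rewrite invr_ge0 mulr_ge0// ltW.
  - by apply: le_trans m1; rewrite gerBl.
apply: (@le_trans _ _ (ibox (lower x r) (upper x r) (fun z => F (u z) * w Gam z))).
  apply: ibox_le; [exact: la|exact: locint_ker (lw rG) cf|move=> z _].
  apply: ler_wpM2r => //; have [h|h] := leP (u z) (k0 + D); first by rewrite aboveF.
  by rewrite aboveT// F1// ltW.
apply: le_trans hF _.
rewrite (_ : _ * M = K1 * 2^-1 ^+ P * (2 * r) * (2 * (Kc + 1) * H / (D * (s - r)) * M)); last first.
  by field; rewrite !gt_eqF.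
by apply: ler_wpM2l => //; rewrite !mulr_ge0 ?exprn_ge0 ?invr_ge0// ltW.
Qed.

(** Radii decrease to [r / 2] and levels increase to [k0 + H / 2], both with steps of order 2^(-j),
    which costs 4^j at step [j]. The invariant is that the mass decays like q^(2j) with q = 2^(-n);
    thus [small_step] can be used with [P = p0 + 2 * j], and its gain 2^(-2j) compensates the
    cost. *)
Lemma degiorgi : exists2 nu : R, 0 < nu & forall Gam A u G x r k k0 H, set_ Gam A -> sol d Gam A u G ->
  0 < r -> k < k0 -> 0 < H -> (forall z, qbox x r z -> u z <= k0 + H) -> (forall z, Gam z -> qbox x r z -> u z <= k) ->
  iq x r (fun z => above u k0 z * w Gam z) <= nu * iq x r (w Gam) -> forall z, qbox x (r / 2) z -> u z <= k0 + H / 2.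
Proof.
have [[K c] /= [K0 c0] HS] := small_step; have [Kd Kd0 HD] := doubling.
pose q : R := 2^-1 ^+ n; have q0 : 0 < q by rewrite exprn_gt0// invr_gt0.
have q1 : q <= 2^-1 by rewrite /q -(prednK n0) exprS ger_pMr ?invr_gt0// exprn_ile1//; fast_lra.
(* Chosen so that [16 * K * 2^(-p0)] is below [q^2], the decay that the induction requires at each
   step; 16 comes from the two increments [h j / 4]. *)
have [p0 hp0] := half_expr_small (divr_gt0 (exprn_gt0 2 q0) (mulr_gt0 (ltr0Sn R 15) K0)).
exists (c * q ^+ p0 / Kd); first by rewrite divr_gt0// mulr_gt0// exprn_gt0.
move=> Gam A u G x r k k0 H sA su r0 kk H0 uH uG small.
have rG : reg Gam by case: sA. have cu : continuous u by case: su.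
have w0 := weight_ge0 d Gam.
pose h j : R := 2^-1 ^+ j; have h0 j : 0 < h j by rewrite exprn_gt0// invr_gt0.
have h1 j : h j <= 1 by rewrite exprn_ile1//; fast_lra.
have hS j : h j.+1 = h j / 2 by rewrite /h exprS mulrC.
pose rr j := r / 2 * (1 + h j); pose kk' j := k0 + H / 2 * (1 - h j).
pose M j := iq x (rr j) (fun z => above u (kk' j) z * w Gam z).
have rrS j : rr j - rr j.+1 = r * h j / 4 by rewrite /rr hS; field.
have rr0 j : r / 2 < rr j by rewrite /rr ltr_pMr; [have := h0 j; fast_lra|fast_lra].
have rr1 j : rr j <= r.
  rewrite /rr -[leRHS](divfK (x := 2))// ?pnatr_eq0// ler_pM2l; [have := h1 j; fast_lra|fast_lra].
have kk0 j : k0 <= kk' j by rewrite /kk' lerDl mulr_ge0//; [fast_lra|have := h1 j; fast_lra].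
have kk1 j : kk' j <= k0 + H / 2.
  by rewrite /kk' lerD2l -[leRHS]mulr1 ler_pM2l; [have := h0 j; fast_lra|fast_lra].
have la k' := locint_above d0 dn C01 k' rG cu.
set m := iq x r (w Gam) in small; have m0 : 0 <= m by exact: iq_ge0.
have M0 j : 0 <= M j by apply: iq_ge0 => z; rewrite mulr_ge0 ?above_ge0.
have M0m : M 0%N <= c * q ^+ p0 / Kd * m.
  rewrite /M; have -> : rr 0%N = r by rewrite /rr /h expr0; field.
  by have -> : kk' 0%N = k0 by rewrite /kk' /h expr0; ring.
have MD j : M j <= (q ^+ 2) ^+ j * M 0%N.
  elim: j => [|j IH]; first by rewrite expr0 mul1r.
  have sm : M j <= c * q ^+ (p0 + 2 * j) * iq x (rr j.+1) (w Gam).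
    apply: le_trans IH _; rewrite exprD exprM.
    have md : m <= Kd * iq x (rr j.+1) (w Gam).
      by apply: HD => //; [have := rr0 j.+1; fast_lra|have := rr0 j.+1; fast_lra].
    have qj : 0 <= (q ^+ 2) ^+ j by rewrite exprn_ge0// exprn_ge0// ltW.
    apply: (@le_trans _ _ ((q ^+ 2) ^+ j * (c * q ^+ p0 / Kd * (Kd * iq x (rr j.+1) (w Gam))))).
      apply: ler_wpM2l => //; apply: le_trans M0m _; apply: ler_wpM2l => //.
      by rewrite divr_ge0 ?mulr_ge0 ?exprn_ge0// ltW.
    by rewrite le_eqVlt; apply/orP; left; apply/eqP; field; rewrite gt_eqF.
  have D0 : 0 < H * h j / 4 by rewrite divr_gt0// mulr_gt0.
  have := HS Gam A u G x (rr j.+1) (rr j) k (kk' j) H (p0 + 2 * j)%N sA su.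
  have kS : kk' j + H * h j / 4 = kk' j.+1 by rewrite /kk' hS; field.
  move=> /(_ _ _ _ H0 _ _ _ D0); rewrite rrS kS -/(M j.+1) -/(M j) => Hs.
  have {}Hs : M j.+1 <= K * 2^-1 ^+ (p0 + 2 * j) * rr j.+1 * H / (H * h j / 4 * (r * h j / 4)) * M j.
    apply: Hs => //.
    - by have := rr0 j.+1; fast_lra.
    - by rewrite -subr_gt0 rrS divr_gt0// mulr_gt0.
    - exact: lt_le_trans (kk0 j).
    - by move=> z /(qbox_mono (rr1 j)) /uH; have := kk0 j; fast_lra.
    - by move=> z Gz /(qbox_mono (rr1 j)); exact: uG.
  apply: le_trans Hs _; rewrite exprS -(mulrA (q ^+ 2)); apply: ler_pM => //.
  - have rj : 0 < rr j.+1 by have := rr0 j.+1; fast_lra.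
    have A1 : 0 < K * 2^-1 ^+ (p0 + 2 * j) * rr j.+1 * H
      by apply: mulr_gt0 => //; apply: mulr_gt0 => //; apply: mulr_gt0 => //; rewrite exprn_gt0// invr_gt0.
    have A2 : 0 < H * h j / 4 * (r * h j / 4) by apply: mulr_gt0 => //; rewrite divr_gt0// mulr_gt0.
    exact: divr_ge0 (ltW A1) (ltW A2).
  - have -> : 2^-1 ^+ (p0 + 2 * j) = 2^-1 ^+ p0 * (h j) ^+ 2 by rewrite exprD mulnC exprM.
    have -> : K * (2^-1 ^+ p0 * h j ^+ 2) * rr j.+1 * H / (H * h j / 4 * (r * h j / 4)) = 2^-1 ^+ p0 * (16 * K) * (rr j.+1 / r).
      by field; rewrite !gt_eqF.
    have b1 : 2^-1 ^+ p0 * (16 * K) <= q ^+ 2 by rewrite -ler_pdivlMr ?mulr_gt0// ltW.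
    have b2 : rr j.+1 / r <= 1 by rewrite ler_pdivrMr// mul1r.
    rewrite -[leRHS]mulr1; apply: ler_pM => //.
      by rewrite mulr_ge0 ?exprn_ge0 ?invr_ge0// mulr_ge0// ltW.
    by rewrite divr_ge0 ?(ltW r0)//; have := rr0 j.+1; fast_lra.
have Z : iq x (r / 2) (fun z => above u (k0 + H / 2) z * w Gam z) <= 0.
  apply: (ler_eps (M0 0%N)) => e e0; rewrite add0r.
  have [j hj] := half_expr_small e0.
  apply: (@le_trans _ _ (M j)).
    apply: le_trans (iq_above_le x (r / 2) rG cu (kk1 j)) _.
    by apply: (@iq_sub Gam) => //; [exact: ltW|move=> z; rewrite mulr_ge0 ?above_ge0].
  apply: le_trans (MD j) _; apply: ler_wpM2r => //; apply: le_trans (ltW hj); rewrite -exprM.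
  apply: (@le_trans _ _ (q ^+ j)).
    by apply: ler_wiXn2l; [exact: ltW|fast_lra|rewrite mul2n -addnn leq_addr].
  by apply: lerXn2r; rewrite ?nnegrE ?invr_ge0 ?(ltW q0).
move=> z hz; have [Gz|Gz] := pselect (Gam z); last exact: mass_zero rG cu Z _ hz Gz.
by have := uG z Gz (qbox_mono _ hz); move=> h'; have := h' ltac:(fast_lra); fast_lra.
Qed.

Lemma growth (KP : R) : 0 < KP -> exists2 c, 0 < c & forall Gam A u G x r k T H, set_ Gam A -> sol d Gam A u G ->
  0 < r -> 0 < H -> k < T - H -> (forall z, qbox x (2 * r) z -> u z <= T) ->
  (forall z, Gam z -> qbox x (2 * r) z -> u z <= k) ->
  (forall F gb, grad_bound d Gam (lower x r) (upper x r) (fun z => F (u z)) gb -> (forall t, 0 <= F t <= 1) ->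
    (forall t, t <= T - H -> F t = 0) -> iq x r (fun z => F (u z) * w Gam z) <= KP * r * iq x r (fun z => gb z * w Gam z)) ->
  forall z, qbox x (r / 2) z -> u z <= T - c * H.
Proof.
move=> KP0; have [nu nu0 HN] := degiorgi; have [Kc Kc0 HC] := cacc; have [Kd Kd0 HD] := doubling.
pose a := 4 * KP; have a0 : 0 < a by rewrite mulr_gt0.
pose K := Kc * Kd; have K0 : 0 < K by rewrite mulr_gt0.
(* With this parameter the energy terms contribute at most half of the threshold [nu]; the other
   half determines the number [N] of levels. *)
pose eps := nu / (2 * a * K); have eps0 : 0 < eps by rewrite divr_gt0// !mulr_gt0.
have b0 : 0 <= 2 * a / (eps * nu) by rewrite ltW// divr_gt0// mulr_gt0.
pose N := (Num.bound (2 * a / (eps * nu))).+1.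
have NR : 2 * a / (eps * nu) <= N%:R by apply/ltW/(lt_trans (archi_boundP b0)); rewrite ltr_nat.
have N0 : 0 < N%:R :> R by rewrite ltr0n.
exists (2^-1 ^+ N / 2); first by rewrite divr_gt0// exprn_gt0// invr_gt0.
move=> Gam A u G x r k T H sA su r0 H0 kT uT uG prem.
have rG : reg Gam by case: sA. have cu : continuous u by case: su.
have w0 := weight_ge0 d Gam.
pose h j : R := H * 2^-1 ^+ j; have h0 j : 0 < h j by rewrite mulr_gt0// exprn_gt0// invr_gt0.
have hH j : h j <= H by rewrite /h ger_pMr// exprn_ile1//; fast_lra.
have hS j : h j.+1 = h j / 2 by rewrite /h exprS; field.
pose kj j := T - h j; pose m := iq x r (w Gam).
pose M j := iq x r (fun z => above u (kj j) z * w Gam z).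
have M0 j : 0 <= M j by apply: iq_ge0 => z; rewrite mulr_ge0 ?above_ge0.
have la k' := locint_above d0 dn C01 k' rG cu.
have Mm j : M j <= m.
  apply: ibox_le; [exact: la|exact: lw|move=> z _].
  by rewrite ler_piMl ?above_le1.
have kk j : k < kj j by rewrite /kj; have := hH j; fast_lra.
have lo i : lower x r ord0 i <= upper x r ord0 i by rewrite !mxE; fast_lra.
have r2 : r < 2 * r by fast_lra.
have hb z y : hbox (lower x r) (upper x r) z -> Gam y -> (forall j, `|y ord0 j - z ord0 j| <= r / 2) -> u y <= k.
  move=> hz Gy hy; apply: uG => // j; have := hz j; have := hy j; rewrite !mxE ler_norml => /andP[? ?] /andP[? ?].
  by apply/andP; split; fast_lra.
have step j : M j.+1 <= a * (eps * K * m + (M j - M j.+1) / eps).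
  pose k1 := T - 3 / 4 * h j.
  have e1 : kj j < k1 by rewrite /k1 /kj; have := h0 j; fast_lra.
  have e2 : k1 < kj j.+1 by rewrite /k1 /kj hS; have := h0 j; fast_lra.
  have [F [gb [gB F01 F0 F1 en]]] := level_energy sA su (lt_trans (kk j) e1) e2 (divr_gt0 r0 (ltr0Sn _ 1)) lo hb.
  have [cf _ _ _ _] := gB.
  have Fz t : t <= T - H -> F t = 0 by move=> ht; apply: F0; rewrite /k1; have := hH j; have := h0 j; fast_lra.
  have hP := prem F gb gB F01 Fz.
  have th0 : 0 < eps * r / h j by rewrite divr_gt0// mulr_gt0.
  have := en _ th0; rewrite -/(iq x r _) -/(iq x r _) -/(iq x r _) -/(iq x r _) -/(M j.+1) => hJ.
  set J := iq x r (fun z => gb z * _) in hP hJ.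
  have uS z : qbox x (2 * r) z -> u z <= kj j + h j by move=> /uT; rewrite /kj; fast_lra.
  have uk z : Gam z -> qbox x (2 * r) z -> u z <= kj j by move=> Gz /(uG z Gz); have := kk j; fast_lra.
  have cE := HC _ _ _ _ x r (2 * r) (kj j) k1 (h j) sA su r0 r2 e1 (ltW (h0 j)) uS uk.
  have m2 : iq x (2 * r) (fun z => above u (kj j) z * w Gam z) <= Kd * m.
    apply: (@le_trans _ _ (iq x (2 * r) (w Gam))).
      apply: ibox_le; [exact: la|exact: lw|move=> z _]; by rewrite ler_piMl ?above_le1.
    by apply: HD => //; exact: ltW.
  have m1 : iq x r (fun z => above u k1 z * w Gam z) <= M j by apply: iq_above_le => //; exact: ltW.
  have dk : kj j.+1 - k1 = h j / 4 by rewrite /kj /k1 hS; field.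
  have J1 : J <= 4 / r * (eps * K * m + (M j - M j.+1) / eps).
    apply: le_trans hJ _; rewrite dk.
    rewrite (_ : 4 / r * _ = 2 / (h j / 4) * ((eps * r / h j) / 2 * (Kc * (h j / (2 * r - r)) ^+ 2 * (Kd * m)) +
       (2 * (eps * r / h j))^-1 * (M j - M j.+1))); last first.
      by rewrite /K; field; rewrite !gt_eqF//; fast_lra.
    apply: ler_wpM2l; first by rewrite !divr_ge0 ?ltW// divr_gt0.
    apply: lerD; apply: ler_wpM2l.
    - by rewrite divr_ge0// ltW.
    - apply: le_trans cE _; apply: ler_wpM2l => //; by rewrite mulr_ge0 ?sqr_ge0// ltW.
    - by rewrite invr_ge0 mulr_ge0// ltW.
    - by rewrite lerD2r.
  apply: (@le_trans _ _ (iq x r (fun z => F (u z) * w Gam z))).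
    apply: ibox_le; [exact: la|exact: locint_ker (lw rG) cf|move=> z _].
    apply: ler_wpM2r => //; have [ht|ht] := leP (u z) (kj j.+1); first by rewrite aboveF//; have /andP[] := F01 (u z).
    by rewrite aboveT// F1// ltW.
  apply: le_trans hP _; apply: le_trans (ler_wpM2l _ J1) _; first by rewrite mulr_ge0// ltW.
  by rewrite le_eqVlt; apply/orP; left; apply/eqP; rewrite /a; field; rewrite !gt_eqF.
have sum j : j%:R * M j <= a * (j%:R * (eps * K * m) + (M 0%N - M j) / eps).
  elim: j => [|j IH]; first by rewrite !mul0r subrr mul0r addr0 mulr0.
  have mono : M j.+1 <= M j by apply: iq_above_le => //; rewrite /kj hS; have := h0 j; fast_lra.
  rewrite -natr1 mulrDl mul1r; apply: le_trans (lerD (le_trans (ler_wpM2l (ler0n R j) mono) IH) (step j)) _.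
  rewrite le_eqVlt; apply/orP; left; apply/eqP; ring.
have small : M N <= nu * m.
  have := sum N; have mN := M0 N; have M00 := Mm 0%N; have m0 : 0 <= m by exact: iq_ge0.
  have e1 : a * (N%:R * (eps * K * m)) = N%:R * (nu / 2 * m) by rewrite /eps; field; rewrite !gt_eqF.
  have e2 : a * ((M 0%N - M N) / eps) <= N%:R * (nu / 2 * m).
    apply: (@le_trans _ _ (a * (m / eps))).
      by rewrite ler_pM2l// ler_pM2r ?invr_gt0//; fast_lra.
    rewrite (_ : a * (m / eps) = 2 * a / (eps * nu) * (nu / 2 * m)); last by field; rewrite !gt_eqF.
    by apply: ler_wpM2r => //; rewrite mulr_ge0 ?divr_ge0// ltW.
  rewrite mulrDr e1 => hh; rewrite -(ler_pM2l N0); apply: le_trans hh _.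
  rewrite (_ : N%:R * (nu * m) = N%:R * (nu / 2 * m) + N%:R * (nu / 2 * m)); last by field.
  by rewrite lerD2l.
move=> z hz; have := HN _ _ _ _ x r k (kj N) (h N) sA su r0 (kk N) (h0 N).
have -> : T - 2^-1 ^+ N / 2 * H = kj N + h N / 2 by rewrite /kj /h; field.
apply => // y hy.
  by rewrite /kj subrK; apply: uT; apply: qbox_mono hy; fast_lra.
by move=> hy'; apply: uG => //; apply: qbox_mono hy'; fast_lra.
Qed.

End degiorgi.

(** * Growth lemmas and Harnack chains *)

Section harnack.
Context (R : realType) (n : nat) (d C0 C1 : R).
Hypotheses (n0 : (0 < n)%N) (d0 : 0 < d) (dn : d < n%:R - 1) (C01 : 1 <= C0) (C11 : 1 <= C1).
Local Notation V := 'rV[R]_n.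
Local Notation mu := (lebesgue_n R n).
Local Notation reg := (regular_set d C0).
Local Notation w Gam := (weight Gam d).
Local Notation set_ := (setting d C0 C1).
Implicit Types (x y z p q X Z : V) (r s t c e l k H T : R) (Gam : set V) (f u v eta : V -> R) (G : V -> V) (A : V -> 'M[R]_n).

Let lw Gam (rG : reg Gam) : locint (w Gam) := locint_weight d0 dn C01 rG.

(** [growth] with [H = T / 2]: truncations above the level [T / 2] vanish on Gam, where [u <= 0], so
    that [trace_poincare] is available. *)
Lemma boundary_growth : exists2 c, 0 < c <= 1 / 2 & forall Gam A u G x r T, set_ Gam A -> sol d Gam A u G -> Gam x ->
  0 < r -> 0 < T -> (forall z, qbox x (2 * r) z -> u z <= T) -> (forall z, Gam z -> qbox x (2 * r) z -> u z <= 0) ->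
  forall z, qbox x (r / 2) z -> u z <= (1 - c) * T.
Proof.
have [KP KP0 HT] := trace_poincare n0 d0 dn C01.
have [c c0 Hg] := growth n0 d0 dn C01 C11 KP0.
exists (Num.min (c / 2) (1 / 2)); first by rewrite lt_min ge_min lexx orbT andbT; apply/andP; split; lra.
move=> Gam A u G x r T sA su Gx r0 T0 uT uG z hz.
have rG : reg Gam by case: sA.
have H0 : 0 < T / 2 by lra.
have k0 : 0 < T - T / 2 by lra.
have := Hg Gam A u G x r 0 T (T / 2) sA su r0 H0 k0 uT uG _ z hz.
move=> h; apply: (@le_trans _ _ (T - c * (T / 2))).
  apply: h => F gb gB F01 F0.
  rewrite /iq (@ibox_eq R n _ _ _ (fun z => `|F (u z)| * w Gam z)); last first.
    by move=> y _; rewrite ger0_norm//; have /andP[] := F01 (u y).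
  apply: HT => // y Gy hy; apply: F0.
  have := uG y Gy (qbox_mono _ hy) => h'; have := h' ltac:(lra); lra.
have : Num.min (c / 2) (1 / 2) <= c / 2 by rewrite ge_min lexx.
move: (Num.min _ _) => m mc; nra.
Qed.

(** Truncations above [T - H] vanish on the subcube of radius [r / 4], which by doubling carries a
    fixed part of the mass; hence [poincare] bounds the average as well. *)
Lemma interior_growth : exists2 c, 0 < c <= 1 & forall Gam A u G x r T H, set_ Gam A -> sol d Gam A u G ->
  0 < r -> 0 < H -> (forall z, qbox x (2 * r) z -> ~ Gam z) -> (forall z, qbox x (2 * r) z -> u z <= T) ->
  (forall z, qbox x (r / 4) z -> u z <= T - H) -> forall z, qbox x (r / 2) z -> u z <= T - c * H.
Proof.
have [K1 K10 HP] := poincare n0 d0 dn C01; have [Kd Kd0 HD] := doubling n0 d0 dn C01.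
have KP0 : 0 < K1 * 2 * (1 + Kd ^+ 2) by rewrite !mulr_gt0// addr_gt0// exprn_gt0.
have [c c0 Hg] := growth n0 d0 dn C01 C11 KP0.
exists (Num.min c 1); first by rewrite lt_min ge_min lexx orbT andbT c0 ltr01.
move=> Gam A u G x r T H sA su r0 H0 noG uT uH z hz.
have rG : reg Gam by case: sA. have cu : continuous u by case: su.
have w0 := weight_ge0 d Gam.
(* The cube misses Gam, so any level below [T - H] serves as bound on Gam. *)
have k0 : T - H - 1 < T - H by fast_lra.
apply: (@le_trans _ _ (T - c * H)); last first.
  have : Num.min c 1 <= c by rewrite ge_min lexx.
  by move: (Num.min _ _) => m mc; rewrite lerD2l lerN2 ler_pM2r.
apply: (Hg Gam A u G x r (T - H - 1) T H sA su r0 H0 k0 uT) hz; first by move=> y Gy /noG.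
move=> F gb gB F01 F0; have [cf lgb lgw gG [g [W lg ggb]]] := gB.
have r20 : 0 < 2 * r by fast_lra.
have := HP _ rG _ _ _ _ _ _ r20 (qbox_tbox x r) W cf lg lgb lgw ggb gG.
set B := avg _ _ _; set I := ibox _ _ (fun z => gb z * _).
have lB : locint (fun z => `|F (u z) - B| * w Gam z) by apply: locint_ker (lw rG) _; apply: locint_normB; exact: cf.
have lF : locint (fun z => F (u z) * w Gam z) := locint_ker (lw rG) cf.
set J := ibox _ _ _ => hJ; set m4 := iq x (r / 4) (w Gam).
have J0 : 0 <= J by apply: ibox_ge0 => y _; exact: mulr_ge0.
have m40 : 0 <= m4 by exact: iq_ge0.
have r4 : r / 4 <= r by fast_lra.
have Bm : `|B| * m4 <= J.
  rewrite -(iboxZ _ _ _ (lw rG)); apply: le_trans (ibox_sub lB (qbox_mono r4) _); last by move=> y _; exact: mulr_ge0.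
  apply: ibox_le; [exact: locintZ (lw rG)|exact: lB|move=> y hy].
  by rewrite F0; [rewrite sub0r normrN|exact: uH].
have mm : iq x r (w Gam) <= Kd ^+ 2 * m4.
  apply: (@le_trans _ _ (Kd * iq x (r / 2) (w Gam))); first by apply: HD => //; fast_lra.
  rewrite expr2 -mulrA; apply: ler_wpM2l; first exact: ltW.
  by apply: HD => //; fast_lra.
apply: (@le_trans _ _ (J + `|B| * iq x r (w Gam))).
  rewrite -(iboxZ _ _ _ (lw rG)) -(iboxD _ _ lB (locintZ _ (lw rG))).
  apply: ibox_le; [exact: lF|exact: locintD lB (locintZ _ (lw rG))|move=> y _].
  rewrite -mulrDl; apply: ler_wpM2r => //.
  by have := ler_normD (F (u y) - B) B; rewrite subrK; apply: le_trans; exact: ler_norm.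
apply: (@le_trans _ _ (J + Kd ^+ 2 * J)).
  rewrite lerD2l; apply: le_trans (ler_wpM2l (normr_ge0 _) mm) _.
  by rewrite mulrCA; apply: ler_wpM2l => //; rewrite exprn_ge0// ltW.
rewrite (_ : J + _ = (1 + Kd ^+ 2) * J); last by ring.
rewrite -/I (_ : _ * r * I = (1 + Kd ^+ 2) * (K1 * (2 * r) * I)); last by ring.
by apply: ler_wpM2l => //; rewrite addr_ge0// exprn_ge0// ltW.
Qed.

(** With steps of length at most [r / 4], the cube of radius [r / 4] around a centre lies in the
    cube of radius [r / 2] around the previous one, to which [interior_growth] has spread the
    bound. *)
Lemma chain : exists2 c, 0 < c <= 1 & forall Gam A u G r T H (z : nat -> V) (N : nat), set_ Gam A -> sol d Gam A u G ->
  0 < r -> 0 < H ->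
  (forall (k : nat) j, (k < N)%N -> `|z k.+1 ord0 j - z k ord0 j| <= r / 4) ->
  (forall (k : nat) y, (k <= N)%N -> qbox (z k) (2 * r) y -> ~ Gam y /\ u y <= T) ->
  (forall y, qbox (z 0%N) (r / 4) y -> u y <= T - H) ->
  forall y, qbox (z N) (r / 4) y -> u y <= T - c ^+ N * H.
Proof.
have [c /andP[c0 c1] Hg] := interior_growth; exists c; first by rewrite c0.
move=> Gam A u G r T H z N sA su r0 H0; elim: N => [|N IH] st nb u0; first by rewrite expr0 mul1r.
move=> y hy; rewrite exprS -mulrA.
apply: (Hg Gam A u G (z N) r T (c ^+ N * H)) => //.
- by rewrite mulr_gt0// exprn_gt0.
- by move=> y' /(nb N y' (leqnSn N))[].
- by move=> y' /(nb N y' (leqnSn N))[].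
- apply: IH => // [k j kN|k y' kN]; first by apply: st; exact: ltnW.
  by apply: nb; exact: leqW.
- move=> j; have := hy j; have := st N j (ltnSn N); rewrite !mxE ler_norml => /andP[? ?] /andP[? ?].
  by apply/andP; split; lra.
Qed.

Lemma n_gt0 : 0 < n%:R :> R. Proof. by rewrite ltr0n. Qed.

Lemma powR_small K e : 0 < K -> 0 < e -> exists2 t, 0 < t & forall s, 0 < s -> s <= t -> K * s `^ (n%:R - 1 - d) < e.
Proof.
move=> K0 e0; have a0 : 0 < n%:R - 1 - d by exact: a_gt0.
pose t := (e / K / 2) `^ (n%:R - 1 - d)^-1.
exists t; first by rewrite powR_gt0// !divr_gt0.
move=> s s0 st; apply: (@le_lt_trans _ _ (K * t `^ (n%:R - 1 - d))).
  by rewrite ler_pM2l//; apply: ge0_ler_powR; rewrite ?nnegrE ?(ltW a0) ?(ltW s0)// ltW// powR_gt0// !divr_gt0.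
rewrite /t -powRrM mulVf ?gt_eqF// powRr1; last by rewrite ltW// !divr_gt0.
by rewrite (_ : K * _ = e / 2); [lra|field; rewrite gt_eqF].
Qed.

(** If all points of the cube were within [kap * r] of Gam, the cube would be contained in a tube of
    smaller volume. *)
Lemma corkscrew : exists2 kap, 0 < kap <= 1 & forall Gam, reg Gam -> forall x r, 0 < r ->
  exists2 Z, qbox x r Z & kap * r <= del Gam Z.
Proof.
have [K K0 H] := tube n C01 (ltW d0).
have [t t0 ht] := powR_small K0 (exprn_gt0 n (ltr0Sn R 1)).
pose kap := Num.min t 1; have kap0 : 0 < kap by rewrite lt_min t0 ltr01.
have kap1 : kap <= 1 by rewrite ge_min lexx orbT.
exists kap; first by rewrite kap0.
move=> Gam [G0 cG AR] x r r0; apply: contrapT => no.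
have kr : kap * r <= r by rewrite ger_pMl.
have := H Gam cG AR G0 x r (kap * r) (mulr_gt0 kap0 r0) kr.
rewrite (_ : qbox x r `&` _ = qbox x r); last first.
  apply/seteqP; split => [z []//|z hz]; split => //=; rewrite ltNge; apply/negP => h; apply: no; by exists z.
rewrite leb_qbox ?(ltW r0)// lee_fin leNgt => /negP; apply.
rewrite powRM ?(ltW kap0) ?(ltW r0)//.
have -> : K * r `^ d * (kap `^ (n%:R - d) * r `^ (n%:R - d)) = K * kap `^ (n%:R - d) * (r `^ d * r `^ (n%:R - d)) by ring.
rewrite -powRD; last by apply/implyP => _; rewrite gt_eqF.
have -> : d + (n%:R - d) = n%:R by ring.
rewrite powR_mulrn ?(ltW r0)// exprMn ltr_pM2r ?exprn_gt0//.
apply: le_lt_trans (ht kap kap0 _); last by rewrite ge_min lexx.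
rewrite ler_pM2l//; apply: ger_powR; first by rewrite kap0.
lra.
Qed.

Lemma far_from_Gam Gam z r y : n%:R * r < del Gam z -> qbox z r y -> ~ Gam y.
Proof.
move=> h hy Gy; have := del_le z Gy; rewrite enormB; have := qbox_enorm hy; lra.
Qed.

(* Pigeonhole by volume: the translations for which some point of the segment comes too close to [Gam] form a
   small part of the cube. *)
Lemma shifted_segment (Lam : R) : 1 <= Lam -> exists th (N : nat),
  [/\ 0 < th, 12 * n%:R ^+ 2 * th <= 1, 4 * Lam <= th * N%:R, (0 < N)%N &
   forall Gam X Z r, reg Gam -> 0 < r -> exists2 v : V, (forall j, `|v ord0 j| <= r / n%:R / 2) &
     forall k : nat, (k <= N)%N -> 3 * n%:R * (th * r) <= del Gam (v + (X + (k%:R / N%:R) *: (Z - X)))].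
Proof.
move=> L1; have [K K0 HT] := tube n C01 (ltW d0); have nR := n_gt0.
pose sg : R := n%:R^-1; have sg0 : 0 < sg by rewrite invr_gt0.
have sg2 : 0 < sg / 2 by exact: divr_gt0.
pose B := (4 * Lam + 2) * K * (sg / 2) `^ d * (3 * n%:R) `^ (n%:R - d).
have B0 : 0 < B.
  rewrite /B; apply: mulr_gt0; last by rewrite powR_gt0// mulr_gt0.
  apply: mulr_gt0; last by rewrite powR_gt0.
  by apply: mulr_gt0 => //; fast_lra.
have [t t0 ht] := powR_small B0 (exprn_gt0 n sg0).
have n12 : 0 < 12 * n%:R ^+ 2 :> R by rewrite mulr_gt0// exprn_gt0.
pose th := Num.min t (1 / (12 * n%:R ^+ 2)).
have th0 : 0 < th by rewrite lt_min t0 divr_gt0.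
have thn : 12 * n%:R ^+ 2 * th <= 1.
  by rewrite mulrC -ler_pdivlMr// ge_min lexx orbT.
have htB : B * th `^ (n%:R - 1 - d) < sg ^+ n by apply: ht => //; rewrite ge_min lexx.
have b0 : 0 <= 4 * Lam / th by apply: divr_ge0; [fast_lra|exact: ltW].
have [N [N1 N2 N0]] : exists N : nat, [/\ N%:R - 1 <= 4 * Lam / th, 4 * Lam / th < N%:R & (0 < N)%N].
  have /andP[h1 h2] := truncn_itv b0; exists (Num.truncn (4 * Lam / th)).+1.
  by split; [rewrite -[X in X - 1]natr1 addrK|exact: h2|].
move: th th0 thn htB b0 N1 N2 => {ht t t0} th th0 thn htB b0 N1 N2.
exists th, N; split => //; first by rewrite -ler_pdivrMl// mulrC ltW.
move=> Gam X Z r [G0 cG AR] r0.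
pose s := sg * r / 2; have s0 : 0 < s by apply: divr_gt0 => //; exact: mulr_gt0.
have sE : r / n%:R / 2 = s by rewrite /s /sg mulrC [r / _]mulrC mulrC.
pose tau := 3 * n%:R * (th * r).
have tau0 : 0 < tau by apply: mulr_gt0; apply: mulr_gt0.
have taus : tau <= s.
  have -> : tau = 12 * n%:R ^+ 2 * th * (s / 2) by rewrite /tau /s /sg; field; rewrite gt_eqF.
  have s20 : 0 <= s / 2 by rewrite divr_ge0// ltW.
  by have := ler_wpM2r s20 thn; rewrite mul1r; move: (_ * (s / 2)) => y; have := ltW s0; fast_lra.
pose pt (k : nat) : V := X + (k%:R / N%:R) *: (Z - X).
(* The bad translations for the k-th point, a translate of a tube of volume about [th^(n-d)]. There
   are about [1 / th] points, so the total is of order [th^(n-1-d)], small because [d < n - 1]. *)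
pose E (k : nat) : set V := qbox 0 s `&` [set v : V | del Gam (v + pt k) < tau].
have leE (k : nat) : (lebesgue_outer (E k) <= (K * s `^ d * tau `^ (n%:R - d))%:E)%E.
  apply: le_trans (HT _ cG AR G0 (pt k) s tau tau0 taus).
  rewrite -[leRHS](lebesgue_outer_shift _ (pt k)); apply: le_outer_measure => v [hv dv]; split => //.
  by move=> j; have := hv j; rewrite !mxE; fast_lra.
suff [v hv Ev] : exists2 v : V, qbox 0 s v & forall k : nat, (k <= N)%N -> tau <= del Gam (v + pt k).
  exists v => // j; have := hv j; rewrite sE !mxE ler_norml => /andP[v1 v2].
  by move: v1 v2; rewrite sub0r add0r => -> /ltW ->.
apply: contrapT => no.
have cov : qbox (0 : V) s `<=` \big[setU/set0]_(k < N.+1) E k.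
  move=> v hv; rewrite -(bigcup_mkord N.+1 E); apply: contrapT => nE; apply: no; exists v => // k kN.
  by rewrite leNgt; apply/negP => h; apply: nE; exists k.
have := le_outer_measure (@lebesgue_n R n) _ _ cov; rewrite leb_qbox ?(ltW s0)//.
move=> /le_trans/(_ (outer_measure_subadditive _ E N.+1)) h.
have {}h := le_trans h (lee_sum _ (fun (k : 'I_N.+1) _ => leE k)).
move: h; rewrite sumEFin sumr_const card_ord -(mulr_natl _ N.+1) lee_fin leNgt => /negP; apply.
have -> : (2 * s) ^+ n = sg ^+ n * r ^+ n by rewrite -exprMn /s; congr (_ ^+ n); field.
have th1 : th <= 1.
  have h : 1 <= 12 * n%:R ^+ 2 :> R.
    have : 1 <= n%:R ^+ 2 :> R by rewrite exprn_ege1// ler1n.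
    by move: (n%:R ^+ 2) => y; fast_lra.
  by apply: le_trans thn; rewrite ler_peMl// ltW.
have NB : N.+1%:R <= (4 * Lam + 2) / th.
  rewrite -natr1 (_ : _ / th = 4 * Lam / th + 2 / th); last by rewrite mulrDl.
  have : 2 <= 2 / th by rewrite ler_pdivlMr// ler_piMr.
  by move: N1; move: (_ / th) (2 / th) N%:R => x y z; fast_lra.
apply: (@le_lt_trans _ _ (B * th `^ (n%:R - 1 - d) * r ^+ n)); last first.
  by rewrite ltr_pM2r ?exprn_gt0.
apply: (@le_trans _ _ ((4 * Lam + 2) / th * (K * s `^ d * tau `^ (n%:R - d)))).
  by apply: ler_wpM2r => //; apply: mulr_ge0; [apply: mulr_ge0; [exact: ltW|exact: powR_ge0]|exact: powR_ge0].
rewrite le_eqVlt; apply/orP; left; apply/eqP.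
have -> : s `^ d = (sg / 2) `^ d * r `^ d by rewrite -powRM ?(ltW r0) ?(ltW sg2)//; congr (_ `^ _); rewrite /s; ring.
have -> : tau `^ (n%:R - d) = (3 * n%:R) `^ (n%:R - d) * (th `^ (n%:R - d) * r `^ (n%:R - d)).
  by rewrite -!powRM ?mulr_ge0 ?(ltW r0) ?(ltW th0) ?(ltW nR).
have -> : r ^+ n = r `^ d * r `^ (n%:R - d).
  rewrite -powRD; last by apply/implyP => _; rewrite gt_eqF.
  by rewrite -(powR_mulrn _ (ltW r0)); congr (_ `^ _); ring.
have -> : th `^ (n%:R - d) = th `^ (n%:R - 1 - d) * th.
  rewrite -[X in _ = _ * X](powRr1 (ltW th0)) -powRD; last by apply/implyP => _; rewrite gt_eqF.
  by congr (_ `^ _); ring.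
by rewrite /B; field; rewrite gt_eqF.
Qed.

(* The chain follows the shifted segment from [X + v] to [Z + v] and then shrinks [v] to [0]. *)
Lemma harnack_chain (Lam : R) : 1 <= Lam -> exists2 c, 0 < c <= 1 & forall Gam A u G X Z r T H, set_ Gam A -> sol d Gam A u G ->
  0 < r -> 0 < H -> r <= del Gam Z -> (forall j, `|Z ord0 j - X ord0 j| <= Lam * r) ->
  (forall y, qbox X ((Lam + 1) * r) y -> u y <= T) -> (forall y, qbox X (r / n%:R) y -> u y <= T - H) ->
  u Z <= T - c * H.
Proof.
move=> L1; have [c /andP[c0 c1] Hc] := chain; have nR := n_gt0.
have [th [N [th0 thn thN N0 Hv]]] := shifted_segment L1.
have n1 : 1 <= n%:R :> R by rewrite ler1n.
exists (c ^+ (N + N)); first by rewrite exprn_gt0//= exprn_ile1// ltW.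
move=> Gam A u G X Z r T H sA su r0 H0 dZ XZ uT uX.
have rG : reg Gam by case: sA. have [G0 _ _] := rG.
have [v nr Ev] := Hv Gam X Z r rG r0.
move: nr Ev; set s := r / n%:R / 2; set rho := th * r => nr Ev.
have rho0 : 0 < rho by exact: mulr_gt0.
have ns : n%:R * s = r / 2 by rewrite /s; field; rewrite gt_eqF.
have nrho : 12 * (n%:R * rho) <= 2 * s.
  rewrite -(ler_pM2l nR) (_ : n%:R * (2 * s) = r); last by rewrite mulrCA ns; field.
  rewrite (_ : n%:R * _ <= _ = (12 * n%:R ^+ 2 * th * r <= r)); last by congr (_ <= _); rewrite /rho; ring.
  by rewrite -[leRHS]mul1r ler_pM2r.
have s0 : 0 <= s by rewrite /s; apply: divr_ge0 => //; apply: divr_ge0; exact: ltW.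
have sr : s <= r / 2 by rewrite -ns ler_peMl.
have rn : rho <= n%:R * rho by rewrite ler_peMl// ltW.
have srs : r / n%:R = 2 * s by rewrite /s; field; rewrite gt_eqF.
have NR : 0 < N%:R :> R by rewrite ltr0n.
have stepsize : Lam * r / N%:R <= rho / 4.
  rewrite ler_pdivrMr// (_ : rho / 4 * N%:R = th * N%:R / 4 * r); last by rewrite /rho; ring.
  by rewrite ler_pM2r// ler_pdivlMr// mulrC.
pose pt (k : nat) : V := X + (k%:R / N%:R) *: (Z - X).
(* Indices up to [N] run along the shifted segment; the next [N] shrink the shift. At [k = N] the
   two formulas agree. *)
pose zz (k : nat) : V := if (k <= N)%N then v + pt k else (1 - (k - N)%:R / N%:R) *: v + Z.
have ptN : pt N = Z by rewrite /pt divff ?gt_eqF// scale1r addrC subrK.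
have zzN (k : nat) : (N <= k)%N -> zz k = (1 - (k - N)%:R / N%:R) *: v + Z.
  rewrite leq_eqVlt => /orP[/eqP <-|h]; first by rewrite /zz leqnn ptN subnn mul0r subr0 scale1r.
  by rewrite /zz leqNgt h.
have zz0 : zz 0%N = v + X by rewrite /zz leq0n /pt mul0r scale0r addr0.
have zz2 : zz (N + N)%N = Z by rewrite zzN ?leq_addr// addKn divff ?gt_eqF// subrr scale0r add0r.
have zstep (k : nat) j : (k < N + N)%N -> `|zz k.+1 ord0 j - zz k ord0 j| <= rho / 4.
  move=> kN; apply: le_trans stepsize; have [kN'|kN'] := ltnP k N.
    rewrite /zz kN' (ltnW kN') !mxE -natr1.
    rewrite (_ : _ - _ = N%:R^-1 * (Z ord0 j - X ord0 j)); last by field; rewrite gt_eqF.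
    rewrite normrM gtr0_norm ?invr_gt0// mulrC; apply: ler_wpM2r; first by rewrite invr_ge0 ltW.
    exact: XZ.
  rewrite !zzN ?leqW// subSn// !mxE -natr1.
  rewrite (_ : _ - _ = - (N%:R^-1 * v ord0 j)); last by field; rewrite gt_eqF.
  rewrite normrN normrM gtr0_norm ?invr_gt0// mulrC; apply: ler_wpM2r; first by rewrite invr_ge0 ltW.
  apply: le_trans (nr j) _; apply: le_trans sr _; apply: (@le_trans _ _ (1 * r)); last by rewrite ler_pM2r.
  fast_lra.
have zfar (k : nat) : (k <= N + N)%N -> 3 * (n%:R * rho) <= del Gam (zz k) /\ forall j, `|zz k ord0 j - X ord0 j| <= Lam * r + s.
  move=> kN; have [kN'|kN'] := leqP k N.
    rewrite /zz kN' mulrA; split => [|j]; first exact: Ev.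
    rewrite !mxE (_ : _ - _ = v ord0 j + k%:R / N%:R * (Z ord0 j - X ord0 j)); last by ring.
    apply: le_trans (ler_normD _ _) _; rewrite addrC; apply: lerD => //.
    rewrite normrM ger0_norm ?divr_ge0//; apply: le_trans (XZ j).
    by rewrite ler_piMl// ler_pdivrMr// mul1r ler_nat.
  have [t1 t2] : (0 : R) <= 1 - (k - N)%:R / N%:R /\ 1 - (k - N)%:R / N%:R <= (1 : R).
    have h0 : 0 <= (k - N)%:R / N%:R :> R by rewrite divr_ge0.
    have h1 : (k - N)%:R / N%:R <= 1 :> R by rewrite ler_pdivrMr// mul1r ler_nat leq_subLR.
    by split; [rewrite subr_ge0|rewrite gerBl].
  (* On this part of the chain the centre stays within [n * s = r / 2] of [Z], whose distance to Gam
     is at least [r]. *)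
  rewrite (zzN _ (ltnW kN')); move: (1 - _) t1 t2 => t t1 t2; split => [|j].
    have h := @del_lip R n Gam Z (t *: v + Z) G0; rewrite enormB addrK in h.
    have h2 : enorm (t *: v) <= n%:R * s.
      apply: enorm_le_sum => j; rewrite mxE normrM ger0_norm//.
      by apply: le_trans (nr j); rewrite ler_piMl.
    fast_lra.
  rewrite !mxE (_ : _ - _ = (Z ord0 j - X ord0 j) + t * v ord0 j); last by ring.
  apply: le_trans (ler_normD _ _) _; apply: lerD => //.
  by rewrite normrM ger0_norm//; apply: le_trans (nr j); rewrite ler_piMl.
have := Hc Gam A u G rho T H zz (N + N)%N sA su rho0 H0 zstep _ _ Z; apply.
- move=> k y kN hy; have [dk bk] := zfar k kN; split.
    apply: far_from_Gam hy; apply: lt_le_trans dk.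
    by rewrite mulrCA; fast_lra.
  apply: uT => j; have := hy j; have := bk j; rewrite !mxE ler_norml => /andP[? ?] /andP[? ?].
  by apply/andP; split; fast_lra.
- rewrite zz0 => y hy; apply: uX => j; have := hy j; rewrite srs !mxE.
  by have := nr j; rewrite ler_norml => /andP[? ?] /andP[? ?]; apply/andP; split; fast_lra.
- by rewrite zz2 => j; rewrite !mxE; apply/andP; split; fast_lra.
Qed.

End harnack.

(** * Boundary Harnack principle *)

Section boundary_harnack.
Context (R : realType) (n : nat) (d C0 C1 : R).
Hypotheses (n0 : (0 < n)%N) (d0 : 0 < d) (dn : d < n%:R - 1) (C01 : 1 <= C0) (C11 : 1 <= C1).
Local Notation V := 'rV[R]_n.
Local Notation reg := (regular_set d C0).
Local Notation set_ := (setting d C0 C1).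
Implicit Types (x y z p q X Z : V) (r s t c e l k H T M a : R) (Gam : set V) (f u v : V -> R) (G : V -> V) (A : V -> 'M[R]_n).

Lemma geometric_small c e : 0 < c <= 1 -> 0 < e -> exists N, (1 - c) ^+ N < e.
Proof.
move=> /andP[c0 c1] e0; have h : `|1 - c| < 1 by rewrite ger0_norm; lra.
have := cvg_geometric (1 : R) h; move=> /cvgrPdist_lt/(_ e e0) [N _ /(_ N (leqnn N))] /=.
by rewrite mul1r sub0r normrN ger0_norm ?exprn_ge0//; [exists N|lra].
Qed.

(* The induction hypothesis of De Silva and Savin, for [- u]: the possibly positive values of [u] are confined to
   a neighbourhood of [Gam] by its very negative values away from [Gam]. *)
Definition low_at_scale Gam u x R0 s M e :=
  (forall z, qbox x R0 z -> u z <= s) /\ (forall z, qbox x R0 z -> e * R0 <= del Gam z -> u z <= - (M * s)).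

(** Away from Gam the bound is clear, since [u] is negative there. A point within [e * R0] of Gam is
    treated by [boundary_growth] at a nearby point of Gam, which gains a factor [1 - c] per step at
    the cost of a slightly smaller cube. *)
Lemma boundary_decay : exists2 c, 0 < c <= 1 / 2 & forall Gam A u G x R0 s M e (N : nat), set_ Gam A -> sol d Gam A u G ->
  0 < R0 -> 0 < s -> 0 < M -> 0 < e -> (forall z, Gam z -> qbox x R0 z -> u z <= 0) -> low_at_scale Gam u x R0 s M e ->
  forall z, qbox x ((1 - 5 * N%:R * e) * R0) z -> u z <= (1 - c) ^+ N * s.
Proof.
have [c /andP[c0 c2] Hg] := boundary_growth n0 d0 dn C01 C11; exists c; first by rewrite c0.
move=> Gam A u G x R0 s M e N sA su R00 s0 M0 e0 uG [us uM].
have G0 : Gam !=set0 by case: sA => -[].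
have c1 : 0 < 1 - c by fast_lra.
elim: N => [|N IH] z hz.
  by rewrite expr0 mul1r; apply: us; move: hz; rewrite mulr0 mul0r subr0 mul1r.
have P0 : 0 < (1 - c) ^+ N * s by apply: mulr_gt0 => //; exact: exprn_gt0.
have eR : 0 < e * R0 by exact: mulr_gt0.
have N0 : 0 <= N%:R :> R by [].
have hN : N.+1%:R = N%:R + 1 :> R by rewrite -natr1.
have NeR : 0 <= N%:R * (e * R0) by rewrite mulr_ge0// ltW.
(* Each step consumes a cube of radius [4 * e * R0] around a point of Gam within [e * R0], so the
   radius shrinks by [5 * e * R0]. *)
have Rsz : (1 - 5 * N.+1%:R * e) * R0 + 5 * (e * R0) = (1 - 5 * N%:R * e) * R0 by rewrite hN; ring.
have Rsz1 : (1 - 5 * N%:R * e) * R0 = R0 - 5 * (N%:R * (e * R0)) by ring.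
rewrite exprS -mulrA.
have [dz|dz] := leP (e * R0) (del Gam z).
  apply: (@le_trans _ _ 0); last by apply: mulr_ge0; exact: ltW.
  apply: le_trans (uM z _ dz) _; first by apply: qbox_mono hz; fast_lra.
  by rewrite oppr_le0 ltW// mulr_gt0.
have [y Gy hy] := del_lt G0 dz.
have cy j : `|z ord0 j - y ord0 j| < e * R0.
  by apply: le_lt_trans hy; have := coord_le_enorm (z - y) j; rewrite !mxE.
have sub p : qbox y (2 * (2 * (e * R0))) p -> qbox x ((1 - 5 * N%:R * e) * R0) p.
  rewrite -Rsz => hp j; have := hp j; have := hz j; have := cy j; rewrite !mxE ltr_norml => /andP[? ?] /andP[? ?] /andP[? ?].
  by apply/andP; split; fast_lra.
apply: (Hg Gam A u G y (2 * (e * R0)) ((1 - c) ^+ N * s)) => //; first by fast_lra.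
- by move=> p hp; apply: IH; exact: sub.
- by move=> p Gp hp; apply: uG => //; apply: qbox_mono (sub _ hp); fast_lra.
- by move=> j; have := cy j; rewrite !mxE ltr_norml => /andP[? ?]; apply/andP; split; fast_lra.
Qed.

(** With [M = 2 / c2] and [a = c2 / 2] one has a M = 1. So on the half cube the lower condition asks
    for u <= - s at points at distance at least e R0 / 2. A Harnack chain of constant [c2] from a
    corkscrew point, where u <= - M s, gives u <= s - c2 (1 + M) s, which is less than - s. The
    upper bound a s comes from [boundary_decay] with [N] steps. *)
Lemma low_at_scale_half : exists a M e : R, [/\ 0 < a < 1, 0 < M, 0 < e <= 1 / 4 & forall Gam A u G x R0 s, set_ Gam A -> sol d Gam A u G ->
  Gam x -> 0 < R0 -> 0 < s -> (forall z, Gam z -> qbox x R0 z -> u z <= 0) -> low_at_scale Gam u x R0 s M e ->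
  low_at_scale Gam u x (R0 / 2) (a * s) M e].
Proof.
have [c /andP[c0 c1] Hd] := boundary_decay; have [kap /andP[kap0 kap1] Hk] := corkscrew d0 dn C01.
pose ik := kap^-1; have ik1 : 1 <= ik by rewrite invf_ge1.
have L1 : 1 <= 2 + 4 * ik by fast_lra.
have [c2 /andP[c20 c21] Hh] := harnack_chain n0 d0 dn C01 C11 L1.
pose a := c2 / 2; have a0 : 0 < a by rewrite /a; fast_lra.
have cc : 0 < c <= 1 by rewrite c0; fast_lra.
have [N hN] := geometric_small cc a0; have N0 : 0 <= N%:R :> R by [].
(* Small enough for the [N] steps of [boundary_decay] to use at most half of the cube, and for the
   corkscrew points and the chains, at scale [ik * e * R0], to stay inside the cube. *)
pose e := (10 * (N%:R + 1) + 10 * ik)^-1.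
have e0 : 0 < e by rewrite invr_gt0; fast_lra.
have he : (10 * (N%:R + 1) + 10 * ik) * e = 1 by rewrite divff//; fast_lra.
have eN : 0 <= N%:R * e by rewrite mulr_ge0// ltW.
have ek : e <= ik * e by rewrite ler_peMl// ltW.
have iM : 2 / c2 * c2 = 2 by rewrite divfK// gt_eqF.
exists a, (2 / c2), e; split; [|by rewrite divr_gt0|by rewrite e0 /=; fast_lra|].
  by rewrite a0 /a; fast_lra.
have M0 : 0 < 2 / c2 by rewrite divr_gt0.
move=> Gam A u G x R0 s sA su Gx R00 s0 uG low; have [us uM] := low.
have rG : reg Gam by case: sA. have [G0 _ _] := rG.
have aM : a * (2 / c2) = 1 by rewrite /a; field; rewrite gt_eqF.
have eR0 : 0 < e * R0 by exact: mulr_gt0.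
have ekR : ik * (e * R0) <= R0 / 10 - e * R0 - N%:R * e * R0.
  have := ler_wpM2r (ltW R00) (_ : ik * e <= 1 / 10 - e - N%:R * e); rewrite mulrBl => h.
  have := h ltac:(fast_lra); fast_lra.
have eNR : 0 <= N%:R * e * R0 by apply: mulr_ge0 => //; exact: ltW.
have eik : e * R0 <= ik * (e * R0) by rewrite ler_peMl// ltW.
split => z hz.
  have h : u z <= (1 - c) ^+ N * s.
    apply: (Hd Gam A u G x R0 s (2 / c2) e N) => //; apply: qbox_mono hz.
    by rewrite (_ : (1 - _) * R0 = R0 - 5 * (N%:R * e * R0)); [fast_lra|ring].
  by apply: le_trans h _; rewrite ler_pM2r// ltW.
move=> dz; rewrite [_ * (a * s)]mulrCA mulrA aM mul1r.
have [dz2|dz2] := leP (e * R0) (del Gam z).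
  apply: le_trans (uM z _ dz2) _; first by apply: qbox_mono hz; fast_lra.
  rewrite lerN2 -[leLHS]mul1r; apply: ler_wpM2r; first exact: ltW.
  by rewrite ler_pdivlMr// mul1r; fast_lra.
have [y Gy hy] := del_lt G0 dz2.
have cy j : `|z ord0 j - y ord0 j| < e * R0.
  by apply: le_lt_trans hy; have := coord_le_enorm (z - y) j; rewrite !mxE.
have rho0 : 0 < 2 * ik * (e * R0) by rewrite -mulrA; fast_lra.
(* At this scale the corkscrew point is at distance at least [2 * e * R0] from Gam, so that a
   neighbourhood of it is still in the region where u <= - M s. *)
have [X hX dX] := Hk Gam rG y _ rho0.
have dX2 : 2 * (e * R0) <= del Gam X by apply: le_trans dX; rewrite /ik; have -> // : kap * (2 * kap^-1 * (e * R0)) = 2 * (e * R0); field; rewrite gt_eqF.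
have XZ j : `|z ord0 j - X ord0 j| <= (2 + 4 * ik) * (e * R0 / 2).
  have := cy j; have := hX j; rewrite !mxE ltr_norml ler_norml => /andP[? ?] /andP[? ?].
  by apply/andP; split; fast_lra.
have sub p : qbox X ((2 + 4 * ik + 1) * (e * R0 / 2)) p -> qbox x R0 p.
  move=> hp j; have := hp j; have := hX j; have := hz j; have := cy j; rewrite !mxE ltr_norml => /andP[? ?] /andP[? ?] /andP[? ?] /andP[? ?].
  by apply/andP; split; fast_lra.
have n1 : 1 <= n%:R :> R by rewrite ler1n.
have h := Hh Gam A u G X z (e * R0 / 2) s (s + 2 / c2 * s) sA su ltac:(fast_lra) _ _ XZ.
apply: (@le_trans _ _ (s - c2 * (s + 2 / c2 * s))); last first.
  have -> : c2 * (s + 2 / c2 * s) = c2 * s + (2 / c2 * c2) * s by ring.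
  by rewrite iM; have := mulr_gt0 c20 s0; fast_lra.
apply: h; first by have := mulr_gt0 M0 s0; fast_lra.
- by fast_lra.
- by move=> p /sub; exact: us.
move=> p hp.
have nn : 0 < n%:R :> R by fast_lra.
have hle : (e * R0 / 2) / n%:R <= e * R0 / 2 by rewrite ler_pdivrMr// ler_peMr//; fast_lra.
rewrite opprD addrA subrr add0r; apply: uM.
  by apply: sub; apply: qbox_mono hp; have : 0 <= (2 + 4 * ik) * (e * R0 / 2) by [rewrite mulr_ge0//; fast_lra]; fast_lra.
have := qbox_enorm hp; rewrite [n%:R * _]mulrC divfK ?gt_eqF// => hn.
have := del_lip X p G0; rewrite enormB; fast_lra.
Qed.

(** The scale is halved until it is comparable to the distance from [z] to [x]. As [z] is
    nontangential and [e <= 1 / 4], [z] then lies in the region of the strongly negative bound. *)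
Lemma boundary_harnack_nonpos : exists2 Me : R * R, 0 < Me.1 /\ 0 < Me.2 & forall Gam A u G x z R0 s, set_ Gam A -> sol d Gam A u G ->
  Gam x -> 0 < R0 -> 0 < s -> (forall z, Gam z -> qbox x R0 z -> u z <= 0) -> low_at_scale Gam u x R0 s Me.1 Me.2 ->
  enorm (z - x) < 2 * del Gam z -> enorm (z - x) < R0 -> u z <= 0.
Proof.
have [a [M [e [/andP[a0 a1] M0 /andP[e0 e4] Hs]]]] := low_at_scale_half.
exists (M, e) => // Gam A u G x z R0 s sA su Gx R00 s0 uG low zd zR.
have zp : 0 < enorm (z - x) by have := del_le z Gx; have := enorm_ge0 (z - x); fast_lra.
have low' (k : nat) : low_at_scale Gam u x (R0 * 2^-1 ^+ k) (a ^+ k * s) M e.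
  elim: k => [|k IH]; first by rewrite !expr0 mulr1 mul1r.
  rewrite !exprS -[a * a ^+ k * s]mulrA mulrCA mulrC.
  have h0 : 0 < 2^-1 ^+ k :> R by rewrite exprn_gt0// invr_gt0.
  have h1 : 2^-1 ^+ k <= 1 :> R by apply: exprn_ile1; [rewrite invr_ge0|rewrite invf_le1//; fast_lra].
  apply: (Hs Gam A u G) => //; first by apply: mulr_gt0.
    by apply: mulr_gt0 => //; exact: exprn_gt0.
  move=> y Gy hy; apply: uG => //; apply: qbox_mono hy.
  by rewrite -[leRHS]mulr1 ler_pM2l.
have [k /andP[k1 k2]] := dyadic zp zR; have [_ hM] := low' k.
apply: le_trans (hM z _ _) _.
- by move=> j; have := coord_le_enorm (z - x) j; rewrite !mxE ler_norml => /andP[? ?]; apply/andP; split; fast_lra.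
- have h0 : 0 < R0 * 2^-1 ^+ k by apply: mulr_gt0 => //; rewrite exprn_gt0// invr_gt0.
  move: k1; rewrite exprS mulrCA => k1; have := ler_wpM2r (ltW h0) e4; fast_lra.
- by rewrite oppr_le0; apply: mulr_ge0; [exact: ltW|apply: mulr_ge0; [rewrite exprn_ge0// ltW|exact: ltW]].
Qed.

End boundary_harnack.

(** * Lipschitz data *)

Section data.
Context (R : realType) (n : nat) (d C0 C1 : R).
Hypotheses (n0 : (0 < n)%N) (d0 : 0 < d) (dn : d < n%:R - 1) (C01 : 1 <= C0) (C11 : 1 <= C1).
Local Notation V := 'rV[R]_n.
Local Notation mu := (lebesgue_n R n).
Local Notation sg := (hausdorff n d).
Local Notation reg := (regular_set d C0).
Local Notation w Gam := (weight Gam d).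
Local Notation set_ := (setting d C0 C1).
Implicit Types (x y z p q : V) (r s t c e l k M L rho : R) (Gam : set V) (f g h u v : V -> R) (G : V -> V) (A : V -> 'M[R]_n).

(** A class of boundary data that is stable under linear combinations and contained in the
    intersection of C_0^0(Gam) and H, so that the weak formulation applies to all data in use. *)
Definition lip_data g := exists L rho M, [/\ 0 <= L, 0 < rho, forall z p, `|g z - g p| <= L * enorm (z - p),
  forall z, `|g z| <= M & forall z, rho <= enorm z -> g z = 0].

Lemma lip_data_lin c g h : lip_data g -> lip_data h -> lip_data (fun z => c * g z + h z).
Proof.
move=> [L [r [M [L0 r0 gL gM g0]]]] [L' [r' [M' [L'0 r'0 hL hM h0]]]].
exists (`|c| * L + L'), (Num.max r r'), (`|c| * M + M'); split.
- by rewrite addr_ge0// mulr_ge0.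
- by rewrite lt_max r0.
- move=> z p; rewrite (_ : _ - _ = c * (g z - g p) + (h z - h p)); last by ring.
  apply: le_trans (ler_normD _ _) _; rewrite mulrDl; apply: lerD; last exact: hL.
  by rewrite normrM -mulrA; apply: ler_wpM2l => //; exact: gL.
- move=> z; apply: le_trans (ler_normD _ _) _; apply: lerD; last exact: hM.
  by rewrite normrM; apply: ler_wpM2l => //; exact: gM.
- by move=> z; rewrite ge_max => /andP[z1 z2]; rewrite g0// h0// mulr0 addr0.
Qed.

Lemma lip_data_cont g : lip_data g -> continuous g.
Proof. by move=> [L [r [M [L0 _ gL _ _]]]]; exact: lip_cont gL. Qed.

Lemma lip_data_Cc Gam g : closed Gam -> lip_data g -> in_Cc Gam g.
Proof.
move=> cG hg; split; first exact/continuous_subspaceT/lip_data_cont.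
have [L [r [M [L0 r0 gL gM g0]]]] := hg.
exists (box (shiftc 0 (- r), shiftc 0 r) `&` Gam); split.
- by apply: compact_closedI => //; exact: compact_box.
- by move=> z [].
move=> x Gx nx; apply: g0; rewrite leNgt; apply/negP => h; apply: nx; split => // j.
by have := coord_le_enorm x j; rewrite !mxE ler_norml => /andP[? ?]; apply/andP; split; lra.
Qed.

Lemma measurable_closed_haus Gam : closed Gam -> measurable (Gam : set (@hausT R n d)).
Proof.
move=> cG; rewrite -(setCK Gam); apply: measurableC; apply: measurable_open_haus; exact: closed_openC.
Qed.

Lemma continuous_measurable_haus Gam g : closed Gam -> continuous g ->
  measurable_fun (Gam : set (@hausT R n d)) (g : @hausT R n d -> R).
Proof.
move=> cG cg; apply: (measurability _ (RGenOpens.measurableE R)) => _ [_ [a [b ->] <-]].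
apply: measurableI; first exact: measurable_closed_haus.
by apply: measurable_open_haus; have := (@continuousP V R g).1 cg; apply; exact: interval_open.
Qed.

Let d1 : 0 <= d + 1. Proof. by rewrite addr_ge0// ltW. Qed.
Let C00 : 0 <= C0. Proof. exact: le_trans C01. Qed.
Let half_powR t : 2^-1 `^ t = (2 `^ t)^-1 :> R.
Proof. by rewrite -powR_inv1// -powRrM mulN1r powRN. Qed.
Let q (j : nat) : R := 2^-1 ^+ j.
Let q0 j : 0 < q j. Proof. by rewrite exprn_gt0// invr_gt0. Qed.

(** On the shell at distance about [s] from [x] the kernel is about [s^(-d-1)] and the surface
    measure at most about [s^d]; the product [1 / s] decays geometrically for [s = rho * 2^j]. *)
Lemma far_layer Gam x rho K : reg Gam -> Gam x -> 0 < rho -> 0 <= K ->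
  let s (j : nat) := rho / q j in let cc (j : nat) := K / (s j / 2) `^ (d + 1) in
  [/\ forall j, 0 <= cc j,
   forall t, rho <= t -> exists2 j, t < 2 * s j & K / t `^ (d + 1) <= cc j &
   forall j, ((cc j)%:E * sg (Gam `&` eball x (2 * s j)%R) <=
     (K * 2 `^ (d + 1) * C0 * 2 `^ d / rho * 2^-1 ^+ j)%:E)%E].
Proof.
move=> [_ cG AR] Gx rho0 K0 s cc.
have s0 j : 0 < s j by rewrite divr_gt0.
split => [j|t rt|j].
- by rewrite divr_ge0// powR_ge0.
- have t0 : 0 < t by lra.
  have h1 : rho / t < 2 by rewrite ltr_pdivrMr//; lra.
  have [j /andP[j1 j2]] := dyadic (divr_gt0 rho0 t0) h1; exists j.
    rewrite /s mulrA ltr_pdivlMr//; move: j1; rewrite exprS mulrA divff// mul1r ler_pdivlMr// -/(q j) mulrC; lra.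
  apply: ler_wpM2l => //; rewrite lef_pV2 ?posrE ?powR_gt0// ?divr_gt0//.
  apply: ge0_ler_powR; rewrite ?nnegrE ?(ltW t0)//; first by rewrite divr_ge0// ltW.
  rewrite /s ler_pdivrMr// ler_pdivrMr//; move: j2; rewrite ltr_pdivrMr// -/(q j); lra.
- have [_ h] := AR x (2 * s j) Gx (mulr_gt0 (ltr0Sn R 1) (s0 j)).
  apply: le_trans (lee_wpmul2l _ h) _; first by rewrite lee_fin divr_ge0// powR_ge0.
  rewrite -EFinM lee_fin /cc -/(q j) [(s j / 2) `^ _]powRM ?(ltW (s0 j)) ?invr_ge0// [(2 * s j) `^ _]powRM ?(ltW (s0 j))//.

  have e3 : s j `^ (d + 1) = s j `^ d * s j by rewrite powRD ?powRr1 ?(ltW (s0 j))//; apply/implyP => _; rewrite gt_eqF.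
  rewrite half_powR e3 le_eqVlt; apply/orP; left; apply/eqP.
  have qn : q j != 0 by rewrite gt_eqF.
  have P1 : 2 `^ (d + 1) != 0 :> R by rewrite gt_eqF// powR_gt0.
  have P2 : s j `^ d != 0 by rewrite gt_eqF// powR_gt0.
  have -> : (q j) = rho / s j by rewrite /s invfM invrK mulrA divff ?gt_eqF// mul1r.
  by field; rewrite P1 P2 !gt_eqF.
Qed.

(** A bound uniform in [x]: at distance [q <= 1] the Lipschitz condition gives
    [q^2 * q^(-d-1) * q^d = q], and farther away the boundedness of [g] and [far_layer] suffice. *)
Lemma lip_data_inner Gam x g L M : reg Gam -> Gam x -> 0 <= L -> 0 <= M -> 
  (forall z p, `|g z - g p| <= L * enorm (z - p)) -> (forall z, `|g z| <= M) ->
  (\int[sg]_(y in Gam) (`|g x - g y| ^+ 2 / enorm (x - y) `^ (d + 1))%:E <=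
   (2 * (L ^+ 2 * C0 * 2 `^ (d + 1) + 4 * M ^+ 2 * 2 `^ (d + 1) * C0 * 2 `^ d))%:E)%E.
Proof.
move=> rG Gx L0 M0 gL gM; have [_ cG AR] := rG.
have K0 : 0 <= 4 * M ^+ 2 by rewrite mulr_ge0// exprn_ge0.
have [f1 f2 f3] := far_layer rG Gx ltr01 K0.
pose E1 j := eball x (q j).
pose c1 j := L ^+ 2 * q j ^+ 2 / (q j / 2) `^ (d + 1).
have f3' := f3; rewrite divr1 in f3'.
apply: (@layer_integral2 _ _ _ sg Gam _ E1 (fun j => eball x (2 * (1 / q j))) c1
  (fun j => 4 * M ^+ 2 / (1 / q j / 2) `^ (d + 1)) (L ^+ 2 * C0 * 2 `^ (d + 1)) (4 * M ^+ 2 * 2 `^ (d + 1) * C0 * 2 `^ d)); last exact: f3'.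
- exact: measurable_closed_haus.
- by move=> j; exact/measurable_open_haus/eball_open.
- by move=> j; exact/measurable_open_haus/eball_open.
- by move=> j; rewrite divr_ge0 ?powR_ge0// mulr_ge0// exprn_ge0// ltW.
- exact: f1.
- by rewrite !mulr_ge0 ?exprn_ge0 ?powR_ge0.
- by rewrite !mulr_ge0 ?exprn_ge0 ?powR_ge0.
- by move=> y _; rewrite lee_fin divr_ge0 ?powR_ge0// exprn_ge0.
- move=> y Gy; have [t1|t1] := leP 1 (enorm (x - y)).
    apply: Or33; have [j h1 h2] := f2 _ t1; exists j; first by rewrite /eball /= enormB.
    rewrite lee_fin; apply: le_trans h2; rewrite ler_pM2r ?invr_gt0 ?powR_gt0//; last by lra.
    have : `|g x - g y| <= 2 * M by apply: le_trans (ler_normB _ _) _; have := gM x; have := gM y; lra.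
    have := normr_ge0 (g x - g y); move: (`|g x - g y|) => a a0 aM; nra.
  have [t0|t0] := leP (enorm (x - y)) 0.
    apply: Or31; have e0 : enorm (x - y) = 0 by apply/eqP; rewrite eq_le t0 enorm_ge0.
    by have := gL x y; rewrite e0 mulr0 normr_le0 => /eqP ->; rewrite normr0 expr0n mul0r.
  apply: Or32; have [j /andP[j1 j2]] := dyadic t0 t1; move: j1 j2; rewrite !mul1r -/(q j) => j1 j2.
  exists j; first by rewrite /E1 /eball /= enormB.
  rewrite lee_fin /c1; apply: ler_pM.
  + by rewrite exprn_ge0.
  + by rewrite invr_ge0 powR_ge0.
  + have h : `|g x - g y| <= L * q j by apply: le_trans (gL x y) _; apply: ler_wpM2l => //; exact: ltW.
    by rewrite -exprMn ler_sqr ?nnegrE// mulr_ge0// ltW.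
  + rewrite lef_pV2 ?posrE ?powR_gt0// ?divr_gt0//.
    apply: ge0_ler_powR; rewrite ?nnegrE ?(ltW t0)//; first by rewrite divr_ge0// ltW.
    by move: j1; rewrite exprS -/(q j); lra.
- move=> j; have [_ h] := AR x (q j) Gx (q0 j).
  apply: le_trans (lee_wpmul2l _ h) _.
    by rewrite lee_fin divr_ge0 ?powR_ge0// mulr_ge0// exprn_ge0// ltW.
  rewrite -EFinM lee_fin /c1 -/(q j).
  rewrite [(q j / 2) `^ _]powRM ?(ltW (q0 j)) ?invr_ge0//.
  have e3 : q j `^ (d + 1) = q j `^ d * q j by rewrite powRD ?powRr1 ?(ltW (q0 j))//; apply/implyP => _; rewrite gt_eqF.
  rewrite half_powR e3 le_eqVlt; apply/orP; left; apply/eqP.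
  have P1 : 2 `^ (d + 1) != 0 :> R by rewrite gt_eqF// powR_gt0.
  have P2 : q j `^ d != 0 by rewrite gt_eqF// powR_gt0.
  by field; rewrite P1 P2 gt_eqF.
Qed.

(** For [x] near [x0] the inner integral is bounded and the surface measure finite. For [x] far away
    [g x = 0], only [y] in the support of [g] contributes, and there the distance from [x] to [y] is
    at least half of that from [x] to [x0]. *)
Lemma lip_data_H Gam g : reg Gam -> lip_data g -> in_H Gam d g.
Proof.
move=> rG hg; have [[x0 Gx0] cG AR] := rG.
split; first by apply: continuous_measurable_haus => //; exact: lip_data_cont.
have [L [r [M [L0 r0 gL gM g0]]]] := hg.
have M0 : 0 <= M := le_trans (normr_ge0 _) (gM 0).
pose rho := r + enorm x0 + 1; have rho0 : 0 < rho by rewrite /rho; have := enorm_ge0 x0; lra.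
have gr z : rho <= enorm (z - x0) -> g z = 0.
  by move=> h; apply: g0; have := enormD z (- x0); have := enormB 0 x0; rewrite sub0r subr0 => ->; rewrite /rho in h; lra.
pose B1 := 2 * (L ^+ 2 * C0 * 2 `^ (d + 1) + 4 * M ^+ 2 * 2 `^ (d + 1) * C0 * 2 `^ d).
have B10 : 0 <= B1 by rewrite mulr_ge0// addr_ge0// !mulr_ge0 ?exprn_ge0 ?powR_ge0.
pose K := M ^+ 2 * 2 `^ (d + 1) * (C0 * rho `^ d).
have K0 : 0 <= K by rewrite !mulr_ge0 ?exprn_ge0 ?powR_ge0.
have rho20 : 0 < 2 * rho by lra.
have [f1 f2 f3] := far_layer rG Gx0 rho20 K0.
pose b1 := B1 * (C0 * (2 * rho) `^ d).
have b10 : 0 <= b1 by apply: mulr_ge0 => //; apply: mulr_ge0 => //; exact: powR_ge0.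
apply: (@le_lt_trans _ _ (2 * (b1 + K * 2 `^ (d + 1) * C0 * 2 `^ d / (2 * rho)))%:E); last by rewrite ltry.
have F0 x y : (0 <= (`|g x - g y| ^+ 2 / enorm (x - y) `^ (d + 1))%:E)%E.
  by rewrite lee_fin divr_ge0 ?powR_ge0// exprn_ge0.
(* The first family is a single ball, used only with index 0; the factors [q j] merely provide the
   required decay. *)
apply: (@layer_integral2 _ _ _ sg Gam _ (fun _ => eball x0 (2 * rho)) (fun j => eball x0 (2 * (2 * rho / q j))) (fun j => B1 * q j)
  (fun j => K / (2 * rho / q j / 2) `^ (d + 1)) b1 (K * 2 `^ (d + 1) * C0 * 2 `^ d / (2 * rho))); last exact: f3.
- exact: measurable_closed_haus.
- by move=> j; exact/measurable_open_haus/eball_open.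
- by move=> j; exact/measurable_open_haus/eball_open.
- by move=> j; rewrite mulr_ge0// ltW.
- exact: f1.
- exact: b10.
- by rewrite divr_ge0 ?(ltW rho20)// !mulr_ge0 ?powR_ge0.
- by move=> x _; apply: integral_ge0 => y _; exact: F0.
- move=> x Gx; have [xr|xr] := ltP (enorm (x - x0)) (2 * rho).
    apply: Or32; exists 0%N => //; rewrite /q expr0 mulr1; exact: lip_data_inner.
  apply: Or33; have [j h1 h2] := f2 _ xr; exists j => //.
  have x0p : 0 < enorm (x - x0) by lra.
  have gx : g x = 0 by apply: gr; lra.
  pose cx := M ^+ 2 * 2 `^ (d + 1) / enorm (x - x0) `^ (d + 1).
  have cx0 : 0 <= cx by rewrite divr_ge0 ?powR_ge0// mulr_ge0 ?powR_ge0// exprn_ge0.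
  apply: (@le_trans _ _ (\int[sg]_(y in Gam) (cx * \1_(eball x0 rho) y)%:E)%E).
    apply: le_integral_nonmeas => [y Gy|y Gy]; first exact: F0.
    rewrite lee_fin gx sub0r normrN indicE.
    have [yr|yr] := leP rho (enorm (y - x0)).
      by rewrite gr// normr0 expr0n mul0r mulr_ge0.
    rewrite mem_set// mulr1 /cx -mulrA; apply: ler_pM.
    + by rewrite exprn_ge0.
    + by rewrite invr_ge0 powR_ge0.
    + by rewrite ler_sqr ?nnegrE.
    + have hxy : enorm (x - x0) / 2 <= enorm (x - y) by have := enorm_tri x y x0; lra.
      have xy0 : 0 < enorm (x - y) by lra.
      rewrite -[X in _ <= X]invrK invfM invrK lef_pV2 ?posrE ?powR_gt0//; last first.
        by rewrite mulr_gt0 ?invr_gt0 ?powR_gt0.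
      rewrite -half_powR.
      rewrite -powRM ?invr_ge0// ?(ltW x0p)//.
      by apply: ge0_ler_powR; rewrite ?nnegrE ?(ltW xy0) ?mulr_ge0 ?invr_ge0 ?(ltW x0p)// mulrC.
  have mB : measurable (eball x0 rho : set (@hausT R n d)) by exact/measurable_open_haus/eball_open.
  rewrite (integral_scale_indic _ cx0 (measurable_closed_haus cG) mB).
  have [_ h] := AR x0 rho Gx0 rho0.
  apply: le_trans (lee_wpmul2l _ h) _; first by rewrite lee_fin.
  by rewrite -EFinM lee_fin; apply: le_trans h2; rewrite /cx /K mulrAC.
- move=> j; have [_ h] := AR x0 (2 * rho) Gx0 rho20.
  apply: le_trans (lee_wpmul2l _ h) _; first by rewrite lee_fin mulr_ge0// ltW.
  by rewrite -EFinM lee_fin /b1 -/(q j) mulrAC.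
Qed.

(** The gradient given by [in_W] is reset to 0 on Gam, which changes no integral over the
    complement. *)
Lemma sol_of_dirichlet Gam A U g : reg Gam -> dirichlet_operator Gam d A U -> lip_data g -> exists G, sol d Gam A (U g) G.
Proof.
move=> rG [_ [M bd] ct wk] hg; have [G0 cG AR] := rG.
have cc := lip_data_Cc cG hg; have [[Lu [H [[LH wH] fin]]] ws _ _] := wk g cc (lip_data_H rG hg).
pose G z := if z \in Gam then 0 else H z.
have GE z : ~ Gam z -> G z = H z by move=> h; rewrite /G memNset.
have GG z : Gam z -> G z = 0 by move=> h; rewrite /G mem_set.
have LG i : L1loc (~` Gam) (fun z => G z ord0 i).
  move=> K cK sub; have h := LH i K cK sub; apply: eq_integrable h; first exact: compact_measurable_leb.
  by move=> z /set_mem /sub h /=; rewrite GE.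
have wG : weak_gradient (~` Gam) (U g) G.
  split => // phi tphi i; rewrite (wH phi tphi i); congr (- _).
  by apply: eq_Rintegral => z /set_mem h; rewrite GE.
have mG i : measurable_fun [set: lebT R n] ((fun z => G z ord0 i) : lebT R n -> R).
  by apply: (measurable_L1loc G0 cG (LG i)) => z /GG ->; rewrite mxE.
have [mw _] := locint_weight d0 dn C01 rG.
have me := measurable_enorm mG.
exists G; split => //.
- exact: ct.
- have [L [r [B [_ _ _ gB _]]]] := hg; exists (M * B) => z; apply: bd => // x _; exact: gB.
- split => //; apply/integrableP; split.
    apply/measurable_EFinP; apply: (measurable_funM _ mw); exact: (measurable_funM me me).
  apply: le_lt_trans fin; rewrite [in leRHS]integral_mkcond le_eqVlt; apply/orP; left; apply/eqP.
  apply: eq_integral => z _; rewrite /patch.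
  have h0 : 0 <= enorm (G z) ^+ 2 * w Gam z by rewrite mulr_ge0 ?exprn_ge0 ?enorm_ge0 ?weight_ge0.
  rewrite gee0_abs ?lee_fin//; case: ifPn => [/set_mem h|]; first by rewrite GE.
  by rewrite notin_setE => /contrapT Gz; rewrite (weight0 dn)// mulr0.
- by move=> v Gv v0 wv; exact: ws v0 wG wv.
Qed.

Lemma sol_addc Gam A u G c : set_ Gam A -> sol d Gam A u G -> sol d Gam A (fun z => u z + c) G.
Proof.
move=> sA su; have [G0 cG _] : reg Gam by case: sA.
have [cu [M uM] wu GG ort] := su; split => //.
- by apply: contD => //; exact: cst_continuous.
- by exists (M + `|c|) => z; apply: le_trans (ler_normD _ _) _; rewrite lerD2r.
have := weak_gradient_comp G0 cG cu (sol_Gi d0 dn C01 sA su) wu (C1R_affine 1 c (@C1R_id R)) (@C1_cst R n 1).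
congr (weak_gradient _ _ _); apply/funext => z; first by rewrite mul1r mulr1.
by apply/rowP => i; rewrite mxE; ring.
Qed.

End data.

(** * Maximum principle and comparison *)

Section maximum.
Context (R : realType) (n : nat) (d C0 C1 : R).
Hypotheses (n0 : (0 < n)%N) (d0 : 0 < d) (dn : d < n%:R - 1) (C01 : 1 <= C0) (C11 : 1 <= C1).
Local Notation V := 'rV[R]_n.
Local Notation mu := (lebesgue_n R n).
Local Notation reg := (regular_set d C0).
Local Notation w Gam := (weight Gam d).
Local Notation set_ := (setting d C0 C1).
Implicit Types (x y z p q : V) (r s t c e l k M L rho Lam : R) (Gam : set V) (f g h u v eta : V -> R) (G : V -> V) (A : V -> 'M[R]_n).

Let lw Gam (rG : reg Gam) : locint (w Gam) := locint_weight d0 dn C01 rG.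

Lemma ibox_le_total a b f : mu.-integrable setT (EFin \o f) -> (forall z, 0 <= f z) -> ibox a b f <= \int[mu]_z f z.
Proof.
move=> If f0; apply: fine_le.
- apply: integrable_fin_num; first exact: measurable_hbox.
  by apply: (@integrableS _ _ _ mu setT) => //; exact: measurable_hbox.
- exact: integrable_fin_num.
- apply: (@ge0_subset_integral _ _ _ mu _ _ (measurable_hbox a b) measurableT _ _ _ (@subsetT _ _)).
    by case/integrableP: If.
  by move=> z _; rewrite lee_fin.
Qed.

(** The derivatives of [eta] vanish where [u > k], so testing with F(u) eta leaves no error term:
    the energy on its support is 0. Then [trace_poincare], on a cube centred on Gam and large enough
    to contain [z], forces F(u) eta = 0. *)
Lemma maximum_principle Gam A u G eta Deta p q k t0 : set_ Gam A -> sol d Gam A u G ->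
  is_C1 eta Deta -> (forall z, 0 <= eta z <= 1) -> (forall i z, ~ hbox p q z -> Deta i z = 0) ->
  (forall i z, k < u z -> Deta i z = 0) -> 0 < t0 ->
  (forall z y, eta z != 0 -> Gam y -> (forall j, `|y ord0 j - z ord0 j| <= t0) -> u y <= k) ->
  forall z, ~ Gam z -> 0 < eta z -> u z <= k.
Proof.
move=> sA su Ce e01 De uD t00 hb z Gz ez.
have rG : reg Gam by case: sA. have [G0 cG _] := rG.
have [cu _ _ [GG mG eG] _] := su; have w0 := weight_ge0 d Gam.
have [ceta _ _] := Ce.
apply/ler_addgt0Pr => e e0; rewrite leNgt; apply/negP => uz.
have e20 : 0 < e / 2 by fast_lra.
have kk : k + e / 2 < k + e by fast_lra.
have [F [F' [CF F01 F'b F0 F1]]] := level_fun kk.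
set B := 2 / _ in F'b; have B0 : 0 < B by rewrite divr_gt0//; fast_lra.
have FD i y : F (u y) * Deta i y = 0.
  have [h|h] := leP (u y) k; last by rewrite uD// mulr0.
  by have [->] : F (u y) = 0 /\ F' (u y) = 0 by [apply: F0; fast_lra]; rewrite mul0r.
have F'0 c : c <= k + e / 2 -> F' c = 0 by case/F0.
have FG y : Gam y -> F (u y) * eta y = 0.
  move=> Gy; have [->|ny] := eqVneq (eta y) 0; first by rewrite mulr0.
  have h : u y <= k by apply: (hb y y ny Gy) => j; rewrite subrr normr0 ltW.
  by have [->] : F (u y) = 0 /\ F' (u y) = 0 by [apply: F0; fast_lra]; rewrite mul0r.
pose E y := enorm (G y) ^+ 2 * w Gam y.
have E0 y : 0 <= E y by apply: mulr_ge0 => //; exact: sqr_ge0.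
pose X y := F' (u y) * eta y * E y.
have cF'e : continuous (fun y => F' (u y) * eta y).
  by apply: contM => //; have [h _] := CF; exact: cont_comp cu h.
have bd y : 0 <= F' (u y) * eta y <= B.
  have /andP[h1 h2] := F'b (u y); have /andP[h3 h4] := e01 y; rewrite mulr_ge0//=.
  by rewrite -[leRHS]mulr1; apply: ler_pM.
have X0 y : 0 <= X y by apply: mulr_ge0 => //; have /andP[] := bd y.
have IX : mu.-integrable setT (EFin \o X).
  apply: (le_integrable measurableT _ _ (integrableZl measurableT B eG)).
    apply/measurable_EFinP; apply: (measurable_funM (continuous_measurable_leb cF'e)).
    by apply/measurable_EFinP; case/integrableP: eG.
  move=> y _ /=; rewrite lee_fin; have /andP[h1 h2] := bd y.
  rewrite (ger0_norm (X0 y)) ger0_norm ?(mulr_ge0 (ltW B0) (E0 y))//; exact: ler_wpM2r.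
have IX0 : \int[mu]_y X y <= 0.
  apply: le_trans (energy_ineq d0 dn C01 C11 sA su CF Ce F'b e01 De FG) _.
  rewrite (@ibox_eq R n p q _ (fun y => 0 * w Gam y)) ?(iboxZ _ _ _ (lw rG)) ?mul0r ?mulr0// => y _.
  have -> : `|F (u y)| * enorm (\row_i Deta i y : V) = 0; last by rewrite !mul0r.
  rewrite -enormZ (_ : _ *: _ = 0) ?enorm0//; apply/rowP => i; rewrite !mxE; exact: FD.
have [x Gx] := G0.
pose r := enorm (z - x) + 1; have r0 : 0 < r by rewrite ltr_wpDl// enorm_ge0.
have zr : qbox x r z.
  by move=> j; have := coord_le_enorm (z - x) j; rewrite !mxE /r ler_norml => /andP[? ?]; apply/andP; split; fast_lra.
have lr i : lower x r ord0 i <= upper x r ord0 i by rewrite !mxE; fast_lra.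
have gB := sol_grad_bound d0 dn C01 sA su CF Ce e20 F'0 t00 lr
  (fun z y _ => hb z y) FD.
have [KP KP0 HT] := trace_poincare n0 d0 dn C01.
pose gb y := `|F' (u y) * eta y| * enorm (G y); pose fe y := F (u y) * eta y.
have := HT Gam rG x r fe gb Gx r0 gB (fun y Gy _ => FG y Gy).
have gbE y : gb y = F' (u y) * eta y * enorm (G y) by rewrite /gb ger0_norm//; have /andP[] := bd y.
have lX : locint X.
  by apply: locint_ker (sol_energy su) _.
have lgb : locint (fun y => gb y * w Gam y).
  by have [] := gB.
(* The energy integral [X] vanishes; the first power of the gradient follows from t <= th + t^2 /
   th, letting [th] tend to 0. *)
have Ig : ibox (lower x r) (upper x r) (fun y => gb y * w Gam y) <= 0.
  have W0 : 0 <= ibox (lower x r) (upper x r) (w Gam) by apply: ibox_ge0.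
  apply: (@ler_eps R _ _ (B * ibox (lower x r) (upper x r) (w Gam))); first by apply: mulr_ge0 => //; exact: ltW.
  move=> th th0; rewrite add0r.
  have h : ibox (lower x r) (upper x r) (fun y => gb y * w Gam y) <=
      ibox (lower x r) (upper x r) (fun y => th * B * w Gam y + th^-1 * X y).
    apply: ibox_le; [exact: lgb|exact: locintD (locintZ _ (lw rG)) (locintZ _ lX)|move=> y _].
    rewrite gbE /X /E; have /andP[] := bd y; move: (F' _ * _) => s s0 sB; set gn := enorm (G y).
    have gn0 : 0 <= gn by exact: enorm_ge0.
    have g1 : gn <= th + th^-1 * gn ^+ 2.
      have [gt|gt] := leP gn th; first by rewrite ler_wpDr// mulr_ge0 ?sqr_ge0// invr_ge0 ltW.
      rewrite ler_wpDl ?(ltW th0)// mulrC ler_pdivlMr// expr2; apply: ler_wpM2l => //; exact: ltW.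
    apply: (@le_trans _ _ (s * (th + th^-1 * gn ^+ 2) * w Gam y)).
      by apply: ler_wpM2r => //; exact: ler_wpM2l.
    rewrite (_ : s * _ * _ = s * (th * w Gam y) + th^-1 * (s * (gn ^+ 2 * w Gam y))); last by ring.
    rewrite lerD2r (_ : th * B * _ = B * (th * w Gam y)); last by ring.
    by apply: ler_wpM2r => //; apply: mulr_ge0 => //; exact: ltW.
  apply: le_trans h _.
  rewrite (iboxD _ _ (locintZ _ (lw rG)) (locintZ _ lX)) (iboxZ _ _ _ (lw rG)) (iboxZ _ _ _ lX).
  rewrite -[X in X + _]mulrA gerDl; apply: mulr_ge0_le0; first by rewrite invr_ge0 ltW.
  exact: le_trans (ibox_le_total _ _ IX X0) IX0.
move=> h; have {}h : ibox (lower x r) (upper x r) (fun y => `|fe y| * w Gam y) <= 0.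
  by apply: le_trans h _; apply: mulr_ge0_le0 => //; apply: mulr_ge0; exact: ltW.
have cfe : continuous fe by apply: contM => //; exact: cont_comp cu (C1R_cont CF).
have fz : fe z = eta z by rewrite /fe; have [->] := F1 (u z) (ltW uz); rewrite mul1r.
suff : fe z <= eta z / 2 by rewrite fz; fast_lra.
apply: (mass_zero d0 dn C01 rG cfe _ zr Gz).
have cabs : continuous (fun y => `|fe y|) := cont_comp (v := fun t : R => `|t|) cfe (@norm_continuous _ _).
apply: (@le_trans _ _ (ibox (lower x r) (upper x r) (fun y => (2 / eta z) * (`|fe y| * w Gam y)))).
  apply: ibox_le; [exact (locint_above d0 dn C01 (eta z / 2) rG cfe)|exact (locintZ _ (locint_ker (lw rG) cabs))|move=> y _].
  rewrite mulrA; apply: ler_wpM2r => //.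
  have [hy|hy] := leP (fe y) (eta z / 2).
    by rewrite aboveF//; apply: mulr_ge0 => //; apply: divr_ge0 => //; exact: ltW.
  rewrite aboveT// mulrAC ler_pdivlMr// mul1r; have := ler_norm (fe y); fast_lra.
rewrite (iboxZ _ _ _ (locint_ker (lw rG) cabs)); apply: mulr_ge0_le0 => //.
by apply: divr_ge0 => //; exact: ltW.
Qed.

(** Here [eta] is constantly 1: the finite energy of a solution over the whole space takes the place
    of a condition at infinity. *)
Lemma maximum_principle_global Gam A u G k : set_ Gam A -> sol d Gam A u G -> (forall z, Gam z -> u z <= k) ->
  forall z, ~ Gam z -> u z <= k.
Proof.
move=> sA su uG z Gz.
apply: (maximum_principle (p := 0) (q := 0) sA su (@C1_cst R n 1) _ _ _ ltr01 _ Gz) => //.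
  by move=> y; apply/andP; split.
by move=> y y' _ Gy _; exact: uG.
Qed.

Lemma C1_coord_sqr (x : V) i : is_C1 (fun z => (z ord0 i - x ord0 i) ^+ 2) (fun j z => (2 * (z ord0 i - x ord0 i)) * (j == i)%:R).
Proof.
split.
- apply: (cont_comp (v := fun t : R => t ^+ 2)); last exact: exprn_continuous.
  by apply: contB; [exact: coord_continuous|exact: cst_continuous].
- move=> j; apply: contM; last exact: cst_continuous.
  apply: contM; first exact: cst_continuous.
  by apply: contB; [exact: coord_continuous|exact: cst_continuous].
move=> j z; rewrite -[z]addr0 -[X in _ + X](scale0r (vdir R j)); apply/is_derive_line.
have -> : (fun t : R => (fun z : V => (z ord0 i - x ord0 i) ^+ 2) (z + t *: vdir R j)) =
    (fun t : R => ((i == j)%:R * t + (z ord0 i - x ord0 i)) ^+ 2).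
  by apply/funext => t; rewrite vdirE; congr (_ ^+ 2); ring.
have [_ h] := C1R_affine (i == j)%:R (z ord0 i - x ord0 i) (C1R_M (@C1R_id R) (@C1R_id R)).
have := h 0; congr is_derive; rewrite vdirE mulr0 add0r mul0r addr0 eq_sym; ring.
Qed.

(** A function of the squared distance, which is C^1 also at the centre. *)
Lemma radial_cutoff (x : V) s t : 0 <= s -> s < t -> exists (eta : V -> R) Deta,
  [/\ is_C1 eta Deta, (forall z, 0 <= eta z <= 1), (forall z, enorm (z - x) <= s -> eta z = 0),
   (forall z, t <= enorm (z - x) -> eta z = 1) &
   forall i z, Deta i z != 0 -> s < enorm (z - x) < t].
Proof.
move=> hs st; have st2 : s ^+ 2 < t ^+ 2 by rewrite ltr_sqr ?nnegrE//; lra.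
have [F [F' [CF F01 _ F0 F1]]] := level_fun st2.
pose Q z := \sum_i (z ord0 i - x ord0 i) ^+ 2.
pose DQ (j : 'I_n) z := \sum_i (2 * (z ord0 i - x ord0 i)) * (j == i)%:R.
have CQ : is_C1 Q DQ.
  rewrite /Q /DQ; have : forall r : seq 'I_n, is_C1 (fun z => \sum_(i <- r) (z ord0 i - x ord0 i) ^+ 2)
      (fun j z => \sum_(i <- r) (2 * (z ord0 i - x ord0 i)) * (j == i)%:R).
    elim=> [|i r IH].
      have := @C1_cst R n 0; congr is_C1; first by apply/funext => z; rewrite big_nil.
      by apply/funext => j; apply/funext => z; rewrite big_nil.
    have := C1D (C1_coord_sqr x i) IH; congr is_C1; first by apply/funext => z; rewrite big_cons.
    by apply/funext => j; apply/funext => z; rewrite big_cons.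
  by move=> h; exact: h.
have QE z : Q z = enorm (z - x) ^+ 2.
  rewrite /enorm sqr_sqrtr; last by apply: sumr_ge0 => i _; rewrite -expr2 sqr_ge0.
  by apply: eq_bigr => i _; rewrite !mxE expr2.
have e0 z : 0 <= enorm (z - x) by exact: enorm_ge0.
exists (fun z => F (Q z)), (fun j z => F' (Q z) * DQ j z); split => //.
- exact: C1_comp.
- by move=> z h; have [] : F (Q z) = 0 /\ F' (Q z) = 0 by apply: F0; rewrite QE ler_sqr ?nnegrE.
- move=> z h; have t0 : 0 <= t by lra.
  by have [] : F (Q z) = 1 /\ F' (Q z) = 0 by apply: F1; rewrite QE ler_sqr ?nnegrE.
- move=> i z; rewrite mulf_eq0 negb_or => /andP[h _]; rewrite !ltNge -negb_or; apply: contra h => /orP[h|h].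
    by have [_ ->] : F (Q z) = 0 /\ F' (Q z) = 0 by [apply: F0; rewrite QE ler_sqr ?nnegrE]; rewrite eqxx.
  have t0 : 0 <= t by lra.
  by have [_ ->] : F (Q z) = 1 /\ F' (Q z) = 0 by [apply: F1; rewrite QE ler_sqr ?nnegrE]; rewrite eqxx.
Qed.

(** [boundary_growth] applied to u + 1, which is at most 1 and nonpositive on the relevant part of
    Gam, gives u <= - c near [x]; a Harnack chain carries this to [Z]. *)
Lemma nondegeneracy Lam : 2 <= Lam -> exists2 c, 0 < c & forall Gam A u G x Z rho, set_ Gam A -> sol d Gam A u G ->
  Gam x -> 0 < rho -> (forall y, u y <= 0) -> (forall y, Gam y -> qbox x (2 * rho) y -> u y <= -1) ->
  rho <= Lam * del Gam Z -> (forall j, `|Z ord0 j - x ord0 j| <= Lam * rho) -> u Z <= - c.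
Proof.
move=> L2; have [c /andP[c0 c1] Hb] := boundary_growth n0 d0 dn C01 C11.
have L1 : 1 <= Lam * Lam by nra.
have [c2 /andP[c20 c21] Hh] := harnack_chain n0 d0 dn C01 C11 L1.
exists (c2 * c); first exact: mulr_gt0.
move=> Gam A u G x Z rho sA su Gx rho0 u0 uG dZ xZ.
have L0 : 0 < Lam by fast_lra.
have small y : qbox x (rho / 2) y -> u y <= 0 - c.
  move=> hy; have := Hb Gam A _ G x rho 1 sA (sol_addc d0 dn C01 1 sA su) Gx rho0 ltr01 _ _ y hy.
  move=> h; have {}h : u y + 1 <= (1 - c) * 1; last by fast_lra.
  by apply: h => [z _|z Gz hz]; [have := u0 z|have := uG z Gz hz]; fast_lra.
rewrite -[leRHS]add0r; apply: (Hh Gam A u G x Z (rho / Lam) 0 c sA su) => //.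
- exact: divr_gt0.
- by rewrite ler_pdivrMr// mulrC.
- by move=> j; rewrite -mulrA [Lam * (rho / Lam)]mulrC divfK ?gt_eqF.
move=> y hy; apply: small; apply: qbox_mono hy.
have nR : 1 <= n%:R :> R by rewrite ler1n.
have nR0 : 0 < n%:R :> R by fast_lra.
rewrite ler_pdivrMr// ler_pdivrMr//; have := mulr_ge0 (ltW rho0) (ltW L0); nra.
Qed.

(** [maximum_principle] with a cutoff that varies only in the shell, where [u <= 0]. The cutoff
    starts at the middle [s'] of the shell, which leaves a margin for the points of Gam near its
    support. *)
Lemma exterior_maximum Gam A u G x s t : set_ Gam A -> sol d Gam A u G -> 0 <= s -> s < t ->
  (forall y, s <= enorm (y - x) < t -> ~ Gam y -> u y <= 0) -> (forall y, Gam y -> s <= enorm (y - x) -> u y <= 0) ->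
  forall z, ~ Gam z -> t <= enorm (z - x) -> u z <= 0.
Proof.
move=> sA su hs st ush uG z Gz tz; pose s' := (s + t) / 2.
have s'0 : 0 <= s' by rewrite /s'; lra.
have s't : s' < t by rewrite /s'; lra.
have [eta [Deta [Ce e01 e0 e1 De]]] := radial_cutoff x s'0 s't.
have nR0 : 0 < n%:R :> R by rewrite ltr0n.
have t00 : 0 < (s' - s) / n%:R by apply: divr_gt0 => //; rewrite /s'; lra.
apply: (maximum_principle (p := lower x t) (q := upper x t) sA su Ce e01 _ _ t00 _ Gz).
- move=> i y hy; apply/eqP/negPn/negP => /De /andP[_ h]; apply: hy; exact: eball_qbox.
- move=> i y uy; apply/eqP/negPn/negP => /De /andP[h1 h2]; move: uy; rewrite ltNge => /negP; apply.
  have [Gy|Gy] := pselect (Gam y); first by apply: uG => //; move: h1; rewrite /s'; lra.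
  by apply: ush => //; rewrite h2 andbT; move: h1; rewrite /s'; lra.
- move=> y y' ny Gy' hyy; apply: uG => //.
  have h1 : s' < enorm (y - x) by rewrite ltNge; apply: contra ny => h; rewrite e0.
  have h2 : enorm (y' - y) <= n%:R * ((s' - s) / n%:R) by apply: enorm_le_sum => j; rewrite !mxE.
  have h3 : n%:R * ((s' - s) / n%:R) = s' - s by rewrite mulrC divfK ?gt_eqF.
  by have := enorm_tri y y' x; rewrite (enormB y y'); lra.
- by rewrite e1.
Qed.

Lemma lip_data0 : lip_data (fun _ : V => 0 : R).
Proof. by exists 0, 1, 0; split => // *; rewrite ?subrr ?normr0 ?mul0r. Qed.

Lemma dirichlet_lin Gam A U c g h z : closed Gam -> dirichlet_operator Gam d A U -> lip_data g -> lip_data h ->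
  U (fun y => c * g y + h y) z = c * U g z + U h z.
Proof. by move=> cG [lin _ _ _] hg hh; apply: lin; exact: lip_data_Cc. Qed.

Lemma dirichlet0 Gam A U z : closed Gam -> dirichlet_operator Gam d A U -> U (fun=> 0) z = 0.
Proof.
move=> cG hU; have := dirichlet_lin 1 z cG hU lip_data0 lip_data0.
by rewrite (_ : (fun _ => _) = (fun=> 0)); [lra|apply/funext => y; rewrite mulr0 addr0].
Qed.

Lemma dirichlet_data Gam A U g z : reg Gam -> dirichlet_operator Gam d A U -> lip_data g -> Gam z -> U g z = g z.
Proof.
move=> rG [_ _ _ h] hg Gz; have [_ cG _] := rG.
by have [_ _ _] := h g (lip_data_Cc cG hg) (lip_data_H d0 C01 rG hg); apply.
Qed.

Lemma dirichlet_le Gam A U g k : set_ Gam A -> dirichlet_operator Gam d A U -> lip_data g ->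
  (forall z, Gam z -> g z <= k) -> forall z, U g z <= k.
Proof.
move=> sA hU hg gk; have rG : reg Gam by case: sA.
have gG z : Gam z -> U g z <= k by move=> Gz; rewrite (dirichlet_data rG hU hg Gz); exact: gk.
move=> z; have [Gz|Gz] := pselect (Gam z); first exact: gG.
have [G su] := sol_of_dirichlet d0 dn C01 rG hU hg.
exact: (maximum_principle_global sA su gG).
Qed.

(** The constant is [C = (1 + M) / c]: where [nondegeneracy] gives U g2 >= c, the difference U g1 -
    C U g2 is at most 1 - C c = - M, as [boundary_harnack_nonpos] requires with [s = 1]. *)
Lemma comparison Lam : exists2 C, 0 < C & forall Gam A U g1 g2 y0 z rho, set_ Gam A -> dirichlet_operator Gam d A U ->
  lip_data g1 -> lip_data g2 -> (forall p, 0 <= g1 p <= 1) -> (forall p, 0 <= g2 p) -> Gam y0 -> 0 < rho ->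
  (forall y, Gam y -> qbox y0 (2 * rho) y -> 1 <= g2 y) -> ~ Gam z -> enorm (z - y0) <= Lam * rho ->
  (forall p, enorm (p - z) <= rho -> g1 p = 0) -> U g1 z <= C * U g2 z.
Proof.
have [[M e] /= [M0 e0] HB] := boundary_harnack_nonpos n0 d0 dn C01 C11.
have nR1 : 1 <= n%:R :> R by rewrite ler1n.
have nR0 : 0 < n%:R :> R by fast_lra.
have ne0 : 0 < 4 * n%:R / e by apply: divr_gt0 => //; fast_lra.
(* The first two terms cover the distance from [y0] to the points used; the other two make [R0 / 2]
   and [e * R0] admissible distances to Gam in [nondegeneracy]. *)
pose L' := `|Lam| + 1 + 8 * n%:R + 4 * n%:R / e.
have L'2 : 2 <= L' by rewrite /L'; have := normr_ge0 Lam; fast_lra.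
have [c c0 HN] := nondegeneracy L'2.
exists ((1 + M) / c); first by apply: divr_gt0 => //; fast_lra.
set C := _ / c; have C00 : 0 < C by apply: divr_gt0 => //; fast_lra.
have Cc : C * c = 1 + M by rewrite divfK// gt_eqF.
move=> Gam A U g1 g2 y0 z rho sA hU h1 h2 g01 g20 Gy0 rho0 g21 Gz zy gz.
have rG : reg Gam by case: sA. have [G0 cG _] := rG.
have U1 y : U g1 y <= 1 by apply: (dirichlet_le sA hU h1) => p _; have /andP[] := g01 p.
(* [nondegeneracy] concerns nonpositive solutions, so it is applied to [- U g2], the solution with
   data in the form that linearity of [U] handles. *)
have hm : lip_data (fun y => -1 * g2 y + 0) by exact: lip_data_lin lip_data0.
have mE y : U (fun y => -1 * g2 y + 0) y = - U g2 y.
  by rewrite (dirichlet_lin _ _ cG hU h2 lip_data0) (dirichlet0 _ cG hU); ring.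
have m0 y : U (fun y => -1 * g2 y + 0) y <= 0.
  by apply: (dirichlet_le sA hU hm) => p _; have := g20 p; fast_lra.
have U2 y : 0 <= U g2 y by have := m0 y; rewrite mE; fast_lra.
have [Gm sm] := sol_of_dirichlet d0 dn C01 rG hU hm.
have hu : lip_data (fun y => - C * g2 y + g1 y) by exact: lip_data_lin.
pose u := U (fun y => - C * g2 y + g1 y).
have uE y : u y = U g1 y - C * U g2 y by rewrite /u (dirichlet_lin _ _ cG hU h2 h1); ring.
have [G su] := sol_of_dirichlet d0 dn C01 rG hU hu.
have low Z : rho <= L' * del Gam Z -> (forall j, `|Z ord0 j - y0 ord0 j| <= L' * rho) -> u Z <= - M.
  move=> dZ yZ; have := HN Gam A _ Gm y0 Z rho sA sm Gy0 rho0 m0 _ dZ yZ; rewrite mE => h.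
  have {}h : c <= U g2 Z.
    suff : - U g2 Z <= - c by fast_lra.
    apply: h => y Gy hy; rewrite (dirichlet_data rG hU hm Gy); have := g21 y Gy hy; fast_lra.
  by rewrite uE; have := U1 Z; have := ler_wpM2l (ltW C00) h; fast_lra.
have u1 y : u y <= 1 by rewrite uE; have := U1 y; have := mulr_ge0 (ltW C00) (U2 y); fast_lra.
suff : u z <= 0 by rewrite uE; fast_lra.
(* Since [n * R0 = rho / 4], a cube of radius [R0] around a point of Gam near [z] stays in the ball
   of radius [rho] around [z], where [g1 = 0]. *)
pose R0 := rho / (4 * n%:R); have R00 : 0 < R0 by apply: divr_gt0 => //; fast_lra.
have nR : n%:R * R0 = rho / 4 by rewrite /R0; field; rewrite gt_eqF.
have R0rho : R0 <= rho / 4 by rewrite -nR ler_peMl// ltW.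
have Lrho : Lam * rho <= `|Lam| * rho by rewrite ler_pM2r// ler_norm.
have L'rho : `|Lam| * rho + rho <= L' * rho.
  rewrite /L' !mulrDl mul1r; have := mulr_gt0 nR0 rho0; have := mulr_gt0 ne0 rho0; fast_lra.
have L'R : rho <= L' * (e * R0) /\ rho <= L' * (R0 / 2).
  have q1 : 4 * n%:R / e * (e * R0) = rho by rewrite /R0; field; rewrite !gt_eqF.
  have q2 : 8 * n%:R * (R0 / 2) = rho by rewrite /R0; field; rewrite gt_eqF.
  have eR : 0 < e * R0 by exact: mulr_gt0.
  have R2 : 0 < R0 / 2 by fast_lra.
  split; [rewrite -[leLHS]q1|rewrite -[leLHS]q2]; apply: ler_wpM2r; rewrite ?ltW// /L'; have := normr_ge0 Lam; fast_lra.
have [LR1 LR2] := L'R; have L'0 : 0 < L' by fast_lra.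
have cz j : `|z ord0 j - y0 ord0 j| <= Lam * rho.
  by apply: le_trans zy; have := coord_le_enorm (z - y0) j; rewrite !mxE.
(* Far from Gam the bound by [- M] applies at [z] itself. Otherwise [z] is nontangential with
   respect to an almost nearest point of Gam, and the boundary Harnack principle applies there. *)
have [dz|dz] := leP (R0 / 2) (del Gam z).
  apply: (@le_trans _ _ (- M)); last by fast_lra.
  apply: low => [|j]; first by apply: le_trans LR2 _; rewrite ler_pM2l.
  by have := cz j; fast_lra.
have dz0 : 0 < del Gam z by exact: del_gt0.
have [x Gx zx] : exists2 x, Gam x & enorm (z - x) < 2 * del Gam z by apply: del_lt => //; fast_lra.
have zxR : enorm (z - x) < R0 by fast_lra.
apply: (HB Gam A u G x z R0 1 sA su Gx R00 ltr01) => //.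
- move=> y Gy hy; rewrite /u (dirichlet_data rG hU hu Gy) gz.
    by have := mulr_ge0 (ltW C00) (g20 y); fast_lra.
  by have := qbox_enorm hy; have := enorm_tri y x z; rewrite (enormB x z) nR; fast_lra.
- split => [y _|y hy dy]; first exact: u1.
  rewrite mulr1; apply: low => [|j]; first by apply: le_trans LR1 _; rewrite ler_pM2l.
  have := hy j; have := cz j; have := coord_le_enorm (z - x) j; rewrite !mxE !ler_norml => /andP[? ?] /andP[? ?] /andP[? ?].
  by apply/andP; split; fast_lra.
Qed.

End maximum.

(** * Harmonic measure *)

Section caps.
Context (R : realType) (n : nat).
Local Notation V := 'rV[R]_n.
Implicit Types (x y z p q : V) (a b s t r : R).

Definition clamp t : R := Num.max 0 (Num.min 1 t).

Lemma clampE t : [/\ t <= 0 -> clamp t = 0, 1 <= t -> clamp t = 1 & 0 <= t <= 1 -> clamp t = t].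
Proof.
split => [h|h|/andP[h1 h2]]; rewrite /clamp.
- by rewrite (min_idPr _) ?(max_idPl _)//; lra.
- by rewrite (min_idPl h) (max_idPr ler01).
- by rewrite (min_idPr h2) (max_idPr h1).
Qed.

Lemma clamp01 t : 0 <= clamp t <= 1.
Proof. by rewrite /clamp le_max lexx ge_max ler01 ge_min lexx. Qed.

Lemma clamp_lip s t : `|clamp s - clamp t| <= `|s - t|.
Proof.
have [s0 s1 s2] := clampE s; have [t0 t1 t2] := clampE t.
rewrite ler_norml; have := ler_norm (s - t); have := ler_norm (- (s - t)); rewrite normrN.
have [hs|hs] := leP s 0; [rewrite s0//|have [hs'|hs'] := leP 1 s; [rewrite s1//|rewrite s2 ?(ltW hs) ?(ltW hs')//]];
(have [ht|ht] := leP t 0; [rewrite t0//|have [ht'|ht'] := leP 1 t; [rewrite t1//|rewrite t2 ?(ltW ht) ?(ltW ht')//]]);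
move=> ? ?; apply/andP; split; lra.
Qed.

Definition cap x a b z := clamp ((b - enorm (z - x)) / (b - a)).

Lemma cap01 x a b z : 0 <= cap x a b z <= 1. Proof. exact: clamp01. Qed.

Lemma cap1 x a b z : a < b -> enorm (z - x) <= a -> cap x a b z = 1.
Proof.
move=> ab h; have ba : 0 < b - a by lra.
by have [_ h1 _] := clampE ((b - enorm (z - x)) / (b - a)); apply: h1; rewrite ler_pdivlMr//; lra.
Qed.

Lemma cap0 x a b z : a < b -> b <= enorm (z - x) -> cap x a b z = 0.
Proof.
move=> ab h; have ba : 0 < b - a by lra.
by have [h0 _ _] := clampE ((b - enorm (z - x)) / (b - a)); apply: h0; rewrite ler_pdivrMr//; lra.
Qed.

Lemma lip_data_cap x a b : 0 < b -> a < b -> lip_data (cap x a b).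
Proof.
move=> b0 ab; have ba : 0 < b - a by lra.
exists (b - a)^-1, (b + enorm x), 1; split.
- by rewrite invr_ge0 ltW.
- by rewrite ltr_wpDr// enorm_ge0.
- move=> z p; apply: le_trans (clamp_lip _ _) _.
  rewrite -mulrBl normrM [X in _ * X]ger0_norm ?invr_ge0 ?(ltW ba)// mulrC ler_pM2l ?invr_gt0//.
  have := enorm_tri z p x; have := enorm_tri p z x; rewrite (enormB p z) ler_norml => ? ?.
  by apply/andP; split; lra.
- by move=> z; have /andP[h1 h2] := cap01 x a b z; rewrite ger0_norm.
- move=> z hz; apply: cap0 => //; have := enormD (z - x) x; rewrite subrK; lra.
Qed.

End caps.

Section harmonic_measure.
Context (R : realType) (n : nat) (d : R).
Local Notation V := 'rV[R]_n.
Implicit Types (Gam : set V) (g : V -> R) (X : V).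

Lemma measurable_open_borel (E : set V) : open E -> measurable (E : set (borelT R n)).
Proof. by move=> oE; apply: sub_sigma_algebra. Qed.

Lemma measurable_closed_borel (E : set V) : closed E -> measurable (E : set (borelT R n)).
Proof.
move=> cE; rewrite -(setCK E); apply: measurableC; apply: measurable_open_borel; exact: closed_openC.
Qed.

Context (Gam : set V) (U : (V -> R) -> V -> R) (X : V) (om : {measure set (borelT R n) -> \bar R}).
Hypotheses (cG : closed Gam) (hm : harmonic_measure Gam U X om).

Lemma harmonic_measure_le (E : set (borelT R n)) g : lip_data g -> measurable E -> E `<=` Gam -> (forall x, 0 <= g x) ->
  (forall x, E x -> 1 <= g x) -> (om E <= (U g X)%:E)%E.
Proof.
move=> hg mE EG g0 g1; have [_ _ ->] := hm; last exact: lip_data_Cc.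
rewrite -[X in om X](setIidl EG) -(integral_indic _ (measurable_closed_borel cG) mE).
apply: le_integral_nonmeas => x _; rewrite lee_fin indicE//.
by have [h|h] := pselect (E x); [rewrite mem_set// g1|rewrite memNset].
Qed.

Lemma harmonic_measure_ge (E : set (borelT R n)) g : lip_data g -> measurable E -> E `<=` Gam -> (forall x, 0 <= g x <= 1) ->
  (forall x, Gam x -> ~ E x -> g x = 0) -> ((U g X)%:E <= om E)%E.
Proof.
move=> hg mE EG g01 g0; have [_ _ ->] := hm; last exact: lip_data_Cc.
rewrite -[X in om X](setIidl EG) -(integral_indic _ (measurable_closed_borel cG) mE).
apply: le_integral_nonmeas => x Gx; rewrite lee_fin ?indicE//; first by have /andP[] := g01 x.
by have [h|h] := pselect (E x); [rewrite mem_set//; have /andP[] := g01 x|rewrite memNset// g0].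
Qed.

End harmonic_measure.

(** Regularity makes the ball of radius [3 * k * r] carry more surface measure than the ball of
    radius [3 * r] as soon as [k^d] exceeds [C0^2]; here it is [2 * C0^2]. *)
Lemma far_point (R : realType) (n : nat) (d C0 : R) : 0 < d -> 1 <= C0 -> exists2 K : R, 3 < K & forall (Gam : set 'rV[R]_n) x r,
  ahlfors_regular Gam d C0 -> Gam x -> 0 < r -> exists2 y, Gam y & 3 * r <= enorm (y - x) < K * r.
Proof.
move=> d0 C01; have C00 : 0 < C0 by lra.
pose k := (2 * C0 ^+ 2) `^ d^-1.
have kd : k `^ d = 2 * C0 ^+ 2.
  by rewrite -powRrM mulVf ?gt_eqF// powRr1// mulr_ge0// exprn_ge0// ltW.
have k1 : 1 < k.
  rewrite ltNge; apply/negP => h; have := @ge0_ler_powR R d (ltW d0) k 1.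
  rewrite !nnegrE powR_ge0 ler01 powR1 kd => /(_ isT isT h); rewrite expr2; nra.
exists (3 * k); first by lra.
move=> Gam x r AR Gx r0; apply: contrapT => no.
have r3 : 0 < 3 * r by lra.
have kr : 0 < 3 * k * r by rewrite mulr_gt0//; lra.
have [h1 _] := AR x _ Gx kr; have [_ h2] := AR x _ Gx r3.
have sub : Gam `&` eball x (3 * k * r) `<=` Gam `&` eball x (3 * r).
  move=> y [Gy hy]; split => //; rewrite /eball /= ltNge; apply/negP => h; apply: no; exists y => //.
  by rewrite h.
have := le_trans h1 (le_trans (le_hausdorff_outer d sub) h2); rewrite lee_fin leNgt => /negP; apply.
rewrite (_ : 3 * k * r = k * (3 * r)); last by ring.
rewrite powRM ?powR_ge0 ?(ltW r3)// kd mulrA ltr_pM2r ?powR_gt0//.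
by rewrite (_ : C0^-1 * _ = 2 * C0); [lra|field; rewrite gt_eqF].
Qed.

Theorem lemma11p12 (R : realType) (n : nat) (hn : (2 <= n)%N)
    (d : R) (hd0 : 0 < d) (hdn : d < n%:R - 1)
    (C0 : R) (hC0 : 1 <= C0) (C1 : R) (hC1 : 1 <= C1) :
  exists C : R, 0 < C /\
  forall (Gam : set 'rV[R]_n), Gam !=set0 -> closed Gam ->
    ahlfors_regular Gam d C0 ->
  forall (A : 'rV[R]_n -> 'M[R]_n), weighted_elliptic Gam d C1 A ->
  forall (U : ('rV[R]_n -> R) -> ('rV[R]_n -> R)),
    dirichlet_operator Gam d A U ->
  forall (om : 'rV[R]_n -> {measure set (borelT R n) -> \bar R}),
    (forall X, ~ Gam X -> harmonic_measure Gam U X (om X)) ->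
  forall (x0 : 'rV[R]_n) (r : R), Gam x0 -> 0 < r ->
    (forall X, (~` Gam `\` eball x0 (4 * r)) X ->
      (om X (eball x0 (2 * r) `&` Gam) <= C%:E * om X (eball x0 r `&` Gam))%E)
    /\
    (forall X, (~` Gam `&` eball x0 (r / 2)) X ->
      (om X (Gam `\` eball x0 r) <= C%:E * om X (Gam `\` eball x0 (2 * r)))%E).
Proof.
have n0 : (0 < n)%N by exact: leq_trans hn.
have nR1 : 1 <= n%:R :> R by rewrite ler1n.
have nR0 : 0 < n%:R :> R by fast_lra.
have [K K3 HK] := @far_point R n d C0 hd0 hC0.
(* The parameters are the distances to be reached divided by [rho]: [4 * r] with [rho = r / (4 * n)]
   here, and [(K + 1) * r] with [rho = r / (8 * n)] in the next line. *)
have [Ca Ca0 Ha] := comparison n0 hd0 hdn hC0 hC1 (16 * n%:R).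
have [Cb Cb0 Hb] := comparison n0 hd0 hdn hC0 hC1 (8 * n%:R * (K + 1)).
exists (Ca + Cb); split; first by fast_lra.
move=> Gam G0 cG AR A hA U hU om hom x0 r Gx0 r0.
have rG : regular_set d C0 Gam by [].
have sA : setting d C0 C1 Gam A by [].
have mB x s : measurable (eball x s : set (borelT R n)) by apply: measurable_open_borel; exact: eball_open.
have mG := measurable_closed_borel cG.
split => X [GX hX].
  have Xr : 4 * r <= enorm (X - x0) by rewrite leNgt; exact/negP.
  have [l1 l2] : r / 2 < r /\ 2 * r < 5 / 2 * r by split; fast_lra.
  (* [g2] lives in B(x0, r); [g1] is 1 on B(x0, 2r) and vanishes from distance 5r/2 on, which leaves
     room r/2 around the points at distance at least 3r. *)
  pose g2 := cap x0 (r / 2) r; pose g1 := cap x0 (2 * r) (5 / 2 * r).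
  have h2 : lip_data g2 by exact: lip_data_cap.
  have h1 : lip_data g1 by apply: lip_data_cap => //; fast_lra.
  have rho0 : 0 < r / (4 * n%:R) by apply: divr_gt0 => //; fast_lra.
  have nrho : n%:R * (2 * (r / (4 * n%:R))) = r / 2 by field; rewrite gt_eqF.
  have rhor : r / (4 * n%:R) <= r / 4 by rewrite invfM mulrA ler_piMr ?invf_le1//; fast_lra.
  have hu : lip_data (fun y => - Ca * g2 y + g1 y) by exact: lip_data_lin.
  have uE y : U (fun y => - Ca * g2 y + g1 y) y = - Ca * U g2 y + U g1 y := dirichlet_lin _ _ cG hU h2 h1.
  have [G su] := sol_of_dirichlet hd0 hdn hC0 rG hU hu.
  have [h3 h34] : 0 <= 3 * r /\ 3 * r < 4 * r by split; fast_lra.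
  have key : U g1 X <= Ca * U g2 X.
    suff : U (fun y => - Ca * g2 y + g1 y) X <= 0 by rewrite uE; fast_lra.
    apply: (exterior_maximum n0 hd0 hdn hC0 hC1 sA su h3 h34 _ _ GX Xr) => [y /andP[y1 y2] Gy|y Gy y1].
      rewrite uE -lerBrDl sub0r mulNr opprK.
      apply: (Ha Gam A U g1 g2 x0 y (r / (4 * n%:R)) sA hU h1 h2) => //.
      - by move=> p; exact: cap01.
      - by move=> p; have /andP[] := cap01 x0 (r / 2) r p.
      - by move=> p _ /qbox_enorm; rewrite nrho => hp; rewrite /g2 cap1.
      - by rewrite (_ : 16 * n%:R * _ = 4 * r); [exact: ltW|field; rewrite gt_eqF].
      - move=> p hp; apply: cap0 => //; have := enorm_tri y p x0; rewrite (enormB y p); fast_lra.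
    rewrite (dirichlet_data hd0 hC0 rG hU hu Gy) /g1 /g2 !cap0; fast_lra.
  have e1 : (om X (eball x0 (2 * r) `&` Gam) <= (U g1 X)%:E)%E.
    apply: (harmonic_measure_le cG (hom X GX) h1) => [|y []//|y|y [hy _]].
    - exact: measurableI.
    - by have /andP[] := cap01 x0 (2 * r) (5 / 2 * r) y.
    - by rewrite /g1 cap1// ltW.
  have e2 : ((U g2 X)%:E <= om X (eball x0 r `&` Gam))%E.
    apply: (harmonic_measure_ge cG (hom X GX) h2) => [|y []//|y|y Gy hy].
    - exact: measurableI.
    - exact: cap01.
    - by apply: cap0 => //; rewrite leNgt; apply/negP => h; apply: hy.
  apply: le_trans e1 _; apply: (@le_trans _ _ (Ca%:E * (U g2 X)%:E)%E); first by rewrite -EFinM lee_fin.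
  apply: (@le_trans _ _ (Ca%:E * om X (eball x0 r `&` Gam))%E); first by apply: lee_wpmul2l => //; rewrite lee_fin ltW.
  by apply: lee_wpmul2r => //; rewrite lee_fin; fast_lra.
have {}hX : enorm (X - x0) < r / 2 by exact: hX.
(* At distance at least 3r from [x0], so that a bump of radius r/2 at [y0] stays outside B(x0, 2r);
   the upper bound K r keeps [comparison] uniform. *)
have [y0 Gy0 /andP[y1 y2]] := HK Gam x0 r AR Gx0 r0.
have [l1 l2] : r / 4 < r / 2 /\ 3 / 4 * r < r by split; fast_lra.
pose g2 := cap y0 (r / 4) (r / 2).
have h2 : lip_data g2 by apply: lip_data_cap => //; fast_lra.
have rho0 : 0 < r / (8 * n%:R) by apply: divr_gt0 => //; fast_lra.
have nrho : n%:R * (2 * (r / (8 * n%:R))) = r / 4 by field; rewrite gt_eqF.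
have rhor : r / (8 * n%:R) <= r / 8 by rewrite invfM mulrA ler_piMr ?invf_le1//; fast_lra.
have e2 : ((U g2 X)%:E <= om X (Gam `\` eball x0 (2 * r)))%E.
  apply: (harmonic_measure_ge cG (hom X GX) h2) => [|y []//|y|y Gy hy].
  - exact: measurableD.
  - exact: cap01.
  - apply: cap0 => //; have hyx : enorm (y - x0) < 2 * r by apply: contrapT => h; apply: hy.
    by have := enorm_tri y0 y x0; rewrite (enormB y0 y); fast_lra.
(* Data have bounded support, so the complement of the ball is exhausted by bounded pieces; the
   estimate is uniform in [k] and passes to the limit by continuity of the measure. *)
pose E (k : nat) : set (borelT R n) := (Gam `\` eball x0 r) `&` eball x0 (k%:R + r).
have mE k : measurable (E k) by apply: measurableI => //; exact: measurableD.
have Ele k : (om X (E k) <= (Ca + Cb)%:E * om X (Gam `\` eball x0 (2 * r)))%E.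
  have kr0 : 0 < k%:R + r by rewrite ltr_wpDl.
  have kr1 : k%:R + r < k%:R + r + 1 by fast_lra.
  have rk : r <= k%:R + r by rewrite lerDr.
  (* A difference of two caps: 0 on B(x0, 3r/4), which contains a ball around [X], and 1 on the
     shell from r to k + r. *)
  pose g1 y := -1 * cap x0 (3 / 4 * r) r y + cap x0 (k%:R + r) (k%:R + r + 1) y.
  have h1 : lip_data g1 by apply: lip_data_lin; apply: lip_data_cap => //; fast_lra.
  have g01 y : 0 <= g1 y <= 1.
    rewrite /g1; have /andP[? ?] := cap01 x0 (3 / 4 * r) r y; have /andP[? ?] := cap01 x0 (k%:R + r) (k%:R + r + 1) y.
    have [h|h] := leP r (enorm (y - x0)); first by rewrite [cap x0 (3 / 4 * r) r y]cap0//; apply/andP; split; fast_lra.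
    by rewrite [cap x0 (k%:R + r) _ y]cap1//; [apply/andP; split; fast_lra|fast_lra].
  have key : U g1 X <= Cb * U g2 X.
    apply: (Hb Gam A U g1 g2 y0 X (r / (8 * n%:R)) sA hU h1 h2) => //.
    - by move=> p; have /andP[] := cap01 y0 (r / 4) (r / 2) p.
    - by move=> p _ /qbox_enorm; rewrite nrho => hp; rewrite /g2 cap1.
    - rewrite (_ : 8 * n%:R * (K + 1) * _ = K * r + r); last by field; rewrite gt_eqF.
      by have := enorm_tri X x0 y0; rewrite (enormB x0 y0); fast_lra.
    - move=> p hp; have := enorm_tri p X x0 => hpx; have hp' : enorm (p - x0) <= 3 / 4 * r by fast_lra.
      by rewrite /g1 !cap1//; [ring|fast_lra].
  have e1 : (om X (E k) <= (U g1 X)%:E)%E.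
    apply: (harmonic_measure_le cG (hom X GX) h1) => [||y|y [[_ hy] hy']]; first exact: mE.
    - by move=> y [[]].
    - by have /andP[] := g01 y.
    - have {}hy : r <= enorm (y - x0) by rewrite leNgt; exact/negP.
      by rewrite /g1 cap0// cap1//; [fast_lra|exact: ltW].
  apply: le_trans e1 _; apply: (@le_trans _ _ (Cb%:E * (U g2 X)%:E)%E); first by rewrite -EFinM lee_fin.
  apply: (@le_trans _ _ (Cb%:E * om X (Gam `\` eball x0 (2 * r)))%E); first by apply: lee_wpmul2l => //; rewrite lee_fin ltW.
  by apply: lee_wpmul2r => //; rewrite lee_fin; fast_lra.
have EU : \bigcup_k E k = Gam `\` eball x0 r.
  apply/seteqP; split => [y [k _ []]//|y hy]; exists (Num.truncn (enorm (y - x0))).+1 => //; split => //.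
  rewrite /eball /=; have /andP[_ h] := truncn_itv (enorm_ge0 (y - x0)).
  by rewrite ltr_wpDr// ltW.
have cvE : om X \o E @ \oo --> om X (\bigcup_k E k).
  apply: nondecreasing_cvg_mu => //; first by rewrite EU; exact: measurableD.
  move=> i j ij; apply/subsetPset => y [hy hy']; split => //; apply: lt_le_trans hy' _.
  by rewrite lerD2r ler_nat.
rewrite -EU -(cvg_lim _ cvE)//; apply: lime_le; first by apply/cvg_ex; exists (om X (\bigcup_k E k)).
by near=> k; exact: Ele.
Unshelve. all: by end_near. Qed.
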